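(* Let $C\subset[0,1]$ have upper box dimension strictly less than $1$, and let $a\colon\mathbb{N}\to S^1$ be an unpretentious completely multiplicative function taking values in the unit circle. Then \[ \lim_{H\to\infty}\limsup_{N\to\infty}\mathbb{E}^{\log}_{n\le N}\sup_{\alpha\in C}\Big|\mathbb{E}_{h\le H}a(n+h)e(h\alpha)\Big|=0 . \]
   Context: $e(x)=e^{2\pi i x}$. $\mathbb{E}_{h\le H}$ is the uniform average over $1\le h\le H$; $\mathbb{E}^{\log}_{n\le N}\psi(n)=\big(\sum_{n\le N}\frac1n\big)^{-1}\sum_{n\le N}\frac{\psi(n)}{n}$. Unpretentious: there is $\varphi\colon\mathbb{N}\to\mathbb{N}$ with $\varphi(A)\to\infty$ such that for every $A$, every Dirichlet character $\chi$ of period at most $A$, all sufficiently large $N$ and all real $|t|\le AN$, $\sum_{p\le N}\frac{1-\mathrm{Re}(a(p)\chi(p)p^{-it})}{p}\ge\varphi(A)$. *)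

(* Defs.v *)
From Stdlib Require Import Reals Lra ZArith Znumtheory List Classical ClassicalEpsilon.
Open Scope R_scope.

Definition Cx : Type := (R * R)%type.
Definition Cre (z : Cx) : R := fst z.
Definition Cim (z : Cx) : R := snd z.
Definition C0 : Cx := (0, 0).
Definition C1 : Cx := (1, 0).
Definition Cmul (z w : Cx) : Cx :=
  (Cre z * Cre w - Cim z * Cim w, Cre z * Cim w + Cim z * Cre w).
Definition Cscale (r : R) (z : Cx) : Cx := (r * Cre z, r * Cim z).
Definition Cnorm (z : Cx) : R := sqrt (Cre z ^ 2 + Cim z ^ 2).
Definition Cexpi (theta : R) : Cx := (cos theta, sin theta).
Definition e (x : R) : Cx := Cexpi (2 * PI * x).

Fixpoint sum1 (f : nat -> R) (N : nat) : R :=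
  match N with
  | O => 0
  | S k => sum1 f k + f (S k)
  end.
Definition Csum1 (f : nat -> Cx) (N : nat) : Cx :=
  (sum1 (fun k => Cre (f k)) N, sum1 (fun k => Cim (f k)) N).

Definition Rsup (E : R -> Prop) : R :=
  epsilon (inhabits 0%R) (fun m => is_lub E m).

Definition nprime (p : nat) : Prop := prime (Z.of_nat p).
Definition nprime_dec (p : nat) : {nprime p} + {~ nprime p} := prime_dec (Z.of_nat p).

Definition completely_multiplicative (a : nat -> Cx) : Prop :=
  a 1%nat = C1 /\
  (forall m n : nat, (1 <= m)%nat -> (1 <= n)%nat -> a (m * n)%nat = Cmul (a m) (a n)).

Definition dirichlet_char (q : nat) (chi : nat -> Cx) : Prop :=
  (1 <= q)%nat /\
  chi 1%nat = C1 /\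
  (forall m n : nat, chi (m * n)%nat = Cmul (chi m) (chi n)) /\
  (forall n : nat, chi (n + q)%nat = chi n) /\
  (forall n : nat, Nat.gcd n q <> 1%nat -> chi n = C0).

Definition pretentious_sum (a chi : nat -> Cx) (t : R) (N : nat) : R :=
  sum1 (fun p => if nprime_dec p then
                   (1 - Cre (Cmul (Cmul (a p) (chi p)) (Cexpi (- t * ln (INR p))))) / INR p
                 else 0) N.

Definition unpretentious (a : nat -> Cx) : Prop :=
  exists phi : nat -> nat,
    (forall M : nat, exists A0 : nat, forall A : nat, (A0 <= A)%nat -> (M <= phi A)%nat) /\
    (forall (A q : nat) (chi : nat -> Cx),
        (q <= A)%nat -> dirichlet_char q chi ->
        exists N0 : nat, forall N : nat, (N0 <= N)%nat ->
          forall t : R, Rabs t <= INR A * INR N ->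
            pretentious_sum a chi t N >= INR (phi A)).

Definition covers (C : R -> Prop) (delta : R) (n : nat) : Prop :=
  exists xs : list R, length xs = n /\
    forall c, C c -> exists x, In x xs /\ x <= c <= x + delta.

(** upper box dimension < 1, i.e.
    limsup_{delta -> 0} log N(C,delta) / log(1/delta) < 1, where N(C,delta) is the
    minimal number of intervals of length delta covering C; unfolded:
    there is s < 1 with N(C,delta) <= delta^{-s} for all small delta > 0. *)
Definition upper_box_dim_lt_1 (C : R -> Prop) : Prop :=
  exists s : R, s < 1 /\
    exists delta0 : R, 0 < delta0 /\
      forall delta : R, 0 < delta < delta0 ->
        exists n : nat, covers C delta n /\ INR n <= Rpower (/ delta) s.

Definition short_avg (a : nat -> Cx) (n H : nat) (alpha : R) : Cx :=
  Cscale (/ INR H) (Csum1 (fun h => Cmul (a (n + h)%nat) (e (INR h * alpha))) H).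

(** sup_{alpha in C} |E_{h<=H} a(n+h) e(h alpha)|  (taken to be 0 if C is empty;
    the values are >= 0 so adjoining 0 does not change the supremum otherwise) *)
Definition sup_short_avg (C : R -> Prop) (a : nat -> Cx) (n H : nat) : R :=
  Rsup (fun y => y = 0 \/ exists alpha, C alpha /\ y = Cnorm (short_avg a n H alpha)).

Definition log_avg (psi : nat -> R) (N : nat) : R :=
  / sum1 (fun n => / INR n) N * sum1 (fun n => psi n / INR n) N.

(* Main.v *)
(* Major arcs: expanding e(nr/b) into joint eigenvectors of the dilations by
   units mod b reduces a rational frequency to short averages of functions f
   with f(pm) = g(p) f(m) for primes p > b, where g = a chi, chi a Dirichlet
   character.  As in Matomaki-Radziwill, duality bounds these by mean squares of
   Dirichlet polynomials at integer points, which are factored by Turan-Kubilius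
   over a chain of windows of primes and estimated by the large sieve.  At the
   few points t left over, the Gram matrix of (p 1_{p|n} - 1) n^{it}, controlled
   by Weyl-van der Corput bounds, shows that the means A_X of f(n) n^{it} nearly
   satisfy A_X = g(p) p^{it} A_{X/p}, and a discrete Fourier transform in log X
   turns unpretentiousness into decay.

   Minor arcs: take an ultrafilter limit of logarithmic means and near-optimal
   frequencies in C.  If the averages stay large, Katai's bilinear argument
   yields p and, at a much larger scale, a positive proportion of primes q with
   frequencies A_q in C close to (q A + integer)/p, A fixed.  As C has box
   dimension below 1, the A_q fall into few short intervals; as primes do not
   concentrate in few residue classes, A/p is close to a rational of bounded
   denominator, so some A_q lies in a major arc after all. *)

Require Import Defs.
From Stdlib Require Import Reals Lra.
From HB Require structures.
From mathcomp Require all_boot all_order all_algebra cyclic.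
From mathcomp Require boolp classical_sets filter Rstruct reals complex.
From mathcomp Require ring lra zify.
Open Scope R_scope.

(** The function [f] attached to a rational frequency is not multiplicative: what is known is
    [f(pm) = g(p) f(m)] for primes [p > b]. It is exploited for primes up to about [N^(1/1000)]:
    small enough for the errors of the Gram matrix, while the larger primes change the pretentious
    sum by a bounded amount.

    In the minor arcs logarithmic means matter because their limits are compatible with dilations: a
    mean over [n] becomes a mean over [x] with [n = floor(x/q)]. The frequency belonging to [q n] is
    then read off at [x], whatever [q] is, and this is the fixed [A].

    Box dimension below 1 enters as [N(C,1/n) log n = o(n)]. The logarithm pays for an elementary
    bound for primes in progressions modulo [b], obtained from factorials, which is weaker than
    Brun-Titchmarsh by about a factor [log b].

    The constant 400 makes the reciprocal sum of the primes in [(m, m^400]] at least 1/4 by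
    Chebyshev-type estimates alone. *)

Module ShortSums.

(** * Bounds for pi and the sine *)

Lemma pi_gt_three : (1+(1+1) < PI)%R.
Proof. assert (H := PI2_3_2); lra. Qed.

Lemma pi_le_four : (PI <= 1+(1+(1+1)))%R.
Proof. assert (H := PI_4); lra. Qed.

Lemma sub_sin_le (x : R) : (0 <= x -> x-sin x <= x*x)%R.
Proof.
intros h0; destruct (Rle_lt_dec x 2) as [h2|h2].
 assert (h3 := PI2_3_2); destruct (sin_bound x 0) as [h _]; [lra|lra|].
 unfold sin_approx, sin_term in h; simpl in h.
 assert (x*x <= 4)%R by nra; nra.
destruct (SIN_bound x); nra.
Qed.

(** Here [x <= 2], so the cubic Taylor bound gives [sin x >= x (1 - x^2/6) >= x/3]. *)
Lemma sin_ge_third (x : R) : (0 <= x -> x+x <= PI -> x <= sin x+(sin x+sin x))%R.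
Proof.
intros h0 h1; assert (h4 := PI_4).
destruct (sin_bound x 0) as [h _]; [lra|lra|].
unfold sin_approx, sin_term in h; simpl in h.
assert (x*x <= 4)%R by nra; nra.
Qed.

Import HB.structures.
Import all_boot all_order all_algebra.
Import Rstruct reals complex.
Import ring lra zify.
Set Implicit Arguments.
Unset Strict Implicit.
Unset Printing Implicit Defensive.
Import Order.TTheory GRing.Theory Num.Theory.
Local Open Scope ring_scope.

Notation leT := le_trans.
Notation leV y := (@le_trans _ _ y).
Notation leqT := leq_trans.
Notation leMl := ler_wpM2l.
Notation leMr := ler_wpM2r.
Notation "\sum_ [ i < n ] F" := (\sum_(0 <= i < n) F)
  (F at level 41, i name, only parsing) : ring_scope.
Notation "\sum_ [ i <= n ] F" := (\sum_(1 <= i < n.+1) F)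
  (F at level 41, i name, only parsing) : ring_scope.
Notation "\sum_ [ i < n ] F" := (\sum_(0 <= i < n) F)%N
  (F at level 41, i name, only parsing) : nat_scope.
Notation "\sum_ [ i <= n ] F" := (\sum_(1 <= i < n.+1) F)%N
  (F at level 41, i name, only parsing) : nat_scope.

(** * Complex numbers *)

(* The field of reals is sealed behind the constant [RT], so that simplification
   does not expose the Stdlib operations. *)
Definition RT : realType := Rdefinitions.R.
Notation R := (Real.sort RT).
Definition rexp : R -> R := exp.
Definition rln : R -> R := ln.
Definition rcos : R -> R := cos.
Definition rsin : R -> R := sin.
Definition rpi : R := locked PI.
Lemma rpiE : rpi = PI. Proof. by rewrite /rpi -lock. Qed.

Lemma rexpD (x y : R) : rexp (x+y) = rexp x*rexp y.
Proof. exact: exp_plus. Qed.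
Lemma rexp0 : rexp 0 = 1.
Proof. exact: exp_0. Qed.
Lemma rexp_gt0 (x : R) : 0 < rexp x.
Proof. exact/RltP/exp_pos. Qed.
Lemma rexp_ge1D (x : R) : 1+x <= rexp x.
Proof. exact/RleP/exp_ineq1_le. Qed.
Lemma rexp_lt (x y : R) : x < y -> rexp x < rexp y.
Proof. by move=> /RltP h; exact/RltP/exp_increasing. Qed.
Lemma rexpK (x : R) : rln (rexp x) = x.
Proof. exact: ln_exp. Qed.
Lemma rlnK (x : R) : 0 < x -> rexp (rln x) = x.
Proof. by move=> /RltP; exact: exp_ln. Qed.
Lemma rcosD (x y : R) : rcos (x+y) = rcos x*rcos y-rsin x*rsin y.
Proof. exact: cos_plus. Qed.
Lemma rsinD (x y : R) : rsin (x+y) = rsin x*rcos y+rcos x*rsin y.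
Proof. exact: sin_plus. Qed.
Lemma rcos0 : rcos 0 = 1. Proof. exact: cos_0. Qed.
Lemma rsin0 : rsin 0 = 0. Proof. exact: sin_0. Qed.
Lemma rcosN (x : R) : rcos (- x) = rcos x. Proof. exact: cos_neg. Qed.
Lemma rsinN (x : R) : rsin (- x) = - rsin x. Proof. exact: sin_neg. Qed.
Lemma rcos2Dsin2 (x : R) : rcos x^+2+rsin x^+2 = 1.
Proof. by rewrite addrC !expr2; exact: sin2_cos2. Qed.
Lemma rcos_pi : rcos rpi = -1. Proof. rewrite rpiE; exact: cos_PI. Qed.
Lemma rsin_pi : rsin rpi = 0. Proof. rewrite rpiE; exact: sin_PI. Qed.
Lemma rcos_2pi : rcos (rpi+rpi) = 1.
Proof. rewrite rcosD rcos_pi rsin_pi; ring. Qed.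
Lemma rsin_2pi : rsin (rpi+rpi) = 0.
Proof. rewrite rsinD rsin_pi; ring. Qed.
Lemma rpi_gt3 : 3 < rpi. Proof. rewrite rpiE; exact/RltP/pi_gt_three. Qed.
Lemma rpi_le4 : rpi <= 4. Proof. rewrite rpiE; exact/RleP/pi_le_four. Qed.
Lemma rsin_le (x : R) : 0 <= x -> rsin x <= x.
Proof.
rewrite le_eqVlt => /orP [/eqP <-|/RltP h]; first by rewrite rsin0.
exact/RleP/Rlt_le/sin_lt_x.
Qed.
Lemma rsub_sin_le (x : R) : 0 <= x -> x-rsin x <= x*x.
Proof. by move=> /RleP h0; exact/RleP/sub_sin_le. Qed.
Lemma rsin_ge (x : R) : 0 <= x -> x *+ 2 <= rpi -> x <= rsin x *+ 3.
Proof. rewrite rpiE; by move=> /RleP h0 /RleP h1; exact/RleP/sin_ge_third. Qed.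

Opaque RT rexp rln rcos rsin rpi.

Local Open Scope complex_scope.
Notation C := (R[i]).
Notation Re := complex.Re.
Notation Im := complex.Im.
Notation cj := (@conjc RT).

(** Squared modulus and modulus with values in [R]; the norm that [R[i]] carries as a numeric field
    takes its values in [R[i]] itself. *)
Definition N2 (z : C) : R := Re z^+2+Im z^+2.
Definition nm (z : C) : R := Num.sqrt (N2 z).

Lemma N2_ge0 z : 0 <= N2 z.
Proof. by rewrite addr_ge0 ?sqr_ge0. Qed.
Lemma nm_ge0 z : 0 <= nm z. Proof. exact: sqrtr_ge0. Qed.
Lemma nm_sqr z : nm z^+2 = N2 z.
Proof. by rewrite sqr_sqrtr ?N2_ge0. Qed.
Lemma N2M x y : N2 (x*y) = N2 x*N2 y.
Proof. case: x => a b; case: y => c d; rewrite /N2 /=; ring. Qed.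
Lemma nmM x y : nm (x*y) = nm x*nm y.
Proof. by rewrite /nm N2M sqrtrM ?N2_ge0. Qed.
Lemma N2J x : N2 (cj x) = N2 x.
Proof. case: x => a b; rewrite /N2 /=; ring. Qed.
Lemma nmJ x : nm (cj x) = nm x. Proof. by rewrite /nm N2J. Qed.
Lemma N2N x : N2 (- x) = N2 x.
Proof. case: x => a b; rewrite /N2 /=; ring. Qed.
Lemma nmN x : nm (- x) = nm x. Proof. by rewrite /nm N2N. Qed.
Lemma N2_real (r : R) : N2 (r%:C) = r^+2.
Proof. rewrite /N2 /=; ring. Qed.
Lemma nm_real (r : R) : 0 <= r -> nm (r%:C) = r.
Proof. by move=> r0; rewrite /nm N2_real sqrtr_sqr ger0_norm. Qed.
Lemma nm_realE (r : R) : nm (r%:C) = `|r|.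
Proof. by rewrite /nm N2_real sqrtr_sqr. Qed.
Lemma nm0 : nm 0 = 0. Proof. by rewrite (nm_real (lexx 0)). Qed.
Lemma nm1 : nm 1 = 1. Proof. by rewrite (nm_real ler01). Qed.
Lemma N20 : N2 0 = 0. Proof. by rewrite -nm_sqr nm0 expr0n. Qed.
Lemma N21 : N2 1 = 1. Proof. by rewrite -nm_sqr nm1 expr1n. Qed.
Lemma nm_N2 z : nm z <= 1 -> N2 z <= 1.
Proof. by move=> h; rewrite -nm_sqr expr_le1 ?nm_ge0. Qed.
Lemma N2_nm z : N2 z <= 1 -> nm z <= 1.
Proof. by rewrite -nm_sqr expr_le1 ?nm_ge0. Qed.
Lemma nm_le z (r : R) : 0 <= r -> N2 z <= r^+2 -> nm z <= r.
Proof. by move=> r0; rewrite -nm_sqr ler_pXn2r // nnegrE ?nm_ge0. Qed.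
Lemma N2_le z (r : R) : nm z <= r -> N2 z <= r^+2.
Proof.
by move=> h; rewrite -nm_sqr ler_pXn2r // nnegrE ?nm_ge0 // (leT (nm_ge0 z)).
Qed.

Lemma N2_mulJ x : x*(cj x) = (N2 x)%:C.
Proof. by case: x => a b; rewrite /N2; simpc; congr (_ +i* _); ring. Qed.
Lemma Re_nm z : `|Re z| <= nm z.
Proof.
rewrite -ler_sqr ?nnegrE ?nm_ge0 // nm_sqr /N2 real_normK ?num_real //.
by rewrite lerDl sqr_ge0.
Qed.
Lemma Re_le_nm z : Re z <= nm z.
Proof. exact: leT (ler_norm _) (Re_nm z). Qed.
Lemma Im_nm z : `|Im z| <= nm z.
Proof.
rewrite -ler_sqr ?nnegrE ?nm_ge0 // nm_sqr /N2 real_normK ?num_real //.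
by rewrite lerDr sqr_ge0.
Qed.

Lemma Re_D (x y : C) : Re (x+y) = Re x+Re y. Proof. by case: x; case: y. Qed.
Lemma nmD x y : nm (x+y) <= nm x+nm y.
Proof.
apply: nm_le; first by rewrite addr_ge0 ?nm_ge0.
have -> : N2 (x+y) = N2 x+N2 y+2*Re (x*(cj y)).
 by case: x => a b; case: y => c d; rewrite /N2 /=; ring.
have := Re_le_nm (x*(cj y)); rewrite nmM nmJ sqrrD !nm_sqr => h; lra.
Qed.
Lemma nmB x y : nm (x-y) <= nm x+nm y.
Proof. by rewrite -(nmN y) nmD. Qed.
Lemma nm_subC x y : nm (x-y) = nm (y-x).
Proof. by rewrite -nmN opprB. Qed.
Lemma nm_tri x y z : nm (x-z) <= nm (x-y)+nm (y-z).
Proof. have -> : x-z = (x-y)+(y-z) by ring. exact: nmD. Qed.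
Lemma N2D x y : N2 (x+y) <= 2*(N2 x+N2 y).
Proof.
case: x => a b; case: y => c d; rewrite /N2 /=.
have := sqr_ge0 (a-c); have := sqr_ge0 (b-d); nra.
Qed.
Lemma N2B x y : N2 (x-y) <= 2*(N2 x+N2 y).
Proof. by rewrite -(N2N y) N2D. Qed.

Lemma Re_sum I (r : seq I) (P : pred I) (F : I -> C) :
 Re (\sum_(i <- r | P i) F i) = \sum_(i <- r | P i) Re (F i).
Proof. by rewrite (big_morph _ Re_D (erefl : Re 0 = 0)). Qed.
Lemma nm_sum I (r : seq I) (P : pred I) (F : I -> C) :
 nm (\sum_(i <- r | P i) F i) <= \sum_(i <- r | P i) nm (F i).
Proof.
elim/big_rec2: _ => [|i x y Pi h]; first by rewrite nm0.
by apply: leT (nmD _ _) _; rewrite lerD2l.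
Qed.
Lemma realC_sum I (r : seq I) (P : pred I) (F : I -> R) :
 (\sum_(i <- r | P i) F i)%:C = \sum_(i <- r | P i) (F i)%:C.
Proof. exact: rmorph_sum. Qed.
Lemma conj_sum I (r : seq I) (P : pred I) (F : I -> C) :
 (cj (\sum_(i <- r | P i) F i)) = \sum_(i <- r | P i) (cj (F i)).
Proof. exact: rmorph_sum. Qed.
Lemma conjM (x y : C) : (cj (x*y)) = (cj x)*(cj y).
Proof. exact: rmorphM. Qed.
Lemma conjB (x y : C) : (cj (x-y)) = (cj x)-(cj y).
Proof. exact: rmorphB. Qed.
Lemma conj_real (r : R) : (cj (r%:C)) = r%:C.
Proof. exact: conjc_real. Qed.

(** * Cauchy-Schwarz, the Schur test and its dual *)

Lemma CS_real I (r : seq I) (P : pred I) (a b : I -> R) :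
 (\sum_(i <- r | P i) a i*b i)^+2 <=
 (\sum_(i <- r | P i) a i^+2)*(\sum_(i <- r | P i) b i^+2).
Proof.
set S := \sum_(i <- r | P i) a i*b i.
set A := \sum_(i <- r | P i) a i^+2; set B := \sum_(i <- r | P i) b i^+2.
have key (x y : R) : 0 <= x^+2*A+2*x*y*S+y^+2*B.
 have -> : x^+2*A+2*x*y*S+y^+2*B =
  \sum_(i <- r | P i) (x*a i+y*b i)^+2.
  rewrite /A /S /B !mulr_sumr -!big_split /=; apply: eq_bigr => i _; ring.
 by apply: sumr_ge0 => i _; apply: sqr_ge0.
have A0: 0 <= A by apply: sumr_ge0 => i _; apply: sqr_ge0.
have [A_eq|A_neq] := eqVneq A 0.
 have B0: 0 <= B by apply: sumr_ge0 => i _; apply: sqr_ge0.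
 have [->|S0] := eqVneq S 0; first by rewrite expr0n A_eq mul0r.
 (* For [A = 0] the form is affine in [x]; at this point it equals [-2(B+1) + B], which is
    negative. *)
 have := key (- (B+1)/S) 1; rewrite A_eq.
 have -> : 2*(- (B+1)/S)*1*S = - 2*(B+1) by field.
 lra.
have := key (- S) A.
have -> : (- S)^+2*A+2 * - S*A*S+A^+2*B = A*(A*B-S^+2) by ring.
by rewrite pmulr_rge0 ?lt_def ?A_neq // subr_ge0.
Qed.

Lemma CS I (r : seq I) (P : pred I) (a b : I -> C) :
 N2 (\sum_(i <- r | P i) a i*b i) <=
 (\sum_(i <- r | P i) N2 (a i))*(\sum_(i <- r | P i) N2 (b i)).
Proof.
have -> : \sum_(i <- r | P i) N2 (a i) = \sum_(i <- r | P i) nm (a i)^+2.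
 by apply: eq_bigr => i _; rewrite nm_sqr.
have -> : \sum_(i <- r | P i) N2 (b i) = \sum_(i <- r | P i) nm (b i)^+2.
 by apply: eq_bigr => i _; rewrite nm_sqr.
apply: leT (CS_real _ _ _ _); rewrite -nm_sqr ler_sqr ?nnegrE ?nm_ge0 //.
 by apply: leT (nm_sum _ _ _) _; apply: ler_sum => i _; rewrite nmM.
by apply: sumr_ge0 => i _; rewrite mulr_ge0 ?nm_ge0.
Qed.

Lemma CS1_real I (r : seq I) (P : pred I) (a : I -> R) :
 (\sum_(i <- r | P i) a i)^+2 <= (\sum_(i <- r | P i) 1)*\sum_(i <- r | P i) a i^+2.
Proof.
have := CS_real r P (fun=> 1) a.
by under eq_bigr do rewrite mul1r; under [X in X*_]eq_bigr do rewrite expr1n.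
Qed.

Lemma CS1 I (r : seq I) (P : pred I) (a : I -> C) :
 N2 (\sum_(i <- r | P i) a i) <= (\sum_(i <- r | P i) 1)*\sum_(i <- r | P i) N2 (a i).
Proof.
have := CS r P (fun=> 1) a.
by under eq_bigr do rewrite mul1r; under [X in X*_]eq_bigr do rewrite N21.
Qed.

(** Expanding the square gives the Hermitian form of the Gram matrix [G]. Each [|c x| |c x'|] is at
    most the mean of the two squares, and by symmetry of [|G|] the form is then bounded by its row
    sums. *)
Lemma schur I J (rI : seq I) (rJ : seq J) (V : J -> R) (w : I -> J -> C) (K : R)
  (c : I -> C) :
 (forall x, \sum_(x' <- rI) nm (\sum_(y <- rJ) (V y)%:C*w x y*(cj (w x' y))) <= K) ->
 \sum_(y <- rJ) V y*N2 (\sum_(x <- rI) c x*w x y) <= K*\sum_(x <- rI) N2 (c x).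
Proof.
move=> hK; pose G x x' := \sum_(y <- rJ) (V y)%:C*w x y*(cj (w x' y)).
have Gsym x x' : nm (G x x') = nm (G x' x).
 rewrite -nmJ /G conj_sum; congr nm; apply: eq_bigr => y _.
 by rewrite !conjM conj_real conjcK mulrAC.
have E: (\sum_(y <- rJ) V y*N2 (\sum_(x <- rI) c x*w x y))%:C =
  \sum_(x <- rI) \sum_(x' <- rI) c x*(cj (c x'))*G x x'.
 rewrite realC_sum.
 transitivity (\sum_(y <- rJ) \sum_(x <- rI) \sum_(x' <- rI)
   c x*(cj (c x'))*((V y)%:C*w x y*(cj (w x' y)))).
  apply: eq_bigr => y _; rewrite rmorphM /= -N2_mulJ conj_sum mulr_suml mulr_sumr.
  apply: eq_bigr => x _; rewrite !mulr_sumr; apply: eq_bigr => x' _.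
  rewrite conjM; ring.
 rewrite exchange_big; apply: eq_bigr => x _; rewrite exchange_big.
 by apply: eq_bigr => x' _; rewrite mulr_sumr.
have -> : \sum_(y <- rJ) V y*N2 (\sum_(x <- rI) c x*w x y) =
  Re (\sum_(x <- rI) \sum_(x' <- rI) c x*(cj (c x'))*G x x') by rewrite -E.
apply: leT (Re_le_nm _) _; apply: leT (nm_sum _ _ _) _.
have b1: \sum_(x <- rI) nm (\sum_(x' <- rI) c x*(cj (c x'))*G x x') <=
 \sum_(x <- rI) \sum_(x' <- rI) (N2 (c x)/2*nm (G x x')+N2 (c x')/2*nm (G x' x)).
 apply: ler_sum => x _; apply: leT (nm_sum _ _ _) _; apply: ler_sum => x' _.
 rewrite (Gsym x' x) -mulrDl !nmM nmJ leMr ?nm_ge0 // -!nm_sqr.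
 have := sqr_ge0 (nm (c x)-nm (c x')); nra.
apply: leT b1 _.
have -> : \sum_(x <- rI) \sum_(x' <- rI) (N2 (c x)/2*nm (G x x')+N2 (c x')/2*nm (G x' x))
 = \sum_(x <- rI) N2 (c x)*\sum_(x' <- rI) nm (G x x').
 under eq_bigr do rewrite big_split /=.
 rewrite big_split /= [X in _+X]exchange_big -big_split /=.
 apply: eq_bigr => x _; rewrite -!mulr_sumr; lra.
rewrite mulr_sumr; apply: ler_sum => x _; rewrite [leRHS]mulrC leMl ?N2_ge0 //.
exact: hK.
Qed.

(** Dual form of [schur]. With [c x] the inner product of [f] and [w x], the left side [S] is the
    inner product of [f] with the combination of the [w x] with coefficients [conj(c x)];
    Cauchy-Schwarz and [schur] give [S^2 <= F K S]. *)
Lemma bessel I J (rI : seq I) (rJ : seq J) (V : J -> R) (w : I -> J -> C) (K : R)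
  (f : J -> C) :
 0 <= K -> (forall y, 0 <= V y) ->
 (forall x, \sum_(x' <- rI) nm (\sum_(y <- rJ) (V y)%:C*w x y*(cj (w x' y))) <= K) ->
 \sum_(x <- rI) N2 (\sum_(y <- rJ) (V y)%:C*f y*w x y) <=
 K*\sum_(y <- rJ) V y*N2 (f y).
Proof.
move=> K0 V0 hK; pose c x := \sum_(y <- rJ) (V y)%:C*f y*w x y.
set S := \sum_(x <- rI) _; set F := \sum_(y <- rJ) _.
have F0: 0 <= F by apply: sumr_ge0 => y _; rewrite mulr_ge0 ?N2_ge0.
have S0: 0 <= S by apply: sumr_ge0 => y _; rewrite N2_ge0.
have E: S%:C = \sum_(y <- rJ)
  ((Num.sqrt (V y))%:C*f y)*((Num.sqrt (V y))%:C*\sum_(x <- rI) (cj (c x))*w x y).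
 rewrite /S realC_sum.
 transitivity (\sum_(x <- rI) \sum_(y <- rJ) (V y)%:C*f y*w x y*(cj (c x))).
  by apply: eq_bigr => x _; rewrite -N2_mulJ mulr_suml.
 rewrite exchange_big; apply: eq_bigr => y _; rewrite !mulr_sumr; apply: eq_bigr => x _.
 have -> : (V y)%:C = (Num.sqrt (V y))%:C*(Num.sqrt (V y))%:C.
  by rewrite -rmorphM -expr2 sqr_sqrtr.
 ring.
have h: S^+2 <= F*(K*S).
 rewrite -N2_real E; apply: leT (CS _ _ _ _) _.
 have -> : \sum_(i <- rJ) N2 ((Num.sqrt (V i))%:C*f i) = F.
  by apply: eq_bigr => y _; rewrite N2M N2_real sqr_sqrtr.
 rewrite leMl //.
 have -> : \sum_(i <- rJ) N2 ((Num.sqrt (V i))%:C*\sum_(x <- rI) (cj (c x))*w x i) =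
   \sum_(y <- rJ) V y*N2 (\sum_(x <- rI) (cj (c x))*w x y).
  by apply: eq_bigr => y _; rewrite N2M N2_real sqr_sqrtr.
 apply: leT (schur _ hK) _.
 by under eq_bigr do rewrite N2J.
have [S_eq|S_neq] := eqVneq S 0; first by rewrite S_eq mulr_ge0.
have Sp: 0 < S by rewrite lt_def S_neq.
by move: h; rewrite expr2 mulrA ler_pM2r // mulrC.
Qed.

Notation bnd1 f := (forall n, nm (f n) <= 1).
Notation qmult b g f := (forall p m, prime p -> (b<p)%N -> (0<m)%N -> f (p * m)%N = g p*f m).

(** * Exponential, logarithm and the unit circle *)

Lemma rexp_le (x y : R) : (rexp x <= rexp y) = (x <= y).
Proof.
case: (ltgtP x y) => [h|h|->]; last by rewrite lexx.
 by rewrite ltW ?rexp_lt.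
by apply/negbTE; rewrite -ltNge rexp_lt.
Qed.
Lemma rexp_ltE (x y : R) : (rexp x < rexp y) = (x < y).
Proof. by rewrite !ltNge rexp_le. Qed.
Lemma rexp_ge0 (x : R) : 0 <= rexp x. Proof. exact/ltW/rexp_gt0. Qed.
Lemma rexpN (x : R) : rexp (- x) = (rexp x)^-1.
Proof.
have h: rexp x != 0 by rewrite gt_eqF ?rexp_gt0.
by apply: (mulfI h); rewrite -rexpD subrr rexp0 divff.
Qed.
Lemma rexpB (x y : R) : rexp (x-y) = rexp x/rexp y.
Proof. by rewrite rexpD rexpN. Qed.
Lemma rexpX (x : R) n : rexp (x*n%:R) = rexp x^+n.
Proof.
elim: n => [|n IH]; first by rewrite mulr0 rexp0 expr0.
by rewrite exprS -IH -rexpD; congr rexp; rewrite -natr1; ring.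
Qed.
Lemma le_of_eq (x y : R) : x = y -> x <= y. Proof. by move->. Qed.

Lemma rln1 : rln 1 = 0. Proof. by rewrite -rexp0 rexpK. Qed.
Lemma rln_le (x y : R) : 0 < x -> x <= y -> rln x <= rln y.
Proof. by move=> x0 xy; rewrite -rexp_le !rlnK // (lt_le_trans x0). Qed.
Lemma rln_lt (x y : R) : 0 < x -> x < y -> rln x < rln y.
Proof. by move=> x0 xy; rewrite -rexp_ltE !rlnK // (lt_trans x0). Qed.
Lemma rlnM (x y : R) : 0 < x -> 0 < y -> rln (x*y) = rln x+rln y.
Proof. by move=> x0 y0; rewrite -(rexpK (_+_)) rexpD !rlnK. Qed.
Lemma rlnV (x : R) : 0 < x -> rln (x^-1) = - rln x.
Proof. by move=> x0; rewrite -(rexpK (- _)) rexpN rlnK. Qed.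
Lemma rlnD (x y : R) : 0 < x -> 0 < y -> rln (x/y) = rln x-rln y.
Proof. by move=> x0 y0; rewrite rlnM ?invr_gt0 // rlnV. Qed.
Lemma rlnX (x : R) n : 0 < x -> rln (x^+n) = n%:R*rln x.
Proof. by move=> x0; rewrite -{1}(rlnK x0) -rexpX rexpK mulrC. Qed.
Lemma rln_le_sub1 (x : R) : 0 < x -> rln x <= x-1.
Proof. by move=> x0; have := rexp_ge1D (rln x); rewrite rlnK //; lra. Qed.
Lemma rln_ge_subV (x : R) : 0 < x -> 1-x^-1 <= rln x.
Proof.
by move=> x0; have := rln_le_sub1 (_ : 0 < x^-1); rewrite rlnV ?invr_gt0 // => /(_ x0); lra.
Qed.
Lemma rln_ge0 (x : R) : 1 <= x -> 0 <= rln x.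
Proof. by move=> h; rewrite -rln1 rln_le. Qed.
Lemma rln_gt0 (x : R) : 1 < x -> 0 < rln x.
Proof. by move=> h; rewrite -rln1 rln_lt. Qed.
Lemma rexp_ge_pow (x : R) n : (0<n)%N -> 0 <= x -> (x/n%:R)^+n <= rexp x.
Proof.
move=> n0 x0; have nn: (n%:R : R) != 0 by rewrite pnatr_eq0 -lt0n.
rewrite -{2}(divfK nn x) rexpX lerXn2r ?nnegrE ?rexp_ge0 ?divr_ge0 //.
by have := rexp_ge1D (x/n%:R); lra.
Qed.
Fact cis_key : unit. Proof. by []. Qed.
Definition cis : R -> C := locked_with cis_key (fun x : R => rcos x +i* rsin x).
Lemma cisE x : cis x = rcos x +i* rsin x. Proof. by rewrite /cis unlock. Qed.

Lemma cisD x y : cis (x+y) = cis x*cis y.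
Proof. by rewrite !cisE rcosD rsinD; simpc; congr (_ +i* _); ring. Qed.
Lemma cis0 : cis 0 = 1. Proof. by rewrite cisE rcos0 rsin0. Qed.
Lemma N2_cis x : N2 (cis x) = 1. Proof. rewrite cisE; exact: rcos2Dsin2. Qed.
Lemma nm_cis x : nm (cis x) = 1. Proof. by rewrite /nm N2_cis sqrtr1. Qed.
Lemma cisN x : cis (- x) = cj (cis x).
Proof. by rewrite !cisE rcosN rsinN. Qed.
Lemma cis_mulJ x : cis x*cj (cis x) = 1.
Proof. by rewrite N2_mulJ N2_cis. Qed.
Lemma cisB x y : cis (x-y) = cis x*cj (cis y).
Proof. by rewrite cisD cisN. Qed.
Lemma cisX x n : cis (x*n%:R) = cis x^+n.
Proof.
elim: n => [|n IH]; first by rewrite mulr0 cis0 expr0.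
by rewrite exprS -IH -cisD; congr cis; rewrite -natr1; ring.
Qed.
Lemma cis_2pi : cis (2*rpi) = 1.
Proof. by rewrite mulr_natl mulr2n cisE rcos_2pi rsin_2pi. Qed.
Lemma cis_2piN n : cis (2*rpi*n%:R) = 1.
Proof. by rewrite cisX cis_2pi expr1n. Qed.
Lemma cis_2piZ (m : int) : cis (2*rpi * m%:~R) = 1.
Proof.
case: m => n; first exact: cis_2piN.
by rewrite NegzE mulrNz mulrN cisN cis_2piN conjc1.
Qed.
Lemma rpi_gt0 : 0 < rpi. Proof. have := rpi_gt3; lra. Qed.

Lemma rsin_abs (x : R) : `|rsin x| <= `|x|.
Proof.
wlog x0 : x / 0 <= x.
 move=> h; have [x0|x0] := leP 0 x; first exact: h.
 by rewrite -normrN -rsinN -(normrN x) h // oppr_ge0 ltW.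
rewrite (ger0_norm x0) ler_norml rsin_le // andbT.
have [x1|x1] := leP x 1; last first.
 have := rcos2Dsin2 x; have := sqr_ge0 (rcos x); nra.
have h2: x <= 3*rsin x.
 by rewrite mulr_natl; apply: rsin_ge => //; rewrite mulr2n; have := rpi_gt3; lra.
lra.
Qed.

Lemma N2_cis_sub1 x : N2 (cis x-1) = 4*rsin (x/2)^+2.
Proof.
have -> : N2 (cis x-1) = (rcos x^+2+rsin x^+2)+1-2*rcos x.
 by rewrite /N2 cisE /=; ring.
rewrite rcos2Dsin2.
have -> : rcos x = 1-2*rsin (x/2)^+2.
 rewrite {1}(_ : x = x/2+x/2); last by field.
 by rewrite rcosD; have := rcos2Dsin2 (x/2); lra.
ring.
Qed.
Lemma nm_cis_sub1 x : nm (cis x-1) = 2*`|rsin (x/2)|.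
Proof.
have -> : nm (cis x-1) = Num.sqrt ((2*rsin (x/2))^+2).
 by rewrite /nm N2_cis_sub1; congr Num.sqrt; ring.
by rewrite sqrtr_sqr normrM ger0_norm.
Qed.
Lemma cis_sub1_le x : nm (cis x-1) <= `|x|.
Proof.
rewrite nm_cis_sub1; have := rsin_abs (x/2); rewrite normrM [`|2^-1|]ger0_norm; lra.
Qed.
Lemma cis_lip x y : nm (cis x-cis y) <= `|x-y|.
Proof.
have -> : cis x-cis y = cis y*(cis (x-y)-1).
 rewrite mulrBr -cisD mulr1; congr (cis _-_); ring.
by rewrite nmM nm_cis mul1r cis_sub1_le.
Qed.
Lemma cis_sub1_ge (x : R) : `|x| <= rpi -> `|x| <= 3*nm (cis x-1).
Proof.
move=> h; rewrite nm_cis_sub1.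
wlog x0 : x h / 0 <= x.
 move=> H; have [x0|x0] := leP 0 x; first exact: H.
 have := H (- x); rewrite normrN oppr_ge0 mulNr rsinN normrN; apply=> //; exact: ltW.
move: h; rewrite (ger0_norm x0) => h.
have h2: x/2 <= 3*rsin (x/2).
 by rewrite mulr_natl; apply: rsin_ge; lra.
have := ler_norm (rsin (x/2)); lra.
Qed.
Lemma cis_taylor2 (x : R) : nm (cis x-1 - 'i*x%:C) <= 2*x^+2.
Proof.
wlog x0 : x / 0 <= x.
 move=> H; have [x0|x0] := leP 0 x; first exact: H.
 have := H (- x); rewrite oppr_ge0 sqrrN => /(_ (ltW x0)).
 rewrite cisN -nmJ !conjB conjcK conjc1; congr (nm (_-_-_) <= _).
 by rewrite conjM conj_real; simpc; congr (_ +i* _); ring.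
have -> : cis x-1 - 'i*x%:C = (rcos x-1) +i* (rsin x-x).
 by rewrite cisE; simpc; congr (_ +i* _); ring.
have h1: nm ((rcos x-1) +i* (rsin x-x)) <= `|rcos x-1| + `|rsin x-x|.
 apply: nm_le; first by rewrite addr_ge0.
 rewrite /N2 /= [leRHS]sqrrD !real_normK ?num_real //.
 by have := mulr_ge0 (normr_ge0 (rcos x-1)) (normr_ge0 (rsin x-x)); lra.
apply: leT h1 _.
have h2: `|rsin x-x| <= x^+2.
 rewrite distrC ger0_norm ?subr_ge0 ?rsin_le // expr2; exact: rsub_sin_le.
have h3: `|rcos x-1| <= x^+2.
 have -> : rcos x-1 = - 2*rsin (x/2)^+2.
  rewrite {1}(_ : x = x/2+x/2); last by field.
  by rewrite rcosD; have := rcos2Dsin2 (x/2); lra.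
 rewrite normrM normrX [`|- 2|]ler0_norm; last by lra.
 have := rsin_abs (x/2); rewrite [`|x/2|]ger0_norm ?divr_ge0 // => h.
 have := normr_ge0 (rsin (x/2)); nra.
lra.
Qed.

Definition npw (n : nat) (t : R) : C := cis (t*rln n%:R).

Lemma nm_npw n t : nm (npw n t) = 1. Proof. exact: nm_cis. Qed.
Lemma N2_npw n t : N2 (npw n t) = 1. Proof. exact: N2_cis. Qed.
Lemma npwM m n t : (0<m)%N -> (0<n)%N -> npw (m*n) t = npw m t*npw n t.
Proof. by move=> m0 n0; rewrite /npw natrM rlnM ?ltr0n // mulrDr cisD. Qed.
Lemma npwD n t u : npw n (t+u) = npw n t*npw n u.
Proof. by rewrite /npw mulrDl cisD. Qed.
Lemma npwN n t : npw n (- t) = cj (npw n t).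
Proof. by rewrite /npw mulNr cisN. Qed.
Lemma npwB n t u : npw n (t-u) = npw n t*cj (npw n u).
Proof. by rewrite npwD npwN. Qed.
Lemma npw1 t : npw 1 t = 1. Proof. by rewrite /npw rln1 mulr0 cis0. Qed.

Lemma nat_above (x : R) : exists n : nat, x <= n%:R.
Proof.
exists (Num.truncn `|x|).+1; apply: leT (ler_norm x) _; apply: ltW; by case/andP: (truncn_itv (normr_ge0 x)).
Qed.

(** * Primes *)

Lemma sum_divn_pow2_le K n : (\sum_[k<=K] n %/ 2 ^ k<=n)%N.
Proof.
elim: K n => [|K IH] n; first by rewrite big_geq.
rewrite big_ltn // big_add1 /=.
under eq_big_nat => i _ do rewrite expnS divnMA.
rewrite expn1; have := IH (n %/ 2)%N; set s := (\sum_(_<=_<_) _)%N; lia.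
Qed.

Lemma logn_fact_le p n : (logn p n`! <= n)%N.
Proof.
have [pp|np] := boolP (prime p); last by rewrite lognE (negbTE np).
rewrite logn_fact //; apply: leqT (sum_divn_pow2_le n n).
rewrite !big_nat; apply: leq_sum => k /andP[k1 _]; apply: leq_div2l; first by rewrite expn_gt0.
by rewrite leq_exp2r // prime_gt1.
Qed.

(** A prime dividing [b] occurs in [n!] to a power at most [n], and in [b^n] to a power at least
    [n]. *)
Lemma fact_part_le b n : (0<b)%N -> ((n`!)`_(\pi(b))<=b ^ n)%N.
Proof.
move=> b0; have l1: (n`! <= n`! + b)%N by exact: leq_addr.
have l2: (b<=n`! + b)%N by exact: leq_addl.
rewrite (widen_partn _ l1).
have -> : (b ^ n = (\prod_(0 <= p < (n`! + b).+1 | p \in \pi(b)) p ^ logn p b) ^ n)%N.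
 by rewrite -(widen_partn _ l2) part_pnat_id // pnat_pi.
rewrite (big_morph (expn^~ n) (fun x y => expnMn x y n) (exp1n n)); apply: leq_prod => p pb; rewrite -expnM.
move: (pb); rewrite mem_primes => /and3P [pp _ pdvd].
rewrite leq_exp2l ?prime_gt1 //; apply: leqT (logn_fact_le p n) _.
by rewrite leq_pmull // logn_gt0.
Qed.

(** Modulo the part [m] of [n!] prime to [b], Bezout gives [a] with [a b = -1]. Multiplied by [a],
    the factors become the consecutive integers [T - i], whose product is a falling factorial and so
    a multiple of [n!]; the factor [a^n] is coprime to [m] and can be removed. *)
Lemma coprime_part_dvd_prod b n r :
 (0<b)%N -> ((n`!)`_(\pi(b)^') %| \prod_(k<n) (b*k+r))%N.
Proof.
move=> b0; set m := ((n`!)`_(\pi(b)^'))%N.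
have m0: (0<m)%N by rewrite part_gt0.
have cmb: coprime m b.
 by rewrite coprime_sym -{1}(part_pnat_id (pnat_pi b0)) coprime_partC.
case: (Bezoutl b m0) => a _; rewrite (eqP cmb) add1n => hdvd.
have cma: coprime m (a ^ n).
 apply: coprimeXr; rewrite /coprime -dvdn1 -(dvdn_addl (n := a*b)) ?addn1 //.
  by apply: dvdn_trans hdvd; apply: dvdn_gcdl.
 by apply: dvdn_mulr; apply: dvdn_gcdr.
rewrite -(Gauss_dvdr _ cma) -[n in (a ^ n)%N]card_ord -prod_nat_const -big_split /=.
(* The summand [m*n] vanishes modulo [m]; it makes the subtraction in [T - i] exact for [i < n]. *)
pose T := (a*r+m*n)%N.
have E: (\prod_(i<n) (a*(b * i+r)) = \prod_(i<n) (T-i) %[mod m])%N.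
 apply: (big_ind2 (fun x y : nat => x = y %[mod m])) => // [x1 x2 y1 y2 h1 h2|i _].
  by rewrite -modnMm h1 h2 modnMm.
 apply/eqP; rewrite -(eqn_modDr i) subnK.
  have -> : (a*(b * i+r) + i = (a*b).+1 * i+a*r)%N by ring.
  rewrite /T; apply/eqP; case/dvdnP: hdvd => c ->.
  by rewrite mulnAC -modnDml modnMl add0n [(m*n)%N]mulnC -modnDmr modnMl addn0.
 have := ltn_ord i; rewrite /T => /ltnW /leqT; apply.
 by rewrite (leqT (leq_pmull n m0)) ?leq_addl.
rewrite /dvdn E -/(dvdn _ _) -ffact_prod -bin_ffact.
by apply: dvdn_mull; apply: dvdn_part.
Qed.

Lemma dvdn_prod_primes (s : seq nat) m A : uniq s -> all prime s ->
 (m %| A)%N -> {in s, forall q, (q %| A)%N} -> {in s, forall q, coprime q m} ->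
 (m*\prod_(q <- s) q %| A)%N.
Proof.
elim: s => [|q s IH] /=; first by rewrite big_nil muln1.
move=> /andP[qs us] /andP[pq ps] mA sA cs; rewrite big_cons mulnCA Gauss_dvd; last first.
 rewrite coprimeMr cs ?mem_head //=.
 rewrite big_seq; apply: (big_ind (fun x => coprime q x)) => [|x y|x xs]; rewrite ?coprimen1 //.
  by rewrite coprimeMr => -> ->.
 rewrite prime_coprime // dvdn_prime2 //; last exact: (allP ps).
 by apply/negP => /eqP qx; rewrite qx xs in qs.
rewrite sA ?mem_head //=; apply: IH => // x xs; [apply: sA|apply: cs]; exact: mem_behead.
Qed.

(** Chebyshev's argument in a progression. Each of the primes is one of the factors [b k + r] of [A]
    and, exceeding [n], is coprime to [n!]. Hence [m] times the product of the primes divides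
    [A <= b^n n!], and cancelling [m] leaves [b^n] times the part of [n!] estimated in
    [fact_part_le]. *)
Lemma prod_primes_ap_le b n r (s : seq nat) : (0<r<b)%N ->
 uniq s -> all prime s ->
 {in s, forall q, (n<q<b*n)%N /\ (q = r %[mod b])} ->
 (\prod_(q <- s) q<=b ^ n*b ^ n)%N.
Proof.
move=> /andP[r0 rb] us ps hs; have b0: (0<b)%N by lia.
set A := (\prod_(k<n) (b*k+r))%N; set m := ((n`!)`_(\pi(b)^'))%N.
have hA: (m*\prod_(q <- s) q %| A)%N.
 apply: dvdn_prod_primes => //; first exact: coprime_part_dvd_prod.
  move=> q /hs [/andP[nq qb] qr].
  have kn: (q %/ b<n)%N by rewrite ltn_divLR // mulnC.
  rewrite /A (bigD1 (Ordinal kn)) //= dvdn_mulr //.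
  rewrite {1}(divn_eq q b) qr (modn_small rb) mulnC; exact: dvdnn.
 move=> q qs; have [/andP[nq _] _] := hs _ qs.
 rewrite prime_coprime ?(allP ps) //; apply: contraL nq => qm.
 rewrite -leqNgt; have : (q %| n`!)%N by apply: dvdn_trans qm (dvdn_part _ _).
 have pq := allP ps _ qs.
 elim: (n) => [|k IH]; first by rewrite fact0 dvdn1 => /eqP q1; rewrite q1 in pq.
 by rewrite factS Euclid_dvdM // => /orP [/dvdn_leq->//|/IH /leqT]; apply.
have A0: (0<A)%N by rewrite prodn_gt0 // => i; rewrite addn_gt0 r0 orbT.
have mA: (m*\prod_(q <- s) q<=b ^ n*n`!)%N.
 apply: leqT (dvdn_leq A0 hA) _.
 rewrite fact_prod big_add1 /= big_mkord -[n in (b ^ n)%N]card_ord -prod_nat_const -big_split /=.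
 by apply: leq_prod => k _; rewrite mulnS addnC leq_add2r ltnW.
have m0: (0<m)%N by rewrite part_gt0.
rewrite -(leq_pmul2l m0); apply: leqT mA _.
rewrite -{1}(partnC \pi(b) (fact_gt0 n)) -/m.
have := fact_part_le n b0; nia.
Qed.

Lemma rln_prod (s : seq nat) : all prime s ->
 rln (\prod_(q <- s) q)%N%:R = \sum_(q <- s) rln q%:R.
Proof.
elim: s => [|q s IH] /=; first by rewrite !big_nil rln1.
move=> /andP[pq ps]; rewrite !big_cons natrM rlnM ?IH // ltr0n.
 exact: prime_gt0.
by rewrite big_seq prodn_cond_gt0 // => i /(allP ps) /prime_gt0.
Qed.

Definition ap_primes (b r Q : nat) : seq nat :=
 [seq q <- index_iota Q.+1 (2*Q).+1 | prime q && (q %% b == r %% b)%N].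

(** With [n = floor(2Q/b) + 1] the primes up to [2Q] lie below [b n], and [n <= Q] because [b >= 3].
    The factor [log b] on the right is affordable: the covering hypothesis in [equidist_rational]
    carries a matching logarithm. *)
Lemma ap_primes_count b r Q : (0<r<b)%N -> (3<=b<=Q)%N ->
 (size (ap_primes b r Q))%:R*rln Q%:R <= 6*(Q%:R/b%:R)*rln b%:R.
Proof.
move=> hr /andP[b3 bQ]; pose n := ((2*Q) %/ b).+1; set s := ap_primes b r Q.
have b0: (0<b)%N by lia.
have nQ: (n<=Q)%N.
 have : ((2*Q) %/ b<=(2*Q) %/ 3)%N by apply: leq_div2l.
 rewrite /n; lia.
have us: uniq s by rewrite filter_uniq // iota_uniq.
have ps: all prime s by apply/allP => q; rewrite mem_filter => /andP[/andP[]].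
have hs q : q \in s -> [/\ (Q<q)%N, (q<=2*Q)%N & q = r %[mod b]].
 by rewrite mem_filter mem_index_iota ltnS => /andP[/andP[_ /eqP ->] /andP[-> ->]].
have hb: (\prod_(q <- s) q<=b ^ n*b ^ n)%N.
 apply: (prod_primes_ap_le hr) => // q /hs [h1 h2 h3]; split => //.
 rewrite (leq_ltn_trans nQ h1) /= (leq_ltn_trans h2) //.
 by rewrite /n [X in (_<X)%N]mulnC ltn_ceil.
have l1: (size s)%:R*rln Q%:R <= \sum_(q <- s) rln q%:R.
 rewrite -[X in X%:R*_]sum1_size natr_sum mulr_suml big_seq [leRHS]big_seq.
 apply: ler_sum => q /hs [h1 _ _]; rewrite mul1r rln_le ?ler_nat ?ltr0n; lia.
have l2: \sum_(q <- s) rln q%:R <= 2*n%:R*rln b%:R.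
 rewrite -rln_prod //.
 have -> : 2*n%:R*rln b%:R = rln (b ^ n*b ^ n)%N%:R.
  by rewrite natrM natrX -exprD rlnX ?ltr0n // addnn -mul2n natrM.
 rewrite rln_le ?ler_nat // ltr0n big_seq prodn_cond_gt0 // => i /(allP ps) /prime_gt0 //.
apply: leT l1 (leT l2 _).
rewrite leMr ?rln_ge0 ?ler1n //.
have bR: 0 < (b%:R : R) by rewrite ltr0n.
have h: (n%:R : R) <= 2*(Q%:R/b%:R)+1.
 rewrite /n -natr1 lerD2r mulrA ler_pdivlMr // -!natrM ler_nat; exact: leq_trunc_div.
have h1: 1 <= Q%:R/b%:R:>R by rewrite ler_pdivlMr // mul1r ler_nat.
lra.
Qed.

(** * Chebyshev and Mertens bounds *)

Definition pcount (Q : nat) : nat := \sum_(Q.+1 <= q < (2*Q).+1 | prime q) 1.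

Lemma rln2_ge : 1/2 <= rln 2.
Proof. by have := @rln_ge_subV 2; lra. Qed.
Lemma rln2_le : rln 2 <= 1.
Proof. by have := @rln_le_sub1 2; lra. Qed.

(** A prime above 3 lies in one of the classes 1 and 2 modulo 3, so the bound for progressions with
    [b = 3] already contains Chebyshev's upper bound. *)
Lemma pcount_le (Q : nat) : (3<=Q)%N -> (pcount Q)%:R*rln Q%:R <= 8*(Q%:R : R).
Proof.
move=> Q3.
have h: (pcount Q<=size (ap_primes 3 1 Q)+size (ap_primes 3 2 Q))%N.
 rewrite -!sum1_size !big_filter /pcount [leqLHS]big_mkcond.
 rewrite [X in (_<=X+_)%N]big_mkcond [X in (_<=_+X)%N]big_mkcond -big_split /=.
 rewrite big_nat_cond [leqRHS]big_nat_cond; apply: leq_sum => q /andP[/andP[q1 q2] _].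
 case: (boolP (prime q)) => //= pq.
 have : (q %% 3 != 0)%N.
  by apply/negP; rewrite -/(dvdn 3 q) dvdn_prime2 // => /eqP q3; lia.
 have : (q %% 3<3)%N by rewrite ltn_mod.
 by case: (q %% 3)%N => [|[|[|]]].
have h1 := @ap_primes_count 3 1 Q isT; have h2 := @ap_primes_count 3 2 Q isT.
have {}h1 := h1 Q3; have {}h2 := h2 Q3.
have l3: rln 3%:R <= 2 by have := @rln_le_sub1 3; lra.
have lQ: 0 <= rln Q%:R by rewrite rln_ge0 // ler1n; lia.
have : (pcount Q)%:R*rln Q%:R <= ((size (ap_primes 3 1 Q))%:R+(size (ap_primes 3 2 Q))%:R)*rln Q%:R.
 by rewrite leMr // -natrD ler_nat.
have Q0: 0 <= Q%:R:>R by [].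
nra.
Qed.

Lemma pcount2_le i : (2<=i)%N -> (pcount (2 ^ i))%:R <= 16*(2^+i/i%:R):>R.
Proof.
move=> i2; have Q3: (3<=2 ^ i)%N by apply: leqT (leq_pexp2l _ i2).
have := pcount_le Q3; rewrite natrX rlnX // => h.
have i0: 0 < i%:R:>R by rewrite ltr0n; lia.
rewrite mulrA ler_pdivlMr //.
have := rln2_ge; have : 0 <= (pcount (2 ^ i))%:R:>R by [].
have : 0 <= (pcount (2 ^ i))%:R * i%:R:>R by rewrite mulr_ge0.
nra.
Qed.

Lemma big_dyadic (T : Type) (idx : T) (op : Monoid.com_law idx) (P : pred nat) (F : nat -> T) j k :
 (j<=k)%N ->
 \big[op/idx]_((2 ^ j).+1 <= q < (2 ^ k).+1 | P q) F q =
 \big[op/idx]_(j <= i < k) \big[op/idx]_((2 ^ i).+1 <= q < (2*2 ^ i).+1 | P q) F q.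
Proof.
move=> /subnKC <-; elim: (k-j)%N => [|n IH]; first by rewrite addn0 !big_geq.
rewrite addnS big_nat_recr ?leq_addr //= -IH -expnS.
by rewrite -big_cat_nat //= ltnS leq_pexp2l // ?leq_addr // addnS ltnW.
Qed.

Lemma sum_dyadic_block_le i (F : nat -> R) (B : R) : 0 <= B ->
 (forall q, (2 ^ i<q<=2*2 ^ i)%N -> prime q -> F q <= B) ->
 \sum_((2 ^ i).+1 <= q < (2*2 ^ i).+1 | prime q) F q <= (pcount (2 ^ i))%:R*B.
Proof.
move=> B0 hF; rewrite /pcount natr_sum mulr_suml big_nat_cond [leRHS]big_nat_cond.
by apply: ler_sum => q /andP[hq pq]; rewrite mul1r hF.
Qed.

Lemma sum_inv_primes_dyadic i : (2<=i)%N ->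
 \sum_((2 ^ i).+1 <= q < (2*2 ^ i).+1 | prime q) q%:R^-1 <= 16/i%:R:>R.
Proof.
move=> i2; have p0: 0 < 2^+i:>R by rewrite exprn_gt0.
apply: leT (sum_dyadic_block_le (B := (2^+i)^-1) _ _) _.
- by rewrite invr_ge0 ltW.
- move=> q /andP[q1 _] _; rewrite lef_pV2 ?posrE ?ltr0n //; last by lia.
 by rewrite -natrX ler_nat ltnW.
by rewrite ler_pdivrMr // (leT (pcount2_le i2)) // mulrAC -mulrA.
Qed.

Lemma sum_inv_primes_le j k : (2<=j)%N -> (j<=k)%N ->
 \sum_((2 ^ j).+1 <= q < (2 ^ k).+1 | prime q) q%:R^-1 <= 16*((k-j)%:R/j%:R):>R.
Proof.
move=> j2 jk; rewrite big_dyadic //=.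
have j0: 0 < j%:R:>R by rewrite ltr0n; lia.
apply: (leV (\sum_(j <= i < k) 16/j%:R)).
 rewrite !big_nat; apply: ler_sum => i /andP[ji _].
 apply: leT (sum_inv_primes_dyadic (leqT j2 ji)) _.
 by rewrite leMl // lef_pV2 ?posrE ?ltr0n ?ler_nat //; lia.
by rewrite sumr_const_nat -[leLHS]mulr_natr; lra.
Qed.

Lemma sum_lnp_dyadic i : (2<=i)%N ->
 \sum_((2 ^ i).+1 <= q < (2*2 ^ i).+1 | prime q) rln q%:R/q%:R <= 32:>R.
Proof.
move=> i2; have p0: 0 < 2^+i:>R by rewrite exprn_gt0.
have i0: 0 < i%:R:>R by rewrite ltr0n; lia.
apply: leT (sum_dyadic_block_le (B := i.+1%:R/2^+i) _ _) _.
- by rewrite divr_ge0 // ltW.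
- move=> q /andP[q1 q2] _; have q0: 0 < q%:R:>R by rewrite ltr0n; lia.
 apply: ler_pM.
 + by rewrite rln_ge0 // ler1n; lia.
 + by rewrite invr_ge0 ltW.
 + apply: leT (_ : rln (2^+i.+1) <= _).
   by rewrite rln_le // -natrX ler_nat expnS.
  by rewrite rlnX // ler_piMr // rln2_le.
 + by rewrite lef_pV2 ?posrE // -natrX ler_nat ltnW.
have h := pcount2_le i2.
apply: (leV (16*(2^+i/i%:R)*(i.+1%:R/2^+i))).
 by rewrite leMr // divr_ge0 // ltW.
have -> : 16*(2^+i/i%:R)*(i.+1%:R/2^+i) = 16*(i.+1%:R/i%:R):>R.
 by field; rewrite !lt0r_neq0.
rewrite -natr1; have : (i%:R+1)/i%:R <= 2:>R.
 by rewrite ler_pdivrMr // mulr_natl mulr2n lerD2l ler1n; lia.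
lra.
Qed.

Lemma sum_lnp_le k : (2<=k)%N ->
 \sum_(1 <= q < (2 ^ k).+1 | prime q) rln q%:R/q%:R <= 32*k%:R:>R.
Proof.
move=> k2.
have l4: (5<=(2 ^ k).+1)%N by rewrite ltnS (leqT _ (leq_pexp2l _ k2)).
rewrite (big_cat_nat (n := 5)) //= -[5%N]/((2 ^ 2).+1) big_dyadic //=.
have h1: \sum_(1 <= q < (2 ^ 2).+1 | prime q) rln q%:R/q%:R <= 2:>R.
 rewrite unlock /= /index_iota /=.
 have := rln2_le; have := @rln_le_sub1 3; lra.
have h2: \sum_(2 <= i < k) \sum_((2 ^ i).+1 <= q < (2*2 ^ i).+1 | prime q) rln q%:R/q%:R
  <= 32*(k-2)%:R:>R.
 rewrite mulr_natr -sumr_const_nat !big_nat; apply: ler_sum => i /andP[i2 _].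
 exact: sum_lnp_dyadic.
have : (k-2)%:R = k%:R-2:>R by rewrite natrB.
lra.
Qed.

Lemma rln_fact n : rln n`!%:R = \sum_[m<=n] rln m%:R.
Proof.
elim: n => [|n IH]; first by rewrite fact0 rln1 big_geq.
by rewrite factS natrM rlnM ?ltr0n ?fact_gt0 // IH [RHS]big_nat_recr //= addrC.
Qed.

Lemma rln_fact_ge n : (0<n)%N -> n%:R*rln n%:R-n%:R <= rln n`!%:R.
Proof.
elim: n => [//|n IH] _; case: n IH => [|n] IH.
 by rewrite (_ : 1`! = 1%N) // rln1; lra.
have {}IH := IH isT; rewrite factS natrM rlnM ?ltr0n ?fact_gt0 //.
have n0: 0 < n.+1%:R:>R by rewrite ltr0n.
have : rln (n.+2%:R/n.+1%:R) <= n.+1%:R^-1.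
 apply: leT (rln_le_sub1 _) _; first by rewrite divr_gt0 ?ltr0n.
 by rewrite -[n.+2%:R]natr1 mulrDl divff ?gt_eqF // mul1r addrAC subrr add0r.
rewrite rlnD ?ltr0n // -(ler_pM2l n0) divff ?gt_eqF // => h.
rewrite -[X in X*_-_]natr1 -[X in _-X]natr1; lra.
Qed.

Lemma rln_logn N m : (0<m<=N)%N ->
 rln m%:R = \sum_(1 <= p < N.+1 | prime p) (logn p m)%:R*rln p%:R.
Proof.
move=> /andP[m0 mN].
have {1}-> : m = (\prod_(0<=p<N.+1 | p \in predT) p ^ logn p m)%N.
 by rewrite -(widen_partn _ mN) partnT.
rewrite big_ltn_cond //= lognE /= mul1n.
have -> : (\prod_(1<=p<N.+1) p ^ logn p m =
      \prod_(1<=p<N.+1 | prime p) p ^ logn p m)%N.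
 rewrite [RHS]big_mkcond; apply: eq_bigr => p _; case: ifP => // np.
 by rewrite lognE np.
rewrite natr_prod; pose Q (x : R) y := 0 < x /\ rln x = y.
suff [_ ->] : Q (\prod_(1 <= p < N.+1 | prime p) (p ^ logn p m)%N%:R)
  (\sum_(1 <= p < N.+1 | prime p) (logn p m)%:R*rln p%:R) by [].
apply: (big_ind2 Q) => [|x1 x2 y1 y2 [h1 <-] [h2 <-]|p /prime_gt0 pp]; rewrite /Q.
- by rewrite rln1.
- by rewrite mulr_gt0 // rlnM.
- by rewrite natrX exprn_gt0 ?rlnX ?ltr0n.
Qed.

Lemma sum_logn_fact p n : (logn p n`! = \sum_[m<=n] logn p m)%N.
Proof.
elim: n => [|n IH]; first by rewrite fact0 logn1 big_geq.
by rewrite factS lognM ?fact_gt0 // IH [RHS]big_nat_recr //= addnC.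
Qed.

Lemma logn_fact_legendre p n : (logn p n`! * p.-1<=n)%N.
Proof.
have [pp|np] := boolP (prime p); last by rewrite lognE (negbTE np).
rewrite logn_fact //; move: (n.+1 in X in (\sum_(_<=_<X) _)%N) => K.
have p1 := prime_gt1 pp; case: K => [|K]; first by rewrite big_geq.
elim: K n => [|K IH] n; first by rewrite big_geq.
rewrite big_ltn // big_add1 /=.
under eq_big_nat => i _ do rewrite expnS divnMA.
have := IH (n %/ p)%N; set s := (\sum_(_<=_<_) _)%N => h.
rewrite expn1 mulnDl; have := leq_trunc_div n p.
have -> : (n %/ p * p = n %/ p * p.-1+n %/ p)%N by rewrite addnC -mulnS prednK // prime_gt0.
lia.
Qed.

(** Compare [log n! >= n log n - n] with its prime factorization, in which Legendre's formula gives
    [v_p(n!) <= n/(p-1) <= 2n/p]. *)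
Lemma sum_lnp_ge n : (0<n)%N ->
 (rln n%:R-1)/2 <= \sum_(1 <= p < n.+1 | prime p) rln p%:R/p%:R.
Proof.
move=> n0; have nR: 0 < n%:R:>R by rewrite ltr0n.
have h1: rln n`!%:R = \sum_(1 <= p < n.+1 | prime p) (logn p n`!)%:R*rln p%:R.
 rewrite rln_fact big_nat.
 rewrite (eq_bigr (fun m => \sum_(1 <= p < n.+1 | prime p) (logn p m)%:R*rln p%:R)); last first.
  by move=> m hm; apply: rln_logn; rewrite -ltnS.
 rewrite -big_nat exchange_big /=; apply: eq_bigr => p _.
 by rewrite -mulr_suml sum_logn_fact natr_sum.
have h2: rln n`!%:R <= \sum_(1 <= p < n.+1 | prime p) n%:R*(2*(rln p%:R/p%:R)).
 rewrite h1; apply: ler_sum => p pp; have p1 := prime_gt1 pp.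
 have lp : 0 <= rln p%:R by rewrite rln_ge0 // ler1n prime_gt0.
 have p0: 0 < p%:R:>R by rewrite ltr0n; lia.
 have -> : n%:R*(2*(rln p%:R/p%:R)) = n%:R*2/p%:R*rln p%:R:>R by field; rewrite gt_eqF.
 rewrite leMr // ler_pdivlMr // -!natrM ler_nat.
 have := logn_fact_legendre p n; nia.
have h3 := rln_fact_ge n0.
move: (leT h3 h2); rewrite -mulr_sumr.
have -> : n%:R*rln n%:R-n%:R = n%:R*(rln n%:R-1) by ring.
rewrite ler_pM2l // -mulr_sumr; lra.
Qed.

(** The sum of [log p / p] up to [m^400] is at least about [200 log m], and up to [m] at most about
    [64 log m]. The difference is at least [100 log m], while each [log p] in the window is at most
    [400 log m]. A large exponent is what makes up for the crude constants. *)
Lemma mertens_window m : (8<=m)%N ->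
 1/4 <= \sum_(m.+1 <= p < (m ^ 400).+1 | prime p) p%:R^-1:>R.
Proof.
move=> m8; pose k := (trunc_log 2 m).+1.
have mk: (m<=2 ^ k)%N by apply/ltnW/trunc_log_ltn.
have km: (2 ^ k.-1<=m)%N by apply: trunc_logP => //; lia.
have k2: (2<=k)%N by rewrite -(ltn_exp2l _ _ (isT : 1<2)%N); apply: leqT mk; lia.
have lm0: 0 < rln m%:R by rewrite rln_gt0 // ltr1n; lia.
have lm: 1 <= rln m%:R.
 have : rln (2^+3) <= rln m%:R by rewrite rln_le ?exprn_gt0 // -natrX ler_nat.
 rewrite rlnX //; have := rln2_ge; lra.
have kl: k%:R <= 2*rln m%:R+1.
 have : rln (2^+k.-1) <= rln m%:R by rewrite rln_le ?exprn_gt0 // -natrX ler_nat.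
 rewrite rlnX //; have -> : k%:R = k.-1%:R+1:>R by rewrite natr1.
 have := rln2_ge; have : 0 <= k.-1%:R:>R by []; nra.
have mm: (m<=m ^ 400)%N by rewrite -{1}(expn1 m) leq_pexp2l //; lia.
have h1 := sum_lnp_ge (_ : 0<m ^ 400)%N; have {}h1 := h1 ltac:(rewrite expn_gt0; lia).
have h2: \sum_(1 <= p < m.+1 | prime p) rln p%:R/p%:R <= 32*k%:R:>R.
 apply: leT (sum_lnp_le k2).
 rewrite [leRHS](big_cat_nat (n := m.+1)) //= ?lerDl.
 by apply: sumr_ge0 => p pp; rewrite divr_ge0 ?rln_ge0 // ler1n prime_gt0.
rewrite (big_cat_nat (n := m.+1)) //= natrX rlnX ?ltr0n in h1; last by lia.
have h3: \sum_(m.+1 <= p < (m ^ 400).+1 | prime p) rln p%:R/p%:R <=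
  400*rln m%:R*\sum_(m.+1 <= p < (m ^ 400).+1 | prime p) p%:R^-1.
 rewrite mulr_sumr big_nat_cond [leRHS]big_nat_cond.
 apply: ler_sum => p /andP[/andP[p1 p2] pp].
 rewrite leMr ?invr_ge0 // -rlnX ?ltr0n; last by lia.
 by rewrite rln_le ?ltr0n ?prime_gt0 // -natrX ler_nat -ltnS.
have : 100*rln m%:R <= 400*rln m%:R*\sum_(m.+1 <= p < (m ^ 400).+1 | prime p) p%:R^-1 by lra.
have -> : 100*rln m%:R = 400*rln m%:R*(1/4) by lra.
by rewrite ler_pM2l //; lra.
Qed.

(** * The large sieve *)

Definition dirk (L : nat) (z : R) : C := \sum_[s<L] cis (s%:R*z).

Lemma nm_dirk_le L z : nm (dirk L z) <= L%:R.
Proof.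
apply: leT (nm_sum _ _ _) _; under eq_bigr do rewrite nm_cis.
by rewrite sumr_const_nat subn0.
Qed.

Lemma geo_cis L z : (cis z-1)*dirk L z = cis (L%:R*z)-1.
Proof.
rewrite mulrC [cis (L%:R*_)](_ : _ = cis z^+L); last by rewrite mulrC cisX.
rewrite /dirk big_mkord; under eq_bigr do rewrite mulrC cisX.
by rewrite mulrC subrX1.
Qed.

Lemma dirk_period L z (k : int) : dirk L (z+2*rpi*k%:~R) = dirk L z.
Proof.
apply: eq_bigr => s _; rewrite mulrDr cisD.
have -> : s%:R*(2*rpi*k%:~R) = 2*rpi*(s%:Z*k)%:~R by rewrite intrM; ring.
by rewrite cis_2piZ mulr1.
Qed.

(** The range goes past 1/2, up to 3/4, because the phases in [dirk_row] and [ker_moment] may exceed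
    half a period by up to a quarter of a period. *)
Lemma abs_le_sin (u : R) : `|u| <= 3/4 -> `|u| <= 3*`|rsin (rpi*u)|.
Proof.
wlog u0 : u / 0 <= u.
 move=> H; have [u0|u0] := leP 0 u; first exact: H.
 have := H (- u); rewrite normrN mulrN rsinN normrN oppr_ge0; apply; exact: ltW.
rewrite (ger0_norm u0) => u34; have p3 := rpi_gt3.
have [u12|u12] := leP u (1/2).
 have : rpi*u <= 3*rsin (rpi*u).
  by rewrite mulr_natl; apply: rsin_ge; [rewrite mulr_ge0 // ltW // rpi_gt0|nra].
 have := ler_norm (rsin (rpi*u)); nra.
have -> : rsin (rpi*u) = rsin (rpi*(1-u)).
 have -> : rpi*u = rpi + - (rpi*(1-u)) by ring.
 rewrite rsinD rsin_pi rcos_pi rsinN; ring.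
have : rpi*(1-u) <= 3*rsin (rpi*(1-u)).
 by rewrite mulr_natl; apply: rsin_ge; [rewrite mulr_ge0 ?ltW ?rpi_gt0 //; lra|nra].
have := ler_norm (rsin (rpi*(1-u))); nra.
Qed.

Lemma nm_dirk_inv L (u : R) (k : int) : u != 0 -> `|u| <= 3/4 ->
 nm (dirk L (2*rpi*u+2*rpi*k%:~R)) <= 3/`|u|.
Proof.
move=> u0 u34; rewrite dirk_period; have h := abs_le_sin u34.
have up: 0 < `|u| by rewrite normr_gt0.
have := congr1 nm (geo_cis L (2*rpi*u)); rewrite nmM nm_cis_sub1.
have -> : 2*rpi*u/2 = rpi*u by field.
have := nmB (cis (L%:R*(2*rpi*u))) 1; rewrite nm_cis nm1 => h1 h2.
rewrite ler_pdivlMr //; have := nm_ge0 (dirk L (2*rpi*u)); nra.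
Qed.

(** With [a = B/A], the term at [m >= 1] is at most [4B^2/(m+a)^2], hence at most [4B^2] times the
    decrease of [1/(x+a)] from [x = m-1] to [x = m]; the sum telescopes. At [e = 0] the bound [A^2]
    is used. *)
Lemma sum_min_inv (A B : R) E : 0 < A -> 0 < B ->
 \sum_[e<E] Num.min (A^+2) (B^+2/e%:R^+2) <= A^+2+4*A*B.
Proof.
move=> A0 B0; pose a := B/A; have a0: 0 < a by rewrite divr_gt0.
case: E => [|E].
 rewrite big_geq // addr_ge0 ?sqr_ge0 // !mulr_ge0 // ltW //.
rewrite big_nat_recl // expr0n /= invr0 mulr0.
have -> : 4*A*B = 4*B^+2*a^-1 by rewrite /a; field; rewrite !gt_eqF.
apply: lerD; first by rewrite ge_min lexx.
suff h n : \sum_[i<n] Num.min (A^+2) (B^+2/i.+1%:R^+2) <=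
  4*B^+2*(a^-1-(n%:R+a)^-1).
 apply: leT (h E) _; apply: leMl; first by rewrite mulr_ge0 ?sqr_ge0.
 by rewrite gerDl oppr_le0 invr_ge0 addr_ge0 // ltW.
elim: n => [|n IH]; first by rewrite big_geq // add0r subrr mulr0.
rewrite big_nat_recr //=.
have -> : 4*B^+2*(a^-1-(n.+1%:R+a)^-1) =
 4*B^+2*(a^-1-(n%:R+a)^-1)+4*B^+2*((n%:R+a)^-1-(n.+1%:R+a)^-1) by ring.
apply: lerD => //.
have n0: 0 <= n%:R:>R by [].
set m : R := n.+1%:R; have -> : n%:R = m-1:>R by rewrite /m -natr1 addrK.
have m1: 1 <= m by rewrite /m ler1n.
have h1: Num.min (A^+2) (B^+2/m^+2) <= 4*B^+2/(m+a)^+2.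
 have p1: 0 < (m+a)^+2 by rewrite exprn_gt0 // addr_gt0 //; lra.
 have [ma|ma] := leP m a.
  apply: leT (_ : A^+2 <= _); first by rewrite ge_min lexx.
  rewrite ler_pdivlMr //.
  have -> : 4*B^+2 = A^+2*(4*a^+2) by rewrite /a; field; rewrite gt_eqF.
  apply: leMl; first exact: sqr_ge0.
  by rewrite (_ : 4*a^+2 = (2*a)^+2); [rewrite ler_sqr ?nnegrE; lra|ring].
 apply: leT (_ : B^+2/m^+2 <= _); first by rewrite ge_min lexx orbT.
 have m0: 0 < m by lra.
 rewrite ler_pdivrMr ?exprn_gt0 //.
 rewrite mulrAC ler_pdivlMr //.
 have h: (m+a)^+2 <= (2 * m)^+2 by rewrite ler_sqr ?nnegrE; lra.
 have := leMl (sqr_ge0 B) h; lra.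
have p1: 0 < m-1+a by lra.
have p2: 0 < m+a by lra.
have h2: ((m+a)^+2)^-1 <= (m-1+a)^-1-(m+a)^-1.
 have -> : (m-1+a)^-1-(m+a)^-1 = ((m-1+a)*(m+a))^-1.
  have e (x : R) : 0 < x -> 0 < x+1 -> x^-1-(x+1)^-1 = (x*(x+1))^-1.
   by move=> x0 x1; field; rewrite !gt_eqF.
  have e1: m+a = m-1+a+1 by ring.
  by rewrite {1 2}e1; apply: e => //; rewrite -e1.
 by rewrite lef_pV2 ?posrE ?exprn_gt0 ?mulr_gt0 // expr2 ler_pM2r //; lra.
have c0: 0 <= 4*B^+2 by rewrite mulr_ge0 ?sqr_ge0.
exact: leT h1 (leMl c0 h2).
Qed.

(** In truncated subtraction [(m-f)+(f-m)] is the distance [|m-f|], which takes each value at most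
    twice. *)
Lemma sum_dist_le (h : nat -> R) M f : (forall e, 0 <= h e) ->
 \sum_[m<M] h ((m-f)+(f-m))%N <= 2*\sum_[e<(M+f).+1] h e.
Proof.
move=> h0; have mono a b : (a<=b)%N -> \sum_[e<a] h e <= \sum_[e<b] h e.
 by move=> ab; rewrite [leRHS](big_cat_nat (n := a)) //= lerDl sumr_ge0.
have up: \sum_[m<f] h ((m-f)+(f-m))%N <= \sum_[e<(M+f).+1] h e.
 rewrite big_nat_rev /= add0n big_nat.
 rewrite (eq_bigr (fun m => h m.+1)); last first.
  by move=> m /andP[_ mf]; congr h; lia.
 rewrite -big_nat; apply: leT (_ : \sum_[e<f.+1] h e <= _).
  by rewrite [leRHS]big_nat_recl // lerDr.
 by apply: mono; lia.
have [Mf|fM] := leqP M f.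
 apply: leT (_ : \sum_[m<f] h ((m-f)+(f-m))%N <= _).
  by rewrite [leRHS](big_cat_nat (n := M)) //= lerDl sumr_ge0.
 apply: leT up _; rewrite mulr_natl mulr2n lerDl; exact: sumr_ge0.
rewrite (big_cat_nat (n := f)) //=; last exact: ltnW.
rewrite mulr_natl mulr2n; apply: lerD => //.
rewrite -{1}[f]add0n big_addn big_nat.
rewrite (eq_bigr (fun m => h m)); last by move=> m _; congr h; lia.
by rewrite -big_nat; apply: mono; lia.
Qed.

Lemma exists_round (x : R) : exists k : int, `|x-k%:~R| <= 1/2.
Proof.
exists (Num.floor (x+1/2)).
have := floor_itv (x+1/2); rewrite intrD ler_norml; lra.
Qed.

Lemma rln_dist_ge (a b M : R) : 0 < a -> 0 < b -> a <= M -> b <= M ->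
 `|a-b| <= M*`|rln a-rln b|.
Proof.
wlog ab : a b / b <= a.
 move=> H a0 b0 aM bM; have [/H|/ltW /H] := leP b a; first exact.
 by rewrite distrC [`|rln b-_|]distrC; apply.
move=> a0 b0 aM bM; have l := rln_le b0 ab.
rewrite !ger0_norm ?subr_ge0 // -rlnD //.
have := @rln_ge_subV (a/b); rewrite divr_gt0 // => /(_ isT); rewrite invf_div => h.
have l2: 0 <= rln (a/b) by rewrite rlnD // subr_ge0.
have : a*(1-b/a) <= a*rln (a/b) by rewrite leMl // ltW.
have -> : a*(1-b/a) = a-b by field; rewrite gt_eqF.
by move=> h2; apply: leT h2 _; rewrite leMr.
Qed.

Definition E4 : R := rexp 4.
Lemma E4_ge1 : 1 <= E4.
Proof. by rewrite -rexp0 rexp_le. Qed.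

(** Three squarings, starting from [exp(3/32) >= 1 + 3/32], give [exp(3/4) >= 2]. *)
Lemma rln4_le : rln 4 <= 3/2.
Proof.
have h1 := rexp_ge1D (3/32).
have h2: 1196/1000 <= rexp (3/32*2) by rewrite rexpX; nra.
have h4: 1430/1000 <= rexp (3/32*2*2) by rewrite rexpX; nra.
have h8: 2 <= rexp (3/32*2*2*2) by rewrite rexpX; nra.
have l2: rln 2 <= 3/32*2*2*2 by rewrite -rexp_le rlnK.
have -> : 4 = 2*2:>R by lra.
by rewrite rlnM //; lra.
Qed.

(** Row sum of the Gram matrix of the large sieve. The points [log m], [K < m <= 4K], span less than
    one period [2 pi]. After removal of a suitable multiple of [2 pi] from [z0], the kernel decays
    like the inverse of [|log x0 - log m|], hence like [K/|x0 - m|], and [sum_min_inv] applies; the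
    few [m] next to [x0] are bounded trivially. [E4] enters through [x0 <= 4 K exp 4]. *)
Lemma dirk_row K L (z0 : R) : (0<K)%N -> (0<L)%N ->
 \sum_(K.+1 <= m < (4*K).+1) N2 (dirk L (z0-rln m%:R)) <=
 1600*E4*L%:R*(L%:R+K%:R).
Proof.
move=> K0 L0; have p3 := rpi_gt3; have p4 := rpi_le4; have pp := rpi_gt0; have E1 := E4_ge1.
have KR: 0 < K%:R:>R by rewrite ltr0n.
have LR: 0 < L%:R:>R by rewrite ltr0n.
have [k0 hk0] := exists_round ((z0-rln K%:R)/(2*rpi)).
pose x0 := rexp (z0-2*rpi*k0%:~R); have x00: 0 < x0 by apply: rexp_gt0.
have hz: `|z0-rln K%:R-2*rpi*k0%:~R| <= rpi.
 have -> : z0-rln K%:R-2*rpi*k0%:~R =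
   ((z0-rln K%:R)/(2*rpi)-k0%:~R)*(2*rpi) by field; rewrite gt_eqF.
 have p2: 0 <= 2*rpi by lra.
 rewrite normrM [`|2*rpi|]ger0_norm //; have := leMr p2 hk0; lra.
have x0M: x0 <= 4*K%:R*E4.
 rewrite -[K%:R in leRHS](rlnK KR) -mulrA -rexpD.
 apply: leT (_ : rexp (rln K%:R+4) <= _).
  by rewrite rexp_le; move: hz; rewrite ler_norml => /andP[_ h]; lra.
 by rewrite ler_peMl ?rexp_ge0 // ler1n.
pose B := 192*E4*K%:R; have B0: 0 < B by rewrite !mulr_gt0 //; lra.
pose f := Num.truncn x0.
have hf1: f%:R <= x0 by rewrite truncn_le ltW.
have hf2: x0 < f.+1%:R by rewrite -truncn_lt_nat ?ltW.
pose h e : R := L%:R^+2*(e<=1)%N%:R+Num.min (L%:R^+2) (B^+2/e%:R^+2).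
have h0 e : 0 <= h e.
 rewrite addr_ge0 ?mulr_ge0 ?sqr_ge0 // le_min sqr_ge0 divr_ge0 ?sqr_ge0 //.
have key m : (K<m<=4*K)%N -> N2 (dirk L (z0-rln m%:R)) <= h ((m-f)+(f-m))%N.
 move=> /andP[Km mK]; set e := (_+_)%N.
 have mR: 0 < m%:R:>R by rewrite ltr0n (leq_ltn_trans _ Km).
 have hL := N2_le (nm_dirk_le L (z0-rln m%:R)).
 have [e1|e1] := leqP e 1.
  rewrite /h e1 mulr1; apply: leT hL _; rewrite lerDl le_min sqr_ge0.
  by rewrite divr_ge0 ?sqr_ge0.
 rewrite /h leqNgt e1 mulr0 add0r le_min hL /=.
 have eR: 0 < e%:R:>R by rewrite ltr0n (ltn_trans _ e1).
 rewrite -expr_div_n; apply: N2_le.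
 pose u := (rln x0-rln m%:R)/(2*rpi).
 have -> : z0-rln m%:R = 2*rpi*u+2*rpi*k0%:~R.
  by rewrite /u rexpK; field; rewrite gt_eqF.
 have dist: e%:R/2 <= `|x0-m%:R|.
  have : e%:R-1 <= `|x0-m%:R|.
   rewrite -natr1 in hf2; rewrite /e; have [fm|mf] := leqP f m.
    rewrite (_ : (m-f+(f-m) = m-f)%N); last by clear -fm; lia.
    by rewrite natrB // distrC; apply: leT _ (ler_norm _); lra.
   rewrite (_ : (m-f+(f-m) = f-m)%N); last by clear -mf; lia.
   by rewrite natrB ?(ltnW mf) //; apply: leT _ (ler_norm _); lra.
  have : 2 <= e%:R:>R by rewrite ler_nat.
  lra.
 have hu: e%:R/2 <= 4*K%:R*E4*(8*`|u|).
  have mM: m%:R <= 4*K%:R*E4.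
   by apply: leT (_ : 4*K%:R <= _); [rewrite -natrM ler_nat|rewrite ler_peMr // mulr_ge0].
  apply: leT dist _; apply: leT (rln_dist_ge x00 mR x0M mM) _.
  apply: leMl; first by rewrite !mulr_ge0 //; lra.
  have -> : rln x0-rln m%:R = u*(2*rpi) by rewrite /u divfK // mulf_neq0 // gt_eqF.
  rewrite normrM [`|2*rpi|]ger0_norm; last by lra.
  by have := normr_ge0 u; nra.
 have up: 0 < `|u|.
  rewrite normr_gt0; apply/eqP => u0; move: hu; rewrite u0 normr0; lra.
 apply: leT (nm_dirk_inv _ _ _ _) _.
 - by rewrite -normr_gt0.
 - have l4 := rln4_le.
  have hm: 0 <= rln m%:R-rln K%:R <= 3/2.
   rewrite subr_ge0 rln_le ?ler_nat ?(ltnW Km) //=.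
   have : rln m%:R <= rln (4*K%:R) by rewrite rln_le // -natrM ler_nat.
   rewrite rlnM //; lra.
  have -> : u = (z0-rln K%:R-2*rpi*k0%:~R)/(2*rpi)-(rln m%:R-rln K%:R)/(2*rpi).
   by rewrite /u rexpK; field; rewrite gt_eqF.
  have p2: 0 < 2*rpi by lra.
  rewrite -mulrBl normrM [`|(2*rpi)^-1|]ger0_norm; last by rewrite invr_ge0 ltW.
  rewrite ler_pdivrMr //.
  apply: leT (ler_normB _ _) _; rewrite [`|rln _-_|]ger0_norm; lra.
 - rewrite ler_pdivrMr // mulrAC ler_pdivlMr // /B; lra.
apply: leT (_ : \sum_[m<(4*K).+1] h ((m-f)+(f-m))%N <= _).
 rewrite [leRHS](big_cat_nat (n := K.+1)) //=; last by clear; lia.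
 apply: leT (_ : \sum_(K.+1 <= m < (4*K).+1) h ((m-f)+(f-m))%N <= _).
  by rewrite !big_nat; apply: ler_sum => m hm; apply: key; rewrite -ltnS.
 by rewrite lerDr sumr_ge0.
apply: leT (sum_dist_le _ _ h0) _; set M := (_+_).+1.
rewrite /h big_split /= -mulr_sumr.
have s1: \sum_[e<M] (e<=1)%N%:R <= 2:>R.
 have -> : M = (4*K+f).+2 by rewrite /M addSn.
 rewrite big_nat_recl // big_nat_recl //= big_nat big1 ?addr0 // => i _.
have s2 := sum_min_inv M LR B0.
have : L%:R^+2*\sum_[e<M] (e<=1)%N%:R <= L%:R^+2*2:>R.
 by rewrite leMl ?sqr_ge0.
have : L%:R^+2 <= E4*L%:R^+2 by rewrite ler_peMl ?sqr_ge0.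
have : 0 <= E4*L%:R*K%:R by rewrite !mulr_ge0 ?ltW //; lra.
have : 0 <= E4*L%:R^+2 by rewrite mulr_ge0 ?sqr_ge0 //; lra.
have : L%:R*B = 192*(E4*L%:R*K%:R) by rewrite /B; ring.
lra.
Qed.

Definition CLS : R := locked (20000*E4).
Lemma CLS_ge1 : 1 <= CLS.
Proof. by have := E4_ge1; rewrite /CLS -lock; lra. Qed.

Lemma sum_addn (V : nmodType) (F : nat -> V) a n :
 \sum_(a <= i < n+a) F i = \sum_[i<n] F (i+a)%N.
Proof. by rewrite -{1}[a]add0n big_addn addnK. Qed.

(** Each integer [|t| <= T] is a difference [s - s'] with [0 <= s, s' <= 3T] in at least [T+1] ways.
    Summing over all pairs [(s, s')] turns the entries of the Gram matrix into [|dirk|^2], whose row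
    sums are bounded without the logarithm that [|dirk|] would cost. *)
Lemma large_sieve T K (c : nat -> C) : (0<K)%N ->
 \sum_[k<(2*T).+1]
   N2 (\sum_(K.+1 <= n < (4*K).+1) c n*npw n (k%:R-T%:R)) <=
 CLS*(T%:R+K%:R)*\sum_(K.+1 <= n < (4*K).+1) N2 (c n).
Proof.
move=> K0; pose S t := \sum_(K.+1 <= n < (4*K).+1) c n*npw n t.
pose L := (3*T).+1; pose rL := index_iota 0 L.
have h1: (T.+1)%:R*\sum_[k<(2*T).+1] N2 (S (k%:R-T%:R)) <=
  \sum_(s' <- rL) \sum_(s <- rL) N2 (S (s%:R-s'%:R)).
 have -> : T.+1%:R*\sum_[k<(2*T).+1] N2 (S (k%:R-T%:R)) =
   \sum_(T <= s' < (2*T).+1) \sum_[k<(2*T).+1] N2 (S (k%:R-T%:R)).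
  by rewrite sumr_const_nat mulr_natl; congr (_ *+ _); lia.
 rewrite /rL [leRHS](big_cat_nat (n := T)) //=; last by rewrite /L; lia.
 rewrite [X in _ <= _+X](big_cat_nat (n := (2*T).+1)) //=; try by rewrite /L; lia.
 rewrite addrCA; apply: leT (_ : \sum_(T <= s' < (2*T).+1) \sum_[s<L] N2 (S (s%:R-s'%:R)) <= _).
  apply: ler_sum_nat => s' /andP[Ts sT].
  rewrite [leRHS](big_cat_nat (n := (s'-T)%N)) //=; last by rewrite /L; lia.
  rewrite [X in _ <= _+X](big_cat_nat (n := ((2*T).+1+(s'-T))%N)) //=; try by rewrite /L; lia.
  rewrite addrCA sum_addn.
  rewrite (eq_bigr (fun k => N2 (S ((k+(s'-T))%N%:R-s'%:R)))); last first.
   by move=> k _; rewrite natrD natrB //; congr (N2 (S _)); ring.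
  by rewrite lerDl addr_ge0 // sumr_ge0 // => *; rewrite N2_ge0.
 by rewrite lerDl addr_ge0 // sumr_ge0 // => *; rewrite sumr_ge0 // => *; rewrite N2_ge0.
pose rJ := [seq (s, s') | s <- rL, s' <- rL].
have L0: (0<L)%N by [].
have h2 := @schur nat (nat*nat)%type (index_iota K.+1 (4*K).+1) rJ (fun=> 1)
 (fun n y => npw n (y.1%:R-y.2%:R)) (1600*E4*L%:R*(L%:R+K%:R)) c.
have {}h2 := h2 _; move: h2.
have -> : \sum_(y <- rJ) 1*N2 (\sum_(K.+1 <= x < (4*K).+1) c x*npw x (y.1%:R-y.2%:R)) =
 \sum_(s' <- rL) \sum_(s <- rL) N2 (S (s%:R-s'%:R)).
 by rewrite big_allpairs exchange_big; do 2!(apply: eq_bigr => ? _); rewrite mul1r.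
move=> h2; have {}h2 : \sum_(s' <- rL) \sum_(s <- rL) N2 (S (s%:R-s'%:R)) <=
 1600*E4*L%:R*(L%:R+K%:R)*\sum_(K.+1 <= n < (4*K).+1) N2 (c n).
 apply: h2 => n; apply: leT (dirk_row (rln n%:R) K0 L0).
 apply: ler_sum => m _.
 have -> : \sum_(y <- rJ) 1%:C*npw n (y.1%:R-y.2%:R)*cj (npw m (y.1%:R-y.2%:R)) =
   dirk L (rln n%:R-rln m%:R)*cj (dirk L (rln n%:R-rln m%:R)).
  rewrite big_allpairs /dirk conj_sum mulr_suml; apply: eq_bigr => s _.
  rewrite mulr_sumr; apply: eq_bigr => s' _; rewrite mul1r /npw -cisB -cisB.
  by congr cis; rewrite /=; ring.
 by rewrite nmM nmJ -expr2 nm_sqr.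
set A := \sum_[k<_] _ in h1 *; set B := \sum_(K.+1 <= n < _) N2 _ in h2 *.
have B0: 0 <= B by rewrite sumr_ge0 // => *; rewrite N2_ge0.
have TR: 0 < T.+1%:R:>R by rewrite ltr0n.
rewrite -(ler_pM2l TR); apply: leT h1 (leT h2 _).
rewrite !mulrA; apply: leMr => //.
have l3: L%:R <= 3*T.+1%:R:>R by rewrite -natrM ler_nat /L; lia.
have l4: L%:R+K%:R <= 4*(T%:R+K%:R):>R by rewrite -!natrD -natrM ler_nat /L; lia.
have e1 := E4_ge1; rewrite /CLS -lock.
have h: L%:R*(L%:R+K%:R) <= 3*T.+1%:R*(4*(T%:R+K%:R)):>R.
 by apply: ler_pM => //; rewrite addr_ge0.
have h0: 0 <= T.+1%:R*(T%:R+K%:R)*E4:>R by rewrite !mulr_ge0 ?addr_ge0 //; lra.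
have := leMl (_ : 0 <= E4) h; lra.
Qed.

(** * Harmonic sums and the discrete Fourier transform *)

Lemma harmonic_le N : (0<N)%N -> \sum_[n<=N] n%:R^-1 <= 1+rln N%:R:>R.
Proof.
elim: N => [//|N IH] _; have [->|N0] := posnP N.
 by rewrite big_nat1 invr1 rln1; lra.
rewrite big_nat_recr //=; have {}IH := IH N0.
have p: 0 < N%:R:>R by rewrite ltr0n.
have := @rln_ge_subV (N.+1%:R/N%:R); rewrite divr_gt0 ?ltr0n // => /(_ isT).
rewrite rlnD ?ltr0n // invf_div.
have -> : 1-N%:R/N.+1%:R = N.+1%:R^-1:>R.
 have q: 0 < N%:R+1:>R by lra.
 by rewrite -[N.+1%:R]natr1; field; rewrite gt_eqF.
by move=> h; apply: leT (lerD IH h) _; lra.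
Qed.

Lemma harmonic_ge N : rln N.+1%:R <= \sum_[n<=N] n%:R^-1:>R.
Proof.
elim: N => [|N IH]; first by rewrite big_geq // rln1.
rewrite big_nat_recr //=; have p: 0 < N.+1%:R:>R by rewrite ltr0n.
have := @rln_le_sub1 (N.+2%:R/N.+1%:R); rewrite divr_gt0 ?ltr0n // => /(_ isT).
rewrite rlnD ?ltr0n //.
have -> : N.+2%:R/N.+1%:R-1 = N.+1%:R^-1:>R.
 by rewrite -[N.+2%:R]natr1 mulrDl divff ?gt_eqF // mul1r addrAC subrr add0r.
by move=> h; apply: leT _ (lerD IH h); lra.
Qed.

Lemma dft_orth M (x : int) : (0<M)%N -> x != 0 -> (`|x| < M)%N ->
 \sum_[j<M] cis (j%:R*(2*rpi*(x%:~R/M%:R))) = 0.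
Proof.
move=> M0 x0 xM; rewrite -/(dirk M _).
have MR: 0 < M%:R:>R by rewrite ltr0n.
have pp := rpi_gt0.
have xR: `|x%:~R| < M%:R:>R by rewrite -intr_norm -[M%:R]/(M%:~R) ltr_int; lia.
have xR0: 0 < `|x%:~R| :> R by rewrite normr_gt0 intr_eq0.
suff h : cis (2*rpi*(x%:~R/M%:R))-1 != 0.
 apply: (mulfI h); rewrite mulr0 geo_cis.
 have -> : M%:R*(2*rpi*(x%:~R/M%:R)) = 2*rpi*x%:~R by field; rewrite gt_eqF.
 by rewrite cis_2piZ subrr.
have key (v : R) : v != 0 -> `|v| <= 1/2 -> cis (2*rpi*v)-1 != 0.
 move=> v0 v12; apply/eqP => h.
 have := @cis_sub1_ge (2*rpi*v); rewrite h nm0 mulr0 normrM [`|2*rpi|]ger0_norm; last by lra.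
 have vp: 0 < `|v| by rewrite normr_gt0.
 move=> h2; have : 2*rpi*`|v| <= 0 by apply: h2; nra.
 by rewrite leNgt mulr_gt0 //; lra.
pose v : R := x%:~R/M%:R.
have vlt: `|v| < 1 by rewrite normrM [`|M%:R^-1|]ger0_norm ?invr_ge0 // ltr_pdivrMr // mul1r.
have v0: v != 0 by rewrite mulf_neq0 ?intr_eq0 // invr_eq0 gt_eqF.
rewrite -/v; move: vlt; rewrite ltr_norml => /andP[v1 v2].
have [h|h] := leP `|v| (1/2); first exact: key.
(* The frequency is moved by an integer into [[-1/2, 1/2]], where [key] applies. *)
have per (k : int) : cis (2*rpi*v) = cis (2*rpi*(v+k%:~R)).
 by rewrite mulrDr cisD cis_2piZ mulr1.
have [vp|vp] := leP 0 v.
 rewrite (per (-1)); apply: key; rewrite ?intrN; move: h; rewrite ger0_norm // => h.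
  by rewrite lt_eqF //; lra.
 by rewrite ler0_norm; lra.
rewrite (per 1); apply: key; move: h; rewrite ltr0_norm // => h.
 by rewrite gt_eqF //; lra.
by rewrite ger0_norm; lra.
Qed.

Definition dft M (g : nat -> C) (j : nat) : C :=
 \sum_[k<M] g k*cis (- (2*rpi*(j%:R*k%:R/M%:R))).

Lemma dft_parseval M (g : nat -> C) : (0<M)%N ->
 \sum_[j<M] N2 (dft M g j) = M%:R*\sum_[k<M] N2 (g k).
Proof.
move=> M0; have MR: 0 < M%:R:>R by rewrite ltr0n.
suff E : (\sum_[j<M] N2 (dft M g j))%:C = (M%:R*\sum_[k<M] N2 (g k))%:C.
 by case: E.
rewrite realC_sum.
have -> : \sum_[j<M] (N2 (dft M g j))%:C =
 \sum_[j<M] \sum_[k<M] \sum_(0 <= k' < M)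
  g k*cj (g k')*cis (j%:R*(2*rpi*((k'%:Z-k%:Z)%:~R/M%:R))).
 apply: eq_bigr => j _; rewrite -N2_mulJ /dft conj_sum mulr_suml; apply: eq_bigr => k _.
 rewrite mulr_sumr; apply: eq_bigr => k' _; rewrite conjM -cisN.
 have -> : cis (j%:R*(2*rpi*((k'%:Z-k%:Z)%:~R/M%:R))) =
   cis (- (2*rpi*(j%:R*k%:R/M%:R)))*cis (- - (2*rpi*(j%:R*k'%:R/M%:R))).
  rewrite -cisD; congr cis; rewrite intrB; field; by rewrite gt_eqF.
 ring.
rewrite exchange_big /= rmorphM /= realC_sum mulr_sumr.
apply: eq_big_nat => k /andP[_ kM].
rewrite exchange_big /= (bigD1_seq k) ?mem_index_iota ?iota_uniq //=.
rewrite subrr mul0r mulr0 [X in X+_](_ : _ = (M%:R)%:C*(N2 (g k))%:C); last first.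
 rewrite -mulr_sumr -N2_mulJ mulrC; congr (_*_).
 under eq_bigr do rewrite mulr0 cis0.
 by rewrite sumr_const_nat subn0 rmorph_nat.
rewrite big_seq_cond big1 ?addr0 // => k'; rewrite mem_index_iota => /andP[/andP[_ k'M] kk'].
rewrite -mulr_sumr dft_orth ?mulr0 //; first by rewrite subr_eq0 eqz_nat.
lia.
Qed.

(** A cyclic shift multiplies the transform by a phase. The zeros of [g] from [L] on, together with
    [L + m <= M], prevent wrapping, so that the cyclic shift agrees with the shift padded by
    zeros. *)
Lemma dft_shift M L m (g : nat -> C) (b : C) : (0<M)%N -> (L+m<=M)%N ->
 (forall k, (L<=k)%N -> g k = 0) ->
 \sum_[k<M] N2 (g k-b*(if (m<=k)%N then g (k-m)%N else 0)) =
 M%:R^-1*\sum_[j<M] N2 (dft M g j) *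
   N2 (1-b*cis (- (2*rpi*(j%:R * m%:R/M%:R)))).
Proof.
move=> M0 LM gL; have MR: 0 < M%:R:>R by rewrite ltr0n.
pose h k := g k-b*(if (m<=k)%N then g (k-m)%N else 0).
have : M%:R*\sum_[k<M] N2 (h k) = M%:R*(M%:R^-1*\sum_[j<M] N2 (dft M g j) *
   N2 (1-b*cis (- (2*rpi*(j%:R * m%:R/M%:R))))).
 rewrite -dft_parseval // mulVKf ?gt_eqF //; apply: eq_bigr => j _.
 rewrite -N2M; congr N2; rewrite mulrBr mulr1 /dft /h.
 under eq_bigr do rewrite mulrBl.
 rewrite sumrB; congr (_-_).
 rewrite (big_cat_nat (n := m)) //=; last by lia.
 rewrite big_nat big1 ?add0r; last first.
  by move=> k /andP[_ km]; rewrite leqNgt km mulr0 mul0r.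
 have {1}-> : M = ((M-m)+m)%N by lia.
 rewrite -{1}[m]add0n big_addn addnK.
 rewrite [X in _ = X*_](big_cat_nat (n := (M-m)%N)) //=; last by lia.
 have -> : \sum_(M-m <= i < M) g i*cis (- (2*rpi*(j%:R * i%:R/M%:R))) = 0.
  by rewrite big_nat big1 // => k /andP[km _]; rewrite gL ?mul0r //; lia.
 rewrite addr0.
 rewrite mulr_suml; apply: eq_bigr => k _; rewrite leq_addl addnK.
 have -> : cis (- (2*rpi*(j%:R*(k+m)%N%:R/M%:R))) =
  cis (- (2*rpi*(j%:R*k%:R/M%:R)))*cis (- (2*rpi*(j%:R * m%:R/M%:R))).
  by rewrite -cisD natrD; congr cis; ring.
 ring.
by move/(mulfI (lt0r_neq0 MR)).
Qed.

(** * Exponential sums *)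

(** Kusmin-Landau inequality. Each [cis (psi n)] is the increment from [cis (psi n)] to
    [cis (psi n.+1)] times [c n = 1/(cis (d n) - 1)]. Summation by parts leaves boundary terms of
    size [1/lam] and the total variation of [c], which telescopes to a multiple of [1/d L - 1/d 0]
    because the increments [d] are monotone. *)
Lemma kusmin_landau L (psi : nat -> R) (lam : R) : 0 < lam ->
 (forall n, (n<L)%N -> lam <= psi n.+1-psi n <= 1) ->
 (forall n, (n.+1<L)%N -> psi n.+2-psi n.+1 <= psi n.+1-psi n) ->
 nm (\sum_[n<L] cis (psi n)) <= 15/lam.
Proof.
move=> lam0 hd hm; pose d n := psi n.+1-psi n; pose c n := (cis (d n)-1)^-1.
have l0: 0 <= lam^-1 by rewrite invr_ge0 ltW.
have hc n : (n<L)%N -> 0 < d n /\ (cis (d n)-1 != 0) /\ nm (c n) <= 3/d n.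
 move=> /hd /andP[h1 h2]; have d0: 0 < d n by apply: lt_le_trans h1.
 have h3 := @cis_sub1_ge (d n); rewrite gtr0_norm // in h3.
 have {}h3 : d n <= 3*nm (cis (d n)-1) by apply: h3; have := rpi_gt3; rewrite /d; lra.
 have np: 0 < nm (cis (d n)-1) by lra.
 have nz: cis (d n)-1 != 0 by apply/eqP => h; move: np; rewrite h nm0 ltxx.
 split=> //; split=> //; rewrite /c.
 have e1: nm (cis (d n)-1)*nm (cis (d n)-1)^-1 = 1 by rewrite -nmM mulfV ?nm1.
 rewrite ler_pdivlMr //; have := nm_ge0 (cis (d n)-1)^-1; nra.
have dl n : (n<L)%N -> (d n)^-1 <= lam^-1.
 by move=> nL; have [d0 _] := hc n nL; rewrite lef_pV2 ?posrE //; have /andP[] := hd n nL.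
case: L hd hm hc dl => [|L] hd hm hc dl.
 by rewrite big_geq // nm0 divr_ge0 // ltW.
have key n : (n<=L)%N ->
 nm (\sum_[i<n.+1] cis (psi i)-c n*cis (psi n.+1)) <= 3/d 0+9*((d n)^-1-(d 0)^-1).
 have cE n' : (n'<=L)%N -> cis (psi n') = c n'*cis (psi n'.+1)-c n'*cis (psi n').
  move=> nL; have [_ [nz _]] := hc n' nL.
  have -> : cis (psi n'.+1) = cis (psi n')*cis (d n') by rewrite -cisD /d; congr cis; ring.
  by rewrite /c; field.
 elim: n => [_|n IH nL].
  rewrite big_nat1 {1}cE // subrr mulr0 addr0 addrAC subrr add0r nmN nmM nm_cis mulr1.
  by have [_ [_ h]] := hc 0%N isT.
 have nL': (n<L.+1)%N by exact: ltnW.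
 rewrite big_nat_recr //=.
 have -> : \sum_[i<n.+1] cis (psi i)+cis (psi n.+1)-c n.+1*cis (psi n.+2) =
  (\sum_[i<n.+1] cis (psi i)-c n*cis (psi n.+1))+(c n-c n.+1)*cis (psi n.+1).
  apply/eqP; rewrite -subr_eq0; set A := \sum_[i<_] _.
  rewrite [X in X == _](_ : _ = cis (psi n.+1)-(c n.+1*cis (psi n.+2)-c n.+1*cis (psi n.+1))).
   by rewrite -cE // subrr.
  ring.
 apply: leT (nmD _ _) _.
 have {}IH := IH (ltnW nL).
 have : nm ((c n-c n.+1)*cis (psi n.+1)) <= 9*((d n.+1)^-1-(d n)^-1).
  rewrite nmM nm_cis mulr1.
  have [d0 [nz h0]] := hc n nL'; have [d1 [nz1 h1]] := hc n.+1 nL.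
  have -> : c n-c n.+1 = (cis (d n.+1)-cis (d n))*(c n*c n.+1).
   by rewrite /c; field; rewrite nz nz1.
  rewrite !nmM.
  have h2: nm (cis (d n.+1)-cis (d n)) <= d n-d n.+1.
   apply: leT (cis_lip _ _) _; rewrite distrC ger0_norm ?subr_ge0 //; exact: hm.
  have -> : 9*((d n.+1)^-1-(d n)^-1) = (d n-d n.+1)*(3/d n*(3/d n.+1)).
   have : d n != 0 by rewrite gt_eqF.
   have : d n.+1 != 0 by rewrite gt_eqF.
   move: (d n) (d n.+1) => x y y0 x0; by field; rewrite x0 y0.
  apply: ler_pM; rewrite ?mulr_ge0 ?nm_ge0 //; apply: ler_pM; rewrite ?nm_ge0 //.
 lra.
have h := key L (leqnn L).
have [d0 [_ hL]] := hc L (leqnn _).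
have := nmD (\sum_[i<L.+1] cis (psi i)-c L*cis (psi L.+1)) (c L*cis (psi L.+1)).
rewrite subrK nmM nm_cis mulr1 => h3.
have := dl 0%N isT; have := dl L (leqnn _).
have [d00 _] := hc 0%N isT.
have : 0 < (d 0)^-1 by rewrite invr_gt0.
lra.
Qed.

(** Van der Corput's inequality as a case of [schur]: [Q] times the sum is a sum over [m] of the [Q]
    shifts [Z r m], and the Gram matrix of these shifts consists of the correlations of [z] at lag
    [|r - r'|]. *)
Lemma weyl_vdc L Q (z : nat -> C) (Gam : nat -> R) : (0<Q)%N ->
 (forall n, (L<=n)%N -> z n = 0) -> (forall h, 0 <= Gam h) ->
 (forall h, (h<Q)%N -> nm (\sum_[n<L] z (n+h)%N*cj (z n)) <= Gam h) ->
 N2 (\sum_[n<L] z n)*Q%:R <= (L+Q)%:R*(2*\sum_[h<Q] Gam h).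
Proof.
move=> Q0 zL G0 hG; pose Z r m := if (r<=m)%N then z (m-r)%N else 0.
have QR: 0 < Q%:R:>R by rewrite ltr0n.
have ext a : (L<=a)%N -> forall F : nat -> C, (forall n, (L<=n)%N -> F n = 0) ->
  \sum_[n<a] F n = \sum_[n<L] F n.
 move=> La F hF; rewrite (big_cat_nat (n := L)) //= [X in _+X]big_nat [X in _+X]big1 ?addr0 //.
 by move=> n /andP[Ln _]; rewrite hF.
have sZ r (F : nat -> C) : (r<Q)%N -> (forall n, (L<=n)%N -> F n = 0) ->
  \sum_[m<L+Q] (if (r<=m)%N then F (m-r)%N else 0) = \sum_[n<L] F n.
 move=> rQ hF; rewrite (big_cat_nat (n := r)) //=; last by lia.
 rewrite big_nat big1 ?add0r; last by move=> m /andP[_ mr]; rewrite leqNgt mr.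
 have -> : (L+Q)%N = ((L+Q-r)+r)%N by lia.
 rewrite -{1}[r]add0n big_addn addnK -(ext (L+Q-r)%N) //; last by lia.
 by apply: eq_bigr => i _; rewrite leq_addl addnK.
have gram r r' : (r<=r')%N -> (r'<Q)%N ->
  \sum_[m<L+Q] Z r m*cj (Z r' m) = \sum_[n<L] z (n+(r'-r))%N*cj (z n).
 move=> rr rQ; rewrite -(sZ r') //; last by move=> n Ln; rewrite (zL n) // conjc0 mulr0.
 apply: eq_bigr => m _; rewrite /Z; case: (leqP r' m) => h; last by rewrite conjc0 mulr0.
 by rewrite (leqT rr h); congr (z _*_); lia.
pose G e := if (e<Q)%N then Gam e else 0.
have GG e : 0 <= G e by rewrite /G; case: ifP.
(* The guard [r < Q] is there because [schur] asks for the row bound at every index, not only at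
   those in the list. *)
have hS := @schur nat nat (index_iota 0 Q) (index_iota 0 (L+Q)) (fun=> 1) 
  (fun r m => if (r<Q)%N then Z r m else 0) (2*\sum_[h<Q] Gam h) (fun=> 1).
have E: Q%:R%:C*\sum_[n<L] z n =
  \sum_[m<L+Q] \sum_[r<Q] 1*(if (r<Q)%N then Z r m else 0).
 rewrite exchange_big /=; transitivity (\sum_[r<Q] \sum_[n<L] z n).
  by rewrite sumr_const_nat subn0 rmorph_nat mulr_natl.
 apply: eq_big_nat => r /andP[_ rQ]; rewrite -(sZ r) // rQ.
 by apply: eq_bigr => m _; rewrite mul1r.
have h1: Q%:R^+2*N2 (\sum_[n<L] z n) <=
  (L+Q)%:R*(2*(\sum_[h<Q] Gam h)*Q%:R).
 rewrite -N2_real -N2M E; apply: leT (CS1 _ _ _) _.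
 rewrite sumr_const_nat subn0 leMl //.
 have -> : \sum_[i<L+Q] N2 (\sum_[r<Q] 1*(if (r<Q)%N then Z r i else 0)) =
   \sum_[i<L+Q] 1*N2 (\sum_[r<Q] 1*(if (r<Q)%N then Z r i else 0)).
  by apply: eq_bigr => i _; rewrite mul1r.
 apply: leT (hS _) _; last by rewrite N21 sumr_const_nat subn0.
 move=> r.
 apply: leT (_ : \sum_(0 <= r' < Q) G ((r'-r)+(r-r'))%N <= _).
  apply: ler_sum_nat => r' /andP[_ rQ']; rewrite rQ'.
  have [rQ|rQ] := ltnP r Q; last first.
   rewrite big1 ?nm0 // => m _; by rewrite mulr0 mul0r.
  have [rr|rr] := leqP r r'.
   rewrite [X in nm X](_ : _ = \sum_[n<L] z (n+(r'-r))%N*cj (z n)); last first.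
    by rewrite -gram //; apply: eq_bigr => m _; rewrite mul1r.
   have -> : (r'-r+(r-r') = r'-r)%N by lia.
   have lt: (r'-r<Q)%N by lia.
   by rewrite /G lt hG.
  rewrite -nmJ [X in nm X](_ : _ = \sum_[n<L] z (n+(r-r'))%N*cj (z n)); last first.
   rewrite -gram ?(ltnW rr) // conj_sum; apply: eq_bigr => m _.
   by rewrite !conjM conj_real conjcK mul1r mulrC.
  have -> : (r'-r+(r-r') = r-r')%N by lia.
  have lt: (r-r'<Q)%N by lia.
  by rewrite /G lt hG.
 apply: leT (sum_dist_le _ _ GG) _; rewrite leMl //.
 rewrite (big_cat_nat (n := Q)) //=; last by lia.
 rewrite [X in _+X]big_nat [X in _+X]big1 ?addr0; last first.
  by move=> i /andP[Qi _]; rewrite /G ltnNge Qi.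
 by apply: ler_sum_nat => i /andP[_ iQ]; rewrite /G iQ.
rewrite -(ler_pM2l QR); lra.
Qed.

(** * Eigenvectors of dilations *)

Import cyclic.

Definition periodic (b : nat) (F : nat -> C) := forall k, F (k+b)%N = F k.
Definition unit_supp (b : nat) (F : nat -> C) := forall k, ~~ coprime k b -> F k = 0.

Lemma periodic_mod b F k : periodic b F -> F (k %% b)%N = F k.
Proof.
move=> pF; rewrite [in RHS](divn_eq k b) addnC.
by elim: (k %/ b)%N => [|q IH]; rewrite ?addn0 // mulSn addnCA addnC pF -IH.
Qed.
Lemma periodic_eqmod b F k l : periodic b F -> k = l %[mod b] -> F k = F l.
Proof. by move=> pF e; rewrite -(periodic_mod k pF) e (periodic_mod l pF). Qed.

(** By Euler's theorem the [m]-th power of the dilation by [g] is the identity, [m = totient b], so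
    [v c] is the component of [F] for the eigenvalue [ze c 1]. Dilations commute, hence an
    eigenvector of another dilation [h] splits into eigenvectors of [h]. *)
Lemma eigen_step b g (F : nat -> C) : (0<b)%N -> coprime g b ->
 periodic b F -> unit_supp b F ->
 exists m, exists v : nat -> nat -> C,
  [/\ forall k, F k = \sum_[c<m] v c k,
    forall c, (c<m)%N -> periodic b (v c) /\ unit_supp b (v c),
    forall c, (c<m)%N -> exists lam, nm lam = 1 /\ forall k, v c (g*k)%N = lam*v c k &
    forall h, coprime h b -> (exists lam, nm lam = 1 /\ forall k, F (h*k)%N = lam*F k) ->
     forall c, (c<m)%N -> exists lam, nm lam = 1 /\ forall k, v c (h*k)%N = lam*v c k].
Proof.
move=> b0 cg pF uF; pose m := totient b; have m0: (0<m)%N by rewrite totient_gt0.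
have mR: 0 < m%:R:>R by rewrite ltr0n.
pose ze (c j : nat) := cis (2*rpi*(c%:R*j%:R/m%:R)).
pose v c k := \sum_[j<m] cj (ze c j)*F (g ^ j*k)%N*(m%:R^-1)%:C.
exists m, v; split.
- move=> k; rewrite /v exchange_big /= big_ltn //=.
 rewrite (eq_bigr (fun=> F k*(m%:R^-1)%:C)); last first.
  by move=> c _; rewrite /ze mulr0 mul0r mulr0 cis0 conjc1 mul1r expn0 mul1n.
 rewrite sumr_const_nat subn0 -mulrnAr -rmorphMn /= -mulr_natr mulVf ?gt_eqF // mulr1.
 rewrite big_nat big1 ?addr0 // => j /andP[j0 jm].
 rewrite -mulr_suml -mulr_suml.
 have -> : \sum_[c<m] cj (ze c j) = 0; last by rewrite !mul0r.
 rewrite -conj_sum; have := @dft_orth m j m0; rewrite eqz_nat -lt0n => /(_ j0 jm) h.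
 suff -> : \sum_[c<m] ze c j = 0 by rewrite conjc0.
 apply: etrans h; apply: eq_bigr => c _.
 by rewrite /ze; congr cis; rewrite -pmulrn; ring.
- move=> c _; split=> k.
  apply: eq_bigr => j _; congr (_*_*_); apply: (periodic_eqmod pF).
  by rewrite mulnDr -modnDmr modnMl addn0.
 move=> ck; rewrite /v big1 // => j _; rewrite uF ?mulr0 ?mul0r //.
 by rewrite coprimeMl coprimeXl.
- move=> c _; exists (ze c 1%N); split; first exact: nm_cis.
 move=> k; pose G j := cj (ze c j)*F (g ^ j*k)%N*(m%:R^-1)%:C.
 have Gm: G m = G 0%N.
  rewrite /G; congr (_*_*_).
   rewrite /ze mulr0 mul0r mulr0 cis0 conjc1.
   have -> : c%:R * m%:R/m%:R = c%:R:>R by rewrite mulfK // gt_eqF.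
   by rewrite cis_2piN conjc1.
  apply: (periodic_eqmod pF); rewrite expn0 -modnMml Euler_exp_totient // modnMml //.
 have e1: \sum_[j<m] G j.+1 = \sum_[j<m] G j.
  apply: (addrI (G 0%N)); rewrite -{2}Gm addrC [RHS]addrC.
  by rewrite -[RHS]big_nat_recr //= [RHS]big_nat_recl // addrC.
 rewrite {2}/v -/(G _) -e1 mulr_sumr; apply: eq_bigr => j _.
 rewrite /G expnSr -mulnA !mulrA; congr (_*_*_).
 have -> : ze c j.+1 = ze c j*ze c 1%N.
  by rewrite /ze -cisD -natr1; congr cis; ring.
 by rewrite conjM mulrCA cis_mulJ mulr1.
- move=> h ch [lam [l1 hl]] c _; exists lam; split=> // k.
 rewrite /v mulr_sumr; apply: eq_bigr => j _.
 by rewrite mulnCA hl; ring.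
Qed.

Lemma eigen_decomp b (gs : seq nat) (F : nat -> C) : (0<b)%N -> all (coprime^~ b) gs ->
 periodic b F -> unit_supp b F ->
 exists m, exists v : nat -> nat -> C,
  [/\ forall k, F k = \sum_[c<m] v c k,
    forall c, (c<m)%N -> periodic b (v c) /\ unit_supp b (v c) &
    forall c, (c<m)%N -> forall g, g \in gs ->
     exists lam, nm lam = 1 /\ forall k, v c (g*k)%N = lam*v c k].
Proof.
move=> b0; elim: gs => [|g gs IH] /= cgs pF uF.
 by exists 1%N, (fun=> F); split=> // k; rewrite big_nat1.
case/andP: cgs => cg cgs; have [m [v [Fv pv ev]]] := IH cgs pF uF.
(* split each of the [m] pieces, one at a time *)
suff [M [w [Fw pw ew]]] : exists M, exists w : nat -> nat -> C,
  [/\ forall k, \sum_[c<m] v c k = \sum_[c<M] w c k,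
    forall c, (c<M)%N -> periodic b (w c) /\ unit_supp b (w c) &
    forall c, (c<M)%N -> forall h, h \in g :: gs ->
     exists lam, nm lam = 1 /\ forall k, w c (h*k)%N = lam*w c k].
 by exists M, w; split=> // k; rewrite Fv Fw.
elim: m pv ev {Fv} => [|m IHm] pv ev.
 by exists 0%N, v; split=> // k; rewrite !big_geq.
have [||M [w [Fw pw ew]]] := IHm.
- by move=> c cm; apply: pv; apply: ltnW.
- by move=> c cm; apply: ev; apply: ltnW.
have [pm um] := pv m (ltnSn m).
have [M' [w' [Fw' pw' ew' hw']]] := eigen_step b0 cg pm um.
exists (M+M')%N, (fun c => if (c<M)%N then w c else w' (c-M)%N); split.
- move=> k; rewrite big_nat_recr //= Fw Fw' [RHS](big_cat_nat (n := M)) //= ?leq_addr //.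
 congr (_+_); first by apply: eq_big_nat => c /andP[_ ->].
 rewrite [(M+M')%N]addnC sum_addn; apply: eq_bigr => c _.
 by rewrite ltnNge leq_addl /= addnK.
- move=> c cM; case: ltnP => h; first exact: pw.
 by apply: pw'; rewrite ltn_subLR.
- move=> c cM h hg; case: ltnP => hc; first exact: ew.
 have cM': (c-M<M')%N by rewrite ltn_subLR.
 move: hg; rewrite inE => /orP [/eqP ->|hgs]; first exact: ew'.
 by apply: hw' cM'; [exact: (allP cgs)|exact: ev].
Qed.

Lemma count_mult d a b : (0<d)%N -> (a<=b)%N ->
 (\sum_(a.+1<=n<b.+1) (d %| n)+a %/ d = b %/ d)%N.
Proof.
move=> d0 /subnKC <-; elim: (b-a)%N => [|k IH]; first by rewrite addn0 big_geq.
by rewrite addnS big_nat_recr ?ltnS ?leq_addr //= divnS // -IH addnAC addnC.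
Qed.

Lemma count_mult_bounds d a b : (0<d)%N -> (a<=b)%N ->
 (b%:R-a%:R)/d%:R-1 <= \sum_(a.+1 <= n < b.+1) (d %| n)%:R:>R /\
 \sum_(a.+1 <= n < b.+1) (d %| n)%:R <= (b%:R-a%:R)/d%:R+1:>R.
Proof.
move=> d0 ab; have dR: 0 < d%:R:>R by rewrite ltr0n.
have := congr1 (fun n => n%:R : R) (count_mult d0 ab).
rewrite /= natrD natr_sum => h.
have key c : (c %/ d)%:R <= c%:R/d%:R:>R /\ c%:R/d%:R < (c %/ d)%:R+1:>R.
 rewrite ler_pdivlMr // ltr_pdivrMr // natr1 -!natrM ler_nat ltr_nat.
 by rewrite leq_trunc_div ltn_ceil.
have [a1 a2] := key a; have [b1 b2] := key b; rewrite mulrBl.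
set S := \sum_(_ <= _ < _) _ in h *; split; lra.
Qed.

(** * The Turan-Kubilius variance for prime divisors in a window *)

Section Omega.
Variables (c c' : nat).
Definition om (n : nat) : R := \sum_(c.+1 <= p < c'.+1 | prime p) (p %| n)%:R.
Definition Wm : R := \sum_(c.+1 <= p < c'.+1 | prime p) p%:R^-1.
Definition pim : R := \sum_(c.+1 <= p < c'.+1 | prime p) 1.

Lemma pim_ge0 : 0 <= pim. Proof. exact: sumr_ge0. Qed.
Lemma pim_le : pim <= c'%:R.
Proof.
apply: leT (_ : \sum_(c.+1 <= p < c'.+1) 1 <= _).
 by rewrite [leLHS]big_mkcond; apply: ler_sum => p _; case: ifP.
by rewrite sumr_const_nat ler_nat subSS leq_subr.
Qed.

Lemma sum_om_ge a b : (a<=b)%N ->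
 (b%:R-a%:R)*Wm-pim <= \sum_(a.+1 <= n < b.+1) om n.
Proof.
move=> ab; rewrite exchange_big /= /Wm /pim mulr_sumr -sumrB.
apply: ler_sum => p /prime_gt0 p0; exact: (proj1 (count_mult_bounds p0 ab)).
Qed.

(** Pairs [p <> q] account for [Wm^2] and the diagonal for [Wm]; each count of multiples is off by
    at most 1, which produces the terms in [pim]. *)
Lemma sum_om2_le a b : (a<=b)%N ->
 \sum_(a.+1 <= n < b.+1) om n^+2 <= (b%:R-a%:R)*(Wm^+2+Wm)+2 * pim^+2.
Proof.
move=> ab; set l : R := b%:R-a%:R.
have l0: 0 <= l by rewrite subr_ge0 ler_nat.
have E n : om n^+2 = \sum_(c.+1 <= p < c'.+1 | prime p)
  \sum_(c.+1 <= q < c'.+1 | prime q) (p %| n)%:R*(q %| n)%:R.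
 by rewrite expr2 /om mulr_suml; apply: eq_bigr => p _; rewrite mulr_sumr.
under eq_bigr do rewrite E.
rewrite exchange_big /=.
have h p : prime p -> \sum_(a.+1 <= n < b.+1) \sum_(c.+1 <= q < c'.+1 | prime q) (p %| n)%:R*(q %| n)%:R
  <= \sum_(c.+1 <= q < c'.+1 | prime q) (l * p%:R^-1*q%:R^-1+1)+(l * p%:R^-1+1):>R.
 move=> pp; rewrite exchange_big /=.
 have p0 := prime_gt0 pp.
 have hq q : prime q -> \sum_(a.+1 <= n < b.+1) (p %| n)%:R*(q %| n)%:R
   <= l * p%:R^-1*q%:R^-1+1+(if q == p then l * p%:R^-1+1 else 0).
  move=> pq; have q0 := prime_gt0 pq; have [->|qp] := eqVneq q p.
   have [_ h2] := count_mult_bounds p0 ab.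
   have -> : \sum_(a.+1 <= n < b.+1) (p %| n)%:R*(p %| n)%:R = \sum_(a.+1 <= n < b.+1) (p %| n)%:R:>R.
    by apply: eq_bigr => n _; case: (p %| n)%N; rewrite ?mulr1 ?mulr0.
   apply: leT h2 _; rewrite lerDr addr_ge0 // !mulr_ge0 ?invr_ge0 //.
  have pq0: (0<p*q)%N by rewrite muln_gt0 p0.
  have [_ h2] := count_mult_bounds pq0 ab.
  have -> : \sum_(a.+1 <= n < b.+1) (p %| n)%:R*(q %| n)%:R =
    \sum_(a.+1 <= n < b.+1) (p*q %| n)%:R:>R.
   apply: eq_bigr => n _; rewrite Gauss_dvd.
    by case: (p %| n)%N; case: (q %| n)%N; rewrite ?mulr1 ?mulr0 ?mul0r.
   by rewrite prime_coprime // dvdn_prime2 // eq_sym.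
  by apply: leT h2 _; rewrite addr0 natrM invfM mulrA.
 apply: leT (ler_sum _ hq) _; rewrite big_split /= lerD2l.
 rewrite -big_mkcondr /=.
 apply: leT (_ : \sum_(i <- index_iota c.+1 c'.+1 | i == p) (l * p%:R^-1+1) <= _).
  rewrite [leLHS]big_mkcond [leRHS]big_mkcond; apply: ler_sum => q _.
  by case: (q == p); rewrite ?andbF ?andbT //; case: ifP => // _; rewrite addr_ge0 ?mulr_ge0 ?invr_ge0.
 have [pin|pin] := boolP (p \in index_iota c.+1 c'.+1).
  by rewrite (big_rem p) //= eqxx big_seq_cond big1 ?addr0 // => q /andP[];
   rewrite mem_rem_uniq ?iota_uniq // inE => /andP[/negbTE ->].
 rewrite big_seq_cond big1 ?addr_ge0 ?mulr_ge0 ?invr_ge0 // => q /andP[qi /eqP qp].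
 by rewrite -qp qi in pin.
apply: leT (ler_sum _ h) _.
have E2: \sum_(c.+1 <= p < c'.+1 | prime p) (\sum_(c.+1 <= q < c'.+1 | prime q) (l * p%:R^-1*q%:R^-1+1)
   + (l * p%:R^-1+1)) = l*Wm^+2+pim^+2+(l*Wm+pim).
 rewrite big_split /=; congr (_+_); last by rewrite big_split /= -mulr_sumr.
 have -> : l*Wm^+2+pim^+2 = \sum_(c.+1 <= p < c'.+1 | prime p) (l * p%:R^-1*Wm+pim).
  rewrite big_split /= -mulr_suml -mulr_sumr -/Wm -mulrA -expr2; congr (_+_).
  rewrite expr2 {1}/pim mulr_suml; by apply: eq_bigr => p _; rewrite mul1r.
 by apply: eq_bigr => p _; rewrite big_split /= -mulr_sumr.
rewrite E2.
have : pim <= pim^+2.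
 have -> : pim = (\sum_(c.+1<=p<c'.+1 | prime p) 1)%N%:R by rewrite natr_sum.
 by rewrite -natrX ler_nat; case: (\sum_(_<=_<_ | _) _)%N => // k; rewrite expnS expn1 leq_pmulr.
lra.
Qed.

Lemma turan_kubilius a b : 0 < Wm -> (a<=b)%N ->
 \sum_(a.+1 <= n < b.+1) (1-om n/Wm)^+2 <=
 (b%:R-a%:R)/Wm+2 * pim/Wm+2 * pim^+2/Wm^+2.
Proof.
move=> W0 ab; have h1 := sum_om_ge ab; have h2 := sum_om2_le ab.
set l : R := b%:R-a%:R in h1 h2 *.
have -> : \sum_(a.+1 <= n < b.+1) (1-om n/Wm)^+2 =
 l-2*Wm^-1*\sum_(a.+1 <= n < b.+1) om n+Wm^-1^+2*\sum_(a.+1 <= n < b.+1) om n^+2.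
 have -> : l = \sum_(a.+1 <= n < b.+1) 1 by rewrite sumr_const_nat subSS natrB.
 rewrite !mulr_sumr -sumrB -big_split /=; apply: eq_bigr => n _; ring.
have i0: 0 < Wm^-1 by rewrite invr_gt0.
have e1: Wm^-1*Wm = 1 by rewrite mulVf // gt_eqF.
have a1 := leMl (_ : 0 <= 2*Wm^-1) h1.
have a2 := leMl (sqr_ge0 Wm^-1) h2.
have {}a1 := a1 ltac:(by rewrite mulr_ge0 // ltW).
have e2: 2*Wm^-1*(l*Wm-pim) = 2 * l*(Wm^-1*Wm)-2 * pim*Wm^-1 by ring.
have e3: Wm^-1^+2*(l*(Wm^+2+Wm)+2 * pim^+2) =
  l*(Wm^-1*Wm)^+2+l*Wm^-1*(Wm^-1*Wm)+2 * pim^+2*Wm^-1^+2 by ring.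
rewrite e2 in a1; rewrite e3 in a2; rewrite !e1 ?expr1n in a1 a2.
rewrite [(Wm^+2)^-1](_ : _ = Wm^-1^+2) ?exprVn //; lra.
Qed.
End Omega.

(** * Turan-Kubilius factorization *)

Lemma sum_blocks (V : nmodType) (F : nat -> V) (P : pred nat) (c : nat -> nat) n :
 (forall i, (c i<=c i.+1)%N) ->
 \sum_[i<n] \sum_((c i).+1 <= p < (c i.+1).+1 | P p) F p =
 \sum_((c 0%N).+1 <= p < (c n).+1 | P p) F p.
Proof.
move=> hc; have mono i : (c 0%N<=c i)%N by elim: i => // i h; apply: leqT h (hc i).
elim: n => [|n IH]; first by rewrite !big_geq.
by rewrite big_nat_recr //= IH -big_cat_nat //= ltnS.
Qed.

Lemma realCM (x y : R) : (x*y)%:C = x%:C*y%:C.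
Proof. exact: (rmorphM (real_complex RT)). Qed.
Lemma realCB (x y : R) : (x-y)%:C = x%:C-y%:C.
Proof. exact: (rmorphB (real_complex RT)). Qed.

Section Level.
Variables (f g : nat -> C) (b : nat).
Hypotheses (hf : bnd1 f) (hm : qmult b g f).
Variables (c : nat -> nat) (k I X X' : nat).
Hypotheses (c_mono : forall i, (c i<=c i.+1)%N) (c_step : forall i, (k*c i.+1<=k.+1*c i)%N).
Hypotheses (c0_gt0 : (0<c 0%N)%N) (b_c0 : (b<=c 0%N)%N).
Hypotheses (k3 : (3<=k)%N) (XX' : (X<=X'<=3*X)%N).
Hypothesis X_gt0 : (0<X)%N.

Definition fh (t : R) : C := X%:R^-1%:C*\sum_(X.+1 <= n < X'.+1) f n*npw n t.
Definition Qb (i : nat) (t : R) : C :=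
 (c i)%:R^-1%:C*\sum_((c i).+1 <= p < (c i.+1).+1 | prime p) g p*npw p t.
Definition Rb (i : nat) (t : R) : C :=
 ((c i)%:R/X%:R)%:C*\sum_((X %/ c i).+1 <= m < (X' %/ c i).+1) f m*npw m t.

(** Factorizations [n = p m] with [p] in block [i] and [m] in a range that depends on the block
    only. The condition [X < p m <= X'] would not separate [p] from [m]; as the blocks have ratio at
    most [1 + 1/k], the two conditions differ only in layers of relative width [1/k] at the
    endpoints. *)
Definition omb (i n : nat) : R :=
 \sum_((c i).+1 <= p < (c i.+1).+1 | prime p)
   \sum_((X %/ c i).+1 <= m < (X' %/ c i).+1) (p * m == n)%N%:R.
Definition om' (n : nat) : R := \sum_[i<I] omb i n.

Lemma c_gt0 i : (0<c i)%N.
Proof. by elim: i => // i IH; apply: leqT IH (c_mono i). Qed.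
Lemma c0_le i : (c 0%N<=c i)%N.
Proof. by elim: i => // i IH; apply: leqT IH (c_mono i). Qed.

Lemma block_range i p m : (c i<p<=c i.+1)%N -> (X %/ c i<m<=X' %/ c i)%N ->
 (X<p * m)%N /\ (k*(p * m)<=k.+1*X')%N.
Proof.
move=> /andP[p1 p2] /andP[]; have ci := c_gt0 i; have cs := c_step i.
rewrite ltn_divLR // leq_divRL // => m1 m2; split; first by nia.
apply: (@leq_trans (k.+1*(m*c i))%N); last by rewrite leq_mul2l m2 orbT.
have : (k * p<=k.+1*c i)%N by apply: leqT cs; rewrite leq_mul2l p2 orbT.
by move=> h; rewrite mulnA (mulnC m) mulnA leq_mul2r h orbT.
Qed.

Lemma range4 n : (k*n<=k.+1*X')%N -> (n<=4*X)%N.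
Proof. case/andP: XX' => _ h1 h; clear -h h1 k3; nia. Qed.

Lemma sum_om'_eq (t : R) :
 \sum_(X.+1 <= n < (4*X).+1) (om' n)%:C*(f n*npw n t) =
 \sum_[i<I] (\sum_((c i).+1 <= p < (c i.+1).+1 | prime p) g p*npw p t) *
   (\sum_((X %/ c i).+1 <= m < (X' %/ c i).+1) f m*npw m t).
Proof.
transitivity (\sum_(X.+1 <= n < (4*X).+1) \sum_[i<I]
  \sum_((c i).+1 <= p < (c i.+1).+1 | prime p) \sum_((X %/ c i).+1 <= m < (X' %/ c i).+1)
  (p * m == n)%N%:R%:C*(f n*npw n t)).
 apply: eq_bigr => n _; rewrite realC_sum mulr_suml; apply: eq_bigr => i _.
 rewrite realC_sum mulr_suml; apply: eq_bigr => p _.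
 by rewrite realC_sum mulr_suml.
rewrite exchange_big /=; apply: eq_bigr => i _.
rewrite exchange_big /= mulr_suml big_nat_cond [RHS]big_nat_cond.
apply: eq_bigr => p /andP[hp pp].
rewrite exchange_big /= mulr_sumr; apply: eq_big_nat => m hmm.
have [r1 r2] := block_range hp hmm; have r3 := range4 r2.
rewrite (bigD1_seq (p * m)%N) ?iota_uniq //=; last by rewrite mem_index_iota r1 ltnS.
rewrite eqxx mul1r big1 ?addr0; last first.
 by move=> n /negbTE nn; rewrite eq_sym nn mul0r.
have p0 := prime_gt0 pp; have m0: (0<m)%N by case/andP: hmm => /(leqT _)->.
rewrite hm // ?npwM //; first by ring.
by case/andP: hp => h _; apply: leq_ltn_trans h; apply: leqT b_c0 (c0_le i).
Qed.

Lemma inner_le i p n : (0<p)%N ->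
 \sum_((X %/ c i).+1 <= m < (X' %/ c i).+1) (p * m == n)%N%:R <= (p %| n)%N%:R:>R.
Proof.
move=> p0; have [/dvdnP [q ->]|pn] := boolP (p %| n)%N; last first.
 rewrite big1 // => m _; case: eqP => // h; by rewrite -h dvdn_mulr in pn.
have [qin|qin] := boolP (q \in index_iota (X %/ c i).+1 (X' %/ c i).+1).
 rewrite (bigD1_seq q) ?iota_uniq //= [(q * p)%N]mulnC eqxx big1 ?addr0 // => m mq.
 by rewrite eqn_pmul2l // (negbTE mq).
rewrite big_seq big1 // => m mi; rewrite [(q * p)%N]mulnC eqn_pmul2l //.
by case: eqP => // mq; rewrite -mq mi in qin.
Qed.

Lemma om'_ge0 n : 0 <= om' n.
Proof. by do 3!(apply: sumr_ge0 => ? _). Qed.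

Notation omI := (om (c 0%N) (c I)).
Notation WI := (Wm (c 0%N) (c I)).

Lemma om'_le n : om' n <= omI n.
Proof.
rewrite /om -(sum_blocks _ _ _ c_mono); apply: ler_sum => i _.
by apply: ler_sum => p pp; apply: inner_le; apply: prime_gt0.
Qed.

Lemma om'_eq n : (k.+1*X<k*n)%N -> (n<=X')%N -> om' n = omI n.
Proof.
move=> n1 n2; rewrite /om -(sum_blocks _ _ _ c_mono); apply: eq_bigr => i _.
rewrite /omb big_nat_cond [RHS]big_nat_cond; apply: eq_bigr => p /andP[/andP[p1 p2] pp].
have p0 := prime_gt0 pp; have ci := c_gt0 i.
have [/dvdnP [q nq]|pn] := boolP (p %| n)%N; last first.
 rewrite big1 // => m _; case: eqP => // h; by rewrite -h dvdn_mulr in pn.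
have qin: q \in index_iota (X %/ c i).+1 (X' %/ c i).+1.
 rewrite mem_index_iota ltn_divLR // ltnS leq_divRL //; apply/andP; split.
  have cs := c_step i; rewrite ltnS in p2.
  have h: (k*n<=k.+1*(q*c i))%N.
   rewrite nq; apply: (@leq_trans (q*(k*c i.+1))%N); last by rewrite [leqRHS]mulnCA leq_mul2l cs orbT.
   by rewrite mulnCA !leq_mul2l p2 !orbT.
  by rewrite -(ltn_pmul2l (ltn0Sn k)); apply: leqT n1 h.
 by apply: leqT n2; rewrite nq leq_mul2l ltnW ?orbT.
rewrite (bigD1_seq q) ?iota_uniq //= nq [(q * p)%N]mulnC eqxx big1 ?addr0 // => m mq.
by rewrite eqn_pmul2l // (negbTE mq).
Qed.

Lemma om'_zero n : (k.+1*X'<k*n)%N -> om' n = 0.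
Proof.
move=> n1; rewrite /om' big1 // => i _; rewrite /omb big_nat_cond big1 // => p /andP[hp pp].
rewrite big_nat big1 // => m hmm; case: eqP => // h.
by have [_] := block_range hp hmm; rewrite h leqNgt n1.
Qed.

Hypothesis W1 : 1 <= WI.

Definition errn (n : nat) : C :=
 ((n<=X')%N%:R-om' n/WI)%:C*f n.

(** In the bulk [om' = om] and Turan-Kubilius applies. In the layers [(X, X+X/k]] and
    [(X', X'+X'/k]] the second moment of [om] suffices, and beyond them [om'] vanishes. *)
Lemma sum_err_le : \sum_(X.+1 <= n < (4*X).+1) N2 (errn n) <=
 2*X%:R/WI+9*(X%:R/k%:R)+8 * pim (c 0%N) (c I)^+2.
Proof.
case/andP: XX' => X1 X3; have W1' := W1; move: W1'; set W := WI => W1'; set pi := pim _ _.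
have W0: 0 < W by lra.
have pi0: 0 <= pi by exact: pim_ge0.
have piS: pi <= pi^+2.
 have -> : pi = (\sum_((c 0%N).+1<=p<(c I).+1 | prime p) 1)%N%:R by rewrite natr_sum.
 by rewrite -natrX ler_nat; case: (\sum_(_<=_<_ | _) _)%N => // j; rewrite expnS expn1 leq_pmulr.
have kR: 0 < k%:R:>R by rewrite ltr0n (leqT _ k3).
pose a1 := (X+X %/ k)%N; pose a2 := (X'+X' %/ k)%N.
have lek n Y : (k*n<=k.+1*Y)%N = (n<=Y+Y %/ k)%N.
 by rewrite -leq_subLR leq_divRL ?(leqT _ k3) // mulnBl leq_subLR mulnC [(Y*k)%N]mulnC mulSn addnC.
have hE n : N2 (errn n) <= (if (n<=X')%N then (1-omI n/W)^+2 else 0) +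
  (if (n<=a1)%N then 1+omI n^+2/W^+2 else 0) +
  (if (X'<n<=a2)%N then omI n^+2/W^+2 else 0).
 have o0 := om'_ge0 n; have o1 := om'_le n.
 have A0: 0 <= omI n^+2/W^+2 by rewrite divr_ge0 ?sqr_ge0.
 have A1: (om' n/W)^+2 <= omI n^+2/W^+2.
  rewrite expr_div_n leMr ?invr_ge0 ?sqr_ge0 // lerXn2r ?nnegrE //.
  exact: leT o0 o1.
 have q0: 0 <= om' n/W by rewrite divr_ge0 // ltW.
 rewrite /errn N2M N2_real.
 apply: (leV (((n<=X')%N%:R-om' n/W)^+2)).
  by rewrite ler_piMr ?sqr_ge0 // nm_N2.
 have [nX|nX] := leqP n X' => /=.
  have [na|na] := leqP n a1.
   have : (1-om' n/W)^+2 <= 1+omI n^+2/W^+2 by nra.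
   have := sqr_ge0 (1-omI n/W); lra.
  rewrite om'_eq //; first by lra.
  by rewrite ltnNge lek -ltnNge.
 rewrite sub0r sqrrN.
 have B0: 0 <= (if (n<=a1)%N then 1+omI n^+2/W^+2 else 0) by case: ifP => // _; lra.
 have [na|na] := leqP n a2 => /=; first by rewrite add0r; apply: leT A1 _; rewrite lerDr.
 rewrite om'_zero ?mul0r ?expr0n //=; first by rewrite add0r addr0.
 by rewrite ltnNge lek -ltnNge.
apply: leT (ler_sum _ (fun n _ => hE n)) _; rewrite !big_split /=.
have sub1 (F : nat -> R) (lo hi : nat) : (forall n, 0 <= F n) -> (X<=lo)%N ->
  \sum_(X.+1 <= n < (4*X).+1) (if (lo<n<=hi)%N then F n else 0) <= \sum_(lo.+1 <= n < hi.+1) F n.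
 move=> F0 Xl; have [lh|hl] := leqP lo hi; last first.
  rewrite [leLHS]big1 ?sumr_ge0 // => n _; case: ifP => // /andP[a b0].
  by move: (leqT a b0); rewrite ltnNge (ltnW hl).
 apply: (leV (\sum_[n<(4*X).+1+hi.+1] (if (lo<n<=hi)%N then F n else 0))).
  rewrite [leRHS](big_cat_nat (n := X.+1)) //=; last by clear; lia.
  rewrite [X in _ <= _+X](big_cat_nat (n := (4*X).+1)) //=; try by clear; lia.
  rewrite addrCA lerDl addr_ge0 // sumr_ge0 // => n _; by case: ifP.
 rewrite (big_cat_nat (n := lo.+1)) //=; last by clear -lh; lia.
 rewrite big_nat big1 ?add0r; last by move=> n /andP[_ nl]; rewrite ltnNge -ltnS nl.
 have lh': (lo.+1<=hi.+1)%N by [].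
 have hh: (hi.+1<=(4*X).+1+hi.+1)%N by clear; lia.
 rewrite (big_cat_nat lh' hh) /=.
 rewrite [X in _+X]big_nat [X in _+X]big1 ?addr0; last first.
  by move=> n /andP[hn _]; rewrite [(n<=hi)%N]leqNgt hn andbF.
 by apply: ler_sum_nat => n /andP[l1 l2]; rewrite l1 -ltnS l2.
have cond_in (G : nat -> R) hi : \sum_(X.+1 <= n < (4*X).+1) (if (n<=hi)%N then G n else 0) =
  \sum_(X.+1 <= n < (4*X).+1) (if (X<n<=hi)%N then G n else 0).
 by apply: eq_big_nat => n /andP[-> _].
have s1: \sum_(X.+1 <= n < (4*X).+1) (if (n<=X')%N then (1-omI n/W)^+2 else 0) <=
  2*X%:R/W+2 * pi/W+2 * pi^+2/W^+2.
 rewrite cond_in; apply: leT (sub1 _ _ _ _ _) _ => //; first by move=> n; apply: sqr_ge0.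
 apply: leT (turan_kubilius W0 X1) _; rewrite -/pi !lerD2r leMr ?invr_ge0 ?(ltW W0) //.
 have : X'%:R <= 3*X%:R:>R by rewrite -natrM ler_nat.
 lra.
have fl Y : (Y %/ k)%:R <= Y%:R/k%:R:>R by rewrite ler_pdivlMr // -natrM ler_nat leq_trunc_div.
have wfrac (l : R) : 0 <= l -> (l*(W^+2+W)+2 * pi^+2)/W^+2 <= 2 * l+2 * pi^+2.
 move=> l0; rewrite ler_pdivrMr ?exprn_gt0 //.
 have : 1 <= W^+2 by rewrite expr_ge1 // ltW.
 have := sqr_ge0 pi; have : W <= W^+2 by rewrite expr2 ler_peMr // ltW.
 nra.
have s2: \sum_(X.+1 <= n < (4*X).+1) (if (n<=a1)%N then 1+omI n^+2/W^+2 else 0) <=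
  3*(X%:R/k%:R)+2 * pi^+2.
 rewrite cond_in; apply: leT (sub1 _ _ _ _ _) _ => //.
  by move=> n; rewrite addr_ge0 // divr_ge0 ?sqr_ge0.
 rewrite big_split /= -mulr_suml sumr_const_nat subSS /a1 addKn.
 have := sum_om2_le (c 0%N) (c I) (leq_addr (X %/ k)%N X); rewrite natrD addrAC subrr add0r => h.
 have := leMr (_ : 0 <= (W^+2)^-1) h; rewrite invr_ge0 sqr_ge0 => /(_ isT) h2.
 have := wfrac _ (ler0n _ (X %/ k)%N); have := fl X; rewrite -/W -/pi in h2; lra.
have s3: \sum_(X.+1 <= n < (4*X).+1) (if (X'<n<=a2)%N then omI n^+2/W^+2 else 0) <=
  6*(X%:R/k%:R)+2 * pi^+2.
 apply: leT (sub1 _ _ _ _ _) _ => //.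
  by move=> n; rewrite divr_ge0 ?sqr_ge0.
 rewrite -mulr_suml.
 have := sum_om2_le (c 0%N) (c I) (leq_addr (X' %/ k)%N X'); rewrite natrD addrAC subrr add0r => h.
 have := leMr (_ : 0 <= (W^+2)^-1) h; rewrite invr_ge0 sqr_ge0 => /(_ isT) h2.
 have := wfrac _ (ler0n _ (X' %/ k)%N); have := fl X'; rewrite -/W -/pi in h2.
 have : X'%:R/k%:R <= 3*(X%:R/k%:R):>R.
  by rewrite mulrA leMr ?invr_ge0 // -natrM ler_nat.
 lra.
have i1: W^-1 <= 1 by rewrite invf_le1.
have : 2 * pi/W <= 2 * pi^+2.
 by apply: leT (_ : 2 * pi <= _); [rewrite ler_piMr // mulr_ge0|lra].
have : 2 * pi^+2/W^+2 <= 2 * pi^+2.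
 by rewrite ler_piMr ?mulr_ge0 ?sqr_ge0 // invf_le1 ?exprn_gt0 // expr_ge1 // ltW.
lra.
Qed.

(** [fh] is the sum of the products [Qb i * Rb i] divided by the reciprocal sum, plus the polynomial
    with coefficients [errn]. The latter is estimated at all integers [|t| <= T] by the large sieve,
    where [T <= X]; the products are kept on the chosen set [S] only. *)
Lemma level_bound T (S : pred nat) : (T<=X)%N -> 8*(c I)%:R^+2*WI <= X%:R ->
 \sum_(0 <= j < (2*T).+1 | S j) N2 (fh (j%:R-T%:R)) <=
 36*CLS*(WI^-1+k%:R^-1) +
 2*I%:R/WI^+2*\sum_[i<I] \sum_(0 <= j < (2*T).+1 | S j)
   N2 (Qb i (j%:R-T%:R))*N2 (Rb i (j%:R-T%:R)).
Proof.
move=> TX; case/andP: (XX') => X1 X3; have W1' := W1; move: W1'; set W := WI => W1' hX.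
have W0: 0 < W by lra.
have XR: 0 < X%:R:>R by rewrite ltr0n.
have kR: 0 < k%:R:>R by rewrite ltr0n (leqT _ k3).
have C1 := CLS_ge1.
pose er t := X%:R^-1%:C*\sum_(X.+1 <= n < (4*X).+1) errn n*npw n t.
have E t : fh t = er t+W^-1%:C*\sum_[i<I] Qb i t*Rb i t.
 have -> : \sum_[i<I] Qb i t*Rb i t =
   X%:R^-1%:C*\sum_(X.+1 <= n < (4*X).+1) (om' n)%:C*(f n*npw n t).
  rewrite sum_om'_eq mulr_sumr; apply: eq_bigr => i _; rewrite /Qb /Rb.
  have ci: (c i)%:R != 0:>R by rewrite pnatr_eq0 -lt0n c_gt0.
  have -> : ((c i)%:R/X%:R)%:C = (c i)%:R%:C*X%:R^-1%:C :> C by rewrite realCM.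
  have e1: (c i)%:R^-1%:C*(c i)%:R%:C = 1 :> C by rewrite -realCM mulVf.
  set A := \sum_(_ <= _ < _ | _) _; set B := \sum_(_ <= _ < _) _.
  transitivity ((c i)%:R^-1%:C*(c i)%:R%:C*(X%:R^-1%:C*(A*B))); first by ring.
  by rewrite e1 mul1r.
 rewrite mulrCA -mulrDr /fh /er; congr (_*_); rewrite mulr_sumr -big_split /=.
 have -> : \sum_(X.+1 <= n < X'.+1) f n*npw n t =
   \sum_(X.+1 <= n < (4*X).+1) (n<=X')%N%:R%:C*(f n*npw n t).
  rewrite [RHS](big_cat_nat (n := X'.+1)) //=; last by clear -X3; lia.
  rewrite [X in _+X]big_nat [X in _+X]big1 ?addr0; last first.
   by move=> n /andP[nX _]; rewrite leqNgt nX mul0r.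
  by apply: eq_big_nat => n /andP[_ nX]; rewrite -ltnS nX mul1r.
 apply: eq_bigr => n _; rewrite /errn realCB realCM; ring.
have Eerr: \sum_[j<(2*T).+1] N2 (er (j%:R-T%:R)) <= 2*CLS*(9*(W^-1+k%:R^-1)).
 have -> : \sum_[j<(2*T).+1] N2 (er (j%:R-T%:R)) =
   X%:R^-1^+2*\sum_[j<(2*T).+1]
    N2 (\sum_(X.+1 <= n < (4*X).+1) errn n*npw n (j%:R-T%:R)).
  by rewrite mulr_sumr; apply: eq_bigr => j _; rewrite N2M N2_real.
 apply: leT (leMl (sqr_ge0 _) (large_sieve T errn X_gt0)) _.
 have h1: \sum_(X.+1 <= n < (4*X).+1) N2 (errn n) <= 9*X%:R*(W^-1+k%:R^-1).
  apply: leT sum_err_le _; rewrite -/W.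
  have h2: 8 * pim (c 0%N) (c I)^+2 <= X%:R/W.
   rewrite ler_pdivlMr //; apply: leT hX; rewrite leMr ?(ltW W0) //.
   by rewrite leMl // lerXn2r ?nnegrE ?pim_ge0 // pim_le.
  have : 0 <= X%:R/W by rewrite divr_ge0 // ltW.
  lra.
 have h3: T%:R+X%:R <= 2*X%:R:>R.
  by have : T%:R <= X%:R:>R by [rewrite ler_nat]; lra.
 set V := W^-1+k%:R^-1 in h1 *.
 have V0: 0 <= V by rewrite addr_ge0 // invr_ge0 ltW.
 have h4: (T%:R+X%:R)*\sum_(X.+1 <= n < (4*X).+1) N2 (errn n) <= 2*X%:R*(9*X%:R*V).
  apply: ler_pM => //; first by rewrite addr_ge0.
  by apply: sumr_ge0 => *; rewrite N2_ge0.
 have c0: 0 <= X%:R^-1^+2*CLS by rewrite mulr_ge0 ?sqr_ge0 //; lra.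
 have := leMl c0 h4.
 have -> : X%:R^-1^+2*CLS*(2*X%:R*(9*X%:R*V)) = 2*CLS*(9*V).
  by field; rewrite gt_eqF.
 by move=> h; apply: leT h; rewrite !mulrA.
have step j : N2 (fh (j%:R-T%:R)) <= 2*N2 (er (j%:R-T%:R)) +
  2*(I%:R/W^+2*\sum_[i<I] N2 (Qb i (j%:R-T%:R))*N2 (Rb i (j%:R-T%:R))).
 rewrite E; apply: leT (N2D _ _) _; rewrite mulrDr lerD2l leMl //.
 rewrite N2M N2_real exprVn mulrC [I%:R/_]mulrC -mulrA mulrC leMl ?invr_ge0 ?sqr_ge0 //.
 apply: leT (CS1 _ _ _) _; rewrite sumr_const_nat subn0 leMl //.
 by apply: ler_sum => i _; rewrite N2M.
apply: leT (ler_sum _ (fun j _ => step j)) _; rewrite big_split /=; apply: lerD.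
 rewrite -mulr_sumr; apply: (leV (2*(2*CLS*(9*(W^-1+k%:R^-1))))); last by lra.
 rewrite leMl //; apply: leT Eerr.
 rewrite [leLHS]big_mkcond /=; apply: ler_sum => j _; case: ifP => // _; exact: N2_ge0.
rewrite -mulr_sumr -mulr_sumr exchange_big /= !mulrA //.
Qed.
End Level.

(** * Moments of prime polynomials *)

Lemma gcdn_mul_le a x y : (0<a)%N -> (gcdn a (x*y)<=gcdn a x * gcdn a y)%N.
Proof.
move=> a0; apply: dvdn_leq; first by rewrite muln_gt0 !gcdn_gt0 a0.
rewrite muln_gcdr dvdn_gcd; apply/andP; split.
 by apply: dvdn_mull; apply: dvdn_gcdl.
rewrite muln_gcdl dvdn_gcd dvdn_gcdr andbT.
by apply: dvdn_mulr; apply: dvdn_gcdl.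
Qed.

Lemma gcdn_prod_le a (l : nat) (F : 'I_l -> nat) : (0<a)%N ->
 (gcdn a (\prod_i F i) <= \prod_i gcdn a (F i))%N.
Proof.
move=> a0; elim/big_rec2: _ => [|i x y _ h]; first by rewrite gcdn1.
by apply: leqT (gcdn_mul_le _ _ a0) _; rewrite leq_mul2l h orbT.
Qed.

Lemma count_dvd_mul a d Y : (0<a)%N -> (0<d)%N ->
 \sum_[m<=Y] (d %| a * m)%N%:R <= Y%:R*((gcdn a d)%:R/d%:R):>R.
Proof.
move=> a0 d0; pose g := gcdn a d; have g0: (0<g)%N by rewrite gcdn_gt0 a0.
have gd: (g %| d)%N by exact: dvdn_gcdr.
pose d' := (d %/ g)%N; have d'0: (0<d')%N by rewrite divn_gt0 // dvdn_leq.
have h m : (d %| a * m)%N -> (d' %| m)%N.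
 move=> dm; have : (d' %| (a %/ g) * m)%N.
  have e1: (d = d' * g)%N by rewrite divnK.
  have e2: (a = a %/ g * g)%N by rewrite divnK // dvdn_gcdl.
  by move: dm; rewrite {1}e1 {1}e2 mulnAC dvdn_pmul2r.
 rewrite Gauss_dvdr //; rewrite /coprime -(eqn_pmul2l g0) muln1 muln_gcdr.
 by rewrite mulnC divnK // mulnC divnK ?dvdn_gcdl // gcdnC.
apply: (leV (\sum_[m<=Y] (d' %| m)%N%:R)).
 apply: ler_sum => m _; rewrite ler_nat.
 by case: (boolP (d %| a * m)%N) => // /h ->.
have : (\sum_[m<=Y] (d' %| m) = Y %/ d')%N.
 elim: Y => [|Y IH]; first by rewrite big_geq // div0n.
 by rewrite big_nat_recr //= IH divnS // addnC.
move=> /(congr1 (fun n => n%:R : R)); rewrite natr_sum => ->.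
have dR: 0 < d'%:R:>R by rewrite ltr0n.
have -> : g%:R/d%:R = d'%:R^-1:>R.
 have -> : (d = d' * g)%N by rewrite divnK.
 by rewrite natrM invfM mulrCA mulfV ?mulr1 // pnatr_eq0 -lt0n.
by rewrite ler_pdivlMr // -natrM ler_nat leq_trunc_div.
Qed.

(** Cauchy-Schwarz over [J] ranges of ratio 4: a power of a prime polynomial spreads over a range
    too wide for one of them. *)
Lemma large_sieve_wide J T K (c : nat -> C) : (0<K)%N ->
 \sum_[k<(2*T).+1]
   N2 (\sum_(K.+1 <= n < (4 ^ J*K).+1) c n*npw n (k%:R-T%:R)) <=
 J%:R*CLS*(T%:R+(4 ^ J*K)%:R)*\sum_(K.+1 <= n < (4 ^ J*K).+1) N2 (c n).
Proof.
move=> K0; have split_sum (V : nmodType) (F : nat -> V) :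
 \sum_(K.+1 <= n < (4 ^ J*K).+1) F n =
 \sum_[j<J] \sum_((4 ^ j*K).+1 <= n < (4*(4 ^ j*K)).+1) F n.
 elim: J => [|j IH]; first by rewrite !big_geq // mul1n.
 rewrite [RHS]big_nat_recr //= -IH -big_cat_nat //= ?ltnS ?mulnA -?expnS //.
  by rewrite leq_pmull // expn_gt0.
 by rewrite leq_mul2r leq_exp2l // leqnSn orbT.
rewrite split_sum.
apply: (leV (\sum_[k<(2*T).+1] J%:R*\sum_[j<J]
  N2 (\sum_((4 ^ j*K).+1 <= n < (4*(4 ^ j*K)).+1) c n*npw n (k%:R-T%:R)))).
 apply: ler_sum => k _; rewrite split_sum; apply: leT (CS1 _ _ _) _.
 by rewrite sumr_const_nat subn0.
rewrite -mulr_sumr exchange_big /= -!mulrA leMl // !mulr_sumr.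
apply: ler_sum_nat => j /andP[_ jJ].
have K'0: (0<4 ^ j*K)%N by rewrite muln_gt0 expn_gt0.
apply: leT (large_sieve T c K'0) _.
rewrite [leRHS]mulrA; apply: leMr; first by apply: sumr_ge0 => *; rewrite N2_ge0.
have C1 := CLS_ge1; rewrite leMl //; first by lra.
by rewrite lerD2l ler_nat leq_mul2r leq_exp2l // (ltnW jJ) orbT.
Qed.

Section Mult.
Variables (g f : nat -> C) (c c' l Y Y' K0 J T : nat).
Hypotheses (hg : bnd1 g) (hf : bnd1 f).
Hypotheses (cc : (0<c)%N /\ (c<=c'<=2*c)%N) (K00 : (0<K0)%N).
Hypotheses (Klo : (K0<Y.+1*c.+1 ^ l)%N) (Khi : (Y'*c' ^ l<=4 ^ J*K0)%N).

Let A (p : nat) := prime p && (c<p<=c')%N.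
Let phis := {ffun 'I_l -> 'I_c'.+1}.
Let inA (phi : phis) := [forall i, A (phi i)].
Let pr (phi : phis) : nat := \prod_i (phi i : nat).

Definition Us (t : R) : C := \sum_(c.+1 <= p < c'.+1 | prime p) g p*npw p t.
Definition Vs (t : R) : C := \sum_(Y.+1 <= m < Y'.+1) f m*npw m t.

Lemma primes_sum_ord (V : nmodType) (F : nat -> V) :
 \sum_(c.+1 <= p < c'.+1 | prime p) F p = \sum_(p < c'.+1 | A p) F p.
Proof.
rewrite -(big_mkord (fun p => A p)) /= [RHS](big_cat_nat (n := c.+1)) //=; last first.
 by case: cc => _ /andP[h _].
rewrite [X in X+_]big_nat_cond [X in X+_]big1 ?add0r; last first.
 by move=> p /andP[/andP[_ pc] /andP[_ /andP[h _]]]; move: pc; rewrite ltnNge h.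
rewrite big_nat_cond [RHS]big_nat_cond; apply: eq_bigl => p; rewrite /A ltnS.
by case: (c<p<=c')%N; rewrite ?andbT ?andbF.
Qed.

Lemma pr_gt0 phi : inA phi -> (0<pr phi)%N.
Proof.
move=> /forallP h; apply: prodn_gt0 => i; by have /andP[/prime_gt0] := h i.
Qed.

Lemma Us_pow t : Us t^+l = \sum_(phi : phis | inA phi) (\prod_i g (phi i))*npw (pr phi) t.
Proof.
rewrite /Us primes_sum_ord.
have -> : (\sum_(p < c'.+1 | A p) g p*npw p t)^+l =
  \prod_(i < l) \sum_(p < c'.+1 | A p) g p*npw p t.
 by rewrite prodr_const card_ord.
rewrite (bigA_distr_big_dep (fun (i : 'I_l) (p : 'I_c'.+1) => A p)) /=.
apply: eq_big => [phi|phi hphi].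
 by apply/familyP/forallP => h i; have := h i; rewrite unfold_in.
rewrite big_split /=; congr (_*_).
have {hphi}h i : (0<phi i)%N.
 by move: hphi => /familyP /(_ i); rewrite unfold_in => /andP[/prime_gt0].
rewrite /pr; suff [_ ->] : (0 < \prod_(i<l) (phi i : nat))%N /\
  npw (\prod_(i < l) (phi i : nat)) t = \prod_(i < l) npw (phi i) t by [].
elim/big_rec2: _ => [|i x y _ [h1 h2]]; first by rewrite npw1.
by rewrite muln_gt0 h h1 npwM // h2.
Qed.

Let rn (n : nat) : R := \sum_(phi : phis | inA phi) \sum_(Y.+1 <= m < Y'.+1) (pr phi * m == n)%N%:R.
Let cn (n : nat) : C := \sum_(phi : phis | inA phi) \sum_(Y.+1 <= m < Y'.+1)
  (pr phi * m == n)%N%:R%:C*((\prod_i g (phi i))*f m).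

Lemma prod_range phi m : inA phi -> (Y<m<=Y')%N -> (K0<pr phi * m<=4 ^ J*K0)%N.
Proof.
move=> /forallP hphi /andP[m1 m2]; apply/andP; split.
 apply: leqT Klo _; rewrite mulnC; apply: leq_mul => //.
 rewrite -[l in (_ ^ l)%N]card_ord -prod_nat_const; apply: leq_prod => i _.
 by have /andP[_ /andP[]] := hphi i.
apply: leqT Khi; rewrite mulnC; apply: leq_mul => //.
rewrite -[l in (_ ^ l)%N]card_ord -prod_nat_const; apply: leq_prod => i _.
by have /andP[_ /andP[]] := hphi i.
Qed.

Lemma UV_eq t : Us t^+l*Vs t = \sum_(K0.+1 <= n < (4 ^ J*K0).+1) cn n*npw n t.
Proof.
transitivity (\sum_(K0.+1 <= n < (4 ^ J*K0).+1) \sum_(phi : phis | inA phi)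
  \sum_(Y.+1 <= m < Y'.+1) (pr phi * m == n)%N%:R%:C*((\prod_i g (phi i))*f m)*npw n t); last first.
 by apply: eq_bigr => n _; rewrite /cn mulr_suml; apply: eq_bigr => phi _; rewrite mulr_suml.
rewrite exchange_big /= Us_pow mulr_suml; apply: eq_bigr => phi hphi.
rewrite exchange_big /= mulr_sumr; apply: eq_big_nat => m hm.
have /andP[r1 r2] := prod_range hphi hm.
rewrite (bigD1_seq (pr phi * m)%N) ?iota_uniq //=; last by rewrite mem_index_iota r1 ltnS.
rewrite eqxx mul1r [X in _+X]big1 ?addr0; last by move=> n /negbTE nn; rewrite eq_sym nn !mul0r.
rewrite npwM ?pr_gt0 //; first by ring.
by case/andP: hm => h _; apply: leq_ltn_trans h.
Qed.

Lemma cn_le n : nm (cn n) <= rn n.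
Proof.
apply: leT (nm_sum _ _ _) _; apply: ler_sum => phi _.
apply: leT (nm_sum _ _ _) _; apply: ler_sum => m _.
rewrite !nmM nm_real // ler_piMr //; apply: mulr_ile1; rewrite ?nm_ge0 //.
elim/big_rec: _ => [|i x _ h]; first by rewrite nm1.
by rewrite nmM mulr_ile1 ?nm_ge0.
Qed.

Lemma rn_ge0 n : 0 <= rn n. Proof. by apply: sumr_ge0 => ? _; apply: sumr_ge0. Qed.

(** A prime dividing [pr phi] is one of the at most [l] values of [phi] and contributes 1. Any other
    contributes at most [1/c], and [c' <= 2c] leaves at most [c] candidates. *)
Lemma sum_gcd_le phi : inA phi ->
 \sum_(q < c'.+1 | A q) (gcdn (pr phi) q)%:R/q%:R <= l.+1%:R:>R.
Proof.
move=> hphi; have pp := pr_gt0 hphi; have [c0 /andP[c1 c2]] := cc.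
have cR: 0 < c%:R:>R by rewrite ltr0n.
apply: (leV (\sum_(q < c'.+1 | A q) ((q \in codom phi)%:R+c%:R^-1))).
 apply: ler_sum => q /andP[pq /andP[q1 q2]].
 have qR: 0 < (q : nat)%:R:>R by rewrite ltr0n prime_gt0.
 have [qd|qd] := boolP (q %| pr phi)%N.
  have -> : q \in codom phi.
   move: qd; rewrite /pr Euclid_dvd_prod // big_orE => /existsP [i /= qi].
   have /forallP /(_ i) /andP[pi _] := hphi.
   move: qi; rewrite dvdn_prime2 // => /eqP /val_inj ->; exact: codom_f.
  rewrite (gcdn_idPr qd) divff ?gt_eqF // lerDl invr_ge0 //.
 have -> : gcdn (pr phi) q = 1%N.
  by apply/eqP; rewrite -/(coprime _ _) coprime_sym prime_coprime.
 rewrite mul1r; apply: (leV c%:R^-1); last by rewrite lerDr.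
 by rewrite lef_pV2 ?posrE // ler_nat ltnW.
rewrite big_split /= -[l.+1%:R]natr1; apply: lerD.
 apply: (leV (\sum_(q < c'.+1) (q \in codom phi)%:R)).
  by rewrite [leLHS]big_mkcond; apply: ler_sum => q _; case: ifP.
 rewrite -natr_sum ler_nat.
 have -> : (\sum_(q<c'.+1) (q \in codom phi) = #|codom phi|)%N.
  by rewrite -sum1_card [RHS]big_mkcond /=; apply: eq_bigr => q _; case: (q \in _).
 by rewrite -[l in (_<=l)%N]card_ord; apply: leqT (card_size _) _; rewrite size_codom.
rewrite -(primes_sum_ord (fun=> c%:R^-1)).
apply: (leV (\sum_(c.+1 <= p < c'.+1) c%:R^-1)).
 by rewrite [leLHS]big_mkcond; apply: ler_sum => p _; case: ifP => // _; rewrite invr_ge0.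
rewrite sumr_const_nat subSS -[leLHS]mulr_natl ler_pdivrMr // mul1r ler_nat; clear -c1 c2; lia.
Qed.

(** The left side counts pairs of factorizations. Given [phi] and [psi], the factor [m] must satisfy
    [pr psi | pr phi * m], a condition of density at most the product of [gcd(pr phi, q)/q] over the
    entries [q] of [psi]. Summed over [psi] this is at most [(l+1)^l] by [sum_gcd_le], and there are
    at most [c^l] tuples [phi]. *)
Lemma sum_rn2_le :
 \sum_(K0.+1 <= n < (4 ^ J*K0).+1) rn n^+2 <= Y'%:R*c%:R^+l * l.+1%:R^+l.
Proof.
have [c0 /andP[c1 c2]] := cc.
have inner phi m psi : inA phi -> inA psi -> (Y<m<=Y')%N ->
  \sum_(Y.+1 <= m' < Y'.+1) (pr psi * m' == pr phi * m)%N%:R <= (pr psi %| pr phi * m)%N%:R:>R.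
 move=> hphi hpsi hm; have p0 := pr_gt0 hpsi.
 have [/dvdnP [q hq]|nd] := boolP (pr psi %| pr phi * m)%N; last first.
  rewrite big1 // => m' _; case: eqP => // h; by rewrite -h dvdn_mulr in nd.
 rewrite hq; have [qin|qin] := boolP (q \in index_iota Y.+1 Y'.+1).
  rewrite (bigD1_seq q) ?iota_uniq //= [(q*_)%N]mulnC eqxx big1 ?addr0 // => m' mq.
  by rewrite eqn_pmul2l // (negbTE mq).
 rewrite big_seq big1 // => m' mi; rewrite [(q*_)%N]mulnC eqn_pmul2l //.
 by case: eqP => // mq; rewrite -mq mi in qin.
have expand n : rn n^+2 = \sum_(phi : phis | inA phi) \sum_(Y.+1 <= m < Y'.+1)
  (pr phi * m == n)%N%:R*rn (pr phi * m).
 rewrite expr2 {1}/rn mulr_suml; apply: eq_bigr => phi _; rewrite mulr_suml.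
 by apply: eq_bigr => m _; case: eqP => [->|]; rewrite ?mul0r.
rewrite (eq_bigr _ (fun n _ => expand n)) exchange_big /=.
apply: (leV (\sum_(phi : phis | inA phi) Y'%:R*(l.+1%:R^+l))); last first.
 rewrite sumr_const -[leLHS]mulr_natl mulrA [_*Y'%:R]mulrC -!mulrA leMl //.
 rewrite leMr ?exprn_ge0 // -natrX ler_nat.
 have -> : #|(fun phi : phis => inA phi)| = #|family (fun (i : 'I_l) => [pred p : 'I_c'.+1 | A p])|.
  by apply: eq_card => phi; apply/forallP/familyP => h i; have := h i; rewrite ?inE.
 rewrite card_family; apply: (@leq_trans (\prod_(i<l) c)%N); last first.
  by rewrite prod_nat_const card_ord.
 rewrite foldrE big_map big_enum /=; apply: leq_prod => i _.
 rewrite -sum1_card; have := primes_sum_ord (fun=> 1%N); rewrite /= => <-.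
 rewrite big_mkcond /=; apply: (@leq_trans (\sum_(c.+1<=p<c'.+1) 1)%N).
  by apply: leq_sum => p _; case: ifP.
 rewrite sum_nat_const_nat muln1; clear -c1 c2; lia.
apply: ler_sum => phi hphi; rewrite exchange_big /=.
have pp := pr_gt0 hphi.
apply: (leV (\sum_(Y.+1 <= m < Y'.+1) rn (pr phi * m))).
 apply: ler_sum_nat => m hm; rewrite -mulr_suml ler_piMl ?rn_ge0 //.
 have /andP[r1 r2] := prod_range hphi hm.
 rewrite (bigD1_seq (pr phi * m)%N) ?iota_uniq //=; last by rewrite mem_index_iota r1 ltnS.
 rewrite eqxx big1 ?addr0 // => n /negbTE nn; by rewrite eq_sym nn.
apply: (leV (\sum_(Y.+1 <= m < Y'.+1) \sum_(psi : phis | inA psi) (pr psi %| pr phi * m)%N%:R)).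
 by apply: ler_sum_nat => m hm; apply: ler_sum => psi hpsi; apply: inner.
rewrite exchange_big /=.
apply: (leV (\sum_(psi : phis | inA psi)
  Y'%:R*\prod_(i < l) ((gcdn (pr phi) (psi i))%:R/(psi i : nat)%:R))).
 apply: ler_sum => psi hpsi; have ps := pr_gt0 hpsi.
 apply: (leV (\sum_[m<=Y'] (pr psi %| pr phi * m)%N%:R)).
  have [YY|YY] := leqP Y Y'.
   rewrite [leRHS](big_cat_nat (n := Y.+1)) //= lerDr; exact: sumr_ge0.
  rewrite [leLHS]big_geq ?sumr_ge0 //; by rewrite ltnS (ltnW YY).
 apply: leT (count_dvd_mul _ pp ps) _; rewrite leMl // big_split /= prodfV.
 rewrite -!natr_prod -/(pr psi) leMr ?invr_ge0 // ler_nat; exact: gcdn_prod_le.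
rewrite -mulr_sumr leMl //.
have := bigA_distr_big_dep (fun (i : 'I_l) (p : 'I_c'.+1) => A p)
 (fun (i : 'I_l) (q : 'I_c'.+1) => (gcdn (pr phi) q)%:R/(q : nat)%:R : R).
move=> dd; have -> : \sum_(psi : phis | inA psi) \prod_(i < l) ((gcdn (pr phi) (psi i))%:R/(psi i : nat)%:R) =
  \prod_(i < l) \sum_(q < c'.+1 | A q) (gcdn (pr phi) q)%:R/(q : nat)%:R:>R.
 rewrite dd; apply: eq_bigl => psi.
 by apply/forallP/familyP => h i; have := h i; rewrite ?inE ?unfold_in.
rewrite prodr_const card_ord lerXn2r ?nnegrE //; last exact: sum_gcd_le.
by apply: sumr_ge0 => q _; rewrite divr_ge0.
Qed.

Lemma power_large_sieve :
 \sum_[k<(2*T).+1] N2 (Us (k%:R-T%:R)^+l*Vs (k%:R-T%:R)) <=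
 J%:R*CLS*(T%:R+(4 ^ J*K0)%:R)*(Y'%:R*c%:R^+l * l.+1%:R^+l).
Proof.
rewrite (eq_bigr _ (fun k _ => congr1 N2 (UV_eq _))).
apply: leT (large_sieve_wide J T cn K00) _; rewrite leMl //.
 have := CLS_ge1 => h; rewrite !mulr_ge0 ?addr_ge0 //; lra.
apply: leT sum_rn2_le; apply: ler_sum => n _.
by rewrite -nm_sqr lerXn2r ?nnegrE ?nm_ge0 ?rn_ge0 // cn_le.
Qed.
End Mult.

(** * Sums of n^(it) *)

Definition zsum (Z : nat) (u : R) : C := \sum_[n<=Z] npw n u.
(** The integral of [x^(iu)] from 0 to [Z], which is [Z^(1+iu)/(1+iu)]. *)
Definition zmain (Z : nat) (u : R) : C := Z%:R%:C*npw Z u/(1 +i* u).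

Lemma nm_1iu (u : R) : 1 <= nm (1 +i* u) /\ `|u| <= nm (1 +i* u).
Proof.
by split; [have := Re_nm (1 +i* u); rewrite normr1 | exact: Im_nm (1 +i* u)].
Qed.
Lemma c1iu_neq0 (u : R) : 1 +i* u != 0.
Proof. by rewrite eq_complex /= oner_eq0. Qed.

Lemma nm_inv (w : C) : w != 0 -> nm w^-1 = (nm w)^-1.
Proof.
move=> w0; have nw: nm w != 0.
 apply: contra w0 => /eqP h; have := nm_sqr w; rewrite h expr0n /= => /esym /eqP.
 by rewrite /N2 paddr_eq0 ?sqr_ge0 // !sqrf_eq0 eq_complex.
by apply: (mulfI nw); rewrite -nmM mulfV // nm1 mulfV.
Qed.

(** The increment of [n^(1+iu)] differs from [(1+iu)(n+1)^(iu)] by [O((|u|+u^2)/n)], by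
    [cis_taylor2]. Summing gives a logarithm, and division by [|1+iu|] reduces [|u|+u^2] to
    [O(|u|)]. *)
Lemma zsum_small Z u : (0<Z)%N ->
 nm (zsum Z u-zmain Z u) <= 10*`|u| * (1+rln Z%:R).
Proof.
move=> Z0; have [h1 h2] := nm_1iu u; set w := 1 +i* u in h1 h2 *.
have wz: w != 0 by exact: c1iu_neq0.
have nw: 0 < nm w by lra.
have u0 := normr_ge0 u.
have step n : (0<n)%N ->
 nm (n.+1%:R%:C*npw n.+1 u-n%:R%:C*npw n u-w*npw n.+1 u) <= 5*(`|u| + `|u| ^+ 2)/n.+1%:R.
 move=> n0; have nR: 0 < n%:R:>R by rewrite ltr0n.
 have n1: n.+1%:R = n%:R+1:>R by rewrite natr1.
 have n1R: 0 < n%:R+1:>R by lra.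
 pose x := u*(rln n%:R-rln n.+1%:R).
 have e1: npw n u = npw n.+1 u*cis x by rewrite /npw -cisD; congr cis; rewrite /x; ring.
 have -> : n.+1%:R%:C*npw n.+1 u-n%:R%:C*npw n u-w*npw n.+1 u =
  - (npw n.+1 u*(n%:R%:C*(cis x-1 - 'i*x%:C) + 'i*(n%:R*x+u)%:C)).
  rewrite e1 n1 (_ : w = 1 + 'i*u%:C); last by rewrite /w; simpc; congr (_ +i* _); ring.
  by rewrite !rmorphD !rmorphM /=; ring.
 rewrite nmN nmM nm_npw mul1r; apply: leT (nmD _ _) _.
 have ni: nm 'i = 1 by rewrite /nm /N2 /= expr0n /= expr1n add0r sqrtr1.
 rewrite !nmM ni mul1r (nm_realE (_+_)) (nm_real (ler0n _ n)).
 have t2 := cis_taylor2 x.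
 have l1: - n%:R^-1 <= rln n%:R-rln n.+1%:R.
  have := @rln_le_sub1 (n.+1%:R/n%:R); rewrite divr_gt0 ?ltr0n // => /(_ isT).
  rewrite rlnD ?ltr0n // n1 mulrDl divff ?gt_eqF // mul1r; lra.
 have l2: rln n%:R-rln n.+1%:R <= - (n%:R+1)^-1.
  have := @rln_ge_subV (n.+1%:R/n%:R); rewrite divr_gt0 ?ltr0n // => /(_ isT).
  rewrite rlnD ?ltr0n // n1 invf_div.
  have -> : 1-n%:R/(n%:R+1) = (n%:R+1)^-1:>R by field; rewrite gt_eqF.
  lra.
 pose y := rln n%:R-rln n.+1%:R; rewrite -/y in l1 l2.
 have xy: x = u*y by [].
 have iv: 0 < n%:R^-1:>R by rewrite invr_gt0.
 have iv1: 0 < (n%:R+1)^-1:>R by rewrite invr_gt0.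
 have e2: n%:R*n%:R^-1 = 1:>R by rewrite divff // gt_eqF.
 have e3: (n%:R+1)*(n%:R+1)^-1 = 1:>R by rewrite divff // gt_eqF.
 have nge1: 1 <= n%:R:>R by rewrite ler1n.
 have i2: n%:R^-1 <= 2*(n%:R+1)^-1:>R.
  by rewrite -ler_pdivrMl // ler_pdivrMr //; nra.
 have ya: `|y| <= n%:R^-1 by rewrite ler0_norm; lra.
 have p1: n%:R*nm (cis x-1 - 'i*x%:C) <= 4*`|u| ^+ 2*(n%:R+1)^-1.
  have xx: x^+2 <= `|u| ^+ 2*(n%:R^-1*n%:R^-1).
   rewrite -[x^+2]real_normK ?num_real // xy normrM exprMn leMl ?sqr_ge0 //.
   by rewrite -expr2 lerXn2r // nnegrE // ltW.
  have := leMl (ltW nR) (leT t2 (leMl (_ : 0 <= 2) xx)).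
  have -> : n%:R*(2*(`|u| ^+ 2*(n%:R^-1*n%:R^-1))) = 2*`|u| ^+ 2*n%:R^-1*(n%:R*n%:R^-1) by ring.
  rewrite e2 mulr1 => h; apply: leT (h _) _ => //.
  have := leMl (_ : 0 <= 2*`|u| ^+ 2) i2; rewrite mulr_ge0 ?sqr_ge0 // => /(_ isT); lra.
 have p2: `|n%:R*x+u| <= `|u| * (n%:R+1)^-1.
  have -> : n%:R*x+u = u*(n%:R*y+1) by rewrite xy; ring.
  rewrite normrM leMl //; rewrite ger0_norm.
   have : n%:R*y <= n%:R * - (n%:R+1)^-1 by rewrite leMl // ltW.
   lra.
  have : n%:R * - n%:R^-1 <= n%:R*y by rewrite leMl // ltW.
  by rewrite mulrN e2; lra.
 rewrite n1.
 have : 0 <= `|u| * (n%:R+1)^-1 by rewrite mulr_ge0 // ltW.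
 have : 0 <= `|u| ^+ 2*(n%:R+1)^-1 by rewrite mulr_ge0 ?sqr_ge0 // ltW.
 lra.
have tot: nm (Z%:R%:C*npw Z u-w*zsum Z u) <=
  5*(`|u| + `|u| ^+ 2)*\sum_[n<=Z] n%:R^-1.
 case: Z Z0 => // Z _; elim: Z => [|Z IH].
  rewrite /zsum !big_nat1 !npw1 !mulr1 invr1 mulr1.
  have -> : 1%:C-w = - ('i*u%:C) by rewrite /w; simpc; congr (_ +i* _); ring.
  have ni: nm 'i = 1 by rewrite /nm /N2 /= expr0n /= expr1n add0r sqrtr1.
  rewrite nmN nmM ni mul1r nm_realE; have := sqr_ge0 `|u|; lra.
 have zS: zsum Z.+2 u = zsum Z.+1 u+npw Z.+2 u by rewrite /zsum big_nat_recr.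
 rewrite zS [X in _ <= _*X]big_nat_recr //=.
 have -> : Z.+2%:R%:C*npw Z.+2 u-w*(zsum Z.+1 u+npw Z.+2 u) =
  (Z.+1%:R%:C*npw Z.+1 u-w*zsum Z.+1 u) +
  (Z.+2%:R%:C*npw Z.+2 u-Z.+1%:R%:C*npw Z.+1 u-w*npw Z.+2 u) by ring.
 by apply: leT (nmD _ _) _; rewrite [leRHS]mulrDr; apply: lerD => //; apply: step.
have hh := harmonic_le Z0.
have lz: 0 <= rln Z%:R by rewrite rln_ge0 // ler1n.
have -> : zsum Z u-zmain Z u = - ((Z%:R%:C*npw Z u-w*zsum Z u)/w).
 by rewrite /zmain -/w; field.
rewrite nmN nmM.
have nwi := nm_inv wz.
rewrite nwi ler_pdivrMr //; apply: leT tot _.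
have c1: 0 <= 5*(`|u| + `|u| ^+ 2) by rewrite mulr_ge0 ?addr_ge0 ?sqr_ge0.
apply: leT (leMl c1 hh) _.
have -> : 10*`|u| * (1+rln Z%:R)*nm w = (10*`|u| * nm w)*(1+rln Z%:R) by ring.
by apply: leMr; [lra|nra].
Qed.

Definition P10 (N : nat) : R := rexp (rln N%:R/10).
Lemma P10_gt0 N : 0 < P10 N. Proof. exact: rexp_gt0. Qed.
Lemma P10_ge1 N : (0<N)%N -> 1 <= P10 N.
Proof. by move=> N0; rewrite -rexp0 rexp_le divr_ge0 // rln_ge0 // ler1n. Qed.
Lemma P10X N : (0<N)%N -> P10 N^+10 = N%:R.
Proof.
move=> N0; rewrite -rexpX (_ : rln N%:R/10*10 = rln N%:R); last by field.
by rewrite rlnK // ltr0n.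
Qed.

(** The phase [u (log(n+h) - log n)] changes by [-u log(1 + h/(n(n+1+h)))] from [n] to [n+1]. This
    is monotone in [n], so Kusmin-Landau applies; a conjugation makes the increments positive. *)
Lemma corr_bound (m0 L h : nat) (u lam : R) : (0<m0)%N -> (0<h)%N -> 0 < lam ->
 (forall m, (m0<=m<m0+L)%N ->
   lam <= `|u| * (h%:R/((m+h)%:R * m.+1%:R)) /\ `|u| * (h%:R/(m%:R*(m.+1+h)%:R)) <= 1) ->
 nm (\sum_[i<L] npw (m0 + i+h) u*cj (npw (m0 + i) u)) <= 15/lam.
Proof.
move=> m00 h0 lam0 hm.
pose psi i := - `|u| * (rln (m0 + i+h)%N%:R-rln (m0 + i)%N%:R).
have hR: 0 < h%:R:>R by rewrite ltr0n.
have E: nm (\sum_[i<L] npw (m0 + i+h) u*cj (npw (m0 + i) u)) =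
  nm (\sum_[i<L] cis (psi i)).
 have [u0|u0] := leP 0 u.
  rewrite -nmJ conj_sum; congr nm; apply: eq_bigr => i _.
  by rewrite -cisB -cisN /psi (ger0_norm u0); congr cis; ring.
 by congr nm; apply: eq_bigr => i _; rewrite -cisB /psi (ltr0_norm u0); congr cis; ring.
pose q m : R := rln (1+h%:R/(m%:R*(m.+1+h)%N%:R)).
have qE m : (0<m)%N -> 1+h%:R/(m%:R*(m.+1+h)%N%:R) =
  (m+h)%N%:R * m.+1%:R/(m%:R*(m.+1+h)%N%:R):>R.
 move=> mp; have mR: 0 < m%:R:>R by rewrite ltr0n.
 rewrite !natrD -natr1; field; rewrite gt_eqF //=; lra.
have dE i : psi i.+1-psi i = `|u| * q (m0 + i)%N.
 rewrite /q qE ?addn_gt0 ?m00 //.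
 rewrite rlnD ?mulr_gt0 ?ltr0n ?addn_gt0 ?m00 //.
 rewrite !rlnM ?ltr0n ?addn_gt0 ?m00 // /psi !addnS !addSn; ring.
rewrite E; apply: kusmin_landau => // i iL.
 have [] := hm (m0 + i)%N; first by rewrite leq_addr ltn_add2l.
 rewrite dE => a1 a2; have mp: (0<m0 + i)%N by rewrite addn_gt0 m00.
 have mR: 0 < (m0 + i)%:R:>R by rewrite ltr0n.
 have gp: 0 < 1+h%:R/((m0 + i)%:R*((m0 + i).+1+h)%N%:R):>R.
  by rewrite addr_gt0 // divr_gt0 // mulr_gt0 // ltr0n.
 apply/andP; split.
  apply: leT a1 _; rewrite leMl //.
  apply: leT (rln_ge_subV gp); rewrite qE // invf_div.
  apply: le_of_eq.
  rewrite !natrD -!natr1 !natrD; field; lra.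
 apply: leT a2; rewrite leMl //; apply: leT (rln_le_sub1 gp) _; lra.
rewrite !dE leMl // /q.
have mp: (0<m0 + i)%N by rewrite addn_gt0 m00.
apply: rln_le.
 by rewrite addr_gt0 // divr_gt0 // mulr_gt0 // ltr0n // addnS.
rewrite lerD2l; apply: leMl; first exact: ltW.
rewrite lef_pV2 ?posrE ?mulr_gt0 ?ltr0n ?addnS //.
by rewrite -!natrM ler_nat leq_mul.
Qed.

Lemma zsum_split n0 Z u : (n0<=Z)%N ->
 zsum Z u = zsum n0 u+\sum_[i<Z-n0] npw (n0.+1 + i) u.
Proof.
move=> h; rewrite /zsum (big_cat_nat (n := n0.+1)) //=; congr (_+_).
rewrite -{1}[n0.+1]add0n big_addn subSS; apply: eq_bigr => i _; by rewrite addnC.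
Qed.

Lemma nm_zsum_le Z u : nm (zsum Z u) <= Z%:R.
Proof.
apply: leT (nm_sum _ _ _) _; under eq_bigr do rewrite nm_npw.
by rewrite sumr_const_nat subn1.
Qed.

Lemma nm_zmain_le Z u : nm (zmain Z u) <= Z%:R /\ nm (zmain Z u)*`|u| <= Z%:R.
Proof.
have [h1 h2] := nm_1iu u; rewrite /zmain !nmM nm_npw mulr1 nm_real // nm_inv ?c1iu_neq0 //.
have nw: 0 < nm (1 +i* u) by lra.
split; first by rewrite ler_pdivrMr // ler_peMr.
by rewrite mulrAC ler_pdivrMr // leMl.
Qed.

(** Let [P = N^(1/10)]. The terms [n <= P^9] are bounded trivially. For larger [n] and shifts
    [h < P^5] the phase increments lie between [h/(25 P N)] and [3/P^3 <= 1], so every correlation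
    is [O(P N/h)] and [weyl_vdc] with about [P^5] shifts gives the claim. *)
Lemma zsum_large (N Z : nat) (u : R) : (0<N)%N -> (Z<=4*N)%N -> `|u| <= 3*N%:R ->
 N%:R/P10 N < `|u| -> 3 <= P10 N ->
 nm (zsum Z u) <= 31*(N%:R/P10 N)*(1+rln N%:R).
Proof.
move=> N0 ZN uN uP P3; set P := P10 N in uP P3 *.
have NR: 0 < N%:R:>R by rewrite ltr0n.
have PX: P^+10 = N%:R by exact: P10X.
have P0: 0 < P by lra.
have Pz: P != 0 by rewrite gt_eqF.
have lN: 0 <= rln N%:R by rewrite rln_ge0 // ler1n.
have ln1: 0 <= 1+rln N%:R by rewrite addr_ge0.
have NP: N%:R/P = P^+9 by rewrite -PX; field.
have P9: 0 < P^+9 by rewrite exprn_gt0.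
rewrite NP in uP *; pose n0 := Num.truncn (P^+9).
have n01: n0%:R <= P^+9 by rewrite truncn_le ltW.
have n02: P^+9 < n0.+1%:R by rewrite -truncn_lt_nat ?ltW.
have c1: P^+9 <= P^+9*(1+rln N%:R) by rewrite ler_peMr ?(ltW P0, ltW NR, ltW P9) //; lra.
have [Zn|nZ] := leqP Z n0.
 apply: leT (nm_zsum_le _ _) _; apply: (leV (P^+9)).
  by apply: leT n01; rewrite ler_nat.
 by have := ltW P9; lra.
rewrite (zsum_split u (ltnW nZ)); apply: leT (nmD _ _) _.
have h1: nm (zsum n0 u) <= P^+9 by apply: leT (nm_zsum_le _ _) n01.
set S := \sum_[i<_] _; suff h2 : nm S <= 30*P^+9*(1+rln N%:R) by lra.
pose L := (Z-n0)%N; pose Q := Num.truncn (P^+5).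
have P5: 0 < P^+5 by rewrite exprn_gt0.
have Q1: Q%:R <= P^+5 by rewrite truncn_le ltW.
have Q2: P^+5 < Q.+1%:R by rewrite -truncn_lt_nat ?(ltW P5).
have P51: 2 <= P^+5.
 have : 3^+5 <= P^+5 by rewrite lerXn2r ?nnegrE ?(ltW P0, ltW NR, ltW P9).
 by rewrite !exprS expr0; lra.
have Qh: P^+5/2 <= Q%:R by rewrite -natr1 in Q2; lra.
have Q0: (0<Q)%N by rewrite -(ltr0n RT); lra.
have P5N: P^+5 <= N%:R by rewrite -PX; apply: ler_weXn2l => //; lra.
have QN: (Q<=N)%N by rewrite -(ler_nat RT); lra.
pose z i := if (i<L)%N then npw (n0.+1 + i) u else 0.
have zS: S = \sum_[i<L] z i by apply: eq_big_nat => i /andP[_ iL]; rewrite /z iL.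
pose Gam h : R := if h == 0%N then 4*N%:R else 375*P*N%:R/h%:R.
have G0 h : 0 <= Gam h.
 by rewrite /Gam; case: ifP => _; rewrite !mulr_ge0 ?invr_ge0 ?(ltW P0, ltW NR, ltW P9).
have LN: (L<=4*N)%N by apply: leqT ZN; rewrite leq_subr.
have W := @weyl_vdc L Q z Gam Q0.
have {}W : N2 (\sum_[n<L] z n)*Q%:R <= (L+Q)%:R*(2*\sum_[h<Q] Gam h).
 apply: W => // [n Ln|h hQ]; first by rewrite /z ltnNge Ln.
 rewrite /Gam; case: eqP => [->|/eqP h0].
  apply: leT (nm_sum _ _ _) _; apply: (leV (\sum_[n<L] 1)).
   apply: ler_sum => n _; rewrite addn0 nmM nmJ /z.
   by case: ifP => _; rewrite ?nm_npw ?nm0 ?mulr1 ?mulr0.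
  by rewrite sumr_const_nat subn0 -natrM ler_nat.
 have hp: (0<h)%N by rewrite lt0n.
 have hR: 0 < h%:R:>R by rewrite ltr0n.
 have hP5: h%:R <= P^+5 by apply: leT Q1; rewrite ler_nat ltnW.
 have -> : \sum_[n<L] z (n+h)%N*cj (z n) =
   \sum_[i<L-h] npw (n0.+1 + i+h) u*cj (npw (n0.+1 + i) u).
  rewrite (big_cat_nat (n := (L-h)%N)) //= ?leq_subr //.
  rewrite [X in _+X]big_nat [X in _+X]big1 ?addr0; last first.
   move=> i /andP[iL _]; have a: (L<=i+h)%N by rewrite addnC -leq_subLR.
   by rewrite {1}/z ltnNge a mul0r.
  apply: eq_big_nat => i /andP[_ iL].
  have a: (i+h<L)%N by rewrite addnC -ltn_subRL.
  by rewrite /z a (leq_ltn_trans (leq_addr h i) a) addnA.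
 have lam0: 0 < h%:R/(25*P*N%:R) by rewrite divr_gt0 // !mulr_gt0.
 apply: leT (corr_bound (_ : 0<n0.+1)%N hp lam0 _) _ => //; last first.
  by rewrite invf_div mulrA; lra.
 move=> m /andP[m1 m2].
 have mlo: P^+9 <= m%:R by apply: leT (ltW n02) _; rewrite ler_nat.
 have mR: 0 < m%:R:>R by apply: lt_le_trans mlo.
 have mhi: m%:R <= 4*N%:R:>R.
  by rewrite -natrM ler_nat; apply: leqT ZN; rewrite /L in m2; clear -m2 nZ; lia.
 have N1: 1 <= N%:R:>R by rewrite ler1n.
 split.
  apply: (leV (P^+9*(h%:R/((m+h)%:R * m.+1%:R)))); last first.
   by rewrite leMr ?divr_ge0 ?mulr_ge0 // ltW.
  have -> : h%:R/(25*P*N%:R) = P^+9*(h%:R/(5*N%:R*(5*N%:R))).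
   by rewrite -PX; field.
  have g1: 0 < 5*N%:R*(5*N%:R):>R by rewrite !mulr_gt0.
  have g2: 0 < (m+h)%:R * m.+1%:R:>R by rewrite mulr_gt0 ?ltr0n // addn_gt0 hp orbT.
  rewrite leMl ?(ltW P9) // leMl // lef_pV2 ?posrE //.
  have h5 := leT hP5 P5N; rewrite natrD -natr1; apply: ler_pM => //; clear -mhi h5 N1 mR hR; lra.
 have mm: P^+9*P^+9 <= m%:R*(m.+1+h)%:R.
  apply: ler_pM; rewrite ?(ltW P9) //; apply: leT mlo _.
  by rewrite ler_nat addSn ltnW // ltnS leq_addr.
 apply: (leV (3*N%:R*(P^+5/(P^+9*P^+9)))).
  apply: ler_pM => //; first by rewrite divr_ge0 // mulr_ge0.
  apply: ler_pM => //; first by rewrite invr_ge0 mulr_ge0.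
  by rewrite lef_pV2 ?posrE // ?mulr_gt0 // ltr0n addSn.
 have -> : 3*N%:R*(P^+5/(P^+9*P^+9)) = 3/P^+3 by rewrite -PX; field.
 rewrite ler_pdivrMr ?exprn_gt0 // mul1r.
 have : 3^+3 <= P^+3 by rewrite lerXn2r ?nnegrE ?(ltW P0, ltW NR, ltW P9).
 by rewrite ![3^+_]exprS expr0; lra.
have sG: \sum_[h<Q] Gam h <= 380*P*N%:R*(1+rln N%:R).
 case: Q Q0 {Q1 Q2 Qh W} QN => // Q _ QN.
 rewrite big_nat_recl // {1}/Gam eqxx.
 have e1: \sum_[i<Q] Gam i.+1 = 375*P*N%:R*\sum_[i<=Q] i%:R^-1.
  by rewrite big_add1 mulr_sumr; apply: eq_bigr => i _.
 rewrite e1; have c0: 0 <= 375*P*N%:R by rewrite !mulr_ge0 ?(ltW P0, ltW NR, ltW P9).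
 have : \sum_[i<=Q] i%:R^-1 <= 1+rln N%:R:>R.
  apply: leT (harmonic_le N0).
  rewrite [leRHS](big_cat_nat (n := Q.+1)) //= ?ltnS ?(ltnW QN) // lerDl.
  by apply: sumr_ge0 => i _; rewrite invr_ge0.
 move=> /(leMl c0) h.
 have PN: N%:R <= P*N%:R by rewrite ler_peMl ?(ltW P0, ltW NR, ltW P9) //; lra.
 have : 0 <= P*N%:R*rln N%:R by rewrite !mulr_ge0 ?(ltW P0, ltW NR, ltW P9).
 lra.
rewrite -zS in W; have LQ: (L+Q)%:R <= 5*N%:R:>R by rewrite -natrM ler_nat; clear -LN QN; lia.
have W2: N2 S*(P^+5/2) <= 5*N%:R*(2*(380*P*N%:R*(1+rln N%:R))).
 apply: leT (_ : N2 S*Q%:R <= _); first by rewrite leMl ?N2_ge0.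
 apply: leT W _; apply: ler_pM => //; last by rewrite leMl.
 by rewrite mulr_ge0 // sumr_ge0.
have l1: 1+rln N%:R <= (1+rln N%:R)^+2 by rewrite expr2 ler_peMr // lerDl.
apply: (leV (90*P^+8*(1+rln N%:R))).
 apply: nm_le; first by rewrite !mulr_ge0 ?exprn_ge0 ?(ltW P0).
 have P5h: 0 < P^+5/2 by rewrite divr_gt0.
 rewrite -(ler_pM2r P5h); apply: leT W2 _.
 have -> : 5*N%:R*(2*(380*P*N%:R*(1+rln N%:R))) = 3800*P^+21*(1+rln N%:R).
  by rewrite -PX; ring.
 have -> : (90*P^+8*(1+rln N%:R))^+2*(P^+5/2) = 4050*P^+21*(1+rln N%:R)^+2.
  by field.
 have p21: 0 <= P^+21 by rewrite exprn_ge0 // ltW.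
 move: (P^+21) p21 (rln N%:R) lN l1 => p p0 l l0 l1.
 have h1' := leMl p0 l1; have : 0 <= p*(1+l)^+2 by rewrite mulr_ge0 ?sqr_ge0.
 lra.
have -> : 30*P^+9*(1+rln N%:R) = 30*P*(P^+8*(1+rln N%:R)) by rewrite exprS; ring.
have : 0 <= P^+8*(1+rln N%:R) by rewrite mulr_ge0 ?exprn_ge0 ?(ltW P0).
by clear -P3; nra.
Qed.

(** [zsum_small] serves up to [|u| = N^(9/10)] and [zsum_large] beyond, where the main term, at most
    [Z/|u|], is itself admissible; for bounded [N^(1/10)] the bound is trivial. The fixed power
    saved here is spent in [small_ok]. *)
Lemma zsum_bound (N Z : nat) (u : R) : (0<N)%N -> (Z<=4*N)%N -> `|u| <= 3*N%:R ->
 nm (zsum Z u-zmain Z u) <= 40*(N%:R/P10 N)*(3+rln N%:R).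
Proof.
move=> N0 ZN uN; set P := P10 N.
have NR: 0 < N%:R:>R by rewrite ltr0n.
have P1: 1 <= P by exact: P10_ge1.
have PX: P^+10 = N%:R by exact: P10X.
have lN: 0 <= rln N%:R by rewrite rln_ge0 // ler1n.
have NP: N%:R/P = P^+9 by rewrite -PX; field; lra.
have P9: 1 <= P^+9 by rewrite exprn_ege1.
have b0: 0 <= 40*(N%:R/P)*(3+rln N%:R) by rewrite NP !mulr_ge0 //; lra.
have [->|Z0] := posnP Z.
 by rewrite /zsum big_geq // /zmain mul0r mul0r subrr nm0.
have ZR: Z%:R <= 4*N%:R:>R by rewrite -natrM ler_nat.
have [uP|uP] := leP `|u| (N%:R/P).
 apply: leT (zsum_small u Z0) _.
 have lz: rln Z%:R <= 2+rln N%:R.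
  apply: leT (_ : rln (4*N%:R) <= _); first by rewrite rln_le ?ltr0n.
  by rewrite rlnM //; have := rln4_le; lra.
 have lz0: 0 <= rln Z%:R by rewrite rln_ge0 // ler1n.
 apply: ler_pM; rewrite ?mulr_ge0 //; lra.
have [nm1' nm2] := nm_zmain_le Z u; have mz := nm_ge0 (zmain Z u).
apply: leT (nmB _ _) _.
have [P3|P3] := leP 3 P.
 have h := zsum_large N0 ZN uN uP P3.
 rewrite NP in uP h *.
 have : nm (zmain Z u)*P^+9 <= 4*P*P^+9.
  rewrite -mulrA -exprS PX; apply: leT ZR; apply: leT nm2.
  by rewrite leMl // ltW.
 rewrite ler_pM2r; last by lra.
 move=> h2; have : P <= P^+9 by rewrite -{1}(expr1 P); apply: ler_weXn2l.
 have : 0 <= P^+9*rln N%:R by rewrite mulr_ge0 //; lra.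
 lra.
have h := nm_zsum_le Z u.
have : N%:R <= 3*P^+9 by rewrite -PX exprS leMr //; lra.
rewrite NP; have : 0 <= P^+9*rln N%:R by rewrite mulr_ge0 //; lra.
lra.
Qed.

(** * Chains of windows of primes *)

Lemma leq_expr a b n : (a<=b)%N -> (a ^ n<=b ^ n)%N.
Proof. by case: n => // n h; rewrite leq_exp2r. Qed.

(** Locked so that powers of it are not evaluated. *)
Definition kap : nat := locked 400%N.
Lemma kapE : kap = 400%N. Proof. by rewrite /kap -lock. Qed.
Lemma kap_gt1 : (1<kap)%N. Proof. by rewrite kapE. Qed.
Lemma kap_gt0 n : (0<kap ^ n)%N. Proof. by rewrite kapE expn_gt0. Qed.
#[global] Hint Resolve kap_gt1 kap_gt0 : core.

(** Division points of a prime window: starting at [2^w], consecutive points have ratio at most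
    [1 + 1/w], so [w] plays the role of [k] in the block decomposition. After [nI w w'] steps the
    points have passed [2^w'] ([cw_top]) but not [exp(4w')] ([rln_cw_le]). *)
Fixpoint cw (w i : nat) : nat := if i is j.+1 then (cw w j+cw w j %/ w)%N else (2 ^ w)%N.
Definition nI (w w' : nat) : nat := (3*w*w')%N.
Definition Ww (w w' : nat) : R := Wm (cw w 0) (cw w (nI w w')).

Lemma cw_mono w i : (cw w i<=cw w i.+1)%N. Proof. exact: leq_addr. Qed.
Lemma cw_step w i : (w*cw w i.+1<=w.+1*cw w i)%N.
Proof. by rewrite /= mulnDr mulSn addnC leq_add2r mulnC leq_trunc_div. Qed.
Lemma cw_ge w i : (2 ^ w<=cw w i)%N.
Proof. by elim: i => // i IH; apply: leqT IH (cw_mono w i). Qed.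
Lemma cw_gt0 w i : (0<cw w i)%N.
Proof. by apply: leqT (cw_ge w i); rewrite expn_gt0. Qed.
Lemma cw_gt1 w i : (0<w)%N -> (1<cw w i)%N.
Proof. by move=> w0; apply: leqT (cw_ge w i); rewrite -{1}(expn0 2) ltn_exp2l. Qed.
Lemma cw_le2 w i : (0<w)%N -> (cw w i.+1<=2*cw w i)%N.
Proof. by move=> w0 /=; rewrite mul2n -addnn leq_add2l leq_div. Qed.
Lemma cw_leI w i j : (i<=j)%N -> (cw w i<=cw w j)%N.
Proof. by move/subnKC <-; elim: (j-i)%N => [|k IH]; rewrite ?addn0 // addnS; apply: leqT IH (cw_mono w _). Qed.

Lemma rln_2w w : rln (2 ^ w)%:R = w%:R*rln 2.
Proof. by rewrite natrX rlnX. Qed.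

Lemma rln_cw_ge w i : w%:R/2 <= rln (cw w i)%:R.
Proof.
have h: w%:R*rln 2 <= rln (cw w i)%:R.
 by rewrite -rln_2w; apply: rln_le; rewrite ?ltr0n ?expn_gt0 // ler_nat cw_ge.
have := rln2_ge; have : 0 <= w%:R:>R by []; nra.
Qed.

Lemma rln_cw_le w w' i : (0<w<=w')%N -> (i<=nI w w')%N -> rln (cw w i)%:R <= 4*w'%:R.
Proof.
move=> /andP[w0 ww] iI; have wR: 0 < w%:R:>R by rewrite ltr0n.
have h: rln (cw w i)%:R <= w%:R + i%:R/w%:R.
 elim: i {iI} => [|i IH].
  rewrite mul0r addr0 /= rln_2w; have := rln2_le; nra.
 have c0: 0 < (cw w i)%:R:>R by rewrite ltr0n cw_gt0.
 have : (cw w i.+1)%:R <= (cw w i)%:R*(1+w%:R^-1):>R.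
  rewrite mulrDr mulr1 /= natrD lerD2l ler_pdivlMr // -natrM ler_nat leq_trunc_div //.
 have p1: 0 < 1+w%:R^-1:>R by rewrite addr_gt0 // invr_gt0.
 move=> /(rln_le (_ : 0 < _)); rewrite ltr0n cw_gt0 => /(_ isT); rewrite rlnM //.
 have := rln_le_sub1 p1; rewrite -[i.+1%:R]natr1 [(i%:R+1)/_]mulrDl mul1r.
 move: IH; set a := rln _; set b := rln _; set c := rln _; set d := _/_; set e := _^-1; lra.
apply: leT h _.
have : i%:R/w%:R <= 3*w'%:R:>R.
 rewrite ler_pdivrMr // mulrAC -!natrM ler_nat; exact: iI.
have : w%:R <= w'%:R:>R by rewrite ler_nat.
lra.
Qed.

(** Since [w <= cw w i], rounding down at most halves the increment, and each step multiplies by at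
    least [1 + 1/(2w)]. *)
Lemma cw_top w w' : (0<w)%N -> (2 ^ w'<=cw w (nI w w'))%N.
Proof.
move=> w0; have wR: 1 <= w%:R:>R by rewrite ler1n.
have h i : i%:R/(2*w%:R+1) <= rln (cw w i)%:R.
 elim: i => [|i IH]; first by rewrite mul0r; apply: rln_ge0; rewrite ler1n cw_gt0.
 have c0: 0 < (cw w i)%:R:>R by rewrite ltr0n cw_gt0.
 have c1: (cw w i)%:R*(1+(2*w%:R)^-1) <= (cw w i.+1)%:R:>R.
  rewrite mulrDr mulr1 /= natrD lerD2l ler_pdivrMr; last by lra.
  rewrite mulrA -!natrM ler_nat.
  have wc: (w<=cw w i)%N by apply: leqT (cw_ge w i); apply: ltnW; apply: ltn_expl.
  have := divn_eq (cw w i) w; have := ltn_pmod (cw w i) w0.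
  have : (0<cw w i %/ w)%N by rewrite divn_gt0.
  move: (cw w i %/ w)%N (cw w i %% w)%N => q r; clear -w0; nia.
 have p1: 0 < 1+(2*w%:R)^-1:>R by rewrite addr_gt0 // invr_gt0; lra.
 have := rln_le (mulr_gt0 c0 p1) c1; rewrite rlnM //.
 have := rln_ge_subV p1.
 have -> : 1-(1+(2*w%:R)^-1)^-1 = (2*w%:R+1)^-1:>R.
  by field; apply/andP; split; rewrite gt_eqF //; lra.
 rewrite -[i.+1%:R]natr1 [(i%:R+1)/_]mulrDl mul1r.
 move: IH; set a := rln _; set b := rln _; set c := rln _; set d := _/_; set e := _^-1; lra.
have := h (nI w w'); rewrite /nI.
have w'0: 0 <= w'%:R:>R by [].
have : w'%:R <= (3*w*w')%:R/(2*w%:R+1):>R.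
 rewrite ler_pdivlMr; last by lra.
 rewrite !natrM; nra.
have : rln (2 ^ w')%:R <= w'%:R by rewrite rln_2w; have := rln2_le; nra.
rewrite -/(nI w w'); set a := rln _; set b := _/_ => h1 h2 h3.
have h4: a <= rln (cw w (nI w w'))%:R by lra.
rewrite -(ler_nat R) -[X in X <= _]rlnK ?ltr0n ?expn_gt0 // -[leRHS]rlnK ?ltr0n ?cw_gt0 //.
by rewrite rexp_le.
Qed.

Lemma Ww_ge w r : (3<=w)%N -> r%:R/4 <= Ww w (w*kap ^ r).
Proof.
rewrite kapE; move=> w3; have w0: (0<w)%N by apply: leqT w3.
pose c i := (2 ^ (w*400 ^ i))%N.
have cm i : (c i<=c i.+1)%N by rewrite leq_exp2l // leq_mul2l leq_exp2l // leqnSn orbT.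
have h: r%:R/4 <= \sum_((c 0%N).+1 <= p < (c r).+1 | prime p) p%:R^-1:>R.
 rewrite -(sum_blocks _ _ _ cm).
 apply: (leV (\sum_[i<r] (1/4 : R))).
  by rewrite sumr_const_nat subn0 -[leRHS]mulr_natl mul1r.
 apply: ler_sum => i _; have : (8<=c i)%N.
  rewrite -[8%N]/(2 ^ 3)%N leq_exp2l //; apply: leqT w3 _.
  by rewrite leq_pmulr // expn_gt0.
 move=> /mertens_window h; apply: leT h _.
 by rewrite /c -expnM -mulnA -expnSr.
apply: leT h _; rewrite /Ww /Wm /c expn0 muln1 /=.
have top := cw_top (w*400 ^ r) w0.
have lo: (2 ^ w<=2 ^ (w*400 ^ r))%N by rewrite leq_exp2l // leq_pmulr // expn_gt0.
rewrite [leRHS](big_cat_nat (n := (2 ^ (w*400 ^ r)).+1)) //= lerDl.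
by apply: sumr_ge0 => p _; rewrite invr_ge0.
Qed.

(** This is [c^(-al)], the saving over the trivial bound that is demanded of a block polynomial. *)
Definition thr (al : R) (c : nat) : R := rexp (- (al*rln c%:R)).
Definition bad (g : nat -> C) (w w' : nat) (al : R) (t : R) : bool :=
 has (fun i => thr al (cw w i) < nm (Qb g (cw w) i t)) (iota 0 (nI w w')).

Section Steps.
Variables (f g : nat -> C) (b X X' T : nat).
Hypotheses (hf : bnd1 f) (hg : bnd1 g).
Hypotheses (hm : qmult b g f) (XX' : (X<=X'<=3*X)%N).
Hypotheses (X_gt0 : (0<X)%N) (TX : (T<=X)%N).
Notation tt j := (j%:R-T%:R : R).

(** The [l]-th power of [Qb] lengthens [Rb] to a polynomial of length about [Y c^l]. Once this
    reaches the order of [T], the large sieve loses only the factor caused by repeated prime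
    factors. *)
Lemma pair_bound u i' w i l : (0<u)%N -> (cw w i<=X)%N ->
 (T<=2*((X %/ cw w i)*cw u i' ^ l))%N ->
 \sum_[j<(2*T).+1] N2 (Qb g (cw u) i' (tt j))^+l*N2 (Rb f (cw w) X X' i (tt j)) <=
 90*CLS*(4 * l.+2%:R)^+l.+1.
Proof.
move=> u0 ciX hT; set c := cw u i'; set d := cw w i; set Y := (X %/ d)%N; set Y' := (X' %/ d)%N.
have c0: (0<c)%N by exact: cw_gt0.
have d0: (0<d)%N by exact: cw_gt0.
have Y0: (0<Y)%N by rewrite divn_gt0.
have Y'5: (Y'<=5*Y)%N.
 case/andP: XX' => _ h; have e1 := divn_eq X d; have e2 := divn_eq X' d.
 have m1 := ltn_pmod X d0; have m2 := ltn_pmod X' d0; rewrite -/Y -/Y' in e1 e2.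
 move: (X %% d)%N (X' %% d)%N e1 e2 m1 m2 => r1 r2 e1 e2 m1 m2; clear -h e1 e2 m1 m2 Y0 d0; nia.
have cR: c%:R != 0:>R by rewrite pnatr_eq0 -lt0n.
have XR: X%:R != 0:>R by rewrite pnatr_eq0 -lt0n.
pose K0 := (Y*c ^ l)%N.
have K00: (0<K0)%N by rewrite muln_gt0 Y0 expn_gt0 c0.
have Klo: (K0<Y.+1*c.+1 ^ l)%N.
 apply: (@leq_trans (Y.+1*c ^ l)%N); first by rewrite mulSn /K0 -[X in (X<_)%N]add0n ltn_add2r expn_gt0 c0.
 by rewrite leq_mul2l leq_expr ?orbT.
have Khi: (Y'*cw u i'.+1 ^ l<=4 ^ l.+2*K0)%N.
 apply: (@leq_trans (5*Y*(2*c) ^ l)%N).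
  apply: leq_mul => //; apply: leq_expr; exact: cw_le2.
 rewrite expnMn /K0.
 have h: (5*2 ^ l<=4 ^ l.+2)%N.
  rewrite !expnS mulnA; apply: leq_mul => //; exact: leq_expr.
 have := leq_mul h (leqnn (Y*c ^ l)); apply: leqT; by rewrite mulnACA.
have cc: (0<c)%N /\ (c<=cw u i'.+1<=2*c)%N by rewrite cw_mono cw_le2.
have := power_large_sieve T hg hf cc K00 Klo Khi => PL.
have -> : \sum_[j<(2*T).+1] N2 (Qb g (cw u) i' (tt j))^+l*N2 (Rb f (cw w) X X' i (tt j)) =
  (c%:R^-1^+2)^+l*(d%:R/X%:R)^+2 *
  \sum_[j<(2*T).+1] N2 (Us g c (cw u i'.+1) (tt j)^+l*Vs f Y Y' (tt j)).
 have N2X z n : N2 (z^+n) = N2 z^+n.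
  by elim: n => [|n IH]; rewrite ?expr0 ?N21 // !exprS N2M IH.
 rewrite mulr_sumr; apply: eq_bigr => j _; rewrite /Qb /Rb -/c -/d -/Y -/Y' !N2M !N2_real N2X exprMn.
 by rewrite mulrACA.
have C1 := CLS_ge1; have C0: 0 <= CLS by lra.
have A0: 0 <= (c%:R^-1^+2)^+l*(d%:R/X%:R)^+2:>R by apply: mulr_ge0; [rewrite exprn_ge0 ?sqr_ge0|exact: sqr_ge0].
apply: leT (leMl A0 PL) _.
have Kr: K0%:R = Y%:R*c%:R^+l:>R by rewrite natrM natrX.
have h1: T%:R+(4 ^ l.+2*K0)%:R <= 18*4^+l*K0%:R:>R.
 have : T%:R <= 2*K0%:R:>R by rewrite -natrM ler_nat.
 rewrite natrM natrX !exprS.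
 have : 1 <= 4^+l:>R by rewrite exprn_ege1 //; lra.
 have : 0 <= K0%:R:>R by [].
 nra.
have Yr: Y'%:R <= 5*Y%:R:>R by rewrite -natrM ler_nat.
have YX: d%:R/X%:R*Y%:R <= 1:>R.
 rewrite mulrAC ler_pdivrMr ?mul1r ?ltr0n // -natrM ler_nat mulnC leq_trunc_div //.
have YX2: (d%:R/X%:R*Y%:R)^+2 <= 1:>R.
 by rewrite exprn_ile1 // !mulr_ge0 // invr_ge0.
set L := l.+1%:R^+l.
have L0: 0 <= L by rewrite exprn_ge0.
apply: (leV ((c%:R^-1^+2)^+l*(d%:R/X%:R)^+2 *
  (l.+2%:R*CLS*(18*4^+l*K0%:R)*(5*Y%:R*c%:R^+l*L)))).
 apply: leMl => //; apply: ler_pM.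
 - by apply: mulr_ge0; [exact: mulr_ge0|exact: addr_ge0].
 - by rewrite !mulr_ge0 ?exprn_ge0.
 - by apply: leMl h1; rewrite mulr_ge0.
 - by apply: leMr => //; apply: leMr; rewrite ?exprn_ge0.
have -> : (c%:R^-1^+2)^+l*(d%:R/X%:R)^+2 *
  (l.+2%:R*CLS*(18*4^+l*K0%:R)*(5*Y%:R*c%:R^+l*L)) =
  (d%:R/X%:R*Y%:R)^+2*(90*CLS*(l.+2%:R*4^+l*L)).
 have -> : (c%:R^-1^+2)^+l = (c%:R^+l)^-1^+2:>R by rewrite -!exprM mulnC exprM exprVn.
 rewrite Kr; set e := c%:R^+l; have e0: e != 0 by rewrite expf_neq0.
 set q := 4^+l; clearbody e q L; field; by rewrite e0 XR.
have q0: 0 <= l.+2%:R*4^+l*L by rewrite !mulr_ge0 ?exprn_ge0.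
apply: (leV (90*CLS*(l.+2%:R*4^+l*L))).
 by apply: ler_piMl => //; apply: mulr_ge0 => //; exact: mulr_ge0.
apply: leMl; first by rewrite mulr_ge0.
rewrite exprMn -mulrA mulrCA [4^+l.+1]exprS [l.+2%:R^+_]exprS.
have h2: L <= l.+2%:R^+l by rewrite lerXn2r ?nnegrE // ler_nat.
have h3: 1 <= 4^+l:>R by rewrite exprn_ege1 //; lra.
rewrite -mulrA; apply: (leV (4^+l*(l.+2%:R * l.+2%:R^+l))).
 by rewrite leMl ?exprn_ge0 // leMl.
rewrite ler_peMl ?mulr_ge0 ?exprn_ge0 //; lra.
Qed.
End Steps.

(** * Duality *)

Definition savg (f : nat -> C) (H n : nat) : C := H%:R^-1%:C*\sum_[h<=H] f (n+h)%N.

Section Duality.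
Variables (f : nat -> C) (X X' H T : nat).
Hypotheses (hf : bnd1 f) (H0 : (0<H)%N).
Hypotheses (T0 : (0<T)%N) (X0 : (0<X)%N).
Hypothesis XX' : (X<=X'<=3*X)%N.

(** [cf n] is the phase that turns [savg f H n] into its modulus, for [n] in [(X, X']]. The average
    [Psi] over [H] consecutive integers, to which the adjoint of [savg] leads, is Lipschitz with
    constant [2/H]. *)
Let cf (n : nat) : C := if (X<n<=X')%N then
 (if savg f H n == 0 then 0 else cj (savg f H n)/(nm (savg f H n))%:C) else 0.
Let Psi (m : nat) : C := H%:R^-1%:C*\sum_[h<=H] cf (m-h)%N.

Lemma nm_eq0 (z : C) : nm z = 0 -> z = 0.
Proof.
move=> h; have := nm_sqr z; rewrite h expr0n /= /N2 => /esym/eqP.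
by rewrite paddr_eq0 ?sqr_ge0 // !sqrf_eq0 => /andP[/eqP a /eqP b]; apply/eqP; rewrite eq_complex a b !eqxx.
Qed.

Lemma cf_le n : nm (cf n) <= 1.
Proof.
rewrite /cf; case: ifP => _; last by rewrite nm0.
case: eqP => [_|/eqP z0]; first by rewrite nm0.
have nz: nm (savg f H n) != 0 by apply: contra z0 => /eqP /nm_eq0 ->.
rewrite nmM nmJ -(rmorphV (real_complex RT)) ?unitfE // nm_real ?invr_ge0 ?nm_ge0 //.
by rewrite mulfV.
Qed.

Lemma cf_mul n : (X<n<=X')%N -> cf n*savg f H n = (nm (savg f H n))%:C.
Proof.
move=> h; rewrite /cf h; case: eqP => [->|/eqP z0]; first by rewrite mulr0 nm0.
have nz: nm (savg f H n) != 0 by apply: contra z0 => /eqP /nm_eq0 ->.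
have nzC: (nm (savg f H n))%:C != 0 :> C by rewrite eq_complex /= eqxx andbT.
by rewrite mulrAC [cj _*_]mulrC N2_mulJ -nm_sqr expr2 realCM mulfK.
Qed.

Lemma avg_le (F : nat -> C) : (bnd1 F) ->
 nm (H%:R^-1%:C*\sum_[h<=H] F h) <= 1.
Proof.
move=> hF; rewrite nmM nm_real ?invr_ge0 // mulrC ler_pdivrMr ?ltr0n // mul1r.
apply: leT (nm_sum _ _ _) _; apply: (leV (\sum_[h<=H] 1)).
 by apply: ler_sum => h _; apply: hF.
by rewrite sumr_const_nat subn1.
Qed.

Lemma Psi_nm_le m : nm (Psi m) <= 1.
Proof. by apply: avg_le => h; apply: cf_le. Qed.

Lemma Psi_lip1 m : nm (Psi m.+1-Psi m) <= 2/H%:R.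
Proof.
have -> : Psi m.+1-Psi m = H%:R^-1%:C*(cf m-cf (m-H)%N).
 rewrite /Psi -mulrBr; congr (_*_).
 rewrite big_nat_recl //= subn1 /=.
 have -> : \sum_(1 <= i < H) cf (m.+1-i.+1)%N = \sum_(1 <= i < H) cf (m-i)%N by [].
 rewrite [in X in _-X]big_nat_recr //=; ring.
rewrite nmM nm_real ?invr_ge0 // mulrC leMr ?invr_ge0 //.
by apply: leT (nmB _ _) _; have := cf_le m; have := cf_le (m-H)%N; lra.
Qed.

Lemma Psi_lip m n : nm (Psi m-Psi n) <= 2/H%:R*`|m%:R-n%:R|.
Proof.
wlog mn : m n / (n<=m)%N.
 move=> h; case: (leqP n m) => [|/ltnW] mn; first exact: h.
 by rewrite nm_subC distrC; apply: h.
rewrite -{1}(subnKC mn) -natrB // ger0_norm //; elim: (m-n)%N => [|k IH].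
 by rewrite addn0 subrr nm0 mulr0.
rewrite addnS; apply: leT (nm_tri _ (Psi (n+k)) _) _.
by rewrite -[k.+1%:R]natr1 mulrDr mulr1 [leRHS]addrC lerD // Psi_lip1.
Qed.

Lemma dual_sum : (\sum_(X.+1 <= n < X'.+1) nm (savg f H n))%:C =
 \sum_(X.+1 <= m < (X'+H).+1) f m*Psi m.
Proof.
rewrite realC_sum.
transitivity (H%:R^-1%:C*\sum_[h<=H] \sum_(X.+1 <= m < (X'+H).+1) cf (m-h)%N*f m).
 transitivity (H%:R^-1%:C*\sum_[h<=H] \sum_(X.+1 <= n < X'.+1) cf n*f (n+h)%N).
  rewrite exchange_big /= mulr_sumr; apply: eq_big_nat => n hn.
  rewrite -cf_mul // /savg -mulr_sumr; ring.
 congr (_*_); apply: eq_big_nat => h /andP[h1 hH]; rewrite ltnS in hH.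
 case/andP: XX' => XX _.
 rewrite [RHS](big_cat_nat (n := (X+h).+1)) //=; first last.
 - by rewrite ltnS; apply: leq_add.
 - by rewrite ltnS leq_addr.
 rewrite [X in _ = X+_]big_nat [X in _ = X+_]big1 ?add0r; last first.
  move=> m /andP[_ mh]; rewrite /cf; case: ifP; last by rewrite mul0r.
  by move=> /andP[q _]; exfalso; clear -mh q; lia.
 rewrite [RHS](big_cat_nat (n := (X'+h).+1)) //=; first last.
 - by rewrite ltnS leq_add2l.
 - by rewrite ltnS leq_add2r.
 rewrite [X in _ = _+X]big_nat [X in _ = _+X]big1 ?addr0; last first.
  move=> m /andP[q1 _]; rewrite /cf; case: ifP; last by rewrite mul0r.
  by move=> /andP[_ q]; exfalso; clear -q q1; lia.
 rewrite -addSn -[(X'+h).+1]addSn big_addn addnK; apply: eq_bigr => n _; by rewrite addnK.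
rewrite exchange_big /= mulr_sumr; apply: eq_bigr => m _.
by rewrite /Psi -mulr_suml; ring.
Qed.

(** Interpolation in the variable [lg m = log(m/X)]. It stays in [[0, pi/2]], inside the period
    [[-pi, pi]] of the nodes, and therefore only integer frequencies [t] occur. [ps j] is the value
    of [Psi] at the integer just below [X exp(node j)], and [rr] lists the coefficients of
    [dirk^2]. *)
Let M := (4*T).+1.
Let node (j : nat) : R := 2*rpi*(j%:R-(2*T)%:R)/M%:R.
Let pt (j : nat) : nat := Num.truncn (X%:R*rexp (node j)).
Let ps (j : nat) : C := Psi (pt j).
Let lg (m : nat) : R := rln (m%:R/X%:R).
Let rr (s : nat) : R := \sum_[a<T] \sum_[c<T] (a+c == s)%N%:R.

Lemma MR0 : 0 < M%:R:>R. Proof. by rewrite ltr0n. Qed.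

Lemma node_abs j : (j<M)%N -> `|node j| <= rpi.
Proof.
move=> jM; have pi0 := ltW rpi_gt0.
have q0: 0 <= 2*rpi/M%:R by rewrite divr_ge0 // mulr_ge0.
have -> : node j = (2*rpi/M%:R)*(j%:R-(2*T)%:R) by rewrite /node; ring.
rewrite normrM (ger0_norm q0) mulrAC ler_pdivrMr ?MR0 //.
have h: `|j%:R-(2*T)%:R| * 2 <= M%:R:>R.
 have j1: j%:R <= (4*T)%:R:>R by rewrite ler_nat.
 have j0: 0 <= j%:R:>R by [].
 rewrite -ler_pdivlMr // ler_norml /M -natr1; rewrite !natrM in j1 *; lra.
have := leMl pi0 h; lra.
Qed.

Lemma rr_ge0 s : 0 <= rr s. Proof. by do 2!(apply: sumr_ge0 => ? _). Qed.

Lemma dirk_sq z : dirk T z^+2 = \sum_[s<2*T] (rr s)%:C*cis (s%:R*z).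
Proof.
transitivity (\sum_[s<2*T] \sum_[a<T] \sum_[c<T]
   (a+c == s)%N%:R%:C*cis (s%:R*z)); last first.
 apply: eq_bigr => s _; rewrite /rr realC_sum mulr_suml; apply: eq_bigr => a _.
 by rewrite realC_sum mulr_suml.
rewrite exchange_big /= expr2 {1}/dirk mulr_suml; apply: eq_big_nat => a /andP[_ aT].
rewrite exchange_big /= /dirk mulr_sumr; apply: eq_big_nat => c /andP[_ cT].
rewrite (bigD1_seq (a+c)%N) ?iota_uniq //=; last first.
 by rewrite mem_index_iota /=; clear -aT cT; lia.
rewrite eqxx mul1r [X in _+X]big1 ?addr0; last by move=> s /negbTE ns; rewrite eq_sym ns mul0r.
by rewrite natrD mulrDl cisD.
Qed.

Lemma sum_rr : \sum_[s<2*T] rr s = T%:R^+2.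
Proof.
rewrite exchange_big /= expr2.
transitivity (\sum_[a<T] T%:R : R); last by rewrite sumr_const_nat subn0 mulr_natl.
apply: eq_big_nat => a /andP[_ aT]; rewrite exchange_big /=.
transitivity (\sum_[c<T] 1 : R); last by rewrite sumr_const_nat subn0.
apply: eq_big_nat => c /andP[_ cT].
rewrite (bigD1_seq (a+c)%N) ?iota_uniq //=; last first.
 by rewrite mem_index_iota /=; clear -aT cT; lia.
by rewrite eqxx big1 ?addr0 // => s /negbTE ns; rewrite eq_sym ns.
Qed.

Lemma rr_le s : rr s <= T%:R.
Proof.
apply: (leV (\sum_[a<T] 1)); last by rewrite sumr_const_nat subn0.
apply: ler_sum => a _; have [sa|sa] := leqP a s.
 have [h|h] := boolP ((s-a)%N \in index_iota 0 T); last first.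
  rewrite big_seq big1 // => c cI; case: eqP => // e; move: h; rewrite -e addKn cI //.
 rewrite (bigD1_seq (s-a)%N) ?iota_uniq //= subnKC // eqxx big1 ?addr0 // => c nc.
 by case: eqP => // e; move: nc; rewrite -e addKn eqxx.
rewrite big1 // => c _; case: eqP => // e; move: sa; rewrite -e; clear; lia.
Qed.

Let nu : R := \sum_[s<2*T] rr s^+2.
Lemma nu_ge : T%:R^+3/2 <= nu.
Proof.
have := CS1_real (index_iota 0 (2*T)) xpredT rr; rewrite sum_rr sumr_const_nat subn0 -/nu natrM => h.
have TR: 0 < T%:R:>R by rewrite ltr0n.
rewrite -(ler_pM2l TR) mulrA -exprS; lra.
Qed.
Lemma nu_gt0 : 0 < nu.
Proof. by apply: lt_le_trans nu_ge; rewrite divr_gt0 ?exprn_gt0 ?ltr0n. Qed.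

(** A trigonometric polynomial with fewer than [M] frequencies is sampled at [M] equally spaced
    points, so Parseval's identity is exact. *)
Lemma parseval_nodes (r : nat -> R) (y : R) :
 \sum_[j<M] N2 (\sum_[s<2*T] (r s)%:C*cis (s%:R*(y-node j))) =
 M%:R*\sum_[s<2*T] r s^+2.
Proof.
pose g (s : nat) : C := if (s<2*T)%N then (r s)%:C*cis (s%:R*(y+2*rpi*(2*T)%:R/M%:R)) else 0.
have cut (V : nmodType) (F : nat -> V) : (forall s, (2*T<=s)%N -> F s = 0) ->
  \sum_[s<M] F s = \sum_[s<2*T] F s.
 move=> hF; rewrite (big_cat_nat (n := (2*T)%N)) //=; last by rewrite /M; clear; lia.
 by rewrite [X in _+X]big_nat [X in _+X]big1 ?addr0 // => s /andP[h _]; apply: hF.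
have M0: (0<M)%N by [].
have := dft_parseval g M0.
have -> : \sum_[k<M] N2 (g k) = \sum_[s<2*T] r s^+2.
 rewrite cut; last by move=> s h; rewrite /g ltnNge h N20.
 by apply: eq_big_nat => s /andP[_ h]; rewrite /g h N2M N2_cis mulr1 N2_real.
move=> <-; apply: eq_bigr => j _; congr N2; rewrite /dft cut; last by move=> s h; rewrite /g ltnNge h mul0r.
apply: eq_big_nat => s /andP[_ h]; rewrite /g h -mulrA -cisD; congr (_*cis _).
rewrite /node; field; by rewrite gt_eqF ?MR0.
Qed.

Lemma sum_dirk2 y : \sum_[j<M] N2 (dirk T (y-node j)) = M%:R*T%:R.
Proof.
have -> : T%:R = \sum_[s<2*T] ((s<T)%N%:R : R)^+2.
 rewrite (big_cat_nat (n := T)) //=; last by clear; lia.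
 rewrite [X in _+X]big_nat [X in _+X]big1 ?addr0; last first.
  by move=> s /andP[h _]; rewrite ltnNge h expr0n.
 rewrite (@eq_big_nat _ _ _ _ _ _ (fun=> 1)); first by rewrite sumr_const_nat subn0.
 by move=> s /andP[_ ->]; rewrite expr1n.
rewrite -(parseval_nodes _ y); apply: eq_bigr => j _; congr N2.
rewrite [RHS](big_cat_nat (n := T)) //=; last by clear; lia.
rewrite [X in _ = _+X]big_nat [X in _ = _+X]big1 ?addr0; last first.
 by move=> s /andP[h _]; rewrite ltnNge h mul0r.
by apply: eq_big_nat => s /andP[_ ->]; rewrite mul1r.
Qed.

(** The Jackson kernel [|dirk|^4]. Its second moment has relative size [1/T^2], which [|dirk|^2]
    would not give and which [approx_err] plays against the Lipschitz bound for [Psi]. *)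
Let ker (y : R) (j : nat) : R := N2 (dirk T (y-node j))^+2.

Lemma sum_ker y : \sum_[j<M] ker y j = M%:R*nu.
Proof.
rewrite -(parseval_nodes _ y); apply: eq_bigr => j _; rewrite /ker -dirk_sq.
by rewrite ![_^+2]expr2 N2M.
Qed.

Lemma ker_ge0 y j : 0 <= ker y j. Proof. exact: sqr_ge0. Qed.

Lemma ker_moment y j : 0 <= y <= rpi/2 -> (j<M)%N ->
 ker y j*(y-node j)^+2 <= 576*N2 (dirk T (y-node j)).
Proof.
move=> /andP[y0 y1] jM; have := node_abs jM; rewrite ler_norml => /andP[n1 n2].
set z := y-node j; have zb: `|z| <= rpi*(3/2) by rewrite ler_norml /z; lra.
have pi0 := rpi_gt0; have pi4 := rpi_le4.
rewrite /ker -/z expr2 -mulrA [leRHS]mulrC; apply: leMl; first exact: N2_ge0.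
have [->|zn] := eqVneq z 0; first by rewrite expr0n mulr0.
pose u := z/(2*rpi).
have zu: z = 2*rpi*u by rewrite /u; field; rewrite gt_eqF.
have un: u != 0 by rewrite mulf_neq0 // invr_eq0 mulf_neq0 // gt_eqF.
have u34: `|u| <= 3/4.
 rewrite /u normrM normfV [`|2*rpi|]ger0_norm; last by lra.
 rewrite ler_pdivrMr; lra.
have := nm_dirk_inv T 0 un u34; rewrite mulr0 addr0 -zu ler_pdivlMr ?normr_gt0 // => h.
have h2: nm (dirk T z)*`|z| <= 24.
 rewrite zu normrM [`|2*rpi|]ger0_norm; last by lra.
 rewrite -zu mulrCA; have : 2*rpi <= 8 by lra.
 move=> h3; apply: (leV (8*3)); last by lra.
 by apply: ler_pM => //; [lra|rewrite mulr_ge0 ?nm_ge0].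
rewrite -nm_sqr -[z^+2]real_normK ?num_real // -exprMn.
have -> : 576 = 24^+2:>R by ring.
by rewrite lerXn2r ?nnegrE // mulr_ge0 ?nm_ge0.
Qed.

Lemma sum_ker_moment y : 0 <= y <= rpi/2 ->
 \sum_[j<M] ker y j*(y-node j)^+2 <= 576*(M%:R*T%:R).
Proof.
move=> hy; rewrite -(sum_dirk2 y) mulr_sumr; apply: ler_sum_nat => j /andP[_ jM].
exact: ker_moment.
Qed.

Lemma rexp_lip (x y : R) : x <= 4 -> y <= 4 -> `|rexp x-rexp y| <= E4*`|x-y|.
Proof.
wlog xy : x y / y <= x.
 move=> h x4 y4; case: (leP y x) => [|/ltW] xy; first exact: h.
 by rewrite distrC [`|x-y|]distrC; apply: h.
move=> x4 y4; rewrite !ger0_norm ?subr_ge0 ?rexp_le //.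
have -> : rexp x-rexp y = rexp x*(1-rexp (y-x)).
 by rewrite mulrBr mulr1 -rexpD; congr (_-rexp _); ring.
apply: ler_pM; rewrite ?rexp_ge0 ?rexp_le //.
 by rewrite subr_ge0 -[leRHS]rexp0 rexp_le; lra.
by have := rexp_ge1D (y-x); lra.
Qed.

Lemma lg_bounds m : (X<m<=X')%N -> 0 <= lg m <= rpi/2.
Proof.
move=> /andP[m1 m2]; have XR: 0 < X%:R:>R by rewrite ltr0n.
have mR: 0 < m%:R:>R by rewrite ltr0n (leq_ltn_trans _ m1).
rewrite /lg; apply/andP; split.
 by apply: rln_ge0; rewrite ler_pdivlMr // mul1r ler_nat ltnW.
apply: (leV (rln 4)).
 apply: rln_le; first exact: divr_gt0.
 rewrite ler_pdivrMr // -natrM ler_nat (leqT m2) //.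
 by case/andP: XX' => _ /leqT -> //; rewrite leq_mul2r orbT.
have := rln4_le; have := rpi_gt3; lra.
Qed.

Lemma pt_dist m j : (X<m<=X')%N -> (j<M)%N ->
 nm (Psi m-ps j) <= 2/H%:R+2*E4*X%:R/H%:R*`|lg m-node j|.
Proof.
move=> hm jM; have XR: 0 < X%:R:>R by rewrite ltr0n.
have HR: 0 < H%:R:>R by rewrite ltr0n.
have mR: 0 < m%:R:>R by case/andP: hm => h _; rewrite ltr0n (leq_ltn_trans _ h).
have /andP[l0 l1] := lg_bounds hm; have := node_abs jM; rewrite ler_norml => /andP[n1 n2].
have p4 := rpi_le4; have p0 := rpi_gt0.
have e1: m%:R = X%:R*rexp (lg m) by rewrite /lg rlnK ?divr_gt0 // mulrCA mulfV ?mulr1 // gt_eqF.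
have t0: 0 <= X%:R*rexp (node j) by rewrite mulr_ge0 ?rexp_ge0.
have := truncn_itv t0; rewrite -/(pt j) -natr1 => /andP[t1 t2].
apply: leT (Psi_lip _ _) _.
have -> : 2/H%:R+2*E4*X%:R/H%:R*`|lg m-node j| =
 2/H%:R*(1+X%:R*(E4*`|lg m-node j|)) by ring.
apply: leMl; first by rewrite divr_ge0.
have h1: `|rexp (lg m)-rexp (node j)| <= E4*`|lg m-node j| by apply: rexp_lip; lra.
have h2 := leMl (ltW XR) h1.
apply: leT (lerD (lexx 1) h2).
have -> : m%:R-(pt j)%:R = (X%:R*rexp (node j)-(pt j)%:R)+X%:R*(rexp (lg m)-rexp (node j)):>R.
 by rewrite e1; ring.
apply: leT (ler_normD _ _) _; rewrite normrM [`|X%:R|]ger0_norm // lerD2r ler_norml; lra.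
Qed.

Lemma approx_err m (eta : R) : (X<m<=X')%N -> 0 < eta ->
 nm (Psi m-(M%:R*nu)^-1%:C*\sum_[j<M] (ker (lg m) j)%:C * ps j) <=
 2/H%:R+eta+288*(2*E4*X%:R/H%:R)^+2/(eta*T%:R^+2).
Proof.
move=> hm e0; set lam := 2*E4*X%:R/H%:R; have hl := lg_bounds hm.
have Mn: 0 < M%:R*nu by rewrite mulr_gt0 ?MR0 ?nu_gt0.
have TR: 0 < T%:R:>R by rewrite ltr0n.
have MnC: (M%:R*nu)^-1%:C*(M%:R*nu)%:C = 1 :> C by rewrite -realCM mulVf // gt_eqF.
have -> : Psi m-(M%:R*nu)^-1%:C*\sum_[j<M] (ker (lg m) j)%:C * ps j =
  (M%:R*nu)^-1%:C*\sum_[j<M] (ker (lg m) j)%:C*(Psi m-ps j).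
 under [in RHS]eq_bigr do rewrite mulrBr.
 rewrite sumrB mulrBr; congr (_-_).
 by rewrite -mulr_suml -realC_sum sum_ker mulrA MnC mul1r.
rewrite nmM nm_real; last by rewrite invr_ge0 ltW.
rewrite mulrC ler_pdivrMr //; apply: leT (nm_sum _ _ _) _.
(* Trades the first moment of the kernel for the second one without a square root; [eta] remains
   free until the parameters are fixed. *)
have amgm (z : R) : lam*`|z| <= eta+lam^+2/(4*eta)*z^+2.
 have -> : lam^+2/(4*eta)*z^+2 = (lam*`|z|)^+2/(4*eta).
  by rewrite [(lam*_)^+2]exprMn real_normK ?num_real //; ring.
 set q := lam*`|z|; have -> : eta+q^+2/(4*eta) = q+(q-2*eta)^+2/(4*eta).
  by field; rewrite gt_eqF.
 by rewrite lerDl divr_ge0 ?sqr_ge0 //; lra.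
apply: (leV (\sum_[j<M] (ker (lg m) j*(2/H%:R+eta) +
  lam^+2/(4*eta)*(ker (lg m) j*(lg m-node j)^+2)))).
 apply: ler_sum_nat => j /andP[_ jM]; rewrite nmM nm_real ?ker_ge0 //.
 rewrite mulrCA -mulrDr; apply: leMl; first exact: ker_ge0.
 apply: leT (pt_dist hm jM) _; rewrite -/lam -addrA lerD2l; exact: amgm.
rewrite big_split /= -mulr_suml -mulr_sumr sum_ker.
have L0: 0 <= lam^+2/(4*eta) by rewrite divr_ge0 ?sqr_ge0 //; lra.
have := leMl L0 (sum_ker_moment hl) => h.
apply: leT (lerD (lexx _) h) _.
rewrite [leRHS]mulrDl [(2/H%:R+eta)*_]mulrC lerD2l.
have -> : lam^+2/(4*eta)*(576*(M%:R*T%:R)) = 288 * lam^+2/(eta*T%:R^+2)*(M%:R*(T%:R^+3/2)).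
 by field; rewrite !gt_eqF.
apply: leMl.
 by apply: divr_ge0; apply: mulr_ge0; rewrite ?sqr_ge0 // ltW.
by apply: leMl => //; exact: nu_ge.
Qed.

Let Phi (t : R) : C := \sum_[j<M] ps j*cis (- (t*node j)).

Lemma sum_Phi : \sum_[k<M] N2 (Phi (k%:R-(2*T)%:R)) <= M%:R^+2.
Proof.
have M0: (0<M)%N by [].
pose g j := ps j*cis (2*rpi*((2*T)%:R*j%:R/M%:R)).
have -> : \sum_[k<M] N2 (Phi (k%:R-(2*T)%:R)) = \sum_[k<M] N2 (dft M g k).
 apply: eq_bigr => k _.
 have -> : Phi (k%:R-(2*T)%:R) = cis ((k%:R-(2*T)%:R)*(2*rpi*(2*T)%:R/M%:R))*dft M g k.
  rewrite /Phi /dft mulr_sumr; apply: eq_bigr => j _; rewrite /g.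
  have assoc (A B D q : C) : A*(q*B*D) = q*(A*B*D) by ring.
  rewrite assoc -!cisD; congr (_*cis _); rewrite /node; field; by rewrite gt_eqF ?MR0.
 by rewrite N2M N2_cis mul1r.
rewrite dft_parseval // expr2; apply: leMl => //.
apply: (leV (\sum_[k<M] 1)); last by rewrite sumr_const_nat subn0.
by apply: ler_sum => k _; rewrite /g N2M N2_cis mulr1 nm_N2 // Psi_nm_le.
Qed.

Let SA : R := \sum_[j<M] N2 (fh f X X' (j%:R-(2*T)%:R)).

Lemma sum_f_cis t : \sum_(X.+1 <= m < X'.+1) f m*cis (t * lg m) =
 cis (- (t*rln X%:R))*(X%:R%:C*fh f X X' t).
Proof.
have XR: 0 < X%:R:>R by rewrite ltr0n.
have -> : X%:R%:C*fh f X X' t = \sum_(X.+1 <= n < X'.+1) f n*npw n t.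
 by rewrite /fh mulrA -realCM mulfV ?mul1r // gt_eqF.
rewrite mulr_sumr; apply: eq_big_nat => m /andP[m1 _]; rewrite mulrCA; congr (_*_).
have mR: 0 < m%:R:>R by rewrite ltr0n (leq_ltn_trans _ m1).
by rewrite /npw -cisD /lg rlnD //; congr cis; ring.
Qed.

(** Expanding the kernel into frequencies produces values of [fh] and of the transform [Phi] of the
    sampled [Psi], at the integers [s - s']. For fixed [s'] these are distinct, so Cauchy-Schwarz
    bounds them by the mean square [SA] of [fh] and by that of [Phi], which [sum_Phi] gets from
    Parseval on the nodes. *)
Lemma bilinear_le :
 nm (\sum_(X.+1 <= m < X'.+1) f m*((M%:R*nu)^-1%:C*\sum_[j<M] (ker (lg m) j)%:C * ps j)) <=
 2*X%:R*Num.sqrt SA.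
Proof.
have Mn: 0 < M%:R*nu by rewrite mulr_gt0 ?MR0 ?nu_gt0.
have TR: 0 < T%:R:>R by rewrite ltr0n.
have kerE y j : (ker y j)%:C = \sum_(0 <= s' < 2*T) \sum_[s<2*T]
  (rr s')%:C*(rr s)%:C*(cis ((s%:R-s'%:R)*y)*cis (- ((s%:R-s'%:R)*node j))).
 have -> : ker y j = N2 (dirk T (y-node j)^+2) by rewrite /ker [in RHS]expr2 N2M -expr2.
 rewrite -N2_mulJ dirk_sq conj_sum mulr_sumr; apply: eq_bigr => s' _; rewrite mulr_suml.
 apply: eq_bigr => s _; rewrite conjM conj_real -cisN.
 have -> : cis ((s%:R-s'%:R)*y)*cis (- ((s%:R-s'%:R)*node j)) =
   cis (s%:R*(y-node j))*cis (- (s'%:R*(y-node j))).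
  by rewrite -!cisD; congr cis; ring.
 ring.
have -> : \sum_(X.+1 <= m < X'.+1) f m*((M%:R*nu)^-1%:C*\sum_[j<M] (ker (lg m) j)%:C * ps j) =
 (M%:R*nu)^-1%:C*\sum_(0 <= s' < 2*T) \sum_[s<2*T] (rr s')%:C*(rr s)%:C *
   ((\sum_(X.+1 <= m < X'.+1) f m*cis ((s%:R-s'%:R) * lg m))*Phi (s%:R-s'%:R)).
 transitivity ((M%:R*nu)^-1%:C*\sum_(X.+1 <= m < X'.+1) \sum_[j<M]
   \sum_(0 <= s' < 2*T) \sum_[s<2*T] (rr s')%:C*(rr s)%:C *
   (f m*cis ((s%:R-s'%:R) * lg m)*(ps j*cis (- ((s%:R-s'%:R)*node j))))).
  rewrite [RHS]mulr_sumr; apply: eq_bigr => m _; rewrite [LHS]mulrCA; congr (_*_).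
  rewrite [LHS]mulr_sumr; apply: eq_bigr => j _; rewrite kerE [X in f m*X]mulr_suml [LHS]mulr_sumr.
  apply: eq_bigr => s' _; rewrite [X in f m*X]mulr_suml [LHS]mulr_sumr; apply: eq_bigr => s _.
  move: (ps j) => q; ring.
 congr (_*_).
 under eq_bigr do rewrite exchange_big /=.
 rewrite exchange_big /=; apply: eq_bigr => s' _.
 under eq_bigr do rewrite exchange_big /=.
 rewrite exchange_big /=; apply: eq_bigr => s _.
 rewrite mulr_suml mulr_sumr; apply: eq_bigr => m _; rewrite /Phi.
 by rewrite [RHS]mulrA mulr_sumr; apply: eq_bigr => j _; rewrite !mulrA.
have S0: 0 <= SA by apply: sumr_ge0 => j _; rewrite N2_ge0.
rewrite nmM nm_real; last by rewrite invr_ge0 ltW.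
rewrite mulrC ler_pdivrMr //; apply: leT (nm_sum _ _ _) _.
have inner s' : (s'<2*T)%N -> \sum_[s<2*T]
  nm (fh f X X' (s%:R-s'%:R))*nm (Phi (s%:R-s'%:R)) <= Num.sqrt SA * M%:R.
 move=> s'T.
 have shift (G : R -> R) : (forall t, 0 <= G t) ->
   \sum_[s<2*T] G (s%:R-s'%:R) <= \sum_[j<M] G (j%:R-(2*T)%:R).
  move=> G0; have -> : \sum_[s<2*T] G (s%:R-s'%:R) =
    \sum_(2*T-s' <= j < 2*T+(2*T-s')) G (j%:R-(2*T)%:R).
   rewrite sum_addn; apply: eq_bigr => s _; congr G; rewrite natrD natrB; last exact: ltnW.
   ring.
  rewrite [leRHS](big_cat_nat (n := (2*T-s')%N)) //=; last by rewrite /M; clear; lia.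
  rewrite [X in _ <= _+X](big_cat_nat (n := (2*T+(2*T-s'))%N)) //=; first last.
  - by rewrite /M; clear; lia.
  - by clear; lia.
  by rewrite addrCA lerDl addr_ge0 ?sumr_ge0.
 set Q := \sum_[s<2*T] _.
 have Q0: 0 <= Q by apply: sumr_ge0 => s _; rewrite mulr_ge0 ?nm_ge0.
 have h: Q^+2 <= SA * M%:R^+2.
  apply: leT (CS_real _ _ _ _) _.
  under eq_bigr do rewrite nm_sqr.
  under [X in _*X]eq_bigr do rewrite nm_sqr.
  apply: ler_pM; try by apply: sumr_ge0 => s _; rewrite N2_ge0.
   by apply: (shift (fun t => N2 (fh f X X' t))) => t; rewrite N2_ge0.
  apply: leT sum_Phi; apply: (shift (fun t => N2 (Phi t))) => t; rewrite N2_ge0 //.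
 rewrite -(ger0_norm Q0) -sqrtr_sqr.
 have -> : Num.sqrt SA * M%:R = Num.sqrt (SA * M%:R^+2).
  by rewrite sqrtrM // sqrtr_sqr ger0_norm.
 by rewrite ler_sqrt // mulr_ge0 // sqr_ge0.
apply: (leV (\sum_(0 <= s' < 2*T) rr s'*(T%:R*X%:R*(Num.sqrt SA * M%:R)))).
 apply: ler_sum_nat => s' /andP[_ s'T]; apply: leT (nm_sum _ _ _) _.
 rewrite -mulrA; apply: (leV (rr s'*(T%:R*(X%:R*\sum_[s<2*T]
   nm (fh f X X' (s%:R-s'%:R))*nm (Phi (s%:R-s'%:R)))))).
  rewrite !mulr_sumr; apply: ler_sum => s _.
  rewrite sum_f_cis (nmM ((rr s')%:C*_)) (nmM (rr s')%:C) (nmM (cis _*_)) (nmM (cis _)).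
  rewrite nm_cis mul1r (nmM X%:R%:C) !nm_real ?rr_ge0 // -[leLHS]mulrA.
  apply: leMl; first exact: rr_ge0.
  rewrite -[X%:R*_*_]mulrA; apply: leMr; last exact: rr_le.
  by apply: mulr_ge0 => //; apply: mulr_ge0; exact: nm_ge0.
 by do 3!(apply: leMl; rewrite ?rr_ge0 //); apply: inner.
rewrite -mulr_suml sum_rr.
have := nu_ge; set q := Num.sqrt SA; have q0: 0 <= q by exact: sqrtr_ge0.
move=> hn; have -> : T%:R^+2*(T%:R*X%:R*(q * M%:R)) = 2*X%:R*q*(M%:R*(T%:R^+3/2)).
 by field.
apply: leMl; first by rewrite !mulr_ge0.
by apply: leMl.
Qed.

Lemma duality (eta : R) : 0 < eta ->
 \sum_(X.+1 <= n < X'.+1) nm (savg f H n) <=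
 H%:R+2*X%:R*(2/H%:R+eta+288*(2*E4*X%:R/H%:R)^+2/(eta*T%:R^+2)) +
 2*X%:R*Num.sqrt (\sum_[j<(4*T).+1] N2 (fh f X X' (j%:R-(2*T)%:R))).
Proof.
move=> e0; case/andP: (XX') => X1 X3.
set er := 2/H%:R+eta+_.
have er0: 0 <= er.
 apply: addr_ge0; first by apply: addr_ge0; [rewrite divr_ge0|exact: ltW].
 apply: divr_ge0; first by apply: mulr_ge0 => //; exact: sqr_ge0.
 by apply: mulr_ge0; [exact: ltW|exact: sqr_ge0].
have nn: 0 <= \sum_(X.+1 <= n < X'.+1) nm (savg f H n) by apply: sumr_ge0 => n _; rewrite nm_ge0.
rewrite -[leLHS]nm_real // dual_sum (big_cat_nat (n := X'.+1)) //=; last by rewrite ltnS leq_addr.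
apply: leT (nmD _ _) _; rewrite addrC -addrA; apply: lerD.
 apply: leT (nm_sum _ _ _) _; apply: (leV (\sum_(X'.+1 <= m < (X'+H).+1) 1)).
  by apply: ler_sum => m _; rewrite nmM mulr_ile1 ?nm_ge0 ?Psi_nm_le.
 by rewrite sumr_const_nat subSS addKn.
pose ap m := (M%:R*nu)^-1%:C*\sum_[j<M] (ker (lg m) j)%:C * ps j.
have -> : \sum_(X.+1 <= m < X'.+1) f m*Psi m =
 \sum_(X.+1 <= m < X'.+1) f m*(Psi m-ap m)+\sum_(X.+1 <= m < X'.+1) f m*ap m.
 by rewrite -big_split /=; apply: eq_bigr => m _; ring.
apply: leT (nmD _ _) _; apply: lerD; last exact: bilinear_le.
apply: leT (nm_sum _ _ _) _; apply: (leV (\sum_(X.+1 <= m < X'.+1) er)).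
 apply: ler_sum_nat => m hm; rewrite nmM -[leRHS]mul1r; apply: ler_pM; rewrite ?nm_ge0 //.
 exact: approx_err.
rewrite sumr_const_nat subSS -[leLHS]mulr_natl; apply: leMr => //.
rewrite -natrM ler_nat leq_subLR; clear -X3; lia.
Qed.
End Duality.

(** * The Gram matrix *)

Lemma nm_2iu (u : R) : nm (1 +i* u) <= nm (2 +i* u).
Proof. by rewrite /nm /N2 /= ler_sqrt ?addr_ge0 ?sqr_ge0 // lerD2r; lra. Qed.
Lemma c2iu_neq0 (u : R) : 2 +i* u != 0.
Proof. by rewrite eq_complex /= negb_and; apply/orP; left; rewrite pnatr_eq0. Qed.

Lemma zmain_lip1 n u : nm (zmain n.+1 u-zmain n u) <= 2.
Proof.
have [w1 w2] := nm_1iu u; set w := 1 +i* u in w1 w2.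
have wz: w != 0 by exact: c1iu_neq0.
rewrite /zmain -/w -mulrBl nmM nm_inv // ler_pdivrMr; last by lra.
have h: nm (n.+1%:R%:C*npw n.+1 u-n%:R%:C*npw n u) <= 1+`|u|.
 case: n => [|n].
  by rewrite mul0r subr0 nmM nm_npw nm_real // mulr1 lerDl.
 have n0: 0 < n.+1%:R:>R by rewrite ltr0n.
 have -> : n.+2%:R%:C*npw n.+2 u-n.+1%:R%:C*npw n.+1 u =
   npw n.+2 u+n.+1%:R%:C*(npw n.+2 u-npw n.+1 u).
  have -> : n.+2%:R%:C = n.+1%:R%:C+1 :> C by rewrite -[n.+2%:R]natr1 rmorphD.
  ring.
 apply: leT (nmD _ _) _; rewrite nm_npw lerD2l nmM nm_real //.
 apply: (leV (n.+1%:R*(`|u| * n.+1%:R^-1))); last first.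
  by rewrite mulrCA mulfV ?mulr1 // gt_eqF.
 rewrite leMl //; apply: leT (cis_lip _ _) _.
 rewrite -mulrBr normrM leMl //.
 have p2: 0 < n.+2%:R:>R by rewrite ltr0n.
 rewrite ger0_norm; last by rewrite subr_ge0 rln_le // ler_nat.
 rewrite -rlnD //; apply: leT (rln_le_sub1 _) _; first by rewrite divr_gt0.
 have -> : n.+2%:R/n.+1%:R-1 = n.+1%:R^-1:>R.
  by rewrite -[n.+2%:R]natr1 mulrDl divff ?gt_eqF // mul1r addrAC subrr add0r.
 exact: lexx.
apply: leT h _; lra.
Qed.

Lemma zmain_lip m n u : (m<=n)%N -> nm (zmain n u-zmain m u) <= 2*(n-m)%:R.
Proof.
move/subnKC => <-; rewrite addKn; elim: (n-m)%N => [|k IH].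
 by rewrite addn0 subrr nm0 mulr0.
rewrite addnS; apply: leT (nm_tri _ (zmain (m+k) u) _) _.
rewrite -[k.+1%:R]natr1 mulrDr mulr1 [leRHS]addrC lerD //; exact: zmain_lip1.
Qed.

Lemma zmain_dil d Z u : (0<d)%N -> d%:R%:C*npw d u*zmain Z u = zmain (d*Z) u.
Proof.
move=> d0; case: Z => [|Z]; first by rewrite muln0 /zmain !mul0r mulr0.
by rewrite /zmain npwM // natrM realCM; ring.
Qed.

Section Gram.
Variables (N X : nat) (E : R).
Hypotheses (X0 : (0<X)%N) (XN : (X<=N)%N).
Hypotheses (E0 : 0 <= E) (hE : forall Z u, (Z<=4*N)%N -> `|u| <= 3*N%:R -> nm (zsum Z u-zmain Z u) <= E).

(** A trapezoid, equal to 1 up to [2X] and falling linearly to 0 beyond [4X], written as a mean of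
    sharp cutoffs. The averaging makes the main term [MV] decay like [1/(1+u^2)] instead of [1/|u|],
    which is summable over distinct integers. *)
Definition Vw (n : nat) : R := (2*X%:R)^-1*\sum_((2*X).+1 <= Y < (4*X).+1) (n<=Y)%N%:R.
Definition SV (d : nat) (u : R) : C :=
 \sum_[n<=(4*X)] (Vw n)%:C*((d %| n)%N%:R%:C*npw n u).
Definition MV (u : R) : C := (2*X%:R)^-1%:C*\sum_((2*X).+1 <= Y < (4*X).+1) zmain Y u.

Lemma Vw_ge0 n : 0 <= Vw n.
Proof. by rewrite mulr_ge0 ?sumr_ge0 // invr_ge0 mulr_ge0. Qed.

Lemma Vw_eq1 n : (n<=2*X)%N -> Vw n = 1.
Proof.
move=> nX; rewrite /Vw (@eq_big_nat _ _ _ _ _ _ (fun=> 1)); last first.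
 by move=> Y /andP[h _]; rewrite (leqT nX) // ltnW.
have -> : \sum_((2*X).+1 <= i < (4*X).+1) 1 = 2*X%:R:>R.
 by rewrite sumr_const_nat subSS -mulnBl -natrM.
by rewrite mulVf // mulf_neq0 // ?pnatr_eq0 -?lt0n.
Qed.

Lemma Vw_le1 n : Vw n <= 1.
Proof.
rewrite -(Vw_eq1 (leq0n _)) /Vw; apply: leMl; first by rewrite invr_ge0 mulr_ge0.
by apply: ler_sum => Y _; rewrite ler_nat leq0n; case: (n<=Y)%N.
Qed.

Lemma sum_mult d (F : nat -> C) Y : (0<d)%N ->
 \sum_[n<=Y] (d %| n)%N%:R%:C*F n = \sum_[m<=(Y %/ d)] F (d * m)%N.
Proof.
move=> d0; elim: Y => [|Y IH]; first by rewrite div0n !big_geq.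
rewrite big_nat_recr //= IH divnS //; case: (boolP (d %| Y.+1)%N) => [h|h]; last first.
 by rewrite add0n mul0r addr0.
rewrite add1n mul1r [RHS]big_nat_recr //=; congr (_+F _).
have : ((Y.+1 %/ d) = (Y %/ d).+1)%N by rewrite divnS // h.
by move=> <-; rewrite mulnC divnK.
Qed.

Lemma SV_eq d u : (0<d)%N -> SV d u =
 (2*X%:R)^-1%:C*\sum_((2*X).+1 <= Y < (4*X).+1) npw d u*zsum (Y %/ d) u.
Proof.
move=> d0.
have -> : SV d u = (2*X%:R)^-1%:C*\sum_[n<=(4*X)]
  \sum_((2*X).+1 <= Y < (4*X).+1) (n<=Y)%N%:R%:C*((d %| n)%N%:R%:C*npw n u).
 rewrite mulr_sumr; apply: eq_bigr => n _; rewrite /Vw realCM realC_sum -mulrA mulr_suml.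
 by [].
congr (_*_); rewrite exchange_big /=; apply: eq_big_nat => Y /andP[_ Y4].
rewrite (big_cat_nat (n := Y.+1)) //= [X in _+X]big_nat [X in _+X]big1 ?addr0; last first.
 by move=> n /andP[h _]; rewrite leqNgt h mul0r.
have -> : \sum_[i<=Y] (i<=Y)%N%:R%:C*((d %| i)%N%:R%:C*npw i u) =
  \sum_[i<=Y] (d %| i)%N%:R%:C*npw i u.
 by apply: eq_big_nat => n /andP[_]; rewrite ltnS => ->; rewrite mul1r.
rewrite sum_mult // /zsum mulr_sumr; apply: eq_big_nat => m /andP[m0 _].
by rewrite npwM.
Qed.

Lemma nm_avgY (F : nat -> C) (B : R) :
 (forall Y, (2*X<Y<=4*X)%N -> nm (F Y) <= B) ->
 nm ((2*X%:R)^-1%:C*\sum_((2*X).+1 <= Y < (4*X).+1) F Y) <= B.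
Proof.
move=> h; have XR: 0 < 2*X%:R:>R by rewrite mulr_gt0 ?ltr0n.
rewrite nmM nm_real ?invr_ge0 ?(ltW XR) // mulrC ler_pdivrMr //.
apply: leT (nm_sum _ _ _) _; apply: (leV (\sum_((2*X).+1 <= Y < (4*X).+1) B)).
 by apply: ler_sum_nat => Y hY; apply: h.
by rewrite sumr_const_nat subSS -mulnBl -[leLHS]mulr_natr natrM.
Qed.

(** [d^(1+iu)] times the main term at [Z] is the main term at [d Z] ([zmain_dil]). So [d] times the
    sum over multiples of [d] has a main term that does not depend on [d]. *)
Lemma SV_main d u : (0<d)%N -> `|u| <= 3*N%:R ->
 nm (d%:R%:C*SV d u-MV u) <= d%:R*(E+2).
Proof.
move=> d0 hu; rewrite SV_eq // /MV mulrCA -mulrBr mulr_sumr -sumrB.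
apply: nm_avgY => Y /andP[_ Y4].
have hz: (Y %/ d<=4*N)%N by apply: leqT (leq_div _ _) _; apply: leqT Y4 _; rewrite leq_mul2l XN orbT.
have e1 := hE hz hu.
have -> : d%:R%:C*(npw d u*zsum (Y %/ d) u)-zmain Y u =
  d%:R%:C*npw d u*(zsum (Y %/ d) u-zmain (Y %/ d) u)-(zmain Y u-zmain (d*(Y %/ d)) u).
 by rewrite -zmain_dil //; ring.
apply: leT (nmB _ _) _; rewrite [leRHS]mulrDr; apply: lerD.
 by rewrite !nmM nm_npw mulr1 nm_real // leMl.
have le1: (d*(Y %/ d)<=Y)%N by rewrite mulnC leq_trunc_div.
apply: leT (zmain_lip u le1) _; rewrite mulrC leMr // ler_nat.
have := ltn_pmod Y d0; have := divn_eq Y d; clear; move: (Y %/ d)%N (Y %% d)%N => q r -> h; lia.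
Qed.

(** Abel summation shows that [(2+iu) G] is [(Z+1) zmain Z u] up to errors. The second division by a
    quantity of size [1+|u|] is the gain from averaging the cutoffs. *)
Lemma sum_zmain_le Z u : (Z<=4*N)%N -> `|u| <= 3*N%:R ->
 nm (\sum_[Y<=Z] zmain Y u) <= 2*Z%:R^+2/(1+u^+2)+3*Z%:R*E.
Proof.
move=> ZN hu; case: (posnP Z) => [->|Z0]; first by rewrite big_geq // nm0 expr0n /= !mulr0 !mul0r addr0.
have [w1 w2] := nm_1iu u; have v1 := nm_2iu u.
have wz := c1iu_neq0 u; have vz := c2iu_neq0 u.
pose G := \sum_[Y<=Z] zmain Y u.
have abel (F : nat -> C) n : \sum_[Y<=n] Y%:R%:C*F Y =
  n.+1%:R%:C*(\sum_[k<=n] F k)-\sum_[m<=n] \sum_[k<=m] F k.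
 elim: n => [|n IH]; first by rewrite !big_geq // mulr0 subrr.
 rewrite big_nat_recr //= IH [\sum_(1 <= m < n.+2) \sum_[k<=m] F k]big_nat_recr //=.
 rewrite [\sum_(1 <= k < n.+2) F k]big_nat_recr //=.
 have -> : n.+2%:R%:C = n.+1%:R%:C+1 :> C by rewrite -[n.+2%:R]natr1 rmorphD.
 ring.
pose er := Z.+1%:R%:C*(zsum Z u-zmain Z u)-\sum_[m<=Z] (zsum m u-zmain m u).
have key: (2 +i* u)*G = Z.+1%:R%:C*zmain Z u+er.
 have gG: (1 +i* u)*G = \sum_[Y<=Z] Y%:R%:C*npw Y u.
  rewrite mulr_sumr; apply: eq_bigr => Y _; rewrite /zmain mulrC mulfVK //.
 have -> : (2 +i* u) = (1 +i* u)+1 by apply/eqP; rewrite eq_complex /= addr0 !eqxx.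
 rewrite mulrDl mul1r gG abel /er /G sumrB -/(zsum Z u).
 have -> : \sum_[m<=Z] \sum_[k<=m] npw k u = \sum_[m<=Z] zsum m u by [].
 ring.
have her: nm er <= 3*Z%:R*E.
 apply: leT (nmB _ _) _.
 have h1: nm (Z.+1%:R%:C*(zsum Z u-zmain Z u)) <= Z.+1%:R*E.
  by rewrite nmM nm_real // leMl // hE.
 have h2: nm (\sum_[m<=Z] (zsum m u-zmain m u)) <= Z%:R*E.
  apply: leT (nm_sum _ _ _) _; apply: (leV (\sum_[m<=Z] E)).
   by apply: ler_sum_nat => m /andP[_ mZ]; apply: hE => //; apply: leqT ZN.
  by rewrite sumr_const_nat subn1 mulr_natl.
 apply: leT (lerD h1 h2) _; rewrite -natr1.
 have : 1 <= Z%:R:>R by rewrite ler1n.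
 move=> /(leMr E0); rewrite mul1r => h; lra.
have w0: 0 < nm (1 +i* u) by lra.
have v0: 0 < nm (2 +i* u) by lra.
have nG: nm (2 +i* u)*nm G <= 2*Z%:R^+2/nm (1 +i* u)+3*Z%:R*E.
 rewrite -nmM key; apply: leT (nmD _ _) _; apply: lerD her.
 rewrite /zmain !nmM nm_npw mulr1 !nm_real // nm_inv // mulrA leMr ?invr_ge0 ?nm_ge0 //.
 rewrite -natr1; have : 1 <= Z%:R:>R by rewrite ler1n.
 nra.
have -> : 1+u^+2 = nm (1 +i* u)^+2 by rewrite nm_sqr /N2 /= expr1n.
rewrite -/G; set n1 := nm (1 +i* u) in w0 w1 v1 nG *; set n2 := nm (2 +i* u) in v0 v1 nG *.
have Ep: 0 <= 3*Z%:R*E by rewrite !mulr_ge0.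
have -> : 2*Z%:R^+2/n1^+2 = 2*Z%:R^+2/n1/n1 by field; rewrite gt_eqF.
move: nG Ep; set a := 2*_/n1; set e := 3*_*E => nG Ep.
have a0: 0 <= a by rewrite /a divr_ge0 ?mulr_ge0 ?exprn_ge0 ?nm_ge0.
have h3: nm G <= (a+e)/n1.
 rewrite ler_pdivlMr //; apply: leT nG; rewrite mulrC leMr ?nm_ge0 //.
apply: leT h3 _; rewrite mulrDl lerD2l ler_pdivrMr // ler_peMr //.
Qed.

Lemma MV_le u : `|u| <= 3*N%:R -> nm (MV u) <= 20*X%:R/(1+u^+2)+9*E.
Proof.
move=> hu; have XR: 0 < X%:R:>R by rewrite ltr0n.
have u1: 0 < 1+u^+2 by have := sqr_ge0 u; lra.
have h4 := @sum_zmain_le (4*X) u; have h2 := @sum_zmain_le (2*X) u.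
have {}h4 := h4 (leq_mul (leqnn 4) XN) hu.
have {}h2 := h2 (leq_mul (isT : 2<=4)%N XN) hu.
have -> : MV u = (2*X%:R)^-1%:C*(\sum_[Y<=(4*X)] zmain Y u-\sum_[Y<=(2*X)] zmain Y u).
 rewrite /MV; congr (_*_).
 rewrite [X in _ = X-_](big_cat_nat (n := (2*X).+1)) //= ?ltnS ?leq_mul2r ?orbT //.
 by rewrite addrAC subrr add0r.
rewrite nmM nm_real; last by rewrite invr_ge0; lra.
rewrite mulrC ler_pdivrMr; last by lra.
apply: leT (nmB _ _) _; apply: leT (lerD h4 h2) _.
rewrite !natrM; set v := 1+u^+2 in u1 *.
apply: le_of_eq.
by clearbody v; field; rewrite !gt_eqF.
Qed.

(** Distinct integers on the two sides of [j] contribute at most 3 each: the partial sums of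
    [1/(1+i^2)] stay below [3 - 3/(m+1)]. *)
Lemma sum_inv_sq_shift (U : seq nat) (j : nat) : uniq U ->
 \sum_(i <- U) (1+(j%:R-i%:R)^+2)^-1 <= 6:>R.
Proof.
move=> uU.
have F0 i : 0 <= (1+(j%:R-i%:R)^+2)^-1:>R.
 by rewrite invr_ge0; have := sqr_ge0 (j%:R-i%:R : R); lra.
pose n := (\max_(i <- U) i+j).+1.
have Usub: {subset U <= index_iota 0 (j+n)}.
 move=> i iU; rewrite mem_index_iota /=; have := @leq_bigmax_seq _ U xpredT id i iU isT.
 by rewrite /n /=; clear; lia.
have sub (F : nat -> R) : (forall i, 0 <= F i) -> \sum_(i <- U) F i <= \sum_[i<j+n] F i.
 move=> FF; rewrite [leRHS](bigID (fun i => i \in U)) /= -[leLHS]addr0.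
 apply: lerD; last by apply: sumr_ge0.
 rewrite -[leRHS]big_filter; apply: le_of_eq; apply: perm_big.
 apply: uniq_perm => //; first by rewrite filter_uniq ?iota_uniq.
 by move=> i; rewrite mem_filter; case: (boolP (i \in U)) => //= /Usub ->.
apply: leT (sub _ F0) _.
have hs m : \sum_[i<m] (1 + i%:R^+2)^-1 <= 3-3/(m%:R+1):>R.
 elim: m => [|m IH]; first by rewrite big_geq // add0r divr1; lra.
 rewrite big_nat_recr //=; apply: leT (lerD IH (lexx _)) _.
 have m0: 0 <= m%:R:>R by [].
 have m1: m%:R = 0:>R \/ 1 <= m%:R:>R.
  by case: (m) => [|k]; [left|right; rewrite ler1n].
 rewrite -[m.+1%:R]natr1; set x := m%:R : R in m0 m1 *.
 have h: (1+x^+2)^-1 <= 3/(x+1)-3/(x+1+1).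
  have -> : 3/(x+1)-3/(x+1+1) = 3/((x+1)*(x+1+1)).
   by field; apply/andP; split; rewrite gt_eqF //; lra.
  rewrite ler_pdivlMr; last by nra.
  rewrite mulrC ler_pdivrMr; last by nra.
  case: m1 => [->|m1]; [lra|nra].
 lra.
have hs3 m : \sum_[i<m] (1 + i%:R^+2)^-1 <= 3:>R.
 apply: leT (hs m) _; have : 0 <= 3/(m%:R+1):>R by rewrite divr_ge0 ?addr_ge0.
 lra.
rewrite (big_cat_nat (n := j)) ?leq_addr //=.
have -> : 6 = 3+3:>R by lra.
apply: lerD.
 rewrite big_nat_rev /=; apply: leT (hs3 j).
 apply: ler_sum_nat => i /andP[_ ij]; rewrite add0n.
 have -> : j%:R-(j-i.+1)%:R = i%:R+1:>R by rewrite natrB // -natr1; ring.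
 have i0: 0 <= i%:R:>R by [].
 rewrite lef_pV2 ?posrE; nra.
rewrite [(j+n)%N]addnC sum_addn; apply: leT (hs3 n).
apply: ler_sum => i _; rewrite natrD.
by have -> : j%:R-(i%:R+j%:R) = - i%:R:>R by [ring]; rewrite sqrrN.
Qed.

(** For [p <> q] the main terms cancel: those belonging to [pq], [p], [q] and 1 enter with signs
    [+], [-], [-], [+]. For [p = q] there remains [(p-1) MV], and the normalisation by [sqrt p]
    twice makes its bound independent of [p]. *)
Lemma gram_entry p q y u : prime p -> prime q -> (p<=y)%N -> (q<=y)%N -> `|u| <= 3*N%:R ->
 nm (((Num.sqrt p%:R)^-1*(Num.sqrt q%:R)^-1)%:C*\sum_[n<=(4*X)]
   (Vw n)%:C*(((p%:R*(p %| n)%N%:R-1)*(q%:R*(q %| n)%N%:R-1))%:C*npw n u)) <=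
 13*y%:R*(E+2)+(p == q)%:R*(20*X%:R*(1+u^+2)^-1).
Proof.
move=> pp pq py qy hu.
have p1: 1 <= p%:R:>R by rewrite ler1n prime_gt0.
have q1: 1 <= q%:R:>R by rewrite ler1n prime_gt0.
have pyR: p%:R <= y%:R:>R by rewrite ler_nat.
have qyR: q%:R <= y%:R:>R by rewrite ler_nat.
have sp: 0 < Num.sqrt p%:R:>R by rewrite sqrtr_gt0; lra.
have sq: 0 < Num.sqrt q%:R:>R by rewrite sqrtr_gt0; lra.
have sp2: Num.sqrt p%:R^+2 = p%:R:>R by rewrite sqr_sqrtr.
have sq2: Num.sqrt q%:R^+2 = q%:R:>R by rewrite sqr_sqrtr.
have ace: p = q -> Num.sqrt p%:R*Num.sqrt q%:R = p%:R:>R.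
 by move=> <-; rewrite -expr2 sp2.
move: sp sq sp2 sq2 ace; move: (Num.sqrt p%:R : R) (Num.sqrt q%:R : R) => a c sp sq sp2 sq2 ace.
have SVp := SV_main (prime_gt0 pp) hu; have SVq := SV_main (prime_gt0 pq) hu.
have SV1 := SV_main (ltn0Sn 0) hu; have MVu := MV_le hu.
move: SVp SVq SV1 MVu (fun d (d0 : (0<d)%N) => SV_main d0 hu); move: (MV u) => m SVp SVq SV1 MVu SVd.
rewrite mul1r in SV1.
have E2: 0 <= E+2 by rewrite addr_ge0.
rewrite nmM nm_real; last by rewrite mulr_ge0 // invr_ge0 ltW.
have acV: a^-1*c^-1 = (a*c)^-1 by rewrite invfM.
have ac0: 0 < a*c by rewrite mulr_gt0.
rewrite acV mulrC ler_pdivrMr //.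
have [pqe|pqn] := eqVneq p q.
 have -> : \sum_[n<=(4*X)] (Vw n)%:C*(((p%:R*(p %| n)%N%:R-1)*(q%:R*(q %| n)%N%:R-1))%:C*npw n u) =
  (p%:R-2)%:C*(p%:R%:C*SV p u-m)+(1%:R%:C*SV 1 u-m)+(p%:R-1)%:C * m.
  have -> : (p%:R-2)%:C*(p%:R%:C*SV p u-m)+(1%:R%:C*SV 1 u-m)+(p%:R-1)%:C * m =
   ((p%:R-2) * p%:R)%:C*SV p u+SV 1 u.
   by rewrite realCM !realCB; ring.
  rewrite /SV mulr_sumr -big_split /=; apply: eq_bigr => n _; rewrite -pqe dvd1n.
  have ee: (p %| n)%N%:R%:C*(p %| n)%N%:R%:C = (p %| n)%N%:R%:C :> C.
   by rewrite -realCM -natrM mulnb andbb.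
  have c1: 1%:C = 1 :> C by [].
  have c2: 2%:C = 2 :> C by exact: (rmorph_nat (real_complex RT) 2).
  have ct: true%:R%:C = 1 :> C by [].
  rewrite !realCM !realCB !realCM c1 c2 ?ct; move: ee; move: ((p %| n)%N%:R%:C : C) => e ee.
  have -> : (p%:R%:C*e-1)*(p%:R%:C*e-1) = p%:R%:C * p%:R%:C*(e*e)-2 * p%:R%:C*e+1 by ring.
  rewrite ee; ring.
 rewrite (ace pqe) mul1r; apply: leT (nmD _ _) _; apply: leT (lerD (nmD _ _) (lexx _)) _.
 rewrite !nmM !nm_realE [`|p%:R-1|]ger0_norm; last by lra.
 have n2: `|p%:R-2| <= p%:R:>R by rewrite ler_norml; lra.
 have h1: `|p%:R-2| * nm (p%:R%:C*SV p u-m) <= (p%:R-1)*(p%:R*(E+2)) .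
  apply: ler_pM => //; rewrite ?nm_ge0 //.
  have p2: 2 <= p%:R:>R by rewrite (ler_nat _ 2) prime_gt1.
  rewrite ger0_norm; lra.
 set k := 20*X%:R*_ in MVu *.
 have k0: 0 <= k by rewrite mulr_ge0 ?mulr_ge0 // invr_ge0; have := sqr_ge0 u; lra.
 have h2: (p%:R-1)*nm m <= p%:R*(k+9*E).
  by apply: ler_pM; rewrite ?nm_ge0 //; lra.
 set x := p%:R : R in h1 h2 p1 pyR *; set yy := y%:R : R in pyR *.
 have h3: x*(x*(E+2)) <= x*(yy*(E+2)) by rewrite leMl ?leMr //; lra.
 have h4: x*(9*(E+2)) <= x*(9*yy*(E+2)).
  by rewrite leMl ?leMr //; lra.
 have h5: E+2 <= x*(yy*(E+2)).
  rewrite mulrA ler_peMl //; nra.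
 have h6: 0 <= x*(E+2) by rewrite mulr_ge0 //; lra.
 rewrite mul1r in SV1; rewrite [true%:R*k]mul1r.
 apply: leT (lerD (lerD h1 SV1) h2) _.
 have -> : (13*yy*(E+2)+k)*x = 13*(x*(yy*(E+2)))+x*k by ring.
 have -> : x*(k+9*E) = x*k+(x*(9*(E+2))-18*x) by ring.
 have -> : (x-1)*(x*(E+2)) = x*(x*(E+2))-x*(E+2) by ring.
 have h4': x*(9*yy*(E+2)) = 9*(x*(yy*(E+2))) by ring.
 lra.
have cop: coprime p q by rewrite prime_coprime // dvdn_prime2.
have pq0: (0<p*q)%N by rewrite muln_gt0 !prime_gt0.
have SVpq := SVd _ pq0.
rewrite mul0r addr0.
have -> : \sum_[n<=(4*X)] (Vw n)%:C*(((p%:R*(p %| n)%N%:R-1)*(q%:R*(q %| n)%N%:R-1))%:C*npw n u) =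
  ((p*q)%:R%:C*SV (p*q) u-m)-(p%:R%:C*SV p u-m)-(q%:R%:C*SV q u-m)+(1%:R%:C*SV 1 u-m).
 have -> : ((p*q)%:R%:C*SV (p*q) u-m)-(p%:R%:C*SV p u-m)-(q%:R%:C*SV q u-m)+(1%:R%:C*SV 1 u-m) =
  (p*q)%:R%:C*SV (p*q) u-p%:R%:C*SV p u-q%:R%:C*SV q u+SV 1 u by ring.
 rewrite /SV !mulr_sumr -!sumrB -big_split /=; apply: eq_bigr => n _.
 have ct: true%:R%:C = 1 :> C by [].
 rewrite Gauss_dvd // dvd1n natrM (realCM p%:R q%:R) ct.
 have -> : ((p%:R*(p %| n)%N%:R-1)*(q%:R*(q %| n)%N%:R-1))%:C =
  (p%:R%:C*(p %| n)%N%:R%:C-1)*(q%:R%:C*(q %| n)%N%:R%:C-1) :> C.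
  by rewrite realCM !realCB !realCM.
 have -> : ((p %| n)%N && (q %| n)%N)%:R%:C = (p %| n)%N%:R%:C*(q %| n)%N%:R%:C :> C.
  by rewrite -realCM -natrM mulnb.
 ring.
apply: leT (nmD _ _) _; apply: leT (lerD (nmB _ _) (lexx _)) _.
apply: leT (lerD (lerD (nmB _ _) (lexx _)) (lexx _)) _.
rewrite mul1r in SV1; rewrite [1%:R%:C*SV 1 u]mul1r.
apply: leT (lerD (lerD (lerD SVpq SVp) SVq) SV1) _.
rewrite natrM -sp2 -sq2 in p1 q1 pyR qyR *.
have h1: a*c <= y%:R by nra.
have acE: 1 <= a*c by have : 1 <= a by [rewrite leNgt; apply/negP => h; nra]; have : 1 <= c by [rewrite leNgt; apply/negP => h; nra]; nra.
have -> : 13*y%:R*(E+2)*(a*c) = 13*(y%:R*(a*c))*(E+2) by ring.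
have -> : a^+2*c^+2*(E+2)+a^+2*(E+2)+c^+2*(E+2)+(E+2) =
  (a^+2*c^+2+a^+2+c^+2+1)*(E+2) by ring.
apply: leMr => //.
have : (a*c)*(a*c) <= y%:R*(a*c) by rewrite leMr // ltW.
have : a^+2 <= a^+2*c^+2 by rewrite ler_peMr // sqr_ge0.
have : c^+2 <= a^+2*c^+2 by rewrite ler_peMl // sqr_ge0.
have : 1 <= a^+2*c^+2 by rewrite -exprMn exprn_ege1.
have -> : a^+2*c^+2 = (a*c)*(a*c) by ring.
lra.
Qed.

Section GramPrimes.
Variables (U : seq nat) (ps : seq nat) (y : nat) (f : nat -> C).
Hypotheses (uU : uniq U) (U2 : forall j, j \in U -> (j<=2*N)%N).
Hypotheses (ups : uniq ps) (psP : forall p, p \in ps -> prime p /\ (p<=y)%N).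
Hypotheses (hf : bnd1 f) (small : 13*y%:R^+2*(size U)%:R*(E+2) <= X%:R).
Hypothesis y1 : (1<=y)%N.
Notation tU j := (j%:R-N%:R : R).

Lemma tU_diff i j : i \in U -> j \in U -> `|tU i-tU j| <= 3*N%:R.
Proof.
move=> /U2 hi /U2 hj; have -> : tU i-tU j = i%:R-j%:R by ring.
have : i%:R <= 2*N%:R:>R by rewrite -natrM ler_nat.
have : j%:R <= 2*N%:R:>R by rewrite -natrM ler_nat.
have : 0 <= i%:R:>R by []. have : 0 <= j%:R:>R by [].
rewrite ler_norml; lra.
Qed.

Lemma gram_basic a c : (a<=c<=2*X)%N ->
 \sum_(j <- U) N2 (\sum_(a.+1 <= n < c.+1) f n*npw n (tU j)) <= 121*X%:R*(c-a)%:R.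
Proof.
move=> /andP[ac cX]; pose F n := if (a<n<=c)%N then f n else 0.
pose w j n := (j \in U)%:R%:C*npw n (tU j).
have restr (G : nat -> C) : \sum_[n<=(4*X)] (Vw n)%:C*F n*G n =
  \sum_(a.+1 <= n < c.+1) f n*G n.
 have c4: (c.+1<=(4*X).+1)%N by rewrite ltnS (leqT cX) // leq_mul2r orbT.
 rewrite (big_cat_nat (n := a.+1)) //=; last by apply: leqT c4; rewrite ltnS.
 rewrite [X in X+_]big_nat [X in X+_]big1 ?add0r; last first.
  by move=> n /andP[_ na]; rewrite /F [(a<n)%N]ltnNge -ltnS na /= mulr0 mul0r.
 rewrite (big_cat_nat (n := c.+1)) //= ?ltnS // [X in _+X]big_nat [X in _+X]big1 ?addr0; last first.
  by move=> n /andP[cn _]; rewrite /F [(n<=c)%N]leqNgt cn andbF mulr0 mul0r.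
 apply: eq_big_nat => n /andP[an nc]; rewrite /F an -ltnS nc Vw_eq1 ?mul1r //.
 by apply: leqT cX; rewrite -ltnS.
have K0: 0 <= 121*X%:R:>R by rewrite mulr_ge0.
have hK x : \sum_(x' <- U) nm (\sum_(n <- index_iota 1 (4*X).+1) (Vw n)%:C*w x n*cj (w x' n)) <= 121*X%:R.
 case: (boolP (x \in U)) => xU; last first.
  rewrite big1 // => x' _; rewrite big1 ?nm0 // => n _; by rewrite /w (negbTE xU) mul0r mulr0 mul0r.
 apply: (leV (\sum_(x' <- U) (10*(E+2)+20*X%:R*(1+(x%:R-x'%:R)^+2)^-1))).
  rewrite big_seq [leRHS]big_seq; apply: ler_sum => x' x'U.
  have hu := tU_diff xU x'U.
  have -> : \sum_(n <- index_iota 1 (4*X).+1) (Vw n)%:C*w x n*cj (w x' n) =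
    1%:R%:C*SV 1 (tU x-tU x')-MV (tU x-tU x')+MV (tU x-tU x').
   rewrite subrK mul1r; apply: eq_bigr => n _; rewrite /w xU x'U !mul1r (npwB n (tU x) (tU x')) dvd1n mul1r.
   by rewrite mulrA.
  apply: leT (nmD _ _) _; apply: leT (lerD (SV_main (ltn0Sn 0) hu) (MV_le hu)) _.
  have -> : tU x-tU x' = x%:R-x'%:R by ring.
  rewrite mul1r; set q := _/_; rewrite -/q; lra.
 rewrite big_split /= big_const_seq count_predT iter_addr_0 -[X in X+_]mulr_natl -mulr_sumr.
 have h1 := sum_inv_sq_shift x uU.
 have h2: (size U)%:R*(E+2)*13 <= X%:R.
  apply: leT small; have yR: 1 <= y%:R^+2:>R by rewrite exprn_ege1 // ler1n.
  have q0: 0 <= (size U)%:R*(E+2) by rewrite mulr_ge0 ?addr_ge0.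
  nra.
 have h3 := leMl (mulr_ge0 (ler0n R 20) (ler0n R X)) h1.
 have q0: 0 <= (size U)%:R*(E+2) by rewrite mulr_ge0 ?addr_ge0.
 lra.
have := bessel (I := nat) (J := nat) F K0 Vw_ge0 hK.
have -> : \sum_(x <- U) N2 (\sum_(y0 <- index_iota 1 (4*X).+1) (Vw y0)%:C*F y0*w x y0) =
  \sum_(j <- U) N2 (\sum_(a.+1 <= n < c.+1) f n*npw n (tU j)).
 rewrite big_seq [RHS]big_seq; apply: eq_bigr => j jU; rewrite restr; congr N2.
 by apply: eq_bigr => n _; rewrite /w jU mul1r.
move=> h; apply: leT h _; apply: leMl => //.
apply: (leV (\sum_[n<=(4*X)] (if (a<n<=c)%N then 1 else 0))).
 apply: ler_sum => n _; rewrite /F; case: ifP => _; last by rewrite N20 mulr0.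
 apply: (leV (1*1)); last by rewrite mulr1.
 by apply: ler_pM; rewrite ?Vw_ge0 ?N2_ge0 ?Vw_le1 ?nm_N2.
rewrite -big_mkcond /= -big_filter big_const_seq count_predT iter_addr_0 ler_nat size_filter.
have : (count (fun n => a<n<=c) (index_iota 1 (4*X).+1)<=size (index_iota a.+1 c.+1))%N.
 rewrite -size_filter; apply: uniq_leq_size; first by rewrite filter_uniq ?iota_uniq.
 by move=> n; rewrite mem_filter mem_index_iota => /andP[/andP[h1 h2] _]; rewrite mem_index_iota h1 ltnS.
by rewrite size_iota subSS.
Qed.

(** [bessel] for the vectors indexed by pairs [(p, j)]. In a row of the Gram matrix the errors add
    up to at most [X], by the hypothesis [small], and the entries with equal primes to at most
    [20 X] times 6: together [121 X]. *)
Lemma gram_primes :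
 \sum_(p <- ps) \sum_(j <- U)
   p%:R^-1*N2 (\sum_[n<=X] f n*((p%:R*(p %| n)%N%:R-1)%:C*npw n (tU j))) <=
 121*X%:R^+2.
Proof.
(* Membership of the indices is built into [w], because [bessel] asks for the row bound at every
   index. *)
pose w (x : nat*nat) n := ((x.1 \in ps) && (x.2 \in U))%:R%:C *
  ((Num.sqrt x.1%:R)^-1%:C*((x.1%:R*(x.1 %| n)%N%:R-1)%:C*npw n (tU x.2))) : C.
pose F n := if (n<=X)%N then f n else 0.
have restr (G : nat -> C) : \sum_[n<=(4*X)] (Vw n)%:C*F n*G n =
  \sum_[n<=X] f n*G n.
 have X4: (X.+1<=(4*X).+1)%N by rewrite ltnS leq_pmull.
 rewrite (big_cat_nat (n := X.+1)) //= [X in _+X]big_nat [X in _+X]big1 ?addr0; last first.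
  by move=> n /andP[cn _]; rewrite /F leqNgt cn mulr0 mul0r.
 apply: eq_big_nat => n /andP[_ nX]; rewrite ltnS in nX; rewrite /F nX Vw_eq1 ?mul1r //.
 by apply: leqT nX _; rewrite leq_pmull.
have K0: 0 <= 121*X%:R:>R by rewrite mulr_ge0.
pose rI := [seq (p, j) | p <- ps, j <- U].
have szps: (size ps<=y)%N.
 have -> : y = size (index_iota 1 y.+1) by rewrite size_iota subn1.
 apply: uniq_leq_size => // p /psP [pp py]; by rewrite mem_index_iota ltnS py prime_gt0.
have hK x : \sum_(x' <- rI) nm (\sum_(n <- index_iota 1 (4*X).+1) (Vw n)%:C*w x n*cj (w x' n)) <= 121*X%:R.
 case: (boolP ((x.1 \in ps) && (x.2 \in U))) => [/andP[x1 x2]|nx]; last first.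
  rewrite big1 // => x' _; rewrite big1 ?nm0 // => n _; by rewrite /w (negbTE nx) mul0r mulr0 mul0r.
 rewrite big_allpairs.
 apply: (leV (\sum_(q <- ps) \sum_(i <- U) (13*y%:R*(E+2) +
   (x.1 == q)%:R*(20*X%:R*(1+(x.2%:R-i%:R)^+2)^-1)))).
  rewrite big_seq [leRHS]big_seq; apply: ler_sum => q qps.
  rewrite big_seq [leRHS]big_seq; apply: ler_sum => i iU.
  have [pp py] := psP x1; have [pq qy] := psP qps.
  have hu := tU_diff x2 iU.
  have -> : x.2%:R-i%:R = tU x.2-tU i:>R by ring.
  apply: leT (gram_entry pp pq py qy hu).
  apply: le_of_eq; congr nm.
  rewrite mulr_sumr; apply: eq_bigr => n _.
  rewrite /w /= x1 x2 qps iU !mul1r !conjM !conj_real (npwB n (tU x.2) (tU i)) !realCM.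
  ring.
 under eq_bigr do rewrite big_split /=.
 rewrite big_split /= [X in _+X](eq_bigr (fun q => (x.1 == q)%:R *
   (\sum_(i <- U) 20*X%:R*(1+(x.2%:R-i%:R)^+2)^-1))); last first.
  by move=> q _; rewrite mulr_sumr.
 have h1: \sum_(q <- ps) (x.1 == q)%:R*(\sum_(i <- U) 20*X%:R*(1+(x.2%:R-i%:R)^+2)^-1) <= 120*X%:R:>R.
  rewrite (bigD1_seq x.1) //= eqxx mul1r [X in _+X]big1 ?addr0; last by move=> q; rewrite eq_sym => /negbTE ->; rewrite mul0r.
  rewrite -mulr_sumr; have := leMl (mulr_ge0 (ler0n R 20) (ler0n R X)) (sum_inv_sq_shift x.2 uU).
  lra.
 have h2: \sum_(q <- ps) \sum_(i <- U) 13*y%:R*(E+2) <= X%:R.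
  rewrite !big_const_seq !count_predT !iter_addr_0 -mulrnA -[leLHS]mulr_natl.
  apply: leT small; rewrite natrM.
  have q0: 0 <= 13*y%:R*(E+2)*(size U)%:R by rewrite !mulr_ge0 ?addr_ge0.
  have : (size ps)%:R <= y%:R:>R by rewrite ler_nat.
  move=> /(leMr q0) h; apply: leT (_ : _ <= y%:R*(13*y%:R*(E+2)*(size U)%:R)) _.
   apply: leT h; apply: le_of_eq; ring.
  apply: le_of_eq; ring.
 lra.
have := bessel F K0 Vw_ge0 hK; rewrite big_allpairs.
have -> : \sum_(p <- ps) \sum_(j <- U)
   N2 (\sum_(y0 <- index_iota 1 (4*X).+1) (Vw y0)%:C*F y0*w (p, j) y0) =
 \sum_(p <- ps) \sum_(j <- U)
   p%:R^-1*N2 (\sum_[n<=X] f n*((p%:R*(p %| n)%N%:R-1)%:C*npw n (tU j))).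
 rewrite big_seq [RHS]big_seq; apply: eq_bigr => p pps.
 rewrite big_seq [RHS]big_seq; apply: eq_bigr => j jU.
 have -> : p%:R^-1 = N2 ((Num.sqrt p%:R)^-1%:C):>R by rewrite N2_real exprVn sqr_sqrtr.
 rewrite -N2M restr; congr N2; rewrite mulr_sumr; apply: eq_bigr => n _.
 rewrite /w /= pps jU mul1r; ring.
move=> h; apply: leT h _; rewrite expr2 mulrA; apply: leMl => //.
apply: (leV (\sum_[n<=X] 1)); last by rewrite sumr_const_nat subn1.
have X4: (X.+1<=(4*X).+1)%N by rewrite ltnS leq_pmull.
rewrite (big_cat_nat (n := X.+1)) //= [X in _+X]big_nat [X in _+X]big1 ?addr0; last first.
 by move=> n /andP[cn _]; rewrite /F leqNgt cn N20 mulr0.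
apply: ler_sum => n _; apply: (leV (1*1)); last by rewrite mulr1.
apply: ler_pM; rewrite ?Vw_ge0 ?N2_ge0 ?Vw_le1 //; rewrite /F; case: ifP => _; rewrite ?N20 ?nm_N2 //.
Qed.
End GramPrimes.
End Gram.

(** * Iteration over the windows *)

Lemma thr_gt0 al c : 0 < thr al c. Proof. exact: rexp_gt0. Qed.

Lemma good_Q g w w' al t i : ~~ bad g w w' al t -> (i<nI w w')%N ->
 N2 (Qb g (cw w) i t) <= thr al (cw w i)^+2.
Proof.
move=> /hasPn h iI; apply: N2_le; rewrite leNgt; apply: h.
by rewrite mem_iota.
Qed.
Lemma bad_Q g w w' al t : bad g w w' al t ->
 exists2 i, (i<nI w w')%N & thr al (cw w i)^+2 <= N2 (Qb g (cw w) i t).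
Proof.
move=> bd; have [i iI h] : exists2 i, i \in iota 0 (nI w w') & thr al (cw w i) < nm (Qb g (cw w) i t).
 exact/hasP.
rewrite mem_iota /= add0n in iI; exists i => //.
by rewrite -nm_sqr lerXn2r ?nnegrE ?nm_ge0 ?ltW ?thr_gt0.
Qed.

Lemma Wm_le c c' : Wm c c' <= c'%:R.
Proof.
apply: leT (pim_le c c'); apply: ler_sum => p pp.
by rewrite invf_le1 ?ltr0n ?ler1n prime_gt0.
Qed.

Lemma cw_small (X w w' : nat) : (0<X)%N -> (0<w<=w')%N -> 15*w'%:R <= rln X%:R ->
 8*(cw w (nI w w'))%:R^+2*Ww w w' <= X%:R /\ (2*cw w (nI w w')<=X)%N.
Proof.
move=> X0 ww h; have h1 := rln_cw_le ww (leqnn _).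
have XR: 0 < X%:R:>R by rewrite ltr0n.
have c0: 0 < (cw w (nI w w'))%:R:>R by rewrite ltr0n cw_gt0.
have c1: 1 <= (cw w (nI w w'))%:R:>R by rewrite ler1n cw_gt0.
have w1: 1 <= w'%:R:>R by rewrite ler1n; case/andP: ww => a b; apply: leqT b.
have e3: 8 <= rexp (3*w'%:R).
 have e1: 2 <= rexp 1 by have := rexp_ge1D 1; lra.
 apply: (leV (rexp (1*3%:R))).
  rewrite rexpX; have -> : 8 = 2^+3:>R by ring.
  by rewrite lerXn2r ?nnegrE // rexp_ge0.
 rewrite rexp_le; lra.
have h2: 8*(cw w (nI w w'))%:R^+3 <= X%:R:>R.
 rewrite -[X in 8*X^+3](rlnK c0) -[leRHS](rlnK XR) -rexpX.
 apply: (leV (rexp (3*w'%:R)*rexp (12*w'%:R))).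
  apply: ler_pM => //; first exact: rexp_ge0.
  rewrite rexp_le; lra.
 rewrite -rexpD rexp_le; lra.
split.
 apply: leT h2; rewrite [leRHS](_ : _ = 8*(cw w (nI w w'))%:R^+2*(cw w (nI w w'))%:R); last by ring.
 apply: leMl; first by rewrite mulr_ge0 ?sqr_ge0.
 exact: Wm_le.
rewrite -(ler_nat R) natrM; apply: leT h2.
have : (cw w (nI w w'))%:R <= (cw w (nI w w'))%:R^+3:>R by rewrite ler_eXnr.
lra.
Qed.

(** One iteration in numbers: [L] and [lam] are the logarithms of a new and an old block, and [l] is
    about [L/lam]. Raising the exponent from [al] to [al'] gains [2L/Z^2 >= Z^14]. The losses are
    [2 al lam <= 8 Z^8], from rounding up [l], and the multiplicities, whose logarithm is about
    [64 Z l], a small fraction of [L/Z^2] since [lam >= Z^4/2]. *)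
Lemma step_numeric (Z L lam al al' : R) (l : nat) :
 1000 <= Z -> Z^+16/2 <= L -> L <= 4*Z^+65 -> Z^+4/2 <= lam -> lam <= 4*Z^+8 ->
 l.-1%:R * lam <= L -> 0 <= al <= 1 -> al+Z ^- 2 <= al' ->
 rexp (- (al'*L))^+2*(rexp (- (al * lam)) ^- 2)^+l*(4 * l.+2%:R)^+l.+1 <= rexp (- Z^+3).
Proof.
move=> Z1 L1 L2 m1 m2 hl /andP[a0 a1] ha.
have Z0: 0 < Z by lra.
have ZX n : 1 <= Z^+n by rewrite exprn_ege1 //; lra.
have L0: 0 < L by have := ZX 16; lra.
have lam0: 0 < lam by have := ZX 4%N; lra.
have p0: 0 < 4 * l.+2%:R:>R by rewrite mulr_gt0 ?ltr0n.
have E1: rexp (- (al'*L))^+2 = rexp (- (2*(al'*L))) by rewrite -rexpX; congr rexp; ring.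
have E2: (rexp (- (al * lam)) ^- 2)^+l = rexp (2*(al * lam) * l%:R).
 by rewrite rexpX; congr (_^+_); rewrite -rexpX -rexpN; congr rexp; ring.
have E3: (4 * l.+2%:R)^+l.+1 = rexp (rln (4 * l.+2%:R) * l.+1%:R) by rewrite rexpX rlnK.
rewrite E1 E2 E3 -!rexpD rexp_le {E1 E2 E3}.
have lle: l%:R <= 1+l.-1%:R:>R by rewrite nat1r ler_nat; case: (l).
set m : R := l.-1%:R in hl lle; have m0: 0 <= m by exact: ler0n.
have mZ: m*Z^+4 <= 2*L by nra.
have q64: rln (4 * l.+2%:R) <= 64*Z.
 apply: (leV (rln (Z^+64))).
  apply: rln_le => //; rewrite -[l.+2%:R]natr1 -[l.+1%:R]natr1.
  have h1: m <= 8*Z^+61.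
   have : m*Z^+4 <= 8*Z^+61*Z^+4 by rewrite -mulrA -exprD; lra.
   by rewrite ler_pM2r // exprn_gt0.
  have h2: Z^+61*1000 <= Z^+64.
   rewrite -[64%N]/(61+3)%N exprD leMl ?exprn_ge0 ?(ltW Z0) //.
   have : 1 <= Z^+2 by exact: ZX.
   rewrite exprS; nra.
  have := ZX 61%N; lra.
 rewrite rlnX //; have := rln_le_sub1 Z0; lra.
have aL: 2*L/Z^+2 <= 2*(al'*L)-2*(al*L).
 have := leMr (ltW L0) ha; rewrite mulrDl [Z ^- 2*L]mulrC.
 have -> : 2*L/Z^+2 = 2*(L/Z^+2) by ring.
 lra.
have alm: al * lam * l%:R <= al*L+lam.
 apply: (leV (al * lam*(1+m))); first by rewrite leMl // mulr_ge0 // ltW.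
 have : al*(m * lam) <= al*L by rewrite leMl.
 have : al * lam <= lam by rewrite ler_piMl // ltW.
 lra.
have qm: rln (4 * l.+2%:R) * l.+1%:R <= 64*Z*(m+2).
 apply: ler_pM => //; last by rewrite -natr1; lra.
 apply: rln_ge0; have : 1 <= l.+2%:R:>R by rewrite ler1n.
 lra.
have mZ1: Z * m <= L/Z^+2*(2/Z).
 have -> : L/Z^+2*(2/Z) = 2*L/Z^+3 by field; rewrite gt_eqF.
 rewrite ler_pdivlMr ?exprn_gt0 //; apply: leT mZ; apply: le_of_eq; ring.
set a := L/Z^+2 in mZ1 *.
have aLe: 2*L/Z^+2 = 2*a by rewrite /a; ring.
have a14: Z^+14/2 <= a.
 rewrite /a ler_pdivlMr ?exprn_gt0 // mulrAC -exprD; exact: L1.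
have Z14: Z^+8*1000 <= Z^+14.
 rewrite -[14%N]/(8+6)%N exprD leMl ?exprn_ge0 ?(ltW Z0) //.
 have : 1 <= Z^+5 by exact: ZX.
 rewrite exprS; nra.
have z3: Z^+3 <= Z^+8 by rewrite ler_eXn2l //; lra.
have z1: Z <= Z^+8 by rewrite -[leLHS]expr1 ler_eXn2l //; lra.
have aZ: a*(2/Z) <= a/100.
 have ap: 0 <= a by have := ZX 14%N; lra.
 apply: leMl => //; rewrite ler_pdivrMr //; lra.
rewrite aLe in aL; move: aL alm qm m2 mZ1 aZ a14 Z14 z3 z1.
set x1 := al'*L; set x2 := al*L; set x3 := al * lam * l%:R; set x4 := rln _*_.
set z8 := Z^+8; set z14 := Z^+14; set zz3 := Z^+3; set a2 := a*(2/Z); set zm := Z * m.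
have -> : 64*Z*(m+2) = 64*zm+128*Z by rewrite /zm; ring.
have -> : 2*(al * lam) * l%:R = 2*x3 by rewrite /x3; ring.
clearbody x1 x2 x3 x4 z8 z14 zz3 a2 zm a; lra.
Qed.

Lemma step_tail (z c : R) : 1000 <= z -> 0 <= c ->
 2*(3*z^+130)^+2*(3*z^+12*(90*c*rexp (- z^+3)))*z <= c.
Proof.
move=> z1 c0; have Z0: 0 < z by lra.
have e1: rexp (- z^+3)*z^+275 <= 1.
 have -> : z^+275 = rexp (rln z*275%:R) by rewrite rexpX rlnK.
 rewrite -rexpD -[leRHS]rexp0 rexp_le.
 have h1 := rln_le_sub1 Z0; have : z*(1000*1000) <= z^+3.
  by rewrite exprS leMl ?(ltW Z0) //; nra.
 lra.
have -> : 2*(3*z^+130)^+2*(3*z^+12*(90*c*rexp (- z^+3)))*z =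
  c*(4860*(rexp (- z^+3)*z^+273)) by ring.
rewrite -[leRHS]mulr1; apply: leMl => //.
apply: leT e1; rewrite mulrCA; apply: leMl; first exact: rexp_ge0.
rewrite -[275%N]/(2+273)%N exprD; apply: leMr; first by rewrite exprn_ge0 // ltW.
by clear -z1; nra.
Qed.

Section Steps2.
Variables (f g : nat -> C) (b X X' T : nat).
Hypotheses (hf : bnd1 f) (hg : bnd1 g).
Hypotheses (hm : qmult b g f) (XX' : (X<=X'<=3*X)%N).
Hypotheses (X_gt0 : (0<X)%N) (TX : (T<=X)%N).
Notation tt j := (j%:R-T%:R : R).

Lemma level_use w w' (S : pred nat) (B : R) : (3<=w<=w')%N -> (b<=2 ^ w)%N -> 1 <= Ww w w' ->
 15*w'%:R <= rln X%:R -> 0 <= B ->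
 (forall i, (i<nI w w')%N -> \sum_(0 <= j < (2*T).+1 | S j)
   N2 (Qb g (cw w) i (tt j))*N2 (Rb f (cw w) X X' i (tt j)) <= B) ->
 \sum_(0 <= j < (2*T).+1 | S j) N2 (fh f X X' (tt j)) <=
 36*CLS*((Ww w w')^-1+w%:R^-1)+2*(nI w w')%:R^+2*B.
Proof.
move=> /andP[w3 ww] bw W1 hX B0 hB.
have w0: (0<w)%N by apply: leqT w3.
have [s1 s2] := cw_small X_gt0 (introT andP (conj w0 ww)) hX.
apply: leT (level_bound hf hm (cw_mono w) (cw_step w) (cw_gt0 w 0) bw w3 XX' X_gt0 W1 S TX s1) _.
rewrite lerD2l -/(Ww w w').
apply: (leV (2*(nI w w')%:R/Ww w w'^+2*((nI w w')%:R*B))).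
 apply: leMl; first by rewrite divr_ge0 ?sqr_ge0 // mulr_ge0.
 apply: (leV (\sum_[i<nI w w'] B)).
  by apply: ler_sum_nat => i /andP[_ iI]; apply: hB.
 by rewrite sumr_const_nat subn0 mulr_natl.
have i1: (Ww w w'^+2)^-1 <= 1 by rewrite invf_le1 ?exprn_gt0 ?exprn_ege1 //; lra.
have A0: 0 <= 2*(nI w w')%:R^+2*B by rewrite !mulr_ge0.
have -> : 2*(nI w w')%:R/Ww w w'^+2*((nI w w')%:R*B) =
  2*(nI w w')%:R^+2*B*(Ww w w'^+2)^-1 by ring.
by rewrite ler_piMr.
Qed.

(** The moment of order [l = 0] suffices: since [T c <= X] for every block, [Rb] is already as long
    as the range of [t]. *)
Lemma first_level u u' al : (3<=u<=u')%N -> (b<=2 ^ u)%N -> 1 <= Ww u u' ->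
 15*u'%:R <= rln X%:R -> 0 <= al -> (T*cw u (nI u u')<=X)%N ->
 \sum_(0 <= j < (2*T).+1 | ~~ bad g u u' al (tt j)) N2 (fh f X X' (tt j)) <=
 36*CLS*((Ww u u')^-1+u%:R^-1)+2*(nI u u')%:R^+2*(rexp (- (al*u%:R))*(720*CLS)).
Proof.
move=> uu bu W1 hX al0 hT; have C1 := CLS_ge1; have C0: 0 <= CLS by lra.
have u0: (0<u)%N by case/andP: uu => h _; apply: leqT h.
have [s1 s2] := cw_small X_gt0 (introT andP (conj u0 (proj2 (andP uu)))) hX.
apply: level_use => //; first by rewrite !mulr_ge0 ?rexp_ge0.
move=> i iI; have ciX: (cw u i<=cw u (nI u u'))%N by apply: cw_leI; apply: ltnW.
apply: (leV (\sum_[j<(2*T).+1] rexp (- (al*u%:R)) *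
  (N2 (Qb g (cw u) 0 (tt j))^+0*N2 (Rb f (cw u) X X' i (tt j))))).
 rewrite [leLHS]big_mkcond /=; apply: ler_sum => j _; case: ifP => [gd|_]; last first.
  by rewrite !mulr_ge0 ?rexp_ge0 ?N2_ge0.
 rewrite expr0 mul1r; apply: leMr; first exact: N2_ge0.
 apply: leT (good_Q gd iI) _; rewrite /thr -rexpX rexp_le.
 have := rln_cw_ge u i; set q := rln _ => hq; nra.
rewrite -mulr_sumr; apply: leMl; first exact: rexp_ge0.
have := @pair_bound f g X X' T hf hg XX' X_gt0 u 0 u i 0 u0.
rewrite expr1 expn0 muln1; have -> : 90*CLS*(4*2%:R) = 720*CLS by ring.
apply; first by apply: leqT ciX _; apply: leqT s2; rewrite leq_pmull.
apply: (@leq_trans (X %/ cw u i)%N); last by rewrite leq_pmull.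
rewrite leq_divRL ?cw_gt0 //; apply: leqT hT; by rewrite leq_mul2l ciX orbT.
Qed.

(** At a point bad for the old window some block polynomial exceeds its threshold, so the ratio of
    the two squares, raised to the power [l], may be inserted as a factor at least 1. With [l] from
    [up_log] the lengthened polynomial reaches [T], and goodness for the new window supplies the
    saving. *)
Lemma step_level (v w w' : nat) (al al' : R) (z := (kap ^ v)%N) : (2<=v)%N ->
 (z ^ 16<=w<=w')%N -> (w'<=z ^ 65)%N -> (b<=2 ^ w)%N -> 1 <= Ww w w' ->
 15*w'%:R <= rln X%:R -> 0 <= al <= 1 -> al+z%:R ^- 2 <= al' ->
 \sum_(0 <= j < (2*T).+1 | bad g (z ^ 4) (z ^ 8) al (tt j) && ~~ bad g w w' al' (tt j))
  N2 (fh f X X' (tt j)) <=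
 36*CLS*((Ww w w')^-1+w%:R^-1)+CLS/z%:R.
Proof.
move=> v2 /andP[zw ww] wz bw W1 hX hal hal'; have C1 := CLS_ge1; have C0: 0 <= CLS by lra.
have z1: (1000<=z)%N.
 by apply: (@leq_trans (kap ^ 2)%N); [rewrite kapE|rewrite leq_exp2l].
have z0: (0<z)%N by apply: leqT z1.
have ZR: 1000 <= z%:R:>R by rewrite ler_nat.
have w3: (3<=w)%N.
 apply: leqT zw; apply: (@leq_trans z); first by apply: leqT z1.
 by rewrite -{1}[z]expn1 leq_exp2l // (leqT _ z1).
have w0: (0<w)%N by apply: leqT w3.
have u0: (0<z ^ 4)%N by rewrite expn_gt0 z0.
have uu: (0<z ^ 4<=z ^ 8)%N by rewrite u0 leq_exp2l // (leqT _ z1).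
have [s1 s2] := cw_small X_gt0 (introT andP (conj w0 ww)) hX.
set S := (fun j => bad g (z ^ 4) (z ^ 8) al (tt j) && ~~ bad g w w' al' (tt j)).
have key i : (i<nI w w')%N -> \sum_(0 <= j < (2*T).+1 | S j)
   N2 (Qb g (cw w) i (tt j))*N2 (Rb f (cw w) X X' i (tt j)) <=
   (nI (z ^ 4) (z ^ 8))%:R*(90*CLS*rexp (- z%:R^+3)).
 move=> iI; have ciX: (cw w i<=X)%N.
  apply: leqT (cw_leI w (ltnW iI)) _; apply: leqT s2; by rewrite leq_pmull.
 pose l i' := up_log (cw (z ^ 4) i') (cw w i).
 pose D i' := thr al' (cw w i)^+2*(thr al (cw (z ^ 4) i') ^- 2)^+l i'.
 have D0 i' : 0 <= D i'.
  by rewrite mulr_ge0 ?exprn_ge0 ?invr_ge0 ?exprn_ge0 // ltW // thr_gt0.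
 apply: (leV (\sum_[j<(2*T).+1] \sum_(0 <= i' < nI (z ^ 4) (z ^ 8))
   D i'*(N2 (Qb g (cw (z ^ 4)) i' (tt j))^+l i'*N2 (Rb f (cw w) X X' i (tt j))))).
  rewrite [leLHS]big_mkcond /=; apply: ler_sum => j _.
  have T0 i' : 0 <= D i'*(N2 (Qb g (cw (z ^ 4)) i' (tt j))^+l i'*N2 (Rb f (cw w) X X' i (tt j))).
   by apply: mulr_ge0 => //; apply: mulr_ge0; rewrite ?exprn_ge0 ?N2_ge0.
  case: ifP => [/andP[bd gd]|_]; last by apply: sumr_ge0.
  have [i' i'I hi'] := bad_Q bd.
  rewrite (bigD1_seq i') ?mem_index_iota ?iota_uniq //=.
  rewrite -[leLHS]addr0; apply: lerD; last by apply: sumr_ge0.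
  rewrite mulrA; apply: leMr; first exact: N2_ge0.
  apply: leT (good_Q gd iI) _; rewrite /D -mulrA ler_peMr ?sqr_ge0 //.
  rewrite -exprMn exprn_ege1 // mulrC ler_pdivlMr ?mul1r // exprn_gt0 //; exact: thr_gt0.
 rewrite exchange_big /=.
 apply: (leV (\sum_(0 <= i' < nI (z ^ 4) (z ^ 8)) 90*CLS*rexp (- z%:R^+3))); last first.
  by rewrite sumr_const_nat subn0 -[leLHS]mulr_natl.
 apply: ler_sum_nat => i' /andP[_ i'I]; rewrite -mulr_sumr.
 have c1 := cw_gt1 i' u0.
 have cl: (cw w i<=cw (z ^ 4) i' ^ l i')%N by exact: up_logP.
 have hT: (T<=2*(X %/ cw w i*cw (z ^ 4) i' ^ l i'))%N.
  apply: leqT TX _.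
  have q1: (0<X %/ cw w i)%N by rewrite divn_gt0 // cw_gt0.
  apply: (@leq_trans (2*(X %/ cw w i*cw w i))%N); last by rewrite !leq_mul2l cl !orbT.
  have := divn_eq X (cw w i); have := ltn_pmod X (cw_gt0 w i).
  move: q1; move: (X %/ cw w i)%N (X %% cw w i)%N (cw w i) => q r c q1 r1 e1; clear -q1 r1 e1; nia.
 have := @pair_bound f g X X' T hf hg XX' X_gt0 (z ^ 4)%N i' w i (l i') u0 ciX hT => PB.
 apply: leT (leMl (D0 i') PB) _.
 have -> : D i'*(90*CLS*(4*(l i').+2%:R)^+(l i').+1) =
   90*CLS*(D i'*(4*(l i').+2%:R)^+(l i').+1) by ring.
 apply: leMl; first by rewrite mulr_ge0.
 apply: step_numeric => //.
 - by rewrite -natrX; apply: leT (rln_cw_ge w i); rewrite leMr ?invr_ge0 // ler_nat.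
 - apply: leT (rln_cw_le (introT andP (conj w0 ww)) (ltnW iI)) _.
  by rewrite leMl // -natrX ler_nat.
 - by rewrite -natrX; apply: rln_cw_ge.
 - by rewrite -natrX; apply: rln_cw_le uu (ltnW i'I).
 rewrite -rlnX ?ltr0n ?cw_gt0 // -natrX; apply: rln_le; first by rewrite ltr0n expn_gt0 cw_gt0.
 rewrite ler_nat; have cw1 := cw_gt1 i w0.
 by have /andP[h _] := up_log_bounds c1 cw1; apply: ltnW.
apply: leT (level_use _ bw W1 hX _ key) _; first by rewrite w3.
 by rewrite !mulr_ge0 ?rexp_ge0.
rewrite lerD2l.
have Z0: 0 < z%:R:>R by rewrite ltr0n.
have ZX n : 0 <= (z%:R : R)^+n by rewrite exprn_ge0 // ltW.
have n1: (nI w w')%:R <= 3*z%:R^+130:>R.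
 rewrite -natrX -natrM ler_nat /nI -mulnA leq_mul2l /=.
 by rewrite -[130%N]/(65+65)%N expnD leq_mul // (leqT ww).
have n2: (nI (z ^ 4) (z ^ 8))%:R = 3*z%:R^+12:>R.
 by rewrite /nI -mulnA -expnD natrM natrX.
rewrite n2 ler_pdivlMr //.
apply: (leV (2*(3*z%:R^+130)^+2*(3*z%:R^+12*(90*CLS*rexp (- z%:R^+3)))*z%:R)).
 apply: leMr; first exact: ltW.
 apply: leMr; first by rewrite !mulr_ge0 ?rexp_ge0.
 by apply: leMl => //; rewrite lerXn2r ?nnegrE ?mulr_ge0.
exact: step_tail.
Qed.
End Steps2.

(** The exponents increase with the level but stay below 1/100. The increment [z^-2] demanded by
    [step_numeric] fits because [z] becomes [z^4] at the next level, see [lev_al_incr]. *)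
Definition lev_al (v : nat) : R := 1/100-(kap ^ v)%:R^-1.
Definition badv g v t := bad g ((kap ^ v) ^ 4) ((kap ^ v) ^ 8) (lev_al v) t.

Lemma invr_le (x y : R) : 0 < x -> x <= y -> y^-1 <= x^-1.
Proof. by move=> x0 xy; rewrite lef_pV2 ?posrE // (lt_le_trans x0). Qed.

Lemma z_ge v : (2<=v)%N -> 1000 <= (kap ^ v)%:R:>R /\ 100*v%:R <= (kap ^ v)%:R:>R.
Proof.
move=> v2; split.
 by rewrite ler_nat; apply: (@leq_trans (kap ^ 2)%N); [rewrite kapE|rewrite leq_exp2l].
rewrite -natrM ler_nat; elim: v v2 => // v IH; rewrite leq_eqVlt => /orP [/eqP <-|v2]; first by rewrite kapE.
rewrite expnS {1}kapE; have := IH v2; move: (kap ^ v)%N => q h; clear -h v2; lia.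
Qed.

Lemma zinv v : (2<=v)%N -> 0 < (kap ^ v)%:R^-1:>R /\ (kap ^ v)%:R^-1 <= 1/1000:>R.
Proof.
move=> /z_ge [z1 _]; split; first by rewrite invr_gt0; lra.
by rewrite -[leLHS]div1r ler_pM2l // lef_pV2 ?posrE //; lra.
Qed.

Lemma lev_al_incr (q : R) : 0 < q -> q <= 1/1000 -> 1/100-q+q^+2 <= 1/100-q^+4.
Proof.
move=> q0 q1; have h1: q^+2 <= q/1000 by rewrite expr2; nra.
have h3: q^+4 <= q^+2 by apply: ler_wiXn2l => //; lra.
lra.
Qed.

Lemma Wlev v : v%:R <= Ww ((kap ^ v) ^ 4) ((kap ^ v) ^ 8).
Proof.
case: v => [|v]; first by apply: sumr_ge0 => *; rewrite invr_ge0.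
have -> : ((kap ^ v.+1) ^ 8 = (kap ^ v.+1) ^ 4*kap ^ (4*v.+1))%N.
 by rewrite -!expnM -expnD; congr (_ ^ _)%N; clear; lia.
have w3: (3<=(kap ^ v.+1) ^ 4)%N.
 rewrite -expnM; apply: (@leq_trans (kap ^ 1)%N); [by rewrite kapE|rewrite leq_exp2l //; clear; lia].
apply: leT (Ww_ge _ w3).
by have -> : v.+1%:R = (4*v.+1)%:R/4:>R by rewrite natrM; field.
Qed.

Lemma level_tail (z al c : R) : 1000 <= z -> 1/200 <= al -> 0 <= c ->
 2*(3*z^+12)^+2*(rexp (- (al*z^+4))*(720*c)) <= c/z.
Proof.
move=> z1 al0 c0; have Z0: 0 < z by lra.
have e1: rexp (- (al*z^+4))*z^+27 <= 1.
 have -> : z^+27 = rexp (rln z*27%:R) by rewrite rexpX rlnK.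
 rewrite -rexpD -[leRHS]rexp0 rexp_le.
 have h1 := rln_le_sub1 Z0.
 have h2: 1/200*z^+4 <= al*z^+4 by rewrite leMr // exprn_ge0 // ltW.
 have h3: z*(1000*1000) <= z^+4.
  rewrite exprS leMl ?(ltW Z0) //; have : 1000*1000 <= z^+2 by nra.
  by move=> h; apply: leT h _; rewrite ler_eXn2l //; lra.
 lra.
rewrite ler_pdivlMr //.
have -> : 2*(3*z^+12)^+2*(rexp (- (al*z^+4))*(720*c))*z =
  c*(18*720*(rexp (- (al*z^+4))*z^+25)) by ring.
rewrite -[leRHS]mulr1; apply: leMl => //.
apply: leT e1; rewrite mulrCA; apply: leMl; first exact: rexp_ge0.
rewrite -[27%N]/(2+25)%N exprD; apply: leMr; first by rewrite exprn_ge0 // ltW.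
by clear -z1; nra.
Qed.

Lemma levels_sum (q c w1 w2 w3 w4 z v tl SS : R) : 0 <= q -> 0 <= c -> w1 <= q -> w2 <= q -> w3 <= 4*q -> w4 <= q ->
 z <= q -> v <= q -> tl <= c*q ->
 36*c*(w1+w2)+tl+(100*c*v+(36*c*(w3+w4)+c*z+SS)) <= 400*c*q+SS.
Proof.
move=> q0 c0 h1 h2 h3 h4 h5 h6 h7; have cq := mulr_ge0 c0 q0.
have -> : 400*c*q = 36*c*(q+q)+c*q+(100*c*q+(36*c*(4*q+q)+c*q))+46*(c*q) by ring.
have d (x y k : R) : 0 <= k -> x <= y -> k*x <= k*y by move=> k0; exact: leMl.
have k36: 0 <= 36*c by lra.
have k100: 0 <= 100*c by lra.
have := d _ _ _ k36 (lerD h1 h2); have := d _ _ _ k36 (lerD h3 h4); have := d _ _ _ c0 h5; have := d _ _ _ k100 h6.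
by clear -h7 cq; lra.
Qed.

Lemma kapv_ge3 v : (2<=v)%N -> (3<=kap ^ v)%N.
Proof. by move=> /z_ge [h _]; rewrite -(ler_nat R); lra. Qed.

Lemma kapv_ge v : (2<=v)%N -> v%:R <= (kap ^ v)%:R:>R.
Proof. by move=> /z_ge [_ h]; have := ler0n RT v; lra. Qed.

Lemma lev_al_itv v : (2<=v)%N -> 1/200 <= lev_al v <= 1.
Proof. by move=> /zinv [q0 q1]; rewrite /lev_al; lra. Qed.

Lemma lev_al_top v : (2<=v)%N -> lev_al v+(kap ^ v)%:R ^- 2 <= 1/100.
Proof.
move=> /zinv [q0 h]; rewrite /lev_al -exprVn; move: (_^-1) q0 h => q q0 h.
have : q^+2 <= q by rewrite expr2 ler_piMr //; lra.
lra.
Qed.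

Section Chain.
Variables (f g : nat -> C) (b X X' T : nat).
Hypotheses (hf : bnd1 f) (hg : bnd1 g).
Hypotheses (hm : qmult b g f) (XX' : (X<=X'<=3*X)%N).
Hypotheses (X_gt0 : (0<X)%N) (TX : (T<=X)%N).
Notation tt j := (j%:R-T%:R : R).
Notation SB P := (\sum_(0 <= j < (2*T).+1 | P (tt j)) N2 (fh f X X' (tt j))).

Lemma split_bad (P Q : pred nat) :
 \sum_(0 <= j < (2*T).+1 | P j) N2 (fh f X X' (tt j)) <=
 \sum_(0 <= j < (2*T).+1 | P j && ~~ Q j) N2 (fh f X X' (tt j)) +
 \sum_(0 <= j < (2*T).+1 | Q j) N2 (fh f X X' (tt j)).
Proof.
rewrite (bigID Q) /= addrC lerD2l.
rewrite [leLHS]big_mkcond [leRHS]big_mkcond /=; apply: ler_sum => j _.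
by case: (P j) (Q j) => [] []; rewrite /= ?N2_ge0.
Qed.

(** Passing from [v] to [4v] turns [z = kap^v] into [z^4], so the next window has exponents from
    [z^16] to [z^32], as [step_level] allows. The reciprocal sum at level [v] is at least [v], hence
    the errors form a geometric series. *)
Lemma chain J v : (2<=v)%N -> (b<=2 ^ ((kap ^ v) ^ 4))%N ->
 15*((kap ^ (v*4 ^ J)) ^ 8)%:R <= rln X%:R ->
 SB (badv g v) <=
 100*CLS/v%:R+SB (badv g (v*4 ^ J)).
Proof.
have C1 := CLS_ge1; have C0: 0 <= CLS by lra.
elim: J v => [|J IH] v v2 bv hX.
 by rewrite muln1 lerDr divr_ge0 ?mulr_ge0.
apply: leT (split_bad _ (fun j => badv g (v*4) (tt j))) _.
have [z1 z2] := z_ge v2; have v0: 0 < v%:R:>R by rewrite ltr0n (leqT _ v2).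
have v42: (2<=v*4)%N by apply: leqT v2 _; rewrite leq_pmulr.
have e16 k : ((kap ^ (v*4)) ^ k = (kap ^ v) ^ (4*k))%N by rewrite -!expnM mulnA.
have g1: (1<kap ^ v)%N by rewrite -(ltr_nat R); lra.
have hX4: 15*((kap ^ (v*4)) ^ 8)%:R <= rln X%:R.
 apply: leT hX; apply: leMl => //; rewrite ler_nat; apply: leq_expr.
 rewrite leq_exp2l // leq_mul2l expnS leq_pmulr ?orbT // expn_gt0 //.
have W4 := Wlev (v*4).
have IH' := IH (v*4)%N v42; rewrite -mulnA -expnS in IH'.
have bw: (b <= 2 ^ ((kap ^ (v*4)) ^ 4))%N.
 apply: leqT bv _; rewrite leq_exp2l // e16 leq_exp2l //.
have {IH'}h2 := IH' bw hX.
have step := @step_level f g b X X' T hf hg hm XX' X_gt0 TX v ((kap ^ (v*4)) ^ 4) ((kap ^ (v*4)) ^ 8)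
  (lev_al v) (lev_al (v*4)) v2.
have {}step : \sum_(0 <= j < (2*T).+1 | badv g v (tt j) && ~~ badv g (v*4) (tt j)) N2 (fh f X X' (tt j)) <=
  36*CLS*((Ww ((kap ^ (v*4)) ^ 4) ((kap ^ (v*4)) ^ 8))^-1+((kap ^ (v*4)) ^ 4)%:R^-1)+CLS/(kap ^ v)%:R.
 apply: step => //.
 - by rewrite !e16 leqnn leq_exp2l.
 - by rewrite e16 leq_exp2l.
 - by apply: leT W4; rewrite (ler_nat _ 1) muln_gt0 (leqT _ v2).
 - by have /andP[h ->] := lev_al_itv v2; rewrite (leT _ h) // divr_ge0.
 have [q0 q1] := zinv v2; rewrite /lev_al.
 have e4: (kap ^ (v*4))%:R^-1 = (kap ^ v)%:R^-1^+4:>R by rewrite expnM natrX exprVn.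
 have e2: (kap ^ v)%:R ^- 2 = (kap ^ v)%:R^-1^+2:>R by rewrite exprVn.
 rewrite e4 e2; move: q0 q1; move: ((kap ^ v)%:R^-1 : R) => q q0 q1.
 exact: lev_al_incr.
apply: leT (lerD step h2) _.
rewrite addrA lerD2r.
have i1: (Ww ((kap ^ (v*4)) ^ 4) ((kap ^ (v*4)) ^ 8))^-1 <= v%:R^-1/4.
 rewrite -invfM -natrM lef_pV2 ?posrE //.
  by apply: lt_le_trans W4; rewrite ltr0n muln_gt0 (leqT _ v2).
 by rewrite ltr0n muln_gt0 (leqT _ v2).
have iz: (kap ^ v)%:R^-1 <= v%:R^-1/100:>R.
 have z0: 0 < (kap ^ v)%:R:>R by lra.
 have v100: 0 < v%:R*100:>R by lra.
 by rewrite -invfM lef_pV2 ?posrE // mulrC.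
have i2: ((kap ^ (v*4)) ^ 4)%:R^-1 <= v%:R^-1/100:>R.
 apply: leT iz; apply: invr_le; [by rewrite ltr0n|rewrite ler_nat e16].
 by rewrite -{1}[(kap ^ v)%N]expn1 leq_exp2l.
have h1: 36*CLS*((Ww ((kap ^ (v*4)) ^ 4) ((kap ^ (v*4)) ^ 8))^-1+((kap ^ (v*4)) ^ 4)%:R^-1) <=
  36*CLS*(v%:R^-1/4+v%:R^-1/100).
 by apply: leMl; [rewrite mulr_ge0|apply: lerD].
have h3: CLS/(kap ^ v)%:R <= CLS*(v%:R^-1/100) by apply: leMl.
have -> : 100*CLS/(v*4)%:R = 25*(CLS*v%:R^-1).
 by rewrite natrM; field; rewrite gt_eqF.
have -> : 100*CLS/v%:R = 100*(CLS*v%:R^-1) by ring.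
have e3: 36*CLS*(v%:R^-1/4+v%:R^-1/100) = (9+9/25)*(CLS*v%:R^-1) by field; rewrite gt_eqF.
have e4: CLS*(v%:R^-1/100) = CLS*v%:R^-1/100 by ring.
rewrite e3 in h1; rewrite e4 in h3.
have q0: 0 <= CLS*v%:R^-1 by rewrite mulr_ge0 // invr_ge0.
lra.
Qed.

(** The chain ends in a window starting at [2^w], where [w] is to be proportional to [log X], so
    that few points are bad for it. Its reciprocal sum is at least [r/4], and [r <= v] makes [1/r]
    dominate the errors of all other levels. *)
Lemma levels_total J v w r : (4<=r)%N -> (r<=v)%N ->
 (b<=2 ^ ((kap ^ v) ^ 4))%N ->
 (T*cw ((kap ^ v) ^ 4) (nI ((kap ^ v) ^ 4) ((kap ^ v) ^ 8)) <= X)%N ->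
 ((kap ^ (v*4 ^ J)) ^ 16<=w)%N -> (w*kap ^ r<=(kap ^ (v*4 ^ J)) ^ 65)%N ->
 15*(w*kap ^ r)%:R <= rln X%:R ->
 \sum_[j<(2*T).+1] N2 (fh f X X' (tt j)) <=
 400*CLS/r%:R +
 \sum_(0 <= j < (2*T).+1 | bad g w (w*kap ^ r) (1/100) (tt j)) N2 (fh f X X' (tt j)).
Proof.
have C1 := CLS_ge1; have C0: 0 <= CLS by lra.
move=> r4 rv bv hT w1 w2 hX.
have v2: (2<=v)%N by apply: leqT rv; apply: leqT r4.
have r0: 0 < r%:R:>R by rewrite ltr0n (leqT _ r4).
set vJ := (v*4 ^ J)%N in w1 w2 *.
have vvJ: (v<=vJ)%N by rewrite leq_pmulr // expn_gt0.
have vJ2: (2<=vJ)%N by apply: leqT vvJ.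
have [z1 _] := z_ge v2.
have g1: (1<kap ^ vJ)%N by apply: leqT (kapv_ge3 vJ2).
have ww: (w<=w*kap ^ r)%N by rewrite leq_pmulr // expn_gt0.
have zle: (kap ^ vJ<=w)%N by apply: leqT w1; rewrite -{1}[(kap ^ vJ)%N]expn1 leq_exp2l.
have w0: 0 < w%:R:>R by rewrite ltr0n (leqT _ zle).
have hX8 k : (k<=vJ)%N -> 15*((kap ^ k) ^ 8)%:R <= rln X%:R.
 move=> kv; apply: leT hX; apply: leMl => //; rewrite ler_nat; apply: leqT ww.
 apply: leqT w1; apply: (@leq_trans ((kap ^ vJ) ^ 8)%N); last by rewrite leq_exp2l.
 by apply: leq_expr; rewrite leq_exp2l.
have Wr: r%:R/4 <= Ww w (w*kap ^ r).
 by apply: Ww_ge; apply: leqT zle; exact: kapv_ge3.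
apply: leT (split_bad xpredT (fun j => badv g v (tt j))) _ => /=.
have W1 := Wlev v.
have u3: (3<=(kap ^ v) ^ 4<=(kap ^ v) ^ 8)%N.
 have gv: (1<kap ^ v)%N by apply: leqT (kapv_ge3 v2).
 rewrite leq_exp2l // andbT; apply: (@leq_trans (kap ^ v)%N); first exact: kapv_ge3.
 by rewrite -{1}[(kap ^ v)%N]expn1 leq_exp2l.
have /andP[al0 _] := lev_al_itv v2.
have W11: 1 <= Ww ((kap ^ v) ^ 4) ((kap ^ v) ^ 8).
 by apply: leT W1; rewrite (ler_nat _ 1) (leqT _ v2).
have first := @first_level f g b X X' T hf hg hm XX' X_gt0 TX _ _ (lev_al v) u3 bv W11 (hX8 _ vvJ).
have al00: 0 <= lev_al v by apply: leT al0; rewrite divr_ge0.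
have {first}fi := first al00 hT.
have ch := chain v2 bv (hX8 _ (leqnn vJ)).
have st := @split_bad (fun j => badv g vJ (tt j)) (fun j => bad g w (w*kap ^ r) (1/100) (tt j)).
have step := @step_level f g b X X' T hf hg hm XX' X_gt0 TX vJ w (w*kap ^ r) (lev_al vJ) (1/100) vJ2.
have {}step : \sum_(0 <= j < (2*T).+1 | badv g vJ (tt j) && ~~ bad g w (w*kap ^ r) (1/100) (tt j)) N2 (fh f X X' (tt j)) <=
  36*CLS*((Ww w (w*kap ^ r))^-1+w%:R^-1)+CLS/(kap ^ vJ)%:R.
 apply: step => //.
 - by rewrite w1.
 - apply: leqT bv _; rewrite leq_exp2l //; apply: leqT w1.
  apply: (@leq_trans ((kap ^ vJ) ^ 4)%N); last by rewrite leq_exp2l.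
  by apply: leq_expr; rewrite leq_exp2l.
 - by apply: leT Wr; rewrite ler_pdivlMr // mul1r (ler_nat _ 4).
 - by have /andP[h ->] := lev_al_itv vJ2; rewrite (leT _ h) // divr_ge0.
 exact: lev_al_top.
have inv_le (x : R) : v%:R <= x -> x^-1 <= r%:R^-1.
 by move=> h; apply: invr_le => //; apply: leT h; rewrite ler_nat.
have a1: (Ww ((kap ^ v) ^ 4) ((kap ^ v) ^ 8))^-1 <= r%:R^-1 by apply: inv_le.
have a2: ((kap ^ v) ^ 4)%:R^-1 <= r%:R^-1:>R.
 apply: inv_le; apply: (leV (kap ^ v)%:R); first exact: kapv_ge.
 by rewrite ler_nat -{1}[(kap ^ v)%N]expn1 leq_exp2l // (leqT _ (kapv_ge3 v2)).
have a3: (Ww w (w*kap ^ r))^-1 <= 4*r%:R^-1.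
 have -> : 4*r%:R^-1 = (r%:R/4)^-1:>R by rewrite invfM invrK mulrC.
 by rewrite lef_pV2 ?posrE //; [apply: lt_le_trans Wr|]; rewrite divr_gt0.
have zJ: (kap ^ vJ)%:R^-1 <= r%:R^-1:>R.
 by apply: inv_le; apply: leT (_ : vJ%:R <= _); [rewrite ler_nat|exact: kapv_ge].
have a4: w%:R^-1 <= r%:R^-1:>R.
 by apply: leT zJ; apply: invr_le; [rewrite ltr0n|rewrite ler_nat].
have a5: v%:R^-1 <= r%:R^-1:>R by apply: inv_le.
have small: 2*(nI ((kap ^ v) ^ 4) ((kap ^ v) ^ 8))%:R^+2*(rexp (- (lev_al v*((kap ^ v) ^ 4)%:R))*(720*CLS)) <= CLS*r%:R^-1.
 apply: (leV (CLS/(kap ^ v)%:R)); last first.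
  by apply: leMl => //; apply: inv_le; exact: kapv_ge.
 have -> : (nI ((kap ^ v) ^ 4) ((kap ^ v) ^ 8))%:R = 3*(kap ^ v)%:R^+12:>R.
  by rewrite /nI -mulnA -expnD natrM natrX.
 by rewrite [((kap ^ v) ^ 4)%:R]natrX; apply: level_tail.
apply: leT (lerD fi (leT ch (lerD (lexx _) (leT st (lerD step (lexx _)))))) _.
by apply: levels_sum => //; rewrite invr_ge0.
Qed.
End Chain.

(** * Decay of the partial sums *)

Section DftArgument.
Variables (Ln h : nat) (U ps : seq nat) (mp : nat -> nat) (a : nat -> nat -> C) (bet : nat -> nat -> C).
Variables (D D' Psi : R).
Let M := (2*Ln)%N.
Hypotheses (Ln0 : (0<Ln)%N) (h0 : (0<h)%N).
Hypotheses (aL : forall i j, (Ln<=i)%N -> a i j = 0) (mpL : forall p, p \in ps -> (mp p<=Ln)%N).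
Hypotheses (Psi0 : 0 < Psi) (hD : \sum_(p <- ps) p%:R^-1*\sum_(j <- U) \sum_[k<M]
  N2 (a k j-bet p j*(if (mp p<=k)%N then a (k-mp p)%N j else 0)) <= D).
Hypothesis hD' : \sum_(j <- U) \sum_[k<M]
  N2 (a k j-(if (1<=k)%N then a (k-1)%N j else 0)) <= D'.
Hypothesis hlow : forall j (x : R), j \in U -> `|x| <= M%:R/h%:R ->
 Psi <= \sum_(p <- ps) p%:R^-1*N2 (1-bet p j*cis (- (2*rpi*(x*(mp p)%:R/M%:R)))).

(** The representative of the frequency [k] modulo [M] of least absolute value. *)
Let kk (k : nat) : R := if (2*k<=M)%N then k%:R else k%:R-M%:R.
Let low (k : nat) : bool := `|kk k| <= M%:R/h%:R.

Lemma M_gt0 : (0<M)%N. Proof. by rewrite muln_gt0. Qed.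
Lemma MRg0 : 0 < M%:R:>R. Proof. by rewrite ltr0n M_gt0. Qed.

Lemma cis_kk k m : cis (- (2*rpi*(k%:R * m%:R/M%:R))) = cis (- (2*rpi*(kk k * m%:R/M%:R))).
Proof.
rewrite /kk; case: ifP => // _.
have -> : - (2*rpi*((k%:R-M%:R) * m%:R/M%:R)) = - (2*rpi*(k%:R * m%:R/M%:R))+2*rpi * m%:R.
 by field; rewrite gt_eqF ?MRg0.
by rewrite cisD cis_2piN mulr1.
Qed.

Lemma kk_half k : (k<M)%N -> `|kk k| <= M%:R/2.
Proof.
move=> kM; rewrite /kk; case: ifP => h2.
 rewrite ger0_norm //; have : (2*k)%:R <= M%:R:>R by rewrite ler_nat.
 by rewrite natrM; lra.
have : M%:R <= (2*k)%:R:>R by rewrite ler_nat ltnW // ltnNge h2.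
have : k%:R <= M%:R:>R by rewrite ler_nat ltnW.
rewrite natrM ler_norml; lra.
Qed.

(** At low frequencies the relations along primes act with total weight at least [Psi]. At high
    frequencies [|1 - cis| >= 2/h], and the small differences of neighbouring terms suffice. The
    length [M = 2 Ln] leaves room for all shifts. *)
Lemma dft_argument : \sum_(j <- U) \sum_[k<Ln] N2 (a k j) <= D/Psi+h%:R^+2/4*D'.
Proof.
have M0 := M_gt0; have MR := MRg0; have hR: 0 < h%:R:>R by rewrite ltr0n.
pose an j k := a k j.
have aM j : \sum_[k<Ln] N2 (a k j) = M%:R^-1*\sum_[k<M] N2 (dft M (an j) k).
 rewrite dft_parseval // mulKf ?gt_eqF // [RHS](big_cat_nat (n := Ln)) //=; last by rewrite /M; clear; lia.
 by rewrite [X in _+X]big_nat [X in _+X]big1 ?addr0 // => k /andP[hk _]; rewrite /an aL // N20.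
rewrite (eq_bigr _ (fun j _ => aM j)) -mulr_sumr.
have w0 j k : 0 <= N2 (dft M (an j) k) by exact: N2_ge0.
have lowb: M%:R^-1*\sum_(j <- U) \sum_(0 <= k < M | low k) N2 (dft M (an j) k) <= D/Psi.
 rewrite ler_pdivlMr // mulrC; apply: leT hD.
 have -> : \sum_(p <- ps) p%:R^-1*\sum_(j <- U) \sum_[k<M]
   N2 (a k j-bet p j*(if (mp p<=k)%N then a (k-mp p)%N j else 0)) =
  M%:R^-1*\sum_(j <- U) \sum_[k<M] N2 (dft M (an j) k) *
   \sum_(p <- ps) p%:R^-1*N2 (1-bet p j*cis (- (2*rpi*(k%:R*(mp p)%:R/M%:R)))).
  transitivity (\sum_(p <- ps) \sum_(j <- U) \sum_[k<M] M%:R^-1*(N2 (dft M (an j) k) *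
    (p%:R^-1*N2 (1-bet p j*cis (- (2*rpi*(k%:R*(mp p)%:R/M%:R))))))).
   rewrite big_seq [RHS]big_seq; apply: eq_bigr => p pps; rewrite mulr_sumr; apply: eq_bigr => j _.
   have := @dft_shift M Ln (mp p) (an j) (bet p j) M0; rewrite /an => -> //.
   - rewrite mulrCA mulr_sumr mulr_sumr; apply: eq_bigr => k _; ring.
   - by rewrite /M mul2n -addnn leq_add2l mpL.
   - by move=> k; apply: aL.
  rewrite exchange_big /= mulr_sumr; apply: eq_bigr => j _; rewrite exchange_big /= mulr_sumr.
  by apply: eq_bigr => k _; rewrite -!mulr_sumr.
 rewrite mulrCA; apply: leMl; first by rewrite invr_ge0.
 rewrite mulr_sumr big_seq [leRHS]big_seq; apply: ler_sum => j jU.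
 rewrite mulr_sumr [leLHS]big_mkcond /=; apply: ler_sum => k _; case: ifP => [lk|_]; last first.
  apply: mulr_ge0 => //; apply: sumr_ge0 => p _; by rewrite mulr_ge0 ?N2_ge0 // invr_ge0.
 rewrite mulrC; apply: leMl => //; apply: leT (hlow jU lk) _.
 by apply: ler_sum => p _; rewrite cis_kk.
have highb: M%:R^-1*\sum_(j <- U) \sum_(0 <= k < M | ~~ low k) N2 (dft M (an j) k) <= h%:R^+2/4*D'.
 have h2: 0 < 4/h%:R^+2:>R by rewrite divr_gt0 ?exprn_gt0.
 have -> : h%:R^+2/4*D' = D'/(4/h%:R^+2) by field; rewrite gt_eqF.
 rewrite ler_pdivlMr // mulrC; apply: leT hD'.
 have -> : \sum_(j <- U) \sum_[k<M] N2 (a k j-(if (1<=k)%N then a (k-1)%N j else 0)) =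
  M%:R^-1*\sum_(j <- U) \sum_[k<M] N2 (dft M (an j) k) *
   N2 (1-cis (- (2*rpi*(k%:R*1%:R/M%:R)))).
  rewrite mulr_sumr; apply: eq_bigr => j _.
  have := @dft_shift M Ln 1 (an j) 1 M0; rewrite /an => h3.
  have e1 k : N2 (a k j-(if (1<=k)%N then a (k-1)%N j else 0)) =
    N2 (a k j-1*(if (1<=k)%N then a (k-1)%N j else 0)) by rewrite mul1r.
  rewrite (eq_bigr _ (fun k _ => e1 k)) h3; first last.
  - by move=> k; apply: aL.
  - by rewrite /M mul2n -addnn leq_add2l.
  by congr (_*_); apply: eq_bigr => k _; rewrite mul1r.
 rewrite mulrCA; apply: leMl; first by rewrite invr_ge0.
 rewrite mulr_sumr; apply: ler_sum => j _.
 rewrite mulr_sumr [leLHS]big_mkcond /=; apply: ler_sum_nat => k /andP[_ kM]; case: ifP => [lk|_]; last first.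
  by apply: mulr_ge0 => //; exact: N2_ge0.
 rewrite mulrC; apply: leMl => //; rewrite cis_kk mulr1.
 set x := - (2*rpi*(kk k/M%:R)).
 have pi0 := rpi_gt0; have pi3 := rpi_gt3.
 have ax: `|x| = 2*rpi*(`|kk k| / M%:R).
  by rewrite /x normrN normrM [`|2*rpi|]ger0_norm ?normrM ?normfV ?[`|M%:R|]ger0_norm //; lra.
 have kh := kk_half kM.
 have q1: `|kk k| / M%:R <= 1/2 by rewrite ler_pdivrMr //; lra.
 have q2: h%:R^-1 <= `|kk k| / M%:R.
  by move: lk; rewrite /low -ltNge => /ltW lk; rewrite ler_pdivlMr // mulrC.
 have := @cis_sub1_ge x; rewrite ax => h3.
 have h4: 2*rpi*(`|kk k| / M%:R) <= 3*nm (cis x-1) by apply: h3; nra.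
 have h5: 2/h%:R <= nm (cis x-1).
  have hi0: 0 < h%:R^-1:>R by rewrite invr_gt0.
  move: h4 q2; move: (`|kk k| / M%:R) (nm (cis x-1)) (h%:R^-1 : R) hi0 => z1 z2 z3 hi0 h4 q2.
  have : 3*z3 <= rpi*z1 by apply: ler_pM; lra.
  lra.
 rewrite -N2N opprB -nm_sqr.
 have -> : 4/h%:R^+2 = (2/h%:R)^+2:>R by field; rewrite gt_eqF.
 by rewrite lerXn2r ?nnegrE ?nm_ge0 // divr_ge0.
apply: leT (lerD lowb highb); rewrite -mulrDr; apply: leMl; first by rewrite invr_ge0.
by rewrite -big_split /=; apply: ler_sum => j _; rewrite (bigID low).
Qed.
End DftArgument.

Lemma N2_1sub (z : C) : N2 z = 1 -> N2 (1-z) = 2-2*Re z.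
Proof. by case: z => x y; rewrite /N2 /= => h; have : x^+2+y^+2 = 1 by []; lra. Qed.

(* A rounding error [2 pi |x| / M] in the phase costs at most its square. *)
Lemma low_freq (ps : seq nat) (g : nat -> C) (mp : nat -> nat) (L M : nat) (t x eps Phi : R) :
 (0<L)%N -> (0<M)%N ->
 (forall p, p \in ps -> [/\ (1<p)%N, N2 (g p) = 1 &
   (mp p)%:R <= L%:R*rln p%:R/rln 2 <= (mp p)%:R+1]) ->
 `|2*rpi*(x/M%:R)| <= eps ->
 Phi <= \sum_(p <- ps) (1-Re (g p*npw p (t-2*rpi*(x/M%:R)*L%:R/rln 2)))/p%:R ->
 Phi-eps^+2*\sum_(p <- ps) p%:R^-1 <=
 \sum_(p <- ps) p%:R^-1*N2 (1-(g p*npw p t)*cis (- (2*rpi*(x*(mp p)%:R/M%:R)))).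
Proof.
move=> L0 M0 hp hx hPhi; set v := 2*rpi*(x/M%:R) in hx hPhi.
apply: (leV (\sum_(p <- ps) ((1-Re (g p*npw p (t-v*L%:R/rln 2)))/p%:R-eps^+2 * p%:R^-1))).
 by rewrite sumrB -mulr_sumr lerD2r.
rewrite big_seq [leRHS]big_seq; apply: ler_sum => p /hp [p1 gp /andP[m1 m2]].
have pR: 0 < p%:R:>R by rewrite ltr0n ltnW.
have -> : (1-Re (g p*npw p (t-v*L%:R/rln 2)))/p%:R-eps^+2 * p%:R^-1 =
  p%:R^-1*((1-Re (g p*npw p (t-v*L%:R/rln 2)))-eps^+2) by ring.
apply: leMl; first by rewrite invr_ge0.
set z1 := g p*npw p (t-v*L%:R/rln 2); set z2 := g p*npw p t*cis _.
have n1: N2 z1 = 1 by rewrite /z1 N2M gp N2_npw mulr1.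
have := N2_1sub n1 => e1.
have d: N2 (z2-z1) <= eps^+2.
 have -> : z2-z1 = g p*npw p t*(cis (- (2*rpi*(x*(mp p)%:R/M%:R)))-cis (- (v*L%:R/rln 2*rln p%:R))).
  have e2: z1 = g p*npw p t*cis (- (v*L%:R/rln 2*rln p%:R)).
   by rewrite /z1 -[g p*npw p t*_]mulrA /npw -cisD; congr (_*cis _); ring.
  by rewrite e2 mulrBr.
 rewrite !N2M gp N2_npw !mul1r; apply: N2_le; apply: leT (cis_lip _ _) _.
 have -> : - (2*rpi*(x*(mp p)%:R/M%:R)) - - (v*L%:R/rln 2*rln p%:R) =
   v*(L%:R*rln p%:R/rln 2-(mp p)%:R) by rewrite /v; ring.
 rewrite normrM; apply: leT hx; rewrite ler_piMr //.
 by rewrite ger0_norm; lra.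
have := N2D (1-z2) (z2-z1); rewrite addrA subrK e1 => h2; lra.
Qed.

(** * The geometric grid *)

Section Grid.
Variable L : nat.
Hypothesis L3 : (3<=L)%N.
(** This is [2^(k/L)], a grid with [L] points per doubling. *)
Definition gy (k : nat) : R := rexp (k%:R*(rln 2/L%:R)).
Definition gx (k : nat) : nat := Num.truncn (gy k).

Lemma gridL_ge3 : 3 <= L%:R:>R. Proof. by rewrite (ler_nat _ 3). Qed.

Lemma gy_gt0 k : 0 < gy k. Proof. exact: rexp_gt0. Qed.

Lemma gx_itv k : (gx k)%:R <= gy k /\ gy k < (gx k)%:R+1.
Proof. by have /andP[] := truncn_itv (ltW (gy_gt0 k)); rewrite -[(Num.truncn _).+1%:R]natr1. Qed.

Lemma gy_mono i k : (i<=k)%N -> gy i <= gy k.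
Proof.
move=> ik; rewrite rexp_le leMr ?ler_nat // divr_ge0 //; by apply: rln_ge0; lra.
Qed.

Lemma gx_ge n k : n%:R <= gy k -> (n<=gx k)%N.
Proof. by move=> h; rewrite truncn_ge_nat // ltW // gy_gt0. Qed.

Lemma gx_mono i k : (i<=k)%N -> (gx i<=gx k)%N.
Proof. by move=> ik; apply: gx_ge; apply: leT (gy_mono ik); case: (gx_itv i). Qed.

Lemma gyD i k : gy (i+k) = gy i * gy k.
Proof. by rewrite /gy natrD mulrDl rexpD. Qed.

Lemma gy_pow m : gy (L * m) = 2^+m.
Proof.
have LR := gridL_ge3.
rewrite /gy; have -> : (L * m)%N%:R*(rln 2/L%:R) = rln 2 * m%:R.
 by rewrite natrM; field; rewrite gt_eqF //; lra.
by rewrite rexpX rlnK.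
Qed.

Lemma gx_pow m : gx (L * m) = (2 ^ m)%N.
Proof. by rewrite /gx gy_pow -natrX natrK. Qed.

Lemma gy1_le : gy 1 <= 1+2/L%:R.
Proof.
have LR := gridL_ge3.
have h2: 0 < 1+2/L%:R:>R by rewrite addr_gt0 // divr_gt0 //; lra.
rewrite -[leRHS]rlnK // rexp_le mul1r; apply: leT (rln_ge_subV h2).
have -> : 1-(1+2/L%:R)^-1 = 2/(L%:R+2):>R by field; rewrite !gt_eqF //; lra.
have l2 := rln2_le; rewrite ler_pdivrMr; last by lra.
have -> : 2/(L%:R+2)*L%:R = 2*L%:R/(L%:R+2):>R by rewrite mulrAC.
by rewrite ler_pdivlMr; nra.
Qed.

Lemma gx_shift k : (gx (k+L)<=3 * gx k)%N.
Proof.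
have LR := gridL_ge3.
have e: gy (k+L) = gy k*2 by have := gy_pow 1; rewrite muln1 expr1 gyD => ->.
have [h1 h2] := gx_itv k; have [h3 _] := gx_itv (k+L).
have k1: (1<=gx k)%N.
 by apply: gx_ge; rewrite -[1%:R](_ : gy 0 = _) ?gy_mono // /gy mul0r rexp0.
have k1R: 1 <= (gx k)%:R:>R by rewrite ler1n.
have : (gx (k+L))%:R < (2 * gx k+2)%:R:>R by rewrite natrD natrM -/(gx _); lra.
rewrite ltr_nat; move: k1; clear; lia.
Qed.

Lemma trunc_close (Z k : nat) : (L+2<=Z)%N -> Z%:R <= gy k ->
 gy k <= (Z%:R+1)*(1+2/L%:R) ->
 (Z<=gx k)%N /\ (gx k)%:R <= (1+3/L%:R)*Z%:R:>R.
Proof.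
have LR := gridL_ge3.
move=> ZL h1 h2; split; first exact: gx_ge.
have [h3 _] := gx_itv k; apply: leT h3 _; apply: leT h2 _.
have ZR: L%:R+2 <= Z%:R:>R by rewrite -(natrD _ L 2) ler_nat.
have l0: 0 < L%:R:>R by lra.
rewrite -subr_ge0.
have -> : (1+3/L%:R)*Z%:R-(Z%:R+1)*(1+2/L%:R) = (Z%:R-2-L%:R)/L%:R:>R.
 by field; rewrite gt_eqF.
by rewrite divr_ge0 ?(ltW l0) //; lra.
Qed.

Lemma grid_succ k : (L+2<=gx k)%N ->
 (gx k<=gx k.+1)%N /\ (gx k.+1)%:R <= (1+3/L%:R)*(gx k)%:R:>R.
Proof.
move=> h; have [h1 h2] := gx_itv k; apply: trunc_close => //; first by apply: leT h1 (gy_mono _).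
rewrite -addn1 gyD; apply: ler_pM; rewrite ?(ltW (gy_gt0 _)) ?gy1_le //; exact: ltW.
Qed.

(** As [m] is [L log_2 p] rounded down, dividing by [p] amounts to going back [m] or [m+1] places on
    the grid; what remains is the effect of integer parts, controlled by [trunc_close]. *)
Lemma grid_div p m k q : (0<p)%N -> (m<=k)%N -> (L*q<=k-m)%N -> (L+2<=2 ^ (q-2))%N -> (2<=q)%N ->
 m%:R <= L%:R*rln p%:R/rln 2 <= m%:R+1 ->
 [/\ (2 ^ (q-2)<=gx k %/ p)%N, (gx k %/ p<=gx (k-m))%N &
   (gx (k-m))%:R <= (1+3/L%:R)*(gx k %/ p)%:R:>R].
Proof.
have LR := gridL_ge3.
move=> p0 mk qk hq q2 /andP[m1 m2]; set Z := (gx k %/ p)%N.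
have l2: 0 < rln 2 by apply: rln_gt0; lra.
have l0: 0 < L%:R:>R by lra.
have pR: 0 < p%:R:>R by rewrite ltr0n.
have [k1 k2] := gx_itv k.
have ek: gy k = gy (k-m) * gy m by rewrite -gyD subnK.
have pm: gy m <= p%:R.
 rewrite -[leRHS]rlnK // rexp_le mulrA ler_pdivrMr // -ler_pdivlMr //; apply: leT m1 _.
 by rewrite [rln p%:R*_]mulrC.
have mp: p%:R <= gy m * gy 1.
 rewrite -gyD -[leLHS]rlnK // rexp_le natrD mulrA ler_pdivlMr // -ler_pdivrMr //; apply: leT m2.
 by rewrite [rln p%:R*_]mulrC.
have g1 := gy1_le; have gm0 := gy_gt0 m; have gk0 := gy_gt0 (k-m); have g10 := gy_gt0 1.
have Zp: (Z * p<=gx k)%N by exact: leq_trunc_div.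
have Zp': ((gx k).+1<=Z.+1 * p)%N by exact: ltn_ceil.
have lo: Z%:R <= gy (k-m).
 rewrite -(ler_pM2r pR) -natrM; apply: leT (_ : (gx k)%:R <= _); first by rewrite ler_nat.
 apply: leT k1 _; rewrite ek; apply: leMl => //; exact: ltW.
have hi: gy (k-m) <= (Z%:R+1)*(1+2/L%:R).
 apply: leT (_ : (Z%:R+1) * gy 1 <= _); last by rewrite leMl // addr_ge0.
 rewrite -(ler_pM2r gm0) -ek -mulrA [gy 1*_]mulrC.
 apply: leT (_ : (Z%:R+1) * p%:R <= _); last by rewrite leMl // addr_ge0.
 rewrite (_ : (Z%:R+1) * p%:R = (Z.+1 * p)%:R:>R); last by rewrite natrM -natr1.
 by apply: leT (ltW k2) _; rewrite natr1 ler_nat.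
have big: (2 ^ (q-2)<=Z)%N.
 have h1: 2^+q <= (Z%:R+1)*(1+2/L%:R):>R by apply: leT hi; rewrite -gy_pow gy_mono.
 have h2: (1+2/L%:R) <= 2:>R.
  by rewrite -lerBrDl ler_pdivrMr //; lra.
 have Zp1: 0 <= Z%:R+1:>R by rewrite addr_ge0.
 have h3: 2^+q <= (2*Z+2)%:R:>R.
  apply: leT h1 _; apply: leT (leMl Zp1 h2) _; rewrite natrD natrM; lra.
 rewrite -natrX ler_nat in h3.
 have e: (2 ^ q = 4*2 ^ (q-2))%N by rewrite -(expnD 2 2) subnKC.
 move: h3 hq; rewrite e; clear; lia.
have [h1 h2] := trunc_close (leqT hq big) lo hi.
by split.
Qed.
End Grid.

Lemma sum_small_le (b M : nat) : \sum_[p<=M] (p<=b)%N%:R <= b%:R:>R.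
Proof.
have -> : \sum_[p<=M] (p<=b)%N%:R = (minn M b)%:R:>R.
 elim: M => [|M IH]; first by rewrite big_geq // min0n.
 rewrite big_nat_recr //= IH -natrD; congr _%:R.
 by case: (leqP M.+1 b); rewrite /minn; clear; do ?case: ifP; lia.
by rewrite ler_nat geq_minr.
Qed.

Lemma sum_inv_primes_log d : (2<=d)%N ->
 \sum_(1 <= p < (2 ^ d).+1 | prime p) p%:R^-1 <= 20+16*rln d%:R:>R.
Proof.
move=> d2; have d0: (0<d)%N by apply: leqT d2.
rewrite (@big_cat_nat _ _ _ 5) //=; last first.
 by rewrite ltnS -[4%N]/(2 ^ 2)%N leq_exp2l.
have h1: \sum_(1 <= p < 5 | prime p) p%:R^-1 <= 2:>R.
 rewrite big_mkcond /= unlock /= !addr0 !add0r; lra.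
have h2: \sum_(5 <= p < (2 ^ d).+1 | prime p) p%:R^-1 <= 16*\sum_(2 <= i < d) i%:R^-1:>R.
 rewrite -[5%N]/((2 ^ 2).+1)%N big_dyadic // mulr_sumr; apply: ler_sum_nat => i /andP[i2 _].
 exact: sum_inv_primes_dyadic.
have h3: \sum_(2 <= i < d) i%:R^-1 <= 1+rln d%:R:>R.
 apply: leT (harmonic_le d0); rewrite [leRHS](@big_cat_nat _ _ _ 2) //=.
 rewrite [X in _+X](@big_cat_nat _ _ _ d) //= addrC -addrA lerDl addr_ge0 //; apply: sumr_ge0 => i _; by rewrite invr_ge0.
lra.
Qed.

(** * Means along the grid and their relations at primes *)

Section AX.
Variables (f g : nat -> C) (b L d h : nat) (U : seq nat) (E Phi : R).
Let N := (2 ^ L)%N.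
Hypotheses (hf : bnd1 f) (hg : bnd1 g).
Hypotheses (hm : qmult b g f) (hg1 : forall p, prime p -> (b<p)%N -> N2 (g p) = 1).
Hypotheses (d2 : (2<=d)%N) (Ld : (1000*d<=L<=1001*d)%N).
Hypotheses (Lbig : (L+2<=2 ^ (L-d-2))%N) (h0 : (0<h)%N).
Hypotheses (E0 : 0 <= E) (hE : forall Z u, (Z<=4*N)%N -> `|u| <= 3*N%:R -> nm (zsum Z u-zmain Z u) <= E).
Hypotheses (uU : uniq U) (U2 : forall j, j \in U -> (j<=2*N)%N).
Hypotheses (small : 13*(2 ^ d)%:R^+2*(size U)%:R*(E+2) <= (2 ^ (L-d-2))%:R) (hPhi : forall t : R, `|t| <= 2*N%:R ->
 Phi <= \sum_(1 <= p < N.+1 | prime p) (1-Re (g p*npw p t))/p%:R).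
Hypothesis hh : (8/h%:R)^+2*(20+16*rln d%:R) <= 1.

Let L3 : (3<=L)%N. Proof. by move: Ld d2; clear; lia. Qed.
Lemma axL_ge3 : 3 <= L%:R:>R. Proof. by rewrite (ler_nat _ 3). Qed.
Let L0 : (0<L)%N. Proof. by apply: leqT L3. Qed.
Let ps := [seq p <- index_iota 1 (2 ^ d).+1 | prime p && (b<p)%N].
Let mp (p : nat) : nat := Num.truncn (L%:R*rln p%:R/rln 2).
Let x (k : nat) : nat := gx L (L*(L-d)+k).
Let tU (j : nat) : R := j%:R-N%:R.
Definition psum (X : nat) (t : R) : C := \sum_[n<=X] f n*npw n t.
Let low := (2 ^ (L-d-2))%N.
Let low0 : (0<low)%N. Proof. by rewrite expn_gt0. Qed.

Let ups : uniq ps. Proof. by rewrite filter_uniq // iota_uniq. Qed.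
Let psP p : p \in ps -> [/\ prime p, (b<p)%N, (1<p)%N & (p<=2 ^ d)%N].
Proof.
by rewrite mem_filter mem_index_iota ltnS => /andP[/andP[pp bp] /andP[_ h1]]; split=> //; exact: prime_gt1.
Qed.

Let smallX X : (low<=X)%N -> 13*(2 ^ d)%:R^+2*(size U)%:R*(E+2) <= X%:R.
Proof. by move=> h1; apply: leT small _; rewrite ler_nat. Qed.

Let basic X a c : (low<=X<=N)%N -> (a<=c<=2*X)%N ->
 \sum_(j <- U) N2 (\sum_(a.+1 <= n < c.+1) f n*npw n (tU j)) <= 121*X%:R*(c-a)%:R.
Proof.
move=> /andP[h1 h2] ac; apply: (@gram_basic N X E _ h2 E0 hE U (2 ^ d)%N f uU U2 hf (smallX h1)) => //.
- exact: leqT low0 h1.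
- by rewrite expn_gt0.
Qed.

Lemma psum_sq X : (low<=X<=N)%N -> \sum_(j <- U) N2 (psum X (tU j)) <= 121*X%:R^+2.
Proof. by move=> h1; have := @basic X 0 X h1; rewrite subn0 expr2 mulrA; apply; rewrite /= mul2n -addnn leq_addr. Qed.

Lemma avg_sq X : (low<=X<=N)%N -> \sum_(j <- U) N2 (X%:R^-1%:C * psum X (tU j)) <= 121.
Proof.
move=> h1; have X0: 0 < X%:R:>R by rewrite ltr0n (leqT low0) //; case/andP: h1.
have -> : \sum_(j <- U) N2 (X%:R^-1%:C * psum X (tU j)) = (X%:R^+2)^-1*\sum_(j <- U) N2 (psum X (tU j)).
 by rewrite mulr_sumr; apply: eq_bigr => j _; rewrite N2M N2_real exprVn.
by rewrite mulrC ler_pdivrMr ?exprn_gt0 //; exact: psum_sq.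
Qed.

(** The two cutoffs have ratio [1 + O(1/L)]. The change of normalisation costs [O(1/L^2)] and the
    terms between the cutoffs [O(1/L)], both by [gram_basic]. *)
Lemma avg_close Z Y (c : R) : (low<=Z)%N -> (Z<=N)%N -> (Z<=Y)%N -> Y%:R <= (1+3/L%:R)*Z%:R:>R ->
 c*Z%:R <= 1 -> 1 <= c*Z%:R*(1+3/L%:R) ->
 \sum_(j <- U) N2 (c%:C * psum Z (tU j)-Y%:R^-1%:C * psum Y (tU j)) <= 1452/L%:R.
Proof.
have LR := axL_ge3.
move=> Zl ZN ZY hY c1 c2.
have Z0: 0 < Z%:R:>R by rewrite ltr0n (leqT low0).
have YZ: Z%:R <= Y%:R:>R by rewrite ler_nat.
have Y0: 0 < Y%:R:>R by lra.
have LR0: 0 < L%:R:>R by lra.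
set u : R := 3/L%:R in hY c2.
have u0: 0 < u by rewrite divr_gt0.
have u1: u <= 1 by rewrite /u ler_pdivrMr; lra.
have hl: (low<=Z<=N)%N by rewrite Zl.
pose del j := \sum_(Z.+1 <= n < Y.+1) f n*npw n (tU j).
have e j : c%:C * psum Z (tU j)-Y%:R^-1%:C * psum Y (tU j) = (c-Y%:R^-1)%:C * psum Z (tU j)-Y%:R^-1%:C*del j.
 have -> : psum Y (tU j) = psum Z (tU j)+del j by rewrite /psum (@big_cat_nat _ _ _ Z.+1).
 by rewrite realCB; ring.
have Y2: (Z<=Y<=2*Z)%N.
 rewrite ZY /= -(ler_nat R) natrM; apply: leT hY _; rewrite leMr ?(ltW Z0) //; lra.
have s1 := psum_sq hl; have s2 := basic hl Y2.
apply: leT (_ : 2*((c-Y%:R^-1)^+2*\sum_(j <- U) N2 (psum Z (tU j))+(Y%:R^+2)^-1*\sum_(j <- U) N2 (del j)) <= _).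
 rewrite !mulr_sumr -big_split /= mulr_sumr; apply: ler_sum => j _; rewrite e.
 by apply: leT (N2B _ _) _; rewrite !N2M !N2_real exprVn.
have zy1: Z%:R/Y%:R <= 1:>R by rewrite ler_pdivrMr // mul1r.
have zy2: 1 <= Z%:R/Y%:R*(1+u):>R by rewrite mulrAC ler_pdivlMr // mul1r mulrC.
set zy := Z%:R/Y%:R in zy1 zy2; set cz := c*Z%:R in c1 c2.
have b1: (c-Y%:R^-1)^+2*\sum_(j <- U) N2 (psum Z (tU j)) <= 121*u^+2.
 apply: leT (leMl (sqr_ge0 _) s1) _.
 have -> : (c-Y%:R^-1)^+2*(121*Z%:R^+2) = 121*(cz-zy)^+2.
  by rewrite /cz /zy; field; rewrite gt_eqF.
 rewrite ler_pM2l // -[leLHS]real_normK ?num_real // lerXn2r ?nnegrE ?(ltW u0) //.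
 by move: c1 c2 zy1 zy2 u0 u1; move: (cz) (zy) (u) => a1 a2 a3 *; rewrite ler_norml; nra.
have b2: (Y%:R^+2)^-1*\sum_(j <- U) N2 (del j) <= 121*u.
 rewrite mulrC ler_pdivrMr ?exprn_gt0 //; apply: leT s2 _.
 have hD: (Y-Z)%:R <= u*Y%:R:>R.
  rewrite natrB //; apply: (leV (u*Z%:R)); last by rewrite ler_pM2l.
  by rewrite lerBlDl; apply: leT hY _; rewrite mulrDl mul1r.
 have := ler_pM (ltW Z0) (ler0n _ _) YZ hD.
 move: (Y%:R : R) (Z%:R : R) ((Y-Z)%:R : R) (u) => y1 y2 y3 y4; lra.
have : u^+2 <= u by rewrite expr2 ler_piMl // ltW.
have -> : 1452/L%:R = 484*u by rewrite /u; field; rewrite gt_eqF.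
lra.
Qed.
Let mpP p : p \in ps -> (mp p)%:R <= L%:R*rln p%:R/rln 2 <= (mp p)%:R+1.
Proof.
move=> /psP [_ _ p1 _]; have l2: 0 < rln 2 by apply: rln_gt0; lra.
have h1: 0 <= L%:R*rln p%:R/rln 2.
 by rewrite divr_ge0 ?(ltW l2) // mulr_ge0 // rln_ge0 // ler1n ltnW.
by have /andP[-> /ltW] := truncn_itv h1; rewrite -[(Num.truncn _).+1%:R]natr1.
Qed.

Let mp_le p : p \in ps -> (mp p<=L*d)%N.
Proof.
move=> pin; have /andP[h1 _] := mpP pin; have [_ _ p1 pd] := psP pin.
have l2: 0 < rln 2 by apply: rln_gt0; lra.
rewrite -(ler_nat R); apply: leT h1 _; rewrite ler_pdivrMr // natrM -mulrA.
apply: leMl => //; rewrite -rlnX // -natrX; apply: rln_le; rewrite ?ltr0n ?ler_nat //; exact: ltnW.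
Qed.

Let sum_ps_le (F : nat -> R) : (forall p, 0 <= F p) ->
 \sum_(p <- ps) F p <= \sum_(1 <= p < (2 ^ d).+1 | prime p) F p.
Proof.
move=> F0; rewrite big_filter big_mkcond [leRHS]big_mkcond /=; apply: ler_sum => p _.
by case: (prime p) => //=; case: ifP.
Qed.

Lemma sum_mp_le : \sum_(p <- ps) p%:R^-1*(mp p)%:R <= 64*(L*d)%:R:>R.
Proof.
have l2 := rln2_ge; have l20: 0 < rln 2 by lra.
apply: (leV (\sum_(p <- ps) 2*L%:R*(rln p%:R/p%:R))).
 rewrite big_seq [leRHS]big_seq; apply: ler_sum => p pin.
 have /andP[h1 _] := mpP pin; have [_ _ p1 _] := psP pin.
 have lp : 0 <= rln p%:R by apply: rln_ge0; rewrite ler1n ltnW.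
 have pi: 0 <= p%:R^-1:>R by rewrite invr_ge0.
 rewrite mulrA [leRHS]mulrC; apply: leMl => //; apply: leT h1 _.
 have : 0 <= L%:R*rln p%:R by rewrite mulr_ge0.
 rewrite ler_pdivrMr // -[2*_*_]mulrA; move: (L%:R*_) => z z0; nra.
rewrite -mulr_sumr; apply: leT (_ : 2*L%:R*(32*d%:R) <= _); last by rewrite natrM; lra.
apply: leMl; first by rewrite mulr_ge0.
apply: leT (sum_lnp_le d2); apply: (@sum_ps_le (fun p => rln p%:R/p%:R)) => p.
case: p => [|p]; first by rewrite invr0 mulr0.
by rewrite divr_ge0 // rln_ge0 // ler1n.
Qed.

Lemma sum_ps_inv : \sum_(p <- ps) p%:R^-1 <= 20+16*rln d%:R:>R.
Proof.
apply: leT (sum_inv_primes_log d2); apply: (@sum_ps_le (fun p => p%:R^-1)) => p; by rewrite invr_ge0.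
Qed.

Let k0 := (L*(L-d))%N.
Let Ln := (L*d)%N.
Let dL : (d<=L)%N. Proof. by move: Ld; clear; lia. Qed.
Let x_range k : (k<Ln)%N -> (low<=x k<=N)%N.
Proof.
move=> kL; apply/andP; split.
 apply: leqT (_ : 2 ^ (L-d)<=_)%N; first by rewrite leq_exp2l // leq_subr.
 by rewrite -(gx_pow L3) gx_mono // leq_addr.
rewrite /N -(gx_pow L3) gx_mono //; move: kL dL; rewrite /Ln; clear; nia.
Qed.

(** The normalised means, extended by 0 past the end of the grid so that [dft_argument] applies. *)
Let ax (i j : nat) : C := if (i<Ln)%N then (x i)%:R^-1%:C * psum (x i) (tU j) else 0.

Lemma ax_sq k : \sum_(j <- U) N2 (ax k j) <= 121.
Proof.
rewrite /ax; case: ltnP => [kL|_]; first by apply: avg_sq; exact: x_range.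
by rewrite big1 // => j _; rewrite N20.
Qed.

Let Lbig' : (L+2<=low)%N. Proof. exact: Lbig. Qed.

(** In the first [m] places the shifted term is missing, and in the [m] places past the end the
    unshifted one; [ax_sq] charges 121 for each. *)
Lemma shift_sum m (bet : nat -> C) : (m<=Ln)%N -> (forall j, N2 (bet j) = 1) ->
 \sum_(j <- U) \sum_[k<2*Ln] N2 (ax k j-bet j*(if (m<=k)%N then ax (k-m)%N j else 0)) <=
 242 * m%:R+\sum_(m <= k < Ln) \sum_(j <- U) N2 (ax k j-bet j*ax (k-m)%N j).
Proof.
move=> mL b1; rewrite exchange_big /=.
have l1: (Ln<=Ln+m)%N by rewrite leq_addr.
have l2: (Ln+m<=2*Ln)%N by move: mL; clear; lia.
rewrite (@big_cat_nat _ _ _ m) //=; last by apply: leqT mL _; apply: leqT l1 l2.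
rewrite [X in _+X](@big_cat_nat _ _ _ Ln) //=; last by apply: leqT l1 l2.
rewrite [X in _+(_+X)](@big_cat_nat _ _ _ (Ln+m)%N) //=.
have s1: \sum_[i<m] \sum_(j <- U) N2 (ax i j-bet j*(if (m<=i)%N then ax (i-m) j else 0)) <= 121 * m%:R.
 rewrite mulrC -[leRHS]mulr1 -mulrA; apply: leT (_ : \sum_[i<m] 121 <= _); last first.
  by rewrite big_const_nat iter_addr_0 subn0 mulr1 mulr_natl.
 apply: ler_sum_nat => i /andP[_ im]; apply: leT (ax_sq i).
 by apply: ler_sum => j _; rewrite leqNgt im /= mulr0 subr0.
have s3: \sum_(Ln <= i < Ln+m) \sum_(j <- U) N2 (ax i j-bet j*(if (m<=i)%N then ax (i-m) j else 0)) <= 121 * m%:R.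
 rewrite mulrC -[leRHS]mulr1 -mulrA; apply: leT (_ : \sum_(Ln <= i < Ln+m) 121 <= _); last first.
  by rewrite big_const_nat iter_addr_0 addKn mulr1 mulr_natl.
 apply: ler_sum_nat => i /andP[Li im]; apply: leT (ax_sq (i-m)).
 apply: ler_sum => j _; rewrite (leqT mL Li) {1}/ax ltnNge Li /= sub0r N2N N2M b1 mul1r //.
have s4: \sum_(Ln+m <= i < 2*Ln) \sum_(j <- U) N2 (ax i j-bet j*(if (m<=i)%N then ax (i-m) j else 0)) = 0.
 rewrite big_nat big1 // => i /andP[Li im]; rewrite big1 // => j _.
 rewrite /ax ltnNge (leqT l1 Li) /= ltnNge leq_subRL ?(leqT mL) ?(leqT l1 Li) //.
 by rewrite [(m+Ln)%N]addnC Li /= mulr0 subr0 N20.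
rewrite s4 addr0.
have s2: \sum_(m <= i < Ln) \sum_(j <- U) N2 (ax i j-bet j*(if (m<=i)%N then ax (i-m) j else 0)) =
  \sum_(m <= k < Ln) \sum_(j <- U) N2 (ax k j-bet j*ax (k-m)%N j).
 by apply: eq_big_nat => i /andP[-> _].
rewrite s2; lra.
Qed.

Lemma ax_diff : \sum_(j <- U) \sum_[k<2*Ln]
  N2 (ax k j-(if (1<=k)%N then ax (k-1)%N j else 0)) <= 242+1452*d%:R.
Proof.
have LR := axL_ge3.
have Ln1: (1<=Ln)%N by rewrite /Ln muln_gt0 L0 ltnW.
have := @shift_sum 1 (fun=> 1) Ln1 (fun=> N21).
have e1 j k : N2 (ax k j-(if (1<=k)%N then ax (k-1)%N j else 0)) =
 N2 (ax k j-1*(if (1<=k)%N then ax (k-1)%N j else 0)) by rewrite mul1r.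
rewrite (eq_bigr _ (fun j _ => eq_bigr _ (fun k _ => e1 j k))) mulr1 => hs; apply: leT hs _.
rewrite lerD2l; apply: leT (_ : \sum_(1 <= k < Ln) 1452/L%:R <= _); last first.
 rewrite big_const_nat iter_addr_0 -[leLHS]mulr_natl; apply: leT (_ : Ln%:R*(1452/L%:R) <= _).
  by rewrite leMr ?divr_ge0 // ler_nat leq_subr.
 by rewrite /Ln natrM; apply: le_of_eq; field; rewrite gt_eqF //; lra.
apply: ler_sum_nat => k /andP[k1 kL].
have kk: (k = (k-1).+1)%N by rewrite subn1 prednK.
have kL1: (k-1<Ln)%N by move: kL; clear; lia.
have /andP[r1 r2] := x_range kL1.
have r3: (L+2<=x (k-1))%N by exact: leqT Lbig' r1.
have [g1 g2] := grid_succ L3 r3.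
have xk: x k = gx L (L*(L-d)+(k-1)).+1 by rewrite /x -addnS -kk.
have Z0: 0 < (x (k-1))%:R:>R by rewrite ltr0n (leqT low0).
apply: leT (_ : \sum_(j <- U) N2 ((x (k-1))%:R^-1%:C * psum (x (k-1)) (tU j)-(x k)%:R^-1%:C * psum (x k) (tU j)) <= _).
 by apply: ler_sum => j _; rewrite mul1r /ax kL kL1 -N2N opprB.
have u0: 0 <= 3/L%:R:>R by rewrite divr_ge0.
apply: avg_close => //; rewrite ?xk // mulVf ?gt_eqF //; lra.
Qed.

(** [T j] is the sum estimated in [gram_primes]. By [f(pm) = g(p) f(m)] it equals [p g(p) p^(it)]
    times the partial sum up to [x_k/p], minus the one up to [x_k]. Replacing [x_k/p] by the nearby
    grid point costs [1452/L]. *)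
Lemma ax_prime p k : p \in ps -> (mp p<=k)%N -> (k<Ln)%N ->
 \sum_(j <- U) N2 (ax k j-g p*npw p (tU j)*ax (k-mp p)%N j) <=
 2*((x k)%:R ^- 2*\sum_(j <- U) N2 (\sum_[n<=(x k)] f n*((p%:R*(p %| n)%N%:R-1)%:C*npw n (tU j)))+1452/L%:R).
Proof.
move=> pin mk kL; have LR := axL_ge3; have [pp bp p1 pd] := psP pin; have p0: (0<p)%N by exact: ltnW.
have k0': (mp p<=L*(L-d)+k)%N by apply: leqT mk (leq_addl _ _).
have q2: (2<=L-d)%N by move: Ld d2; clear; lia.
have qk: (L*(L-d)<=L*(L-d)+k-mp p)%N by rewrite -addnBA // leq_addr.
have [z1 z2 z3] := grid_div L3 p0 k0' qk Lbig q2 (mpP pin).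
rewrite -addnBA // -/(x _) -/(x k) in z1 z2 z3.
have kL1: (k-mp p<Ln)%N by apply: leq_ltn_trans (leq_subr _ _) kL.
have /andP[r1 r2] := x_range kL.
have X0: 0 < (x k)%:R:>R by rewrite ltr0n (leqT low0).
set Z := (x k %/ p)%N in z1 z2 z3.
have ZN: (Z<=N)%N by apply: leqT r2; exact: leq_div.
have pR: 0 < p%:R:>R by rewrite ltr0n.
pose T j := \sum_[n<=(x k)] f n*((p%:R*(p %| n)%N%:R-1)%:C*npw n (tU j)).
have eT j : T j = p%:R%:C*(g p*npw p (tU j) * psum Z (tU j))-psum (x k) (tU j).
 have <- : \sum_[n<=(x k)] (p %| n)%N%:R%:C*(f n*npw n (tU j)) = g p*npw p (tU j) * psum Z (tU j).
  rewrite sum_mult // mulr_sumr; apply: eq_big_nat => m /andP[m1 _].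
  by rewrite hm // npwM //; ring.
 rewrite mulr_sumr -sumrB; apply: eq_bigr => n _; rewrite realCB realCM; ring.
have e j : ax k j-g p*npw p (tU j)*ax (k-mp p)%N j =
  g p*npw p (tU j)*((p%:R/(x k)%:R)%:C * psum Z (tU j)-(x (k-mp p))%:R^-1%:C * psum (x (k-mp p)) (tU j))
  - (x k)%:R^-1%:C*T j.
 by rewrite eT /ax kL kL1 realCM; ring.
apply: (leV (\sum_(j <- U) 2*(N2 ((p%:R/(x k)%:R)%:C * psum Z (tU j)-(x (k-mp p))%:R^-1%:C * psum (x (k-mp p)) (tU j))+(x k)%:R ^- 2*N2 (T j)))).
 apply: ler_sum => j _; rewrite e; apply: leT (N2B _ _) _.
 by rewrite ![N2 (_*_)]N2M hg1 // N2_npw !mul1r N2_real exprVn.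
rewrite -mulr_sumr ler_pM2l // big_split /= -mulr_sumr addrC lerD2l.
have Zp: (Z * p<=x k)%N by exact: leq_trunc_div.
have Zp': (x k<=Z.+1 * p)%N by apply: ltnW; exact: ltn_ceil.
have Zl: (L+2<=Z)%N by exact: leqT Lbig' z1.
apply: avg_close => //.
 by rewrite mulrAC ler_pdivrMr // mul1r -natrM ler_nat mulnC.
have -> : p%:R/(x k)%:R*Z%:R*(1+3/L%:R) = p%:R*(Z%:R*(1+3/L%:R))/(x k)%:R:>R by ring.
rewrite ler_pdivlMr // mul1r.
apply: (leV (Z.+1 * p)%:R); first by rewrite ler_nat.
rewrite natrM [leLHS]mulrC ler_pM2l // -[Z.+1%:R]natr1 mulrDr mulr1 lerD2l.
have : L%:R <= Z%:R:>R by rewrite ler_nat (leqT _ Zl) // leq_addr.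
move=> LZ; rewrite mulrA ler_pdivlMr; lra.
Qed.

(** Per grid point, the ends of the shifts cost at most [242 * 64], by [sum_mp_le], and the interior
    at most 1000. *)
Lemma ax_D : \sum_(p <- ps) p%:R^-1*\sum_(j <- U) \sum_[k<2*Ln]
  N2 (ax k j-g p*npw p (tU j)*(if (mp p<=k)%N then ax (k-mp p)%N j else 0)) <= 17*1000*Ln%:R.
Proof.
have LR := axL_ge3.
pose T p k := (x k)%:R ^- 2*\sum_(j <- U) N2 (\sum_[n<=(x k)] f n*((p%:R*(p %| n)%N%:R-1)%:C*npw n (tU j))).
have T0 p k : 0 <= T p k.
 by rewrite mulr_ge0 ?invr_ge0 ?exprn_ge0 //; apply: sumr_ge0 => j _; exact: N2_ge0.
have c0: 0 <= 1452/L%:R:>R by rewrite divr_ge0.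
apply: (leV (\sum_(p <- ps) (242*(p%:R^-1*(mp p)%:R)+\sum_[k<Ln] 2*(p%:R^-1*T p k+1452/L%:R * p%:R^-1)))).
 rewrite big_seq [leRHS]big_seq; apply: ler_sum => p pin.
 have [pp bp _ _] := psP pin.
 have b1 j : N2 (g p*npw p (tU j)) = 1 by rewrite N2M hg1 // N2_npw mulr1.
 have pi: 0 <= p%:R^-1:>R by rewrite invr_ge0.
 apply: leT (leMl pi (shift_sum (mp_le pin) b1)) _.
 rewrite mulrDr mulrCA lerD2l.
 apply: (leV (p%:R^-1*\sum_(mp p <= k < Ln) 2*(T p k+1452/L%:R))).
  by apply: leMl => //; apply: ler_sum_nat => k /andP[k1 k2]; exact: ax_prime.
 rewrite mulr_sumr [leRHS](@big_cat_nat _ _ _ (mp p)) ?mp_le //= -[leLHS]add0r; apply: lerD.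
  by apply: sumr_ge0 => k _; rewrite mulr_ge0 // addr_ge0 // mulr_ge0.
 by apply: ler_sum => k _; apply: le_of_eq; ring.
rewrite big_split /= -mulr_sumr exchange_big /=.
have s1: \sum_[k<Ln] \sum_(p <- ps) 2*(p%:R^-1*T p k+1452/L%:R * p%:R^-1) <= \sum_[k<Ln] 1000.
 apply: ler_sum_nat => k /andP[_ kL]; rewrite -mulr_sumr big_split /= -mulr_sumr.
 have /andP[r1 r2] := x_range kL.
 have X0: 0 < (x k)%:R:>R by rewrite ltr0n (leqT low0).
 have h1: \sum_(p <- ps) p%:R^-1*T p k <= 121.
  have psP' p : p \in ps -> prime p /\ (p<=2 ^ d)%N by move=> /psP [].
  have X0': (0<x k)%N by rewrite -(ltr_nat R).

  have := @gram_primes N (x k) E X0' r2 E0 hE U ps (2 ^ d)%N f uU U2 ups psP' hf (smallX r1).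
  rewrite -ler_pdivrMr ?exprn_gt0 // => hg2; apply: leT hg2.
  rewrite mulr_suml; apply: ler_sum => p _; rewrite /T -mulr_sumr; apply: le_of_eq; ring.
 have h2: 1452/L%:R*\sum_(p <- ps) p%:R^-1 <= 38:>R.
  have h3 := sum_ps_inv.
  have dR: 2 <= d%:R:>R by rewrite (ler_nat _ 2).
  have hd: rln d%:R <= d%:R-1 by apply: rln_le_sub1; lra.
  have h4: \sum_(p <- ps) p%:R^-1 <= 26*d%:R:>R by lra.
  apply: leT (leMl c0 h4) _; rewrite mulrAC ler_pdivrMr; last by lra.
  have : (1000*d)%:R <= L%:R:>R by rewrite ler_nat; case/andP: Ld.
  rewrite natrM; lra.
 lra.
have s2: \sum_(p <- ps) p%:R^-1*(mp p)%:R <= 64*Ln%:R:>R := sum_mp_le.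
rewrite big_const_nat iter_addr_0 subn0 -[1000 *+ Ln]mulr_natl in s1.
have Lp: 0 <= Ln%:R:>R by [].
apply: leT (lerD (leMl _ s2) s1) _ => //; lra.
Qed.

(** Primes up to [b] account for at most [2b]. Those in [(2^d, 2^L]] have reciprocal sum at most
    [16 (L-d)/d <= 16000], so the primes up to [2^d] already see the distance up to a constant. *)
Lemma ps_Phi (t : R) : `|t| <= 2*N%:R ->
 Phi-2*b%:R-32*1000 <= \sum_(p <- ps) (1-Re (g p*npw p t))/p%:R.
Proof.
move=> /hPhi; pose F p := (1-Re (g p*npw p t))/p%:R.
have gp p : nm (g p*npw p t) <= 1 by rewrite nmM nm_npw mulr1.
have re p : `|Re (g p*npw p t)| <= 1 by apply: leT (Re_nm _) (gp p).
have F0 p : 0 <= F p.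
 by rewrite divr_ge0 // subr_ge0; apply: leT (ler_norm _) (re p).
have F2 p : F p <= 2 * p%:R^-1.
 rewrite leMr ?invr_ge0 //; have := re p; rewrite ler_norml => /andP[h1 _].
 by move: h1; move: (Re _) => z; lra.
rewrite (@big_cat_nat _ _ _ (2 ^ d).+1) //=; last by rewrite ltnS leq_exp2l.
rewrite (bigID (fun p => (b<p)%N)) /= -[\sum_(1 <= p < (2 ^ d).+1 | prime p && (b<p)%N) _]big_filter -/ps.
have s2: \sum_(1 <= p < (2 ^ d).+1 | prime p && ~~ (b<p)%N) F p <= 2*b%:R.
 apply: leT (leMl _ (sum_small_le b (2 ^ d))) => //.
 rewrite mulr_sumr big_mkcond /=; apply: ler_sum_nat => p /andP[p1 _].
 case: ifP => [/andP[_]|_]; last by rewrite mulr_ge0.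
 rewrite -leqNgt => -> /=; rewrite mulr1; apply: leT (F2 p) _.
 by rewrite -[leRHS]mulr1 ler_pM2l // invf_le1 ?ltr0n // ler1n.
have s3: \sum_((2 ^ d).+1 <= p < N.+1 | prime p) F p <= 32*1000.
 apply: leT (_ : 2*(16*((L-d)%:R/d%:R)) <= _).
  apply: leT (leMl _ (sum_inv_primes_le d2 dL)) => //.
  by rewrite mulr_sumr; apply: ler_sum.
 have dR: 0 < d%:R:>R by rewrite ltr0n ltnW.
 have : (L-d)%:R/d%:R <= 1000:>R.
  rewrite ler_pdivrMr // -natrM ler_nat; move: Ld; clear; lia.
 lra.
move: s2 s3; rewrite -/(F _); lra.
Qed.

(** A low frequency of the transform twists by [p^(iv)] with [|v| <= 16 L <= N], so the twisted
    point still satisfies [|t| <= 2N]; [low_freq] takes care of the rounding in [mp]. *)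
Lemma ax_low j (z : R) : j \in U -> `|z| <= (2*Ln)%:R/h%:R ->
 Phi-2*b%:R-(32*1000+1) <= \sum_(p <- ps) p%:R^-1 *
   N2 (1-(g p*npw p (tU j))*cis (- (2*rpi*(z*(mp p)%:R/(2*Ln)%:R)))).
Proof.
move=> jU hz; have LR := axL_ge3.
have M0: (0<2*Ln)%N by rewrite /Ln !muln_gt0 L0 /=; apply: ltnW d2.
have MR: 0 < (2*Ln)%:R:>R by rewrite ltr0n.
have hR: 0 < h%:R:>R by rewrite ltr0n.
have h1R: 1 <= h%:R:>R by rewrite ler1n.
have pi4 := rpi_le4; have pi3 := rpi_gt3.
have hq: `|z/(2*Ln)%:R| <= h%:R^-1.
 rewrite normrM normfV [`|(2*Ln)%:R|]ger0_norm // ler_pdivrMr // mulrC; exact: hz.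
have hi: h%:R^-1 <= 1:>R by rewrite invf_le1.
have hi0: 0 < h%:R^-1:>R by rewrite invr_gt0.
have hv: `|2*rpi*(z/(2*Ln)%:R)| <= 8/h%:R.
 rewrite normrM [`|2*rpi|]ger0_norm; last by lra.
 by apply: ler_pM => //; lra.
have hps p : p \in ps -> [/\ (1<p)%N, N2 (g p) = 1 & (mp p)%:R <= L%:R*rln p%:R/rln 2 <= (mp p)%:R+1].
 by move=> pin; have [pp bp p1 _] := psP pin; split=> //; [exact: hg1|exact: mpP].
have ht: `|tU j-2*rpi*(z/(2*Ln)%:R)*L%:R/rln 2| <= 2*N%:R.
 have h1: `|tU j| <= N%:R.
  have : j%:R <= 2*N%:R:>R by rewrite -natrM ler_nat U2.
  have : 0 <= j%:R:>R by [].
  rewrite /tU ler_norml; lra.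
 have h2: `|2*rpi*(z/(2*Ln)%:R)*L%:R/rln 2| <= 16*L%:R.
  have l2 := rln2_ge.
  rewrite normrM normfV [`|rln 2|]ger0_norm; last by lra.
  rewrite ler_pdivrMr; last by lra.
  rewrite normrM [`|L%:R|]ger0_norm //.
  apply: leT (_ : 8*L%:R <= _); last by nra.
  by apply: leMr => //; lra.
 have h3: 16*L%:R <= N%:R:>R.
  rewrite -natrM ler_nat; apply: leqT (_ : 2 ^ d.+2 * low<=_)%N; last first.
   by rewrite /low -expnD /N leq_exp2l //; move: Ld d2; clear; lia.
  apply: leq_mul; first by rewrite -[16%N]/(2 ^ 4)%N leq_exp2l.
  by apply: leqT Lbig'; rewrite leq_addr.
 apply: leT (ler_normB _ _) _; lra.
have := low_freq L0 M0 hps hv (ps_Phi ht).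
have e2: (8/h%:R)^+2*\sum_(p <- ps) p%:R^-1 <= 1:>R.
 by apply: leT hh; apply: leMl; [exact: sqr_ge0|exact: sum_ps_inv].
lra.
Qed.

(** Divided by the number [L d] of grid points, the bound is [O(1/Psi + h^2/L)]. *)
Theorem avg_psum (Psi : R) : 0 < Psi -> Psi <= Phi-2*b%:R-(32*1000+1) ->
 \sum_(j <- U) \sum_[k<L*d] N2 ((gx L (L*(L-d)+k))%:R^-1%:C * psum (gx L (L*(L-d)+k)) (j%:R-N%:R)) <=
 17*1000*(L*d)%:R/Psi+h%:R^+2/4*(242+1452*d%:R).
Proof.
move=> P0 hP.
have Ln0: (0<Ln)%N by rewrite /Ln !muln_gt0 L0 ltnW.
have aL i j : (Ln<=i)%N -> ax i j = 0 by rewrite /ax ltnNge => ->.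
have hlow j (z : R) : j \in U -> `|z| <= (2*Ln)%:R/h%:R -> Psi <= _ := fun jU hz => leT hP (ax_low jU hz).
have := @dft_argument Ln h U ps mp ax (fun p j => g p*npw p (tU j)) _ _ Psi Ln0 h0 aL mp_le P0 ax_D ax_diff hlow.
apply: leT; apply: ler_sum => j _; apply: ler_sum_nat => k /andP[_ kL].
by rewrite /ax kL.
Qed.
End AX.

(** * Short averages of multiplicative functions *)

Section BadCount.
Variable (g : nat -> C).
Hypothesis hg : bnd1 g.

(** [power_large_sieve] with the trivial second factor, consisting of the term [m = 1] alone. *)
Lemma Qb_power_sum (N w i l : nat) : (0<w)%N -> (0<l)%N -> (N<=cw w i ^ l)%N ->
 \sum_[j<(2*N).+1] N2 (Qb g (cw w) i (j%:R-N%:R))^+l <= 2*CLS*(4 * l.+1%:R)^+l.+1.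
Proof.
move=> w0 l0 hl; set c := cw w i; set c' := cw w i.+1.
have c0: (0<c)%N by exact: cw_gt0.
have cR: 0 < c%:R:>R by rewrite ltr0n.
have C1 := CLS_ge1.
have cc: (0<c)%N /\ (c<=c'<=2*c)%N by split=> //; rewrite cw_mono cw_le2.
have K00: (0<c ^ l)%N by rewrite expn_gt0 c0.
have Klo: (c ^ l<1*c.+1 ^ l)%N by rewrite mul1n ltn_exp2r.
have Khi: (1*c' ^ l<=4 ^ l*c ^ l)%N.
 by rewrite mul1n -expnMn leq_expr //; case: cc => _ /andP[_ /leqT]; apply; rewrite leq_mul2r orbT.
have := @power_large_sieve g (fun=> 1) c c' l 0 1 (c ^ l) l N hg (fun=> eq_ind_r (fun x => x <= 1) (lexx _) nm1) cc K00 Klo Khi.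
have V1 t : N2 (Vs (fun=> 1) 0 1 t) = 1 by rewrite /Vs big_nat1 mul1r N2_npw.
have cl0: 0 < c%:R^+l:>R by rewrite exprn_gt0.
have e t : N2 (Qb g (cw w) i t)^+l = (c%:R^+l) ^- 2*N2 (Us g c c' t^+l*Vs (fun=> 1) 0 1 t).
 have N2X z : N2 (z^+l) = N2 z^+l.
  by elim: (l) => [|m IH]; [rewrite !expr0 N21|rewrite !exprS N2M IH].
 rewrite N2M V1 mulr1 N2X /Qb -/c -/c' -/(Us g c c' t) N2M N2_real exprMn -!exprM -exprVn.
 by rewrite mulnC.
move=> h; rewrite (eq_bigr _ (fun j _ => e _)) -mulr_sumr.
apply: leT (leMl _ h) _; first by rewrite invr_ge0 exprn_ge0 ?exprn_ge0.

have h2: N%:R+(4 ^ l*c ^ l)%:R <= 2*(4^+l*c%:R^+l):>R.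
 rewrite natrM !natrX mulrDl mul1r lerD2r; apply: leT (_ : c%:R^+l <= _).
  by rewrite -natrX ler_nat.
 by rewrite ler_peMl ?(ltW cl0) // exprn_ege1 // ler1n.
have lR: 0 <= l%:R:>R by [].
apply: (leV ((c%:R^+l) ^- 2*(l%:R*CLS*(2*(4^+l*c%:R^+l))*(1%:R*c%:R^+l * l.+1%:R^+l)))).
 apply: leMl; first by rewrite invr_ge0 exprn_ge0 ?exprn_ge0.
 apply: leMr; first by rewrite mul1r mulr_ge0 ?exprn_ge0.
 by apply: leMl => //; rewrite mulr_ge0 //; lra.
have -> : (c%:R^+l) ^- 2*(l%:R*CLS*(2*(4^+l*c%:R^+l))*(1%:R*c%:R^+l * l.+1%:R^+l)) =
  2*CLS*(l%:R*(4 * l.+1%:R)^+l) by rewrite exprMn; field; rewrite gt_eqF.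
apply: leMl; first by lra.
rewrite [leRHS]exprS; apply: leMr; first by rewrite exprn_ge0 // mulr_ge0.
by rewrite -[l.+1%:R]natr1; lra.
Qed.

(** Chebyshev's inequality with the moment of order [l], where [l] is minimal with [c^l >= N]. Then
    [c^(l-1) < N], and the thresholds cost [c^(2 al l) <= (N c)^(2 al)]. *)
Lemma bad_count (N w w' D : nat) (al : R) : (1<N)%N -> (0<w<=w')%N -> 0 <= al ->
 2*rln N%:R <= w%:R*D%:R ->
 (size [seq j <- iota 0 (2*N).+1 | bad g w w' al (j%:R-N%:R)])%:R <=
 (nI w w')%:R*(rexp (2*al*(rln N%:R+4*w'%:R))*(2*CLS*(4*(D.+2)%:R)^+D.+2)).
Proof.
move=> N1 ww al0 hD; have w0: (0<w)%N by case/andP: ww.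
have C1 := CLS_ge1.
pose l i := up_log (cw w i) N.
set M := rexp (2*al*(rln N%:R+4*w'%:R)).
have M0: 0 <= M by exact: rexp_ge0.
have lP i : (i<=nI w w')%N -> [/\ (0<l i)%N, (N<=cw w i ^ l i)%N, (l i<=D.+1)%N &
  thr al (cw w i) ^- 2^+l i <= M].
 move=> iI; have c1 := cw_gt1 i w0.
 have /andP[h1 h2] := up_log_bounds c1 N1.
 have li0: (0<l i)%N by rewrite up_log_gt0 c1.
 have cR: 0 < (cw w i)%:R:>R by rewrite ltr0n cw_gt0.
 have lc := rln_cw_ge w i; have lc2 := rln_cw_le ww iI.
 have h3: (l i).-1%:R*rln (cw w i)%:R <= rln N%:R.
  rewrite -rlnX // -natrX; apply: rln_le; first by rewrite ltr0n expn_gt0 cw_gt0.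
  by rewrite ler_nat ltnW.
 have wR: 0 < w%:R:>R by rewrite ltr0n.
 have lp : (l i)%:R = (l i).-1%:R+1:>R by rewrite natr1 prednK.
 split=> //.
  rewrite -(prednK li0) ltnS -(ler_nat R) -(ler_pM2l wR); apply: leT hD.
  have : (l i).-1%:R*(w%:R/2) <= (l i).-1%:R*rln (cw w i)%:R:>R by rewrite leMl.
  lra.
 rewrite /thr -rexpX -rexpN -rexpX /M rexp_le.
 have -> : - (- (al*rln (cw w i)%:R)*2%:R)*(l i)%:R = 2*al*((l i)%:R*rln (cw w i)%:R) by ring.
 apply: leMl; first by rewrite mulr_ge0.
 rewrite lp mulrDl mul1r; lra.
set K := 2*CLS*(4*(D.+2)%:R)^+D.+2.
have K0: 0 <= K by rewrite mulr_ge0 ?exprn_ge0 ?mulr_ge0 //; lra.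
have s1 i : (i<nI w w')%N -> \sum_[j<(2*N).+1] N2 (Qb g (cw w) i (j%:R-N%:R))^+l i <= K.
 move=> /ltnW iI; have [l0 lN lD _] := lP i iI; apply: leT (Qb_power_sum w0 l0 lN) _.
 apply: leMl; first by lra.
 have b0: 1 <= (D.+2)%:R:>R by rewrite ler1n.
 have b1: 1 <= 4*(D.+2)%:R:>R by lra.
 apply: leT (_ : (4*(D.+2)%:R)^+(l i).+1 <= _); last by rewrite ler_weXn2l.
 by rewrite lerXn2r ?nnegrE ?mulr_ge0 // leMl // ler_nat.
rewrite -sum1_size natr_sum big_filter.
apply: (leV (\sum_(j <- iota 0 (2*N).+1) \sum_[i<nI w w'] M*N2 (Qb g (cw w) i (j%:R-N%:R))^+l i)).
 rewrite big_mkcond /=; apply: ler_sum => j _; case: ifP => [hb|_]; last first.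
  by apply: sumr_ge0 => i _; rewrite mulr_ge0 // exprn_ge0 // N2_ge0.
 have [i iI hq] := bad_Q hb; have [l0 lN lD hM] := lP i (ltnW iI).
 rewrite (bigD1_seq i) /= ?mem_index_iota ?iota_uniq //.
 have t0 := thr_gt0 al (cw w i).
 have x1: 1 <= M*N2 (Qb g (cw w) i (j%:R-N%:R))^+l i.
  apply: (leV (thr al (cw w i) ^- 2^+l i*(thr al (cw w i)^+2)^+l i)).
   by rewrite -exprMn mulVf ?expr1n // expf_neq0 // gt_eqF.
  apply: ler_pM => //; rewrite ?exprn_ge0 ?invr_ge0 ?exprn_ge0 ?(ltW t0) //.
  by rewrite lerXn2r ?nnegrE ?N2_ge0 ?exprn_ge0 ?(ltW t0).
 apply: leT x1 _; rewrite lerDl; apply: sumr_ge0 => i' _.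
 by rewrite mulr_ge0 // exprn_ge0 // N2_ge0.
rewrite exchange_big /=.
apply: (leV (\sum_[i<nI w w'] M*K)).
 by apply: ler_sum_nat => i /andP[_ iI]; rewrite -mulr_sumr; apply: leMl => //; exact: s1.
by rewrite big_const_nat iter_addr_0 subn0 -[leLHS]mulr_natl.
Qed.
End BadCount.

Lemma exp_beats (K c : R) n : 0 < c ->
 exists L0, forall L, (L0<=L)%N -> K*(L%:R+3)^+n <= rexp (c*L%:R).
Proof.
move=> c0; pose a := (c/n.+1%:R)^+n.+1.
have n0: 0 < n.+1%:R:>R by rewrite ltr0n.
have a0: 0 < a by rewrite exprn_gt0 // divr_gt0.
pose B := `|K| * 4^+n/a; exists (Num.truncn B).+1 => L hL.
have B0: 0 <= B by apply: divr_ge0; [rewrite mulr_ge0 ?exprn_ge0|exact: ltW].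
have LB: B <= L%:R.
 by have /andP[_ /ltW h1] := truncn_itv B0; apply: leT h1 _; rewrite ler_nat.
have L1: 1 <= L%:R:>R by rewrite ler1n (leqT _ hL).
have h1 := @rexp_ge_pow (c*L%:R) n.+1 isT (mulr_ge0 (ltW c0) (ler0n _ _)).
apply: leT h1.
have -> : (c*L%:R/n.+1%:R)^+n.+1 = a*L%:R^+n.+1 by rewrite mulrAC exprMn.
apply: leT (_ : `|K| * (4*L%:R)^+n <= _).
 apply: leT (leMr _ (ler_norm K)) _; first by rewrite exprn_ge0 // addr_ge0.
 apply: leMl => //; rewrite lerXn2r ?nnegrE ?addr_ge0 ?mulr_ge0 //; lra.
rewrite exprMn [L%:R^+n.+1]exprS !mulrA; apply: leMr; first by rewrite exprn_ge0.
by rewrite [leRHS]mulrC -ler_pdivrMr.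
Qed.

(** In powers of [N = 2^L]: at most about [2/1000] from [2^(2d)], [1/50] from the bad points and
    [9/10] from [zsum_bound], against roughly [1 - 1/1000] on the right. The spare power absorbs the
    polynomial factors in [L] by [exp_beats]. *)
Lemma small_ok (KD : R) : 0 <= KD -> exists L0, forall L d w' (s : R), (L0<=L)%N -> (1000*d<=L)%N ->
 (1000*w'<=L)%N -> 0 <= s ->
 s <= 3*w'%:R^+2*(rexp (2*(1/100)*(rln (2 ^ L)%:R+4*w'%:R))*KD) ->
 13*(2 ^ d)%:R^+2*s*(40*((2 ^ L)%:R/P10 (2 ^ L))*(3+rln (2 ^ L)%:R)+2) <= (2 ^ (L-d-2))%:R.
Proof.
move=> KD0; have c0: 0 < 1/50:>R by lra.
have [L0 hL0] := @exp_beats (1000*1000*KD) (1/50) 3 c0; exists (maxn L0 1000) => L d w' s.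
rewrite geq_max => /andP[LL0 L1000] hd hw s0 hs.
have l1 := rln2_ge; have l2 := rln2_le.
have LR: 1000 <= L%:R:>R by rewrite (ler_nat _ 1000).
have dR: 1000*d%:R <= L%:R:>R by rewrite -natrM ler_nat.
have wR: 1000*w'%:R <= L%:R:>R by rewrite -natrM ler_nat.
have w0: 0 <= w'%:R:>R by [].
have d0: 0 <= d%:R:>R by [].
have pw n : (2 ^ n)%:R = rexp (rln 2*n%:R):>R by rewrite rexpX rlnK // natrX.
set lam := rln 2 in l1 l2 pw *.
have lnN: rln (2 ^ L)%:R = lam*L%:R by rewrite pw rexpK.
have dL: (d+2<=L)%N by move: hd L1000; clear; lia.
have hE: 40*((2 ^ L)%:R/P10 (2 ^ L))*(3+rln (2 ^ L)%:R)+2 <= 42*(L%:R+3)*rexp (9/10*(lam*L%:R)).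
 have -> : (2 ^ L)%:R/P10 (2 ^ L) = rexp (9/10*(lam*L%:R)).
  by rewrite /P10 lnN pw -rexpB; congr rexp; lra.
 set X := rexp _.
 have lam0: 0 <= lam by clear -l1; lra.
 have X1: 1 <= X by rewrite -[leLHS]rexp0 rexp_le; apply: mulr_ge0; [exact: divr_ge0|exact: mulr_ge0].
 rewrite lnN; have : lam*L%:R <= L%:R by rewrite ler_piMl.
 move: (lam*L%:R) => z hz; have : X*z <= X*L%:R by rewrite leMl //; clear -X1; lra.
 have : X*1000 <= X*L%:R by rewrite leMl //; clear -X1; lra.
 clear -X1; lra.
have h1: s <= 3*(L%:R+3)^+2*(rexp (1/50*(lam*L%:R)+1/1000*L%:R)*KD).
 apply: leT hs _; apply: ler_pM; rewrite ?mulr_ge0 ?exprn_ge0 ?rexp_ge0 //.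
  by rewrite ler_pM2l // lerXn2r ?nnegrE ?addr_ge0 //; lra.
 apply: leMr => //; rewrite rexp_le lnN; lra.
have yE: (2 ^ d)%:R^+2 <= rexp (2/1000*L%:R):>R.
 rewrite pw -rexpX rexp_le -mulrA; have hq: lam*(d%:R*2) <= d%:R*2 by rewrite ler_piMl ?mulr_ge0.
 clear -hq dR; lra.
have rE: rexp (lam*L%:R-1/1000*L%:R-2) <= (2 ^ (L-d-2))%:R.
 rewrite pw rexp_le -subnDA natrB // natrD mulrBr mulrDr.
 have hq: lam*d%:R <= d%:R by rewrite ler_piMl.
 clear -hq dR l2; lra.
apply: leT rE.
have E0: 0 <= 40*((2 ^ L)%:R/P10 (2 ^ L))*(3+rln (2 ^ L)%:R)+2.
 rewrite addr_ge0 // !mulr_ge0 ?invr_ge0 ?(ltW (P10_gt0 _)) // addr_ge0 // lnN mulr_ge0 //; clear -l1; lra.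
apply: (leV (13*rexp (2/1000*L%:R)*(3*(L%:R+3)^+2*(rexp (1/50*(lam*L%:R)+1/1000*L%:R)*KD))*(42*(L%:R+3)*rexp (9/10*(lam*L%:R))))).
 apply: ler_pM => //; first by rewrite !mulr_ge0.
 by apply: ler_pM => //; [rewrite mulr_ge0 ?exprn_ge0|rewrite ler_pM2l].
have -> : 13*rexp (2/1000*L%:R)*(3*(L%:R+3)^+2*(rexp (1/50*(lam*L%:R)+1/1000*L%:R)*KD))*(42*(L%:R+3)*rexp (9/10*(lam*L%:R))) =
  1638*KD*(L%:R+3)^+3*rexp (2/1000*L%:R+(1/50*(lam*L%:R)+1/1000*L%:R)+9/10*(lam*L%:R)).
 by rewrite !rexpD; ring.
have h2 := hL0 L LL0.
have KL: 0 <= KD*(L%:R+3)^+3 by rewrite mulr_ge0 ?exprn_ge0 // addr_ge0.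
apply: (leV (rexp (1/50*L%:R)*rexp (2/1000*L%:R+(1/50*(lam*L%:R)+1/1000*L%:R)+9/10*(lam*L%:R)))).
 apply: leMr; first exact: rexp_ge0.
 by apply: leT h2; move: KL; rewrite -!mulrA; move: (KD*_); clear => z z0; lra.
rewrite -rexpD rexp_le.
have : 1/2*L%:R <= lam*L%:R by rewrite leMr.
move: (lam*L%:R) => z hz; clear -hz LR; lra.
Qed.

Lemma root4 s0 : exists L0, forall L, (L0<=L)%N -> exists s, [/\ (s0<=s)%N, (s ^ 4<=L)%N & (L<s.+1 ^ 4)%N].
Proof.
exists (s0 ^ 4)%N => L hL.
have ex: exists s, (s ^ 4<=L)%N by exists 0%N.
have bd s : (s ^ 4<=L)%N -> (s<=L)%N.
 by case: s => // s; apply: leqT; rewrite expnS leq_pmulr // expn_gt0.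
case: (ex_maxnP ex bd) => s h1 h2; exists s; split=> //; first exact: h2.
by rewrite ltnNge; apply/negP => /h2; rewrite ltnn.
Qed.

(** As [J] grows, the ranges from the 16th to the 64th power of [kap^(v 4^J)] abut, so the largest
    admissible [J] works. *)
Lemma level_choice v w : (0<v)%N -> ((kap ^ v) ^ 16<=w)%N ->
 exists J, ((kap ^ (v*4 ^ J)) ^ 16<=w)%N /\ (w<=(kap ^ (v*4 ^ J)) ^ 64)%N.
Proof.
move=> v0 hw.
have ex: exists J, ((kap ^ (v*4 ^ J)) ^ 16<=w)%N by exists 0%N; rewrite expn0 muln1.
have bd J : ((kap ^ (v*4 ^ J)) ^ 16<=w)%N -> (J<=w)%N.
 apply: leqT; rewrite -expnM; apply: leqT (ltnW (ltn_expl J (isT : 1<4)%N)) _.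
 apply: leqT (ltnW (ltn_expl _ kap_gt1)) _; rewrite leq_exp2l //.
 by move: v0; move: (4 ^ J)%N => q; clear; nia.
case: (ex_maxnP ex bd) => J h1 h2; exists J; split=> //.
rewrite leqNgt; apply/negP => h3; have : ((kap ^ (v*4 ^ J.+1)) ^ 16<=w)%N.
 by apply: ltnW; apply: leq_ltn_trans h3; rewrite -!expnM leq_exp2l // [(4 ^ J.+1)%N]expnS; move: (4 ^ J)%N => q; clear; nia.
by move/h2; rewrite ltnn.
Qed.

Lemma pow2_big L d : (100<=L)%N -> (1000*d<=L)%N -> (L+2<=2 ^ (L-d-2))%N.
Proof.
move=> h1 h2; have h3: (2*(L %/ 3)<=L-d-2)%N by lia.
apply: leqT (_ : 2 ^ (2*(L %/ 3))<=_)%N; last by rewrite leq_exp2l.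
rewrite mul2n -addnn expnD; have := ltn_expl (L %/ 3) (isT : 1<2)%N.
move: (2 ^ _)%N => z hz; have : (33<=L %/ 3)%N by lia.
have : (L<3*(L %/ 3)+3)%N by lia.
by move: hz; clear; nia.
Qed.

(** Each [n] in [(x_L, x_m]] lies in [L] of the windows [(x_i, x_(i+L)]]. In the application such a
    window is about one doubling long. *)
Lemma overlap (x : nat -> nat) (F : nat -> R) L m : (forall i, (x i<=x i.+1)%N) -> (L<=m)%N ->
 (forall n, 0 <= F n) ->
 L%:R*\sum_((x L).+1 <= n < (x m).+1) F n <= \sum_[i<m] \sum_((x i).+1 <= n < (x (i+L)%N).+1) F n.
Proof.
move=> xm Lm F0.
have mono i j : (i<=j)%N -> (x i<=x j)%N.
 by move=> /subnK <-; elim: (j-i)%N => // k IH; rewrite addSn; exact: leqT IH (xm _).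
have e i : \sum_((x i).+1 <= n < (x (i+L)%N).+1) F n =
  \sum_[l<L] \sum_((x (i+l)%N).+1 <= n < (x (i+l).+1).+1) F n.
 have := @sum_blocks R F predT (fun l => x (i+l)%N) L; rewrite addn0 => <-.
  by apply: eq_bigr => l _; rewrite addnS.
 by move=> l; rewrite addnS.
rewrite (eq_bigr _ (fun i _ => e i)) exchange_big /=.
have -> : L%:R*\sum_((x L).+1 <= n < (x m).+1) F n = \sum_[l<L] \sum_((x L).+1 <= n < (x m).+1) F n.
 by rewrite [RHS]big_const_nat iter_addr_0 subn0 -[RHS]mulr_natl.
apply: ler_sum_nat => l /andP[_ lL].
have := @sum_blocks R F predT (fun i => x (i+l)%N) m; rewrite add0n => h.
rewrite h; last by move=> i; rewrite addSn.
rewrite [leRHS](@big_cat_nat _ _ _ (x L).+1) /=; first last.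
- by rewrite ltnS mono // (leqT Lm) // leq_addr.
- by rewrite ltnS mono // ltnW.
rewrite [X in _ <= _+X](@big_cat_nat _ _ _ (x m).+1) /=; first last.
- by rewrite ltnS mono // leq_addr.
- by rewrite ltnS mono.
have s0 u w : 0 <= \sum_(u <= n < w) F n by apply: sumr_ge0.
have := s0 (x l).+1 (x L).+1; have := s0 (x m).+1 (x (m+l)%N).+1; lra.
Qed.

Lemma sqrt_amgm (z k : R) : 0 <= z -> 0 < k -> Num.sqrt z <= k+z/k.
Proof.
move=> z0 k0; have [s0 sz] : 0 <= Num.sqrt z /\ Num.sqrt z^+2 = z by rewrite sqrtr_ge0 sqr_sqrtr.
rewrite -{2}sz; move: (Num.sqrt z) s0 => s s0; rewrite -(ler_pM2r k0) mulrDl divfK ?gt_eqF //; nra.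
Qed.

Section MR.
Variables (f g : nat -> C) (b : nat).
Hypotheses (hf : bnd1 f) (hg : bnd1 g).
Hypothesis hm : qmult b g f.

Lemma fh_sq X X' t : (0<X)%N -> (X<=X'<=3*X)%N ->
 N2 (fh f X X' t) <= 18*N2 (X'%:R^-1%:C * psum f X' t)+2*N2 (X%:R^-1%:C * psum f X t).
Proof.
move=> X0 /andP[XX' X3]; have XR: 0 < X%:R:>R by rewrite ltr0n.
have XR': 0 < X'%:R:>R by rewrite ltr0n (leqT X0).
have e: fh f X X' t = (X'%:R/X%:R)%:C*(X'%:R^-1%:C * psum f X' t)-X%:R^-1%:C * psum f X t.
 have -> : (X'%:R/X%:R)%:C*(X'%:R^-1%:C * psum f X' t) = X%:R^-1%:C * psum f X' t.
  by rewrite mulrA -realCM; congr (_%:C*_); field; rewrite !gt_eqF.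
 rewrite -mulrBr; congr (_*_).
 have -> : psum f X' t = psum f X t+\sum_(X.+1 <= n < X'.+1) f n*npw n t.
  by rewrite /psum (@big_cat_nat _ _ _ X.+1).
 by rewrite addrAC subrr add0r.
rewrite e; apply: leT (N2B _ _) _; rewrite N2M N2_real.
have q3: X'%:R/X%:R <= 3:>R by rewrite ler_pdivrMr // -natrM ler_nat.
have q0: 0 <= X'%:R/X%:R:>R by rewrite divr_ge0.
have := N2_ge0 (X'%:R^-1%:C * psum f X' t); move: (N2 (X'%:R^-1%:C * psum f X' t)) (N2 (X%:R^-1%:C * psum f X t)) => z y z0.
have q9: (X'%:R/X%:R)^+2 <= 9:>R by rewrite -[9](_ : 3^+2 = _:>R) ?lerXn2r ?nnegrE //; lra.
have := leMr z0 q9; lra.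
Qed.

Definition cI v := cw ((kap ^ v) ^ 4) (nI ((kap ^ v) ^ 4) ((kap ^ v) ^ 8)).
Definition badU w r L := [seq j <- iota 0 (2*2 ^ L).+1 | bad g w (w*kap ^ r) (1/100) (j%:R-(2 ^ L)%:R)].

(** [T = floor(X/(2 cI v))] satisfies the length condition of [first_level] with [2T] in place of
    [T]. At the same time [X/T <= 4 cI v], so the smoothing error of [duality] depends on [H] and
    [v] but not on [X]; hence [H] can be fixed before [L]. *)
Lemma window_bound (r v w J L H X X' : nat) (eta k : R) : (4<=r<=v)%N -> (b<=2 ^ ((kap ^ v) ^ 4))%N ->
 ((kap ^ (v*4 ^ J)) ^ 16<=w)%N -> (w*kap ^ r<=(kap ^ (v*4 ^ J)) ^ 65)%N ->
 15*(w*kap ^ r)%:R <= rln X%:R -> (X<=X'<=3*X)%N -> (2*cI v<=X)%N -> (X<=2 ^ L)%N -> (0<H)%N ->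
 0 < eta -> 0 < k ->
 \sum_(X.+1 <= n < X'.+1) nm (savg f H n)/n%:R <=
 H%:R/X%:R+4/H%:R+2*eta+576*(8*E4*(cI v)%:R/H%:R)^+2/eta+2*k +
 2/k*(400*CLS/r%:R+\sum_(j <- badU w r L)
   (18*N2 (X'%:R^-1%:C * psum f X' (j%:R-(2 ^ L)%:R))+2*N2 (X%:R^-1%:C * psum f X (j%:R-(2 ^ L)%:R)))).
Proof.
move=> /andP[r4 rv] hb hw hw' hX XX' cX XL H0 eta0 k0.
have c0: (0<cI v)%N by exact: cw_gt0.
have X0: (0<X)%N by apply: leqT cX; rewrite muln_gt0.
have XR: 0 < X%:R:>R by rewrite ltr0n.
pose T := (X %/ (2*cI v))%N.
have T0: (0<T)%N by rewrite divn_gt0 // muln_gt0.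
have T2: (2*T*cI v<=X)%N by rewrite -mulnA mulnCA; exact: leq_trunc_div.
have TX: (2*T<=X)%N by apply: leqT T2; rewrite leq_pmulr.
have XT: X%:R <= 4*(cI v)%:R*T%:R:>R.
 rewrite -!natrM ler_nat; have := ltn_ceil X (isT : 0<2)%N => _.
 have : (X<T.+1*(2*cI v))%N by apply: ltn_ceil; rewrite muln_gt0.
 by move: T0; clear; nia.
have HR: 0 < H%:R:>R by rewrite ltr0n.
have TR: 0 < T%:R:>R by rewrite ltr0n.
have E1 := E4_ge1.
set S := \sum_[j<(4*T).+1] N2 (fh f X X' (j%:R-(2*T)%:R)).
have hdual: \sum_(X.+1 <= n < X'.+1) nm (savg f H n) <= _ := @duality f X X' H T hf H0 T0 X0 XX' eta eta0.
rewrite -/S in hdual.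
have S0: 0 <= S by apply: sumr_ge0 => j _; exact: N2_ge0.
have hS: S <= 400*CLS/r%:R+\sum_(j <- badU w r L) (18*N2 (X'%:R^-1%:C * psum f X' (j%:R-(2 ^ L)%:R))+2*N2 (X%:R^-1%:C * psum f X (j%:R-(2 ^ L)%:R))).
 have h1 := @levels_total f g b X X' (2*T)%N hf hg hm XX' X0 TX J v w r r4 rv hb T2 hw hw' hX.
 rewrite mulnA in h1; apply: leT h1 _; rewrite lerD2l.
 pose G (t : R) := if bad g w (w*kap ^ r) (1/100) t then N2 (fh f X X' t) else 0.
 have G0 t : 0 <= G t by rewrite /G; case: ifP => // _; exact: N2_ge0.
 apply: leT (_ : \sum_[i<(2*2 ^ L).+1] G (i%:R-(2 ^ L)%:R) <= _); last first.
  rewrite /badU big_filter [leRHS]big_mkcond /=; apply: ler_sum => j _; rewrite /G; case: ifP => // _; exact: fh_sq.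
 rewrite [leLHS]big_mkcond /= -/(G _).
 pose s := (2 ^ L-2*T)%N.
 have Ts: (2*T<=2 ^ L)%N by exact: leqT TX XL.
 have := @sum_addn R (fun i => G (i%:R-(2 ^ L)%:R)) s (4*T).+1 => e.
 have e2: \sum_[i<(2*2*T).+1] G (i%:R-(2*T)%:R) = \sum_(s <= i < (4*T).+1+s) G (i%:R-(2 ^ L)%:R).
  rewrite e; apply: eq_bigr => i _; congr G; rewrite natrD /s natrB //; ring.
 have -> : \sum_[i<(2*2*T).+1]  (if bad g w (w*kap ^ r) (1/100) (i%:R-(2*T)%:R) then N2 (fh f X X' (i%:R-(2*T)%:R)) else 0) = \sum_[i<(2*2*T).+1] G (i%:R-(2*T)%:R) by [].
 rewrite e2 [leRHS](@big_cat_nat _ _ _ s) //=; last by rewrite /s; move: Ts; clear; lia.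
 rewrite [X in _ <= _+X](@big_cat_nat _ _ _ ((4*T).+1+s)%N) //=; first last.
 - by rewrite /s; move: Ts; clear; lia.
 - by rewrite leq_addl.
 have p0 u u' : 0 <= \sum_(u <= i < u') G (i%:R-(2 ^ L)%:R) by apply: sumr_ge0.
 have := p0 0%N s; have := p0 ((4*T).+1+s)%N (2*2 ^ L).+1.
 move: (\sum_(s <= i < _) _) (\sum_[i<s] _) (\sum_(_ <= i < (2*2 ^ L).+1) _) => *; lra.
apply: (leV ((\sum_(X.+1 <= n < X'.+1) nm (savg f H n))/X%:R)).
 rewrite mulr_suml; apply: ler_sum_nat => n /andP[Xn _]; apply: leMl; first exact: nm_ge0.
 by apply: invr_le => //; rewrite ler_nat ltnW.
have XTi: X%:R/T%:R <= 4*(cI v)%:R:>R by rewrite ler_pdivrMr.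
have hs := sqrt_amgm S0 k0.
rewrite ler_pdivrMr //; apply: leT hdual _.
set Z := 400*CLS/r%:R+_ in hS *.
have m1: 288*(2*E4*X%:R/H%:R)^+2/(eta*T%:R^+2) <= 288*(8*E4*(cI v)%:R/H%:R)^+2/eta.
 have -> : 288*(2*E4*X%:R/H%:R)^+2/(eta*T%:R^+2) = 288*(2*E4*(X%:R/T%:R)/H%:R)^+2/eta.
  by field; rewrite !gt_eqF.
 apply: leMr; first by rewrite invr_ge0 ltW.
 have E2: 0 <= 2*E4 by lra.
 have a0: 0 <= 2*E4*(X%:R/T%:R)/H%:R by apply: divr_ge0 => //; apply: mulr_ge0 => //; exact: divr_ge0.
 have ab: 2*E4*(X%:R/T%:R)/H%:R <= 8*E4*(cI v)%:R/H%:R.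
  apply: leMr; first by rewrite invr_ge0 ltW.
  have -> : 8*E4*(cI v)%:R = 2*E4*(4*(cI v)%:R) by ring.
  exact: leMl.
 by rewrite ler_pM2l // lerXn2r ?nnegrE // (leT a0).
have m2: Num.sqrt S <= k+Z/k.
 by apply: leT hs _; rewrite lerD2l; apply: leMr => //; rewrite invr_ge0 ltW.
set m := 288*_/(eta*_) in m1 *; set m' := 288*_/eta in m1.
apply: (leV (H%:R+X%:R*(2*(2/H%:R+eta+m')+2*(k+Z/k)))).
 have u1: X%:R*(2/H%:R+eta+m) <= X%:R*(2/H%:R+eta+m') by rewrite ler_pM2l // lerD2l.
 have u2: X%:R*Num.sqrt S <= X%:R*(k+Z/k) by rewrite ler_pM2l.
 move: u1 u2; move: (2/H%:R+eta+m) (2/H%:R+eta+m') (k+Z/k) (Num.sqrt S) => y1 y2 y3 y4 u1 u2.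
 lra.
apply: le_of_eq; rewrite /m'.
by field; rewrite !gt_eqF.
Qed.
End MR.

(** [r] and [v] depend on [eps] and [b], and [H] has to be large in terms of [cI v]. With [w] about
    [L/(1000 kap^r)] the last window stays below an exponent [L/1000], while the order of the
    moments in [bad_count] stays bounded by [D.+1]. *)
Lemma mr_step (f g : nat -> C) (b : nat)
 (hf : bnd1 f) (hg : bnd1 g)
 (hm : qmult b g f)
 (hg1 : forall p, prime p -> (b<p)%N -> N2 (g p) = 1)
 (hPhi : forall M : R, exists N0, forall N, (N0<=N)%N -> forall t : R, `|t| <= 2*N%:R ->
  M <= \sum_(1 <= p < N.+1 | prime p) (1-Re (g p*npw p t))/p%:R) (eps : R) : 0 < eps -> exists H0, forall H, (H0<=H)%N -> exists L0, forall L, (L0<=L)%N ->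
 let d := (L %/ 1000)%N in (4<=d)%N /\
 \sum_((2 ^ (L-d).+1).+1 <= n < (2 ^ L.-1).+1) nm (savg f H n)/n%:R <= eps*d%:R.
Proof.
move=> eps0; have C1 := CLS_ge1; have E1 := E4_ge1.
(* Serves twice below: as the parameter [eta] of [duality] and as the one that replaces the square
   root in [window_bound]. *)
pose k : R := eps/16; have k0: 0 < k by rewrite /k; lra.
have ke0: 0 < k*eps by rewrite mulr_gt0.
have [r0 hr0] := nat_above (800*8*CLS/(k*eps)).
pose r := maxn 4 r0; pose v := maxn r b.
have r4: (4<=r)%N by rewrite leq_maxl.
have rR: 0 < r%:R:>R by rewrite ltr0n (leqT _ r4).
have rv: (4<=r<=v)%N by rewrite r4 leq_maxl.
have hrk: 2/k*(400*CLS/r%:R) <= eps/8.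
 have : 800*8*CLS/(k*eps) <= r%:R by apply: leT hr0 _; rewrite ler_nat leq_maxr.
 rewrite ler_pdivrMr // => h.
 have -> : 2/k*(400*CLS/r%:R) = 800*CLS/(k*r%:R) by field; rewrite !gt_eqF.
 rewrite ler_pdivrMr ?mulr_gt0 //; move: h; rewrite /k; lra.
have hb: (b<=2 ^ ((kap ^ v) ^ 4))%N.
 apply: leqT (_ : v<=_)%N; first by rewrite leq_maxr.
 apply: leqT (ltnW (ltn_expl v kap_gt1)) _; apply: leqT (ltnW (ltn_expl _ (isT : 1<2)%N)) _.
 by rewrite leq_exp2l // -{1}[(kap ^ v)%N]expn1 leq_pexp2l.
have v0: (0<v)%N by case/andP: rv => h1; apply: leqT; apply: leqT h1.
have cR: 1 <= (cI v)%:R:>R by rewrite ler1n cw_gt0.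
have [h1 hh1] := nat_above (32/eps).
have [h2 hh2] := nat_above (576*8*(8*E4*(cI v)%:R)^+2/(k*eps)).
exists (maxn 1 (maxn h1 h2)) => H; rewrite !geq_max => /and3P [H0 Hh1 Hh2].
have HR: 1 <= H%:R:>R by rewrite ler1n.
have t2: 4/H%:R <= eps/8.
 have : 32/eps <= H%:R by apply: leT hh1 _; rewrite ler_nat.
 rewrite ler_pdivrMr // => h; rewrite ler_pdivrMr; lra.
have t4: 576*(8*E4*(cI v)%:R/H%:R)^+2/k <= eps/8.
 have : 576*8*(8*E4*(cI v)%:R)^+2/(k*eps) <= H%:R by apply: leT hh2 _; rewrite ler_nat.
 rewrite ler_pdivrMr // => h; set q := 8*E4*(cI v)%:R in h *.
 have -> : 576*(q/H%:R)^+2/k = 576*q^+2/(H%:R^+2*k) by field; rewrite !gt_eqF //; lra.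
 rewrite ler_pdivrMr; last by rewrite mulr_gt0 ?exprn_gt0 //; lra.
 have : H%:R*(k*eps) <= H%:R^+2*(k*eps) by rewrite leMr ?(ltW ke0) // expr2 ler_peMl //; lra.
 lra.
have [N0 hN0] := hPhi (40*17*1000*8/(k*eps)+2*b%:R+(32*1000+1)).
set Psi := 40*17*1000*8/(k*eps) in hN0.
have Psi0: 0 < Psi by rewrite divr_gt0 // !mulr_gt0.
(* As [w >= 1], [L < 2 w (1000 kap^r)], so that [w D >= 2 L] as [bad_count] requires. *)
pose D := (4*1000*kap ^ r)%N.
pose KD : R := 2*CLS*(4*(D.+2)%:R)^+D.+2.
have KD0: 0 <= KD by rewrite mulr_ge0 ?exprn_ge0 ?mulr_ge0 //; lra.
have [L1 hL1] := small_ok KD0.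
have [s0 hs0] := nat_above (40*394*8/(k*eps)).
have [L2 hL2] := root4 (maxn s0 5000).
have [L3 hL3] := nat_above (8*H%:R/eps).
exists (L1+L2+L3+N0+4*cI v+1000*1000+1000*kap ^ r*(kap ^ v) ^ 16)%N => L hL d.
have kr0: (0<kap ^ r)%N by exact: kap_gt0.
have d1000: (1000<=d)%N by rewrite leq_divRL //; move: hL; clear; lia.
split; first by apply: leqT d1000.
have Ld: (1000*d<=L<=1001*d)%N by move: d1000; rewrite /d; clear; lia.
have /andP[Ld1 Ld2] := Ld.
have L100: (100<=L)%N by move: hL; clear; lia.
have Lbig := pow2_big L100 Ld1.
(* [s] is about [L^(1/4)]: then [s^2/L] tends to 0, while [s^2] still dominates [log d] in the
   rounding condition [hh]. *)
have [s [ss0 s4 Ls]] := hL2 L ltac:(move: hL; clear; lia).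
pose w := (L %/ (1000*kap ^ r))%N.
have K0: (0<1000*kap ^ r)%N by rewrite muln_gt0.
have hw: ((kap ^ v) ^ 16<=w)%N.
 by rewrite leq_divRL // mulnC; move: hL; clear; lia.
have w0: (0<w)%N by apply: leqT hw; rewrite expn_gt0 kap_gt0.
have wL: (1000*(w*kap ^ r)<=L)%N by rewrite mulnCA; exact: leq_trunc_div.
have Lw: (2*L<=w*D)%N.
 have : (L<w.+1*(1000*kap ^ r))%N by exact: ltn_ceil.
 by move: w0; rewrite /D; move: (kap ^ r)%N (w) => q z; clear; nia.
have [J [hJ1 hJ2]] := level_choice v0 hw.
have hJ3: (w*kap ^ r<=(kap ^ (v*4 ^ J)) ^ 65)%N.
 rewrite (expnS _ 64) mulnC; apply: leq_mul => //; rewrite leq_pexp2l ?kap_gt0 //; first by apply: ltnW.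
 by case/andP: rv => _ /leqT; apply; rewrite leq_pmulr // expn_gt0.
set N := (2 ^ L)%N; set U := badU g w r L; pose m := (L*d-L)%N.
pose x i := gx L (L*(L-d) + i).
pose E := 40*(N%:R/P10 N)*(3+rln N%:R).
have L3': (3<=L)%N by apply: leqT L100.
have LR: 1000 <= L%:R:>R by rewrite (ler_nat _ 1000); move: hL; clear; lia.
have dR: 1000 <= d%:R:>R by rewrite (ler_nat _ 1000).
have LdR: 1000*d%:R <= L%:R:>R by rewrite -natrM ler_nat.
have N1: (1<N)%N by rewrite -[1%N](expn0 2) ltn_exp2l // (leqT _ L3').
have l20 := rln2_ge; have l21 := rln2_le.
have lnN: rln N%:R = L%:R*rln 2 by exact: rln_2w.
have E0: 0 <= E.
 rewrite !mulr_ge0 ?invr_ge0 ?(ltW (P10_gt0 _)) // addr_ge0 // rln_ge0 // ler1n; exact: ltnW.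
have hE Z u : (Z<=4*N)%N -> `|u| <= 3*N%:R -> nm (zsum Z u-zmain Z u) <= E.
 by move=> ? ?; apply: zsum_bound => //; exact: ltnW.
have uU: uniq U by rewrite filter_uniq // iota_uniq.
have U2 j : j \in U -> (j<=2*N)%N by rewrite mem_filter mem_iota /= add0n ltnS => /andP[].
have sU: (size U)%:R <= 3*(w*kap ^ r)%:R^+2*(rexp (2*(1/100)*(rln N%:R+4*(w*kap ^ r)%:R))*KD).
 have ww: (0<w<=w*kap ^ r)%N by rewrite w0 leq_pmulr.
 have al0: 0 <= 1/100:>R by rewrite divr_ge0.
 have hD: 2*rln N%:R <= w%:R*D%:R.
  apply: leT (_ : (2*L)%:R <= _); last by rewrite -natrM ler_nat.
  by rewrite lnN natrM ler_pM2l // ler_piMr.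
 have hbc: (size U)%:R <= _ := bad_count hg N1 ww al0 hD; apply: leT hbc _.
 apply: leMr; first by rewrite mulr_ge0 // rexp_ge0.
 rewrite -natrX -natrM ler_nat /nI -mulnA leq_mul2l /= expnS expn1 leq_mul2r; apply/orP; right; exact: leq_pmulr.
have small: 13*(2 ^ d)%:R^+2*(size U)%:R*(E+2) <= (2 ^ (L-d-2))%:R.
 by apply: hL1 sU => //; move: hL; clear; lia.
have hPhi' (t : R) : `|t| <= 2*N%:R -> Psi+2*b%:R+(32*1000+1) <= \sum_(1 <= p < N.+1 | prime p) (1-Re (g p*npw p t))/p%:R.
 apply: hN0; apply: leqT (ltnW (ltn_expl L (isT : 1<2)%N)); move: hL; clear; lia.
have s5: (5000<=s)%N by apply: leqT ss0; rewrite leq_maxr.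
have sR: 5000 <= s%:R:>R by rewrite (ler_nat _ 5000).
have s00: 0 < s%:R:>R by apply: lt_le_trans sR; rewrite ltr0n.
have hh: (8/s%:R)^+2*(20+16*rln d%:R) <= 1.
 have ld: rln d%:R <= 4*s%:R.
  apply: (leV (rln (s.+1 ^ 4)%:R)).
   apply: rln_le; first by rewrite ltr0n (leqT _ d1000).
   by rewrite ler_nat; apply: leqT (ltnW Ls); apply: leq_div.
  rewrite natrX rlnX ?ltr0n // ler_pM2l //.
  by apply: leT (rln_le_sub1 _) _; rewrite ?ltr0n // -[s.+1%:R]natr1 addrK.
 rewrite expr_div_n mulrAC ler_pdivrMr ?exprn_gt0 // mul1r.
 by clear -ld sR; nra.
have d2: (2<=d)%N by apply: leqT d1000.
have s0': (0<s)%N by apply: leqT s5.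
have Psi': Psi <= Psi+2*b%:R+(32*1000+1)-2*b%:R-(32*1000+1).
 by apply: le_of_eq; ring.
have hS := @avg_psum f g b L d s U E (Psi+2*b%:R+(32*1000+1)) hf hg hm hg1 d2 Ld Lbig s0' E0 hE uU U2 small hPhi' hh Psi Psi0 Psi'.
have Ln0: 0 < (L*d)%:R:>R by rewrite ltr0n muln_gt0 (leqT _ d2) // (leqT _ L3').
have hS2: 17*1000*(L*d)%:R/Psi+s%:R^+2/4*(242+1452*d%:R) <= (k/40*(eps/4))*(L*d)%:R.
 have a1: 17*1000*(L*d)%:R/Psi = k/40*(eps/8)*(L*d)%:R.
  by rewrite /Psi; field; rewrite !gt_eqF.
 have a2: s%:R^+2/4*(242+1452*d%:R) <= k/40*(eps/8)*(L*d)%:R.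
  have b1: 242+1452*d%:R <= 4*394*d%:R:>R by clear -dR; lra.
  apply: leT (leMl _ b1) _; first by rewrite divr_ge0 ?exprn_ge0.
  have b2: 40*394*8/(k*eps) <= s%:R by apply: leT hs0 _; rewrite ler_nat; apply: leqT ss0; rewrite leq_maxl.
  have b3: s%:R^+4 <= L%:R:>R by rewrite -natrX ler_nat.
  rewrite ler_pdivrMr // in b2; rewrite natrM.
  have b4: s%:R^+2*(40*394*8) <= L%:R*(k*eps).
   apply: leT (_ : s%:R^+4*(k*eps) <= _); last by rewrite ler_pM2r.
   rewrite (exprD _ 2 2) -[s%:R^+2*s%:R^+2*_]mulrA; apply: leMl; first by rewrite exprn_ge0.
   apply: leT b2 _; rewrite ler_pM2r // expr2 ler_peMl ?(ltW s00) //; clear -sR; lra.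
  have -> : s%:R^+2/4*(4*394*d%:R) = s%:R^+2*(40*394*8)*(d%:R/320):>R by field.
  have -> : k/40*(eps/8)*(L%:R*d%:R) = L%:R*(k*eps)*(d%:R/320):>R by field.
  by apply: leMr => //; rewrite divr_ge0.
 by rewrite a1; apply: leT (lerD (lexx _) a2) _; apply: le_of_eq; field.
have {hS2} hS := leT hS hS2.
pose A i := \sum_(j <- U) N2 ((x i)%:R^-1%:C * psum f (x i) (j%:R-N%:R)).
have A0 i : 0 <= A i by apply: sumr_ge0 => j _; exact: N2_ge0.
rewrite exchange_big /= -/(A _) in hS.
have xmono i : (x i<=x i.+1)%N by rewrite /x gx_mono // addnS.
have dL: (d<=L)%N by move: Ld1; clear; lia.
have xlo i : (2 ^ (L-d)<=x i)%N by rewrite -(gx_pow L3') gx_mono // leq_addr.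
have xhi i : (i<=L*d)%N -> (x i<=N)%N.
 move=> il; rewrite /N -(gx_pow L3') gx_mono //; apply: leqT (_ : L*(L-d)+L*d<=_)%N; first by rewrite leq_add2l.
 by rewrite -mulnDr subnK.
have mL: (m+L = L*d)%N by rewrite subnK // leq_pmulr // (leqT _ d2).
have Lm: (L<=m)%N by rewrite -(leq_add2r L) mL addnn -muln2 leq_mul2l d2 orbT.
pose c1 : R := eps*(3/4).
have win i : (i<m)%N -> \sum_((x i).+1 <= n < (x (i+L)%N).+1) nm (savg f H n)/n%:R <= c1+2/k*(18*A (i+L)%N+2*A i).
 move=> im.
 have i1: (i<=L*d)%N by rewrite -mL; apply: leqT (ltnW im) (leq_addr _ _).
 have X0: (0<x i)%N by apply: leqT (xlo i); rewrite expn_gt0.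
 have XL: (L<=x i)%N.
  apply: leqT (xlo i); apply: leqT (leqT (leq_addr 2 L) Lbig) _; by rewrite leq_exp2l // leq_subr.
 have b1: 15*(w*kap ^ r)%:R <= rln (x i)%:R.
  apply: leT (_ : rln (2 ^ (L-d))%:R <= _); last first.
   by apply: rln_le; rewrite ?ltr0n ?expn_gt0 // ler_nat.
  rewrite rln_2w natrB //; have wR: 1000*(w*kap ^ r)%:R <= L%:R:>R by rewrite -natrM ler_nat.
  have q0: (L%:R-d%:R)*(1/2) <= (L%:R-d%:R)*rln 2 by rewrite leMl // subr_ge0 ler_nat.
  clear -q0 wR LdR dR LR; lra.
 have b2: (x i<=x (i+L)<=3*x i)%N.
  by rewrite /x addnA gx_shift // gx_mono // leq_addr.
 have b3: (2*cI v<=x i)%N by apply: leqT XL; move: hL; clear; lia.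
 have H0': (0<H)%N by [].
 apply: leT (@window_bound f g b hf hg hm r v w J L H (x i) (x (i+L)%N) k k rv hb hJ1 hJ3 b1 b2 b3 (xhi _ i1) H0' k0 k0) _.
 have t1: H%:R/(x i)%:R <= eps/8.
  rewrite ler_pdivrMr ?ltr0n //; have e1: 8*H%:R/eps <= (x i)%:R.
   by apply: leT hL3 _; rewrite ler_nat; apply: leqT XL; move: hL; clear; lia.
  rewrite ler_pdivrMr // in e1; clear -e1; lra.
 have -> : \sum_(j <- badU g w r L) (18*N2 ((x (i+L)%N)%:R^-1%:C * psum f (x (i+L)%N) (j%:R-(2 ^ L)%:R))+2*N2 ((x i)%:R^-1%:C * psum f (x i) (j%:R-(2 ^ L)%:R))) = 18*A (i+L)%N+2*A i.
  by rewrite big_split /= -!mulr_sumr.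
 rewrite mulrDr addrA lerD2r /c1.
 move: t1 t2 t4 hrk; rewrite /k; move: (H%:R/_) (4/_) (576*_/_) (2/_*_) => u1 u2 u3 u4 t1 t2 t4 hrk.
 clear -t1 t2 t4 hrk; lra.
have F0 n : 0 <= nm (savg f H n)/n%:R by rewrite divr_ge0 // nm_ge0.
have := @overlap x (fun n => nm (savg f H n)/n%:R) L m xmono Lm F0.
have xL: x L = (2 ^ (L-d).+1)%N by rewrite /x -[X in gx _ (_+X)]muln1 -mulnDr addn1 gx_pow.
have xm: x m = (2 ^ L.-1)%N.
 have e: (L*(L-d)+m = L*L.-1)%N.
  by rewrite /m addnBA ?leq_pmulr ?(leqT _ d2) // -mulnDr subnK // -subn1 mulnBr muln1.
 by rewrite /x e gx_pow.
rewrite xL xm => hov.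
have LR0: 0 < L%:R:>R by clear -LR; lra.
rewrite -(ler_pM2l LR0); apply: leT hov _.
apply: leT (_ : \sum_[i<m] (c1+2/k*(18*A (i+L)%N+2*A i)) <= _).
 by apply: ler_sum_nat => i /andP[_ im]; exact: win.
have -> : \sum_[i<m] (c1+2/k*(18*A (i+L)%N+2*A i)) =
  \sum_[i<m] c1+2/k*(18*\sum_[i<m] A (i+L)%N+2*\sum_[i<m] A i).
 by rewrite big_split /=; congr (_+_); rewrite -mulr_sumr; congr (_*_); rewrite big_split /= -!mulr_sumr.
have sA: \sum_[i<m] A i <= \sum_[i<L*d] A i.
 rewrite [leRHS](@big_cat_nat _ _ _ m) //=; last by rewrite -mL leq_addr.
 by rewrite lerDl; apply: sumr_ge0.
have sAL: \sum_[i<m] A (i+L)%N <= \sum_[i<L*d] A i.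
 rewrite -(@sum_addn R A L m) mL [leRHS](@big_cat_nat _ _ _ L) //=; last by rewrite -mL leq_addl.
 by rewrite lerDr; apply: sumr_ge0.
have c1s: \sum_[i<m] c1 <= c1*(L*d)%:R.
 rewrite big_const_nat iter_addr_0 subn0 -[leLHS]mulr_natl mulrC; apply: leMl; first by rewrite /c1; clear -eps0; lra.
 by rewrite ler_nat -mL leq_addr.
apply: (leV (c1*(L*d)%:R+2/k*(20*(k/40*(eps/4)*(L*d)%:R)))).
 apply: lerD => //; apply: leMl; first by rewrite divr_ge0 // ltW.
 move: sA sAL hS; move: (\sum_[i<m] A i) (\sum_[i<m] A (i+L)%N) (\sum_[i<L*d] A i) (k/40*_*_) => u1 u2 u3 u4 h1' h2' h3'.
 clear -h1' h2' h3'; lra.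
by rewrite /c1 natrM; apply: le_of_eq; field; rewrite gt_eqF.
Qed.

(** [mr_step] treats about [L/1000] consecutive doublings at a cost proportional to their number;
    strong induction on the exponent puts such stretches together. *)
Theorem mr_log (f g : nat -> C) (b : nat)
 (hf : bnd1 f) (hg : bnd1 g)
 (hm : qmult b g f)
 (hg1 : forall p, prime p -> (b<p)%N -> N2 (g p) = 1)
 (hPhi : forall M : R, exists N0, forall N, (N0<=N)%N -> forall t : R, `|t| <= 2*N%:R ->
  M <= \sum_(1 <= p < N.+1 | prime p) (1-Re (g p*npw p t))/p%:R) (eps : R) : 0 < eps -> exists H0, forall H, (H0<=H)%N -> exists N0, forall N, (N0<=N)%N ->
 \sum_[n<=N] nm (savg f H n)/n%:R <= eps*rln N%:R.
Proof.
move=> eps0; have e8: 0 < eps/16 by lra.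
have [H0 hH0] := mr_step hf hg hm hg1 hPhi e8; exists H0 => H /hH0 [L0 hL0] {hH0}.
pose F n := nm (savg f H n)/n%:R; pose G M := \sum_[n<=M] F n.
have F0 n : 0 <= F n by rewrite divr_ge0 // nm_ge0.
have G0 M : 0 <= G M by apply: sumr_ge0.
have Gm a c : (a<=c)%N -> G c = G a+\sum_(a.+1 <= n < c.+1) F n.
 by move=> ac; rewrite /G (@big_cat_nat _ _ _ a.+1).
have Gmono a c : (a<=c)%N -> G a <= G c by move=> ac; rewrite (Gm _ _ ac) lerDl sumr_ge0.
pose C0 := G (2 ^ L0)%N.
have main m : G (2 ^ m)%N <= C0+eps/8 * m%:R.
 elim/ltn_ind: m => m IH; have [hm1|hm1] := leqP L0 m.+1; last first.
  apply: leT (Gmono _ (2 ^ L0)%N _) _; first by rewrite leq_exp2l // ltnW // ltnW.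
  by rewrite lerDl mulr_ge0 //; lra.
 have [d4 hd] := hL0 m.+1 hm1; set d := (m.+1 %/ 1000)%N in d4 hd.
 have dm: (1000*d<=m.+1)%N by rewrite mulnC; exact: leq_trunc_div.
 have lt: ((m.+1-d).+1<m)%N by move: d4 dm; clear; lia.
 rewrite (Gm (2 ^ (m.+1-d).+1)%N) /=; last by rewrite leq_exp2l // ltnW.
 have := IH _ lt; move: hd; rewrite /= => hd hI.
 have e: (m.+1-d).+1%:R = m%:R+2-d%:R:>R.
  by rewrite -natr1 natrB -?natr1; [ring|move: d4 dm; clear; lia].
 rewrite e in hI; have dR: 4 <= d%:R:>R by rewrite (ler_nat _ 4).
 apply: leT (lerD hI hd) _; nra.
have c0: 0 <= C0 by exact: G0.
pose B := 8*(C0+eps)/eps.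
have B0: 0 <= B by rewrite divr_ge0 // ?mulr_ge0 //; lra.
exists (2 ^ (Num.truncn B).+1)%N => N hN.
have N0: (0<N)%N by apply: leqT hN; rewrite expn_gt0.
pose m := trunc_log 2 N.
have /andP[m1 m2] := trunc_log_bounds (isT : 1<2)%N N0.
apply: leT (Gmono _ (2 ^ m.+1)%N _) _; first exact: ltnW.
apply: leT (main _) _.
have l2 := rln2_ge.
have lnN: m%:R/2 <= rln N%:R.
 apply: leT (_ : m%:R*rln 2 <= _); first by rewrite leMl //; lra.
 by rewrite -rln_2w; apply: rln_le; rewrite ?ltr0n ?expn_gt0 // ler_nat.
have mB: B <= m%:R.
 have /andP[_ /ltW h1] := truncn_itv B0; apply: leT h1 _; rewrite ler_nat.
 have : (2 ^ (Num.truncn B).+1<2 ^ m.+1)%N by apply: leq_ltn_trans hN m2.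
 by rewrite ltn_exp2l.
rewrite /B ler_pdivrMr // in mB; rewrite -[m.+1%:R]natr1.
have := leMl (ltW eps0) lnN; lra.
Qed.

(** * Equidistribution of primes and box dimension *)

Lemma size_fibers (T : eqType) (G : seq nat) (key : nat -> T) (ks : seq T) m :
 (forall q, q \in G -> key q \in ks) ->
 (forall k, (size [seq q <- G | key q == k] <= m)%N) -> (size G<=size ks * m)%N.
Proof.
move=> + hm; elim: ks G hm => [|k ks IH] G hm hk.
 by case: G hk {hm} => // q G /(_ q); rewrite mem_head => /(_ isT).
have -> : size G = (size [seq q <- G | key q == k]+size [seq q <- G | key q != k])%N.
 by rewrite !size_filter count_predC.
rewrite /= mulSn; apply: leq_add => //; apply: IH.
 move=> k'; apply: leqT (hm k'); rewrite -filter_predI !size_filter.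
 by apply: sub_count => q /= /andP[].
move=> q; rewrite mem_filter => /andP[nk qG]; have := hk q qG.
by rewrite in_cons (negbTE nk).
Qed.

(** Dirichlet's pigeonhole argument on the fractional parts of multiples of [beta]; reducing the
    fraction afterwards only improves the bound. *)
Lemma dirichlet_approx (beta : R) (Q : nat) : (0<Q)%N ->
 exists b : nat, exists a : int, [/\ (0<b<=Q)%N, coprime `|a| b &
  `|beta-a%:~R/b%:R| <= (b%:R*Q%:R)^-1].
Proof.
move=> Q0; have QR: 0 < Q%:R:>R by rewrite ltr0n.
pose fr (k : nat) : R := k%:R*beta-(Num.floor (k%:R*beta))%:~R.
have fr01 k : 0 <= fr k < 1.
 by have := floor_itv (k%:R*beta); rewrite intrD /fr; lra.
pose key (k : nat) : nat := Num.truncn (Q%:R*fr k).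
have keyP k : (key k)%:R <= Q%:R*fr k < (key k)%:R+1.
 have /andP[f0 _] := fr01 k.
 by have := truncn_itv (mulr_ge0 (ltW QR) f0); rewrite -/(key k) -natr1.
have [k [k' [kk' kQ e]]] : exists k k', [/\ (k<k')%N, (k'<=Q)%N & key k = key k'].
 pose s := [seq key k | k <- iota 0 Q.+1].
 have : ~~ uniq s.
  apply/negP => us; have : (size s<=size (iota 0 Q))%N.
   apply: uniq_leq_size => // x /mapP [k _ ->]; rewrite mem_iota /= add0n.
   have /andP[h1 _] := keyP k; have /andP[_ f1] := fr01 k.
   rewrite -(ltr_nat R); apply: le_lt_trans h1 _; rewrite -[ltRHS]mulr1 ltr_pM2l //.
  by rewrite size_map !size_iota ltnn.
 move=> /(uniqPn 0%N) [i [j [ij js e]]]; rewrite size_map size_iota in js.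
 exists i, j; split=> //.
 by move: e; rewrite !(nth_map 0%N) ?size_iota ?nth_iota // (ltn_trans ij).
pose d := (k'-k)%N; pose m : int := Num.floor (k'%:R*beta)-Num.floor (k%:R*beta).
have d0: (0<d)%N by rewrite subn_gt0.
have dQ: (d<=Q)%N by apply: leqT (leq_subr _ _) kQ.
have close: `|d%:R*beta-m%:~R| <= Q%:R^-1.
 have -> : d%:R*beta-m%:~R = fr k'-fr k.
  by rewrite /d natrB ?(ltnW kk') // /fr /m intrB; ring.
 rewrite -[leRHS]div1r ler_pdivlMr // -[X in _*X](ger0_norm (ltW QR)) -normrM.
 have := keyP k; have := keyP k'; rewrite -e ler_norml; nra.
pose g := gcdn `|m|%N d; have g0: (0<g)%N by rewrite gcdn_gt0 d0 orbT.
have gd: (g %| d)%N by exact: dvdn_gcdr.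
have gm: (g%:Z %| m)%Z by rewrite dvdzE /= dvdn_gcdl.
exists (d %/ g)%N, (m %/ g%:Z)%Z.
have b0: (0<d %/ g)%N by rewrite divn_gt0 // dvdn_leq.
have bQ: (d %/ g<=Q)%N by apply: leqT (leq_div _ _) dQ.
have ed: d%:R = (d %/ g)%:R * g%:R:>R by rewrite -natrM divnK.
have em: m%:~R = (m %/ g%:Z)%Z%:~R * g%:R:>R.
 by rewrite -{1}(divzK gm) intrM.
have gR: 0 < g%:R:>R by rewrite ltr0n.
have bR: 0 < (d %/ g)%:R:>R by rewrite ltr0n.
split; first by rewrite b0.
- have aq: (`|(m %/ g%:Z)%Z| * g = `|m|)%N by rewrite -{2}(divzK gm) abszM.
 by rewrite /coprime -(eqn_pmul2r g0) muln_gcdl aq divnK // mul1n.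
move: close; rewrite ed em; set x := (d %/ g)%:R : R; set y := _%:~R.
have -> : x * g%:R*beta-y * g%:R = g%:R*x*(beta-y/x) by field; rewrite gt_eqF.
rewrite normrM [`|g%:R*x|]ger0_norm ?mulr_ge0 // => h.
have h2: x*`|beta-y/x| <= Q%:R^-1.
 by apply: leT h; rewrite leMr // ler_peMl ?(ltW bR) // ler1n.
by rewrite invfM -(ler_pM2l bR) mulrA mulfV ?mul1r // gt_eqF.
Qed.

Lemma size_le_diam (S : seq nat) D : uniq S ->
 (forall q q', q \in S -> q' \in S -> (q'<=q)%N -> (q-q'<=D)%N) -> (size S<=D.+1)%N.
Proof.
move=> uS h; have [->//|exS] : S = [::] \/ exists q, q \in S.
 by case: (S) => [|q s]; [left|right; exists q; rewrite mem_head].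
case: (ex_minnP exS) => q0 q0S hmin.
rewrite -(size_iota q0 D.+1); apply: uniq_leq_size => // q qS.
have q0q := hmin q qS; have := h q q0 qS q0S q0q.
by rewrite mem_iota q0q /= addnS ltnS leq_subLR.
Qed.

Lemma ap_fiber_count b r Q (S : seq nat) : (1<b)%N -> (3<=b<=Q)%N -> uniq S ->
 (forall q, q \in S -> [/\ prime q, (Q<q<=2*Q)%N & (q %% b = r %% b)%N]) ->
 (size S)%:R*rln Q%:R <= 6*(Q%:R/b%:R)*rln b%:R.
Proof.
move=> b1 bQ uS hS; have b0: (0<b)%N by apply: ltnW.
have Qb: (b<=Q)%N by case/andP: bQ.
have [->|[q0 q0S]] : S = [::] \/ exists q, q \in S.
 by case: (S) => [|q s]; [left|right; exists q; rewrite mem_head].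
 rewrite mul0r; apply: mulr_ge0; first by rewrite mulr_ge0 ?divr_ge0.
 by apply: rln_ge0; rewrite ler1n.
have r0: (0<r %% b)%N.
 have [pq /andP[qQ _] e] := hS _ q0S; rewrite lt0n -e; apply/negP => /eqP /eqP; rewrite -/(dvdn b q0).
 have bn1: b != 1%N by rewrite gtn_eqF.
 by move/(prime_nt_dvdP pq bn1) => bq; move: qQ; rewrite -bq ltnNge Qb.
have := @ap_primes_count b (r %% b) Q; rewrite r0 ltn_pmod // => /(_ isT bQ) h; apply: leT h.
apply: leMr; first by apply: rln_ge0; rewrite ler1n (leqT _ Qb).
rewrite ler_nat; apply: uniq_leq_size => // q /hS [pq qQ e].
by rewrite mem_filter pq mem_index_iota ltnS qQ modn_mod e eqxx.
Qed.

Lemma half_inv_le (x y : R) : 1 <= x -> 8 <= y -> y/2*(x*y)^-1 <= 1/2.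
Proof. by move=> hx hy; rewrite ler_pdivrMr; nra. Qed.

Lemma inv8_le (y : R) : 8 <= y -> y^-1 <= 1/8.
Proof. by move=> hy; rewrite -[leLHS]div1r ler_pdivrMr; lra. Qed.

Section LemmaL.
Variable C : R -> Prop.
Hypothesis cov : forall e : R, 0 < e -> exists n0 : nat, forall n, (n0<=n)%N ->
 exists xs : seq R, (size xs)%:R*rln n%:R <= e*n%:R /\
  forall c, C c -> exists2 x, x \in xs & x <= c <= x+n%:R^-1.

(** Let [a/b] be a Dirichlet approximation of [beta]. If [b > B], cover [C] at scale [1/b]: the
    interval containing [A q] leaves 7 values for the integer [q a + b k(q)], and each determines
    [q] modulo [b]; few intervals times few primes per class contradict the size of [G]. If [b <= B]
    but [a/b] is too far from [beta], cover at scale [1/Q]: primes sharing interval, class modulo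
    [b] and half of [(Q, 2Q]] differ by at most [6H'], and again there are too few. *)
Lemma equidist_rational (eta : R) : 0 < eta -> exists B : nat, forall H' : nat, (0<H')%N ->
 exists Q0 : nat, forall (Q : nat) (G : seq nat) (beta gam : R) (A : nat -> R) (k : nat -> int),
 (Q0<=Q)%N -> uniq G ->
 (forall q, q \in G -> [/\ prime q, (Q<q<=2*Q)%N, C (A q) &
   `|A q-q%:R*beta-gam-(k q)%:~R| <= (4*Q%:R)^-1]) ->
 eta*Q%:R <= (size G)%:R*rln Q%:R ->
 exists b : nat, exists a : int, (0<b<=B)%N /\ `|beta-a%:~R/b%:R| <= (4*H'%:R*Q%:R)^-1.
Proof.
move=> eta0; have e43: 0 < eta/43 by lra.
have [n0 hn0] := cov e43; pose B := maxn n0 3; exists B => H' H'0.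
have HR: 1 <= H'%:R:>R by rewrite ler1n.
have BR: 1 <= B%:R:>R by rewrite ler1n leq_max orbT.
pose K : R := 2*B%:R*(6*H'%:R+1).
have K0: 0 < K by rewrite !mulr_gt0 //; lra.
have eK: 0 < eta/(2*K) by rewrite divr_gt0 //; lra.
have [n1 hn1] := cov eK; exists (maxn n1 (maxn B 8)) => Q G beta gam A k.
rewrite !geq_max => /and3P [Qn1 QB Q8] uG hG sG.
have Q0: (0<Q)%N by apply: leqT Q8.
have QR: 8 <= Q%:R:>R by rewrite ler_nat.
have lnQ: 0 < rln Q%:R by apply: rln_gt0; lra.
have [b [a [/andP[b0 bQ] cop th]]] := dirichlet_approx beta Q0.
have bR: 1 <= b%:R:>R by rewrite ler1n.
have bR0: 0 < b%:R:>R by rewrite ltr0n.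
have QR0: 0 < Q%:R:>R by rewrite ltr0n.
set theta := beta-a%:~R/b%:R in th.
have be: beta = a%:~R/b%:R+theta by rewrite /theta addrC subrK.
have qR q : q \in G -> Q%:R < q%:R:>R /\ q%:R <= 2*Q%:R:>R.
 by move=> /hG [_ /andP[h1 h2] _ _]; rewrite ltr_nat h1 -natrM ler_nat.
have [bB|Bb] := leqP b B; last first.
 exfalso.
 have b3: (3<=b)%N by apply: ltnW; apply: leq_ltn_trans Bb; rewrite leq_max leqnn orbT.
 have bn: (n0<=b)%N by apply: ltnW; apply: leq_ltn_trans Bb; rewrite leq_max leqnn.
 have [xs [sxs hxs]] := hn0 b bn.
 pose cell q := find (fun x => x <= A q <= x+b%:R^-1) xs.
 have cellP q : q \in G -> (cell q<size xs)%N /\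
   nth 0 xs (cell q) <= A q <= nth 0 xs (cell q)+b%:R^-1.
  move=> /hG [_ _ /hxs [x xin hx] _].
  have hh: has (fun x => x <= A q <= x+b%:R^-1) xs by apply/hasP; exists x.
  by split; [rewrite -has_find|exact: (nth_find 0 hh)].
 pose nq q : int := q%:Z*a+b%:Z*k q.
 (* With [x] the left end of the interval, [nq q] differs from [b (x - gam)] by at most 1 from the
    interval, 1/4 from the approximation of [A q] and 2 from [b q theta]; this leaves seven integers
    above the base. *)
 pose base i : int := Num.floor (b%:R*(nth 0 xs i-gam)-5/2).
 pose key q : nat*nat := (cell q, `|nq q-base (cell q)|%N).
 have dd q : q \in G -> 0 <= nq q-base (cell q) < 7.
  move=> qG; have [c1 c2] := cellP q qG.
  have [_ _ _ hA] := hG q qG; have [q1 q2] := qR q qG.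
  have := floor_itv (b%:R*(nth 0 xs (cell q)-gam)-5/2); rewrite -/(base _) intrD => /andP[f1 f2].
  have bQ0: 0 < b%:R*Q%:R:>R by rewrite mulr_gt0.
  have qth: `|b%:R*(q%:R * theta)| <= 2.
   rewrite mulrA normrM [`|b%:R*q%:R|]ger0_norm ?mulr_ge0 //.
   apply: (leV (b%:R*q%:R*(b%:R*Q%:R)^-1)); first by rewrite leMl ?mulr_ge0.
   by rewrite ler_pdivrMr // mulrCA leMl.
  have bA: `|b%:R*(A q-q%:R*beta-gam-(k q)%:~R)| <= 1/4.
   rewrite normrM [`|b%:R|]ger0_norm //; apply: (leV (b%:R*(4*Q%:R)^-1)); first by rewrite leMl.
   rewrite ler_pdivrMr ?mulr_gt0 //; have : b%:R <= Q%:R:>R by rewrite ler_nat.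
   by move: (b%:R : R) (Q%:R : R); clear => x y; lra.
  have nqE: (nq q)%:~R = b%:R*(A q-gam)-b%:R*(A q-q%:R*beta-gam-(k q)%:~R)-b%:R*(q%:R * theta).
   by rewrite /nq intrD !intrM be; field; rewrite gt_eqF.
  have cA: b%:R*nth 0 xs (cell q) <= b%:R*A q /\ b%:R*A q <= b%:R*nth 0 xs (cell q)+1.
   move/andP: c2 => [c3 c4]; split; first by rewrite leMl.
   have := leMl (ler0n R b) c4; by rewrite mulrDr mulfV // gt_eqF.
  case: cA; move: qth bA; rewrite !ler_norml => /andP[t1 t2] /andP[u1 u2] cA1 cA2.
  move: nqE f1 f2 t1 t2 u1 u2 cA1 cA2; rewrite !mulrBr.
  rewrite -(ler_int R) -(ltr_int R) intrB.
  move: (b%:R*A q) (b%:R*nth 0 xs (cell q)) (b%:R * gam) (b%:R*(q%:R * theta)) => x1 x2 x3 x4.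
  move: (b%:R*(q%:R*beta)) (b%:R*(k q)%:~R) ((base (cell q))%:~R : R) => x5 x6 x7 ->; clear; lra.
 have keyin q : q \in G -> key q \in [seq (i, j) | i <- iota 0 (size xs), j <- iota 0 7].
  move=> qG; have [c1 c2] := cellP q qG; apply/allpairsP; exists (key q); split=> //.
   by rewrite mem_iota.
  have /andP[] := dd q qG; rewrite mem_iota /=; clear; move: (nq q-base _) => z; lia.
 have fib kk : (size [seq q <- G | key q == kk])%:R*rln Q%:R <= 6*(Q%:R/b%:R)*rln b%:R.
  set S := [seq q <- G | _].
  have uS: uniq S by rewrite filter_uniq.
  have [e|[q0 q0S]] : S = [::] \/ exists q, q \in S.
   by case: (S) => [|q s]; [left|right; exists q; rewrite mem_head].
   rewrite e mul0r; apply: mulr_ge0; first by rewrite mulr_ge0 ?divr_ge0.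
   by apply: rln_ge0; rewrite ler1n.
  apply: (@ap_fiber_count b q0); rewrite ?b3 ?(leqT _ b3) // => q qS.
  have := qS; rewrite mem_filter => /andP[/eqP kq qG].
  have := q0S; rewrite mem_filter => /andP[/eqP kq0 q0G].
  have [pq qQ _ _] := hG q qG; split=> //.
  have nn: nq q = nq q0.
   have /andP[d1 _] := dd q qG; have /andP[d2 _] := dd q0 q0G.
   move: kq0; rewrite -kq => [[e1 e2]]; rewrite e1 in e2 d2; move: d1 d2 e2.
   move: (nq q) (nq q0) (base _) => z1 z2 z3; clear; lia.
  have dv: (b%:Z %| (q%:Z-q0%:Z)*a)%Z.
   apply/dvdzP; exists (k q0-k q); move: nn; rewrite /nq; clear; lia.
  have : (b%:Z %| q%:Z-q0%:Z)%Z.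
   by move: dv; rewrite Gauss_dvdzl // coprimezE /= coprime_sym.
  by rewrite -eqz_mod_dvd !modz_nat => /eqP [].
 pose m := Num.truncn (6*(Q%:R/b%:R)*rln b%:R/rln Q%:R).
 have lnb: 0 <= rln b%:R by apply: rln_ge0.
 have x0: 0 <= 6*(Q%:R/b%:R)*rln b%:R/rln Q%:R.
  by rewrite divr_ge0 ?(ltW lnQ) // mulr_ge0 // mulr_ge0 // divr_ge0.
 have szG: (size G<=size [seq (i, j) | i <- iota 0 (size xs), j <- iota 0 7] * m)%N.
  apply: (size_fibers keyin) => kk; rewrite truncn_ge_nat // ler_pdivlMr //; exact: fib.
 rewrite size_allpairs !size_iota in szG.
 have mle: m%:R*rln Q%:R <= 6*(Q%:R/b%:R)*rln b%:R.
  by rewrite -ler_pdivlMr //; have /andP[] := truncn_itv x0.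
 have h1: (size G)%:R*rln Q%:R <= (size xs)%:R*7*(6*(Q%:R/b%:R)*rln b%:R).
  apply: (leV ((size xs)%:R*7*(m%:R*rln Q%:R))); last by rewrite leMl ?mulr_ge0.
  by rewrite mulrA leMr ?(ltW lnQ) // -!natrM ler_nat.
 have e1: (size xs)%:R*7*(6*(Q%:R/b%:R)*rln b%:R) = 42*(Q%:R/b%:R)*((size xs)%:R*rln b%:R) by ring.
 have h2: 42*(Q%:R/b%:R)*((size xs)%:R*rln b%:R) <= 42*(Q%:R/b%:R)*(eta/43*b%:R).
  by apply: leMl => //; rewrite mulr_ge0 // divr_ge0.
 have e2: 42*(Q%:R/b%:R)*(eta/43*b%:R) = eta*Q%:R*(42/43).
  by field; rewrite gt_eqF.
 rewrite e1 in h1; rewrite e2 in h2; have := leT sG (leT h1 h2).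
 have : 0 < eta*Q%:R by rewrite mulr_gt0.
 by move: (eta*_); clear => x; lra.
exists b, a; rewrite b0 bB; split=> //; rewrite -/theta leNgt; apply/negP => thl.
have [xs [sxs hxs]] := hn1 Q Qn1.
pose cell q := find (fun x => x <= A q <= x+Q%:R^-1) xs.
have cellP q : q \in G -> (cell q<size xs)%N /\
  nth 0 xs (cell q) <= A q <= nth 0 xs (cell q)+Q%:R^-1.
 move=> /hG [_ _ /hxs [x xin hx] _].
 have hh: has (fun x => x <= A q <= x+Q%:R^-1) xs by apply/hasP; exists x.
 by split; [rewrite -has_find|exact: (nth_find 0 hh)].
(* The last entry separates the halves of [(Q, 2Q]]. Within a half [|q - q'| <= Q/2], so
   [(q - q') theta] is at most 1/2 and cannot wrap around modulo 1. *)
pose key q : nat*nat*bool := (cell q, (q %% b)%N, (2*q<=3*Q)%N).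
pose ks := [seq (ij, h) | ij <- [seq (i, j) | i <- iota 0 (size xs), j <- iota 0 b], h <- [:: true; false]].
have keyin q : q \in G -> key q \in ks.
 move=> qG; have [c1 _] := cellP q qG; apply/allpairsP; exists (key q); split=> //=; last first.
  by rewrite !inE; case: (2*q<=3*Q)%N.
 apply/allpairsP; exists (cell q, (q %% b)%N); split=> //=; rewrite mem_iota //=.
 by rewrite add0n ltn_pmod.
have fib kk : (size [seq q <- G | key q == kk] <= (6*H').+1)%N.
 apply: size_le_diam; first by rewrite filter_uniq.
 move=> q q'; rewrite !mem_filter => /andP[/eqP kq qG] /andP[/eqP kq' q'G] qq'.
 move: kq'; rewrite -kq => [[e1 e2 e3]].
 have [_ c1] := cellP q qG; have [_ c2] := cellP q' q'G; rewrite e1 in c2.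
 have [_ /andP[Qq q2Q] _ hA] := hG q qG; have [_ /andP[Qq' q'2Q] _ hA'] := hG q' q'G.
 have half: (2*(q-q')<=Q)%N.
  move: e3; case: (leqP (2*q) (3*Q)) => h1; case: leqP => // h2 _; move: h1 h2 Qq q2Q Qq' q'2Q qq'; clear; lia.
 pose D := (q-q')%N; have DR: D%:R = q%:R-q'%:R:>R by rewrite natrB.
 have bd: (b %| D)%N by rewrite -eqn_mod_dvd // eq_sym; apply/eqP.
 have [n0' en] := dvdnP bd.
 pose n : int := n0'%:Z*a+(k q-k q').
 have thn: D%:R * theta+n%:~R = (A q-A q')-(A q-q%:R*beta-gam-(k q)%:~R) +
   (A q'-q'%:R*beta-gam-(k q')%:~R).
  rewrite /n intrD intrM intrB be DR.
  have : q%:R-q'%:R = n0'%:R*b%:R:>R by rewrite -DR en natrM.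
  move=> e; have -> : (n0'%:Z)%:~R*a%:~R = (q%:R-q'%:R)*(a%:~R/b%:R):>R.
   by rewrite e; field; rewrite gt_eqF.
  ring.
 have Qi: 0 < Q%:R^-1:>R by rewrite invr_gt0.
 have small: `|D%:R * theta+n%:~R| <= 3/2*Q%:R^-1.
  rewrite thn; move: hA hA' c1 c2; rewrite invfM !ler_norml.
  by move: (Q%:R^-1) (_-_-_-_) (_-_-_-_); clear => y x x'; lra.
 have Dth: `|D%:R * theta| <= 1/2.
  rewrite normrM [`|D%:R|]ger0_norm //; apply: (leV (Q%:R/2*(b%:R*Q%:R)^-1)).
   apply: ler_pM => //; have : (2*D)%:R <= Q%:R:>R by rewrite ler_nat.
   by rewrite natrM ler_pdivlMr // mulrC.
  exact: half_inv_le.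
 have Q8i: Q%:R^-1 <= 1/8:>R by apply: inv8_le.
 have nz: n = 0.
  have : `|n%:~R| < 1:>R.
   have -> : n%:~R = (D%:R * theta+n%:~R)-D%:R * theta by ring.
   apply: le_lt_trans (ler_normB _ _) _; apply: le_lt_trans (lerD small Dth) _.
   by move: Q8i; move: (Q%:R^-1 : R); clear => y; lra.
  rewrite -intr_norm -[1]/(1%:~R) ltr_int; clear; lia.
 rewrite nz addr0 normrM [`|D%:R|]ger0_norm // in small.
 have HQ: 0 < 4*H'%:R*Q%:R:>R by rewrite !mulr_gt0 // ltr0n.
 have h1: D%:R*(4*H'%:R*Q%:R)^-1 <= 3/2*Q%:R^-1:>R.
  by apply: leT small; rewrite leMl // ltW.
 rewrite ler_pdivrMr // in h1.
 have e4: 3/2*Q%:R^-1*(4*H'%:R*Q%:R) = (6*H')%:R:>R.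
  by rewrite natrM; field; rewrite gt_eqF.
 by rewrite e4 ler_nat in h1.
have szG := size_fibers keyin fib.
rewrite !size_allpairs !size_iota /= in szG.
have szR: (size G)%:R <= (size xs)%:R*K:>R.
 apply: (leV ((size xs)%:R*(2*b%:R*(6*H'%:R+1)))).
  have := szG; rewrite -(ler_nat R) !natrM -[(6*H').+1%:R]natr1 natrM => h; apply: leT h _.
  by apply: le_of_eq; ring.
 rewrite leMl // leMr //; first by rewrite addr_ge0 ?mulr_ge0.
 by rewrite leMl // ler_nat.
have h1 := leMr (ltW lnQ) szR.
have h2: K*((size xs)%:R*rln Q%:R) <= K*(eta/(2*K)*Q%:R) by rewrite leMl // ltW.
have e2: K*(eta/(2*K)*Q%:R) = eta*Q%:R/2 by field; rewrite gt_eqF.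
have e1: (size xs)%:R*K*rln Q%:R = K*((size xs)%:R*rln Q%:R) by ring.
rewrite e1 in h1; rewrite e2 in h2; have := leT sG (leT h1 h2).
have : 0 < eta*Q%:R by rewrite mulr_gt0.
by move: (eta*_); clear => x; lra.
Qed.
End LemmaL.

(** * Logarithmic means along an ultrafilter *)

Import boolp classical_sets filter.

Definition harm (N : nat) : R := \sum_[n<=N] n%:R^-1.
Definition lsum (F : nat -> R) (N : nat) : R := \sum_[n<=N] F n/n%:R.
Definition lavg (F : nat -> R) (N : nat) : R := lsum F N/harm N.
Definition bdd (F : nat -> R) := exists B : R, forall n, `|F n| <= B.

Lemma harm_gt0 N : (0<N)%N -> 0 < harm N.
Proof.
move=> N0; apply: lt_le_trans (harmonic_ge N); apply: rln_gt0.
by rewrite ltr1n ltnS.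
Qed.

Lemma harm_large (K : R) : exists N0, forall N, (N0<=N)%N -> K <= harm N.
Proof.
exists (Num.truncn (rexp K)) => N h; apply: leT (harmonic_ge N).
rewrite -[K]rexpK; apply: rln_le; first exact: rexp_gt0.
have := truncn_itv (rexp_ge0 K) => /andP[_ /ltW h2]; apply: leT h2 _.
by rewrite ler_nat ltnS.
Qed.

Lemma bdd_ge0 (F : nat -> R) (B : R) : (forall n, `|F n| <= B) -> 0 <= B.
Proof. by move=> h; apply: leT (h 0%N). Qed.

Lemma lavg_bdd (F : nat -> R) (B : R) N : (forall n, `|F n| <= B) -> `|lavg F N| <= B.
Proof.
move=> h; have B0 := bdd_ge0 h; case: N => [|N].
 by rewrite /lavg /lsum big_geq // mul0r normr0.
have h0 := harm_gt0 (ltn0Sn N).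
rewrite /lavg normrM normfV [`|harm _|]ger0_norm ?ler_pdivrMr ?(ltW h0) //.
apply: leT (ler_norm_sum _ _ _) _; rewrite /harm mulr_sumr; apply: ler_sum => n _.
by rewrite normrM normfV [`|n%:R|]ger0_norm // leMr // invr_ge0.
Qed.

Section Mean.
Variable U : set (set nat).
Hypotheses (Uultra : UltraFilter U) (Ucof : forall N0, U (fun N => is_true (N0<=N)%N)).

Let UI (A B : set nat) : U A -> U B -> U (fun n => A n /\ B n).
Proof. by move=> a b; apply: (filterI a b). Qed.
Let US (A B : set nat) : (forall n, A n -> B n) -> U A -> U B.
Proof. by move=> h; apply: filterS. Qed.
Let UE (A : set nat) : U A -> exists n, A n.
Proof. by move=> a; apply: filter_ex a. Qed.
Let UC (A : set nat) : U A \/ U (fun n => ~ A n).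
Proof. exact: in_ultra_setVsetC. Qed.

Lemma ultra_lim (u : nat -> R) : bdd u -> exists l : R, forall e, 0 < e -> U (fun N => is_true (`|u N-l| <= e)).
Proof.
move=> [B hB]; pose E : set R := fun r => U (fun N => is_true (r <= u N)).
have E0: E (- B).
 apply: (@US (fun=> True)); last exact: filterT.
 by move=> n _; have := hB n; rewrite ler_norml => /andP[].
have Eub r : E r -> r <= B.
 move=> /UE [n h]; apply: leT h _; have := hB n; rewrite ler_norml => /andP[] //.
have hs: has_sup E by split; [exists (- B)|exists B => r; apply: Eub].
exists (sup E) => e e0.
have [r Er hr] := sup_adherent e0 hs.
have nE: ~ E (sup E+e).
 move=> h; have := sup_upper_bound hs h; lra.
case: (UC (fun N => is_true (sup E+e <= u N))) => // h.
apply: US (UI Er h) => n [h1 /negP]; rewrite -ltNge => h2.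
rewrite ler_norml; lra.
Qed.

(** The limit along [U] of the logarithmic means. It exists for bounded [F], so the default 0 does
    not occur there. *)
Definition Lam (F : nat -> R) : R :=
 xget 0 (fun l : R => forall e, 0 < e -> U (fun N => is_true (`|lavg F N-l| <= e))).

Lemma LamP F : bdd F -> forall e, 0 < e -> U (fun N => is_true (`|lavg F N-Lam F| <= e)).
Proof.
move=> [B hB]; rewrite /Lam; case: xgetP => // h.
have [l hl] := @ultra_lim (lavg F) (ex_intro _ B (fun N => lavg_bdd N hB)).
by case: (h l).
Qed.

Lemma Lam_uniq F l : bdd F -> (forall e, 0 < e -> U (fun N => is_true (`|lavg F N-l| <= e))) -> Lam F = l.
Proof.
move=> bF h; apply/eqP; rewrite -subr_eq0 -normr_eq0; apply/eqP.
apply: le_anti; rewrite normr_ge0 andbT; apply/ler_addgt0Pl => e e0; rewrite addr0.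
have e2: 0 < e/2 by lra.
have [N [h1 h2]] := UE (UI (LamP bF e2) (h _ e2)).
have -> : Lam F-l = (lavg F N-l)-(lavg F N-Lam F) by ring.
apply: leT (ler_normB _ _) _; lra.
Qed.

Lemma Lam_close F G (K : R) : bdd F -> bdd G ->
 (forall N, (0<N)%N -> `|lsum F N-lsum G N| <= K) -> Lam F = Lam G.
Proof.
move=> bF bG h; apply: Lam_uniq => // e e0.
have K0: 0 <= K by apply: leT (h 1%N isT).
have e2: 0 < e/2 by lra.
have [N0 hN] := harm_large (2*K/e).
apply: US (UI (LamP bG e2) (UI (Ucof N0) (Ucof 1%N))) => N [h1 [h2 h3]].
have -> : lavg F N-Lam G = (lavg F N-lavg G N)+(lavg G N-Lam G) by ring.
apply: leT (ler_normD _ _) _.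
have H0 := harm_gt0 h3.
have : `|lavg F N-lavg G N| <= e/2.
 rewrite /lavg -mulrBl normrM normfV [`|harm N|]ger0_norm ?(ltW H0) // ler_pdivrMr //.
 apply: leT (h N h3) _; have := hN N h2; rewrite ler_pdivrMr //; lra.
lra.
Qed.

Lemma bddD F G : bdd F -> bdd G -> bdd (fun n => F n+G n).
Proof.
move=> [B hB] [D hD]; exists (B+D) => n; apply: leT (ler_normD _ _) _; exact: lerD.
Qed.
Lemma bddZ (c : R) F : bdd F -> bdd (fun n => c*F n).
Proof. by move=> [B hB]; exists (`|c| * B) => n; rewrite normrM leMl. Qed.

Lemma LamD F G : bdd F -> bdd G -> Lam (fun n => F n+G n) = Lam F+Lam G.
Proof.
move=> bF bG; apply: Lam_uniq; first exact: bddD.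
move=> e e0; have e2: 0 < e/2 by lra.
apply: US (UI (LamP bF e2) (LamP bG e2)) => N [h1 h2].
have -> : lavg (fun n => F n+G n) N = lavg F N+lavg G N.
 rewrite /lavg -mulrDl /lsum -big_split /=; congr (_/_); apply: eq_bigr => n _; exact: mulrDl.
have -> : lavg F N+lavg G N-(Lam F+Lam G) = (lavg F N-Lam F)+(lavg G N-Lam G) by ring.
apply: leT (ler_normD _ _) _; lra.
Qed.

Lemma LamZ (c : R) F : bdd F -> Lam (fun n => c*F n) = c*Lam F.
Proof.
move=> bF; apply: Lam_uniq; first exact: bddZ.
move=> e e0; have c1: 0 < `|c| + 1 by have := normr_ge0 c; lra.
have e2: 0 < e/(`|c| + 1) by rewrite divr_gt0.
apply: US (LamP bF e2) => N h1.
have -> : lavg (fun n => c*F n) N = c * lavg F N.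
 by rewrite /lavg mulrA /lsum mulr_sumr; congr (_/_); apply: eq_bigr => n _; rewrite mulrA.
rewrite -mulrBr normrM; move: h1; rewrite ler_pdivlMr // => h1.
have := normr_ge0 (lavg F N-Lam F); nra.
Qed.

Lemma Lam_ge0 F : bdd F -> (forall n, 0 <= F n) -> 0 <= Lam F.
Proof.
move=> bF F0; rewrite leNgt; apply/negP => h.
have e0: 0 < - Lam F/2 by lra.
have [N hN] := UE (LamP bF e0).
have : 0 <= lavg F N.
 by rewrite /lavg divr_ge0 ?sumr_ge0 // => n _; rewrite ?divr_ge0 ?invr_ge0.
move: hN; rewrite ler_norml; lra.
Qed.

Lemma Lam_cst (c : R) : Lam (fun=> c) = c.
Proof.
apply: Lam_uniq; first by exists `|c|.
move=> e e0; apply: US (Ucof 1%N) => N N0; have H0 := harm_gt0 N0.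
have -> : lavg (fun=> c) N = c.
 by rewrite /lavg /lsum -mulr_sumr -/(harm N) mulfK // gt_eqF.
by rewrite subrr normr0 ltW.
Qed.

Lemma sum_inv_nn1 N : \sum_[n<=N] (n%:R^-1-n.+1%:R^-1) = 1-N.+1%:R^-1:>R.
Proof.
elim: N => [|N IH]; first by rewrite big_geq // invr1 subrr.
by rewrite big_nat_recr //= IH; ring.
Qed.

Lemma Lam_shift1 F : bdd F -> Lam (fun n => F n.+1) = Lam F.
Proof.
move=> [B hB]; have B0 := bdd_ge0 hB; apply: (@Lam_close _ _ (3*B)); try by exists B.
move=> N N0.
have e: lsum (fun n => F n.+1) N-lsum F N =
  \sum_[n<=N] F n.+1*(n%:R^-1-n.+1%:R^-1)+(F N.+1/N.+1%:R-F 1%N).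
 have -> : \sum_[n<=N] F n.+1*(n%:R^-1-n.+1%:R^-1) =
   lsum (fun n => F n.+1) N-\sum_[n<=N] F n.+1/n.+1%:R.
  by rewrite /lsum -sumrB; apply: eq_bigr => n _; rewrite mulrBr.
 have : lsum F N.+1 = F 1%N+\sum_[n<=N] F n.+1/n.+1%:R.
  by rewrite /lsum big_nat_recl //= divr1.
 have : lsum F N.+1 = lsum F N+F N.+1/N.+1%:R by rewrite /lsum big_nat_recr.
 move=> h1 h2; have e3: \sum_[n<=N] F n.+1/n.+1%:R = lsum F N+F N.+1/N.+1%:R-F 1%N.
  by rewrite -h1 h2 addrAC subrr add0r.
 rewrite e3; ring.
rewrite e; apply: leT (ler_normD _ _) _.
have i1: N.+1%:R^-1 <= 1:>R by rewrite invf_le1 ?ltr0n // ler1n.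
have i0: 0 <= N.+1%:R^-1:>R by rewrite invr_ge0.
have h1: `|\sum_[n<=N] F n.+1*(n%:R^-1-n.+1%:R^-1)| <= B.
 apply: leT (ler_norm_sum _ _ _) _.
 apply: (leV (B*\sum_[n<=N] (n%:R^-1-n.+1%:R^-1))).
  rewrite mulr_sumr; apply: ler_sum_nat => n /andP[n1 _].
  rewrite normrM [`|_^-1-_|]ger0_norm ?leMr // subr_ge0 lef_pV2 ?posrE ?ltr0n // ler_nat //.
 by rewrite sum_inv_nn1 ler_piMr // gerBl.
have h2: `|F N.+1/N.+1%:R| <= B.
 rewrite normrM [`|_^-1|]ger0_norm //; apply: leT (hB N.+1).
 by rewrite ler_piMr.
have := hB 1%N; have := ler_normB (F N.+1/N.+1%:R) (F 1%N); lra.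
Qed.

Lemma Lam_shift F k : bdd F -> Lam (fun n => F (n+k)%N) = Lam F.
Proof.
move=> bF; elim: k => [|k IH].
 by congr Lam; apply: funext => n; rewrite addn0.
rewrite -[RHS]IH -[RHS]Lam_shift1; last by case: bF => B h; exists B.
by congr Lam; apply: funext => n; rewrite addnS addSn.
Qed.

(** The property peculiar to logarithmic means: the sum over multiples [n = p m <= N] is [1/p] times
    the sum over [m <= N/p]. The missing terms [N/p < m <= N] have bounded total, each being at most
    [B p/N]. *)
Lemma Lam_dil F p : bdd F -> (0<p)%N ->
 Lam (fun n => if (p %| n)%N then F (n %/ p)%N else 0) = Lam F/p%:R.
Proof.
move=> [B hB] p0; have B0 := bdd_ge0 hB; have pR: 0 < p%:R:>R by rewrite ltr0n.
rewrite mulrC -LamZ; last by exists B.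
apply: (@Lam_close _ _ B).
- by exists B => n; case: ifP => _ //; rewrite normr0.
- by apply: bddZ; exists B.
move=> N N0.
have -> : lsum (fun n => if (p %| n)%N then F (n %/ p)%N else 0) N = p%:R^-1 * lsum F (N %/ p).
 rewrite /lsum mulr_sumr; elim: N {N0} => [|N IH]; first by rewrite div0n !big_geq.
 rewrite big_nat_recr //= IH divnS //; case: (boolP (p %| N.+1)%N) => [h|h]; last first.
  by rewrite add0n mul0r addr0.
 rewrite add1n [RHS]big_nat_recr //=; congr (_+_).
 have e: (N.+1 %/ p = (N %/ p).+1)%N by rewrite divnS // h.
 rewrite -e; have e2: (N.+1 = N.+1 %/ p * p)%N by rewrite divnK.
 have : N.+1%:R = (N.+1 %/ p)%:R * p%:R:>R by rewrite -natrM -e2.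
 move=> ->; rewrite invfM; ring.
have -> : lsum (fun n => p%:R^-1*F n) N = p%:R^-1 * lsum F N.
 by rewrite /lsum mulr_sumr; apply: eq_bigr => n _; rewrite mulrA.
rewrite -mulrBr normrM [`|_^-1|]ger0_norm ?invr_ge0 // mulrC ler_pdivrMr //.
have le: (N %/ p<=N)%N by exact: leq_div.
rewrite /lsum [\sum_[n<=N] _](big_cat_nat (n := (N %/ p).+1)) //= opprD addNKr normrN.
apply: leT (ler_norm_sum _ _ _) _.
apply: (leV (\sum_((N %/ p).+1 <= n < N.+1) B*(p%:R/N%:R))).
 apply: ler_sum_nat => n /andP[n1 _]; rewrite normrM; apply: ler_pM => //.
 have n0: 0 < n%:R:>R by rewrite ltr0n (leq_ltn_trans _ n1).
 have NR: 0 < N%:R:>R by rewrite ltr0n.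
 rewrite ger0_norm ?invr_ge0 ?(ltW n0) // -[leLHS]div1r ler_pdivrMr // mulrAC ler_pdivlMr // mul1r.
 by rewrite -natrM ler_nat mulnC; move: n1; rewrite ltn_divLR // => /ltnW.
rewrite sumr_const_nat subSS -mulrnAr leMl // -mulr_natr.
have NR: 0 < N%:R:>R by rewrite ltr0n.
rewrite mulrAC ler_pdivrMr // leMl // ler_nat leq_subr //.
Qed.

Lemma Lam_ge F (c : R) (S : set nat) : bdd F -> U S -> (forall N, S N -> c <= lavg F N) -> c <= Lam F.
Proof.
move=> bF US' h; apply/ler_addgt0Pl => e e0.
have [N [h1 h2]] := UE (UI (LamP bF e0) US').
have := h N h2; move: h1; rewrite ler_norml; lra.
Qed.

Lemma Lam_le F (c : R) N0 : bdd F -> (forall N, (N0<=N)%N -> lavg F N <= c) -> Lam F <= c.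
Proof.
move=> bF h; apply/ler_addgt0Pl => e e0.
have [N [h1 h2]] := UE (UI (LamP bF e0) (Ucof N0)).
have := h N h2; move: h1; rewrite ler_norml; lra.
Qed.
End Mean.

Lemma exists_ultra (S : nat -> Prop) : (forall N0, exists2 N, (N0<=N)%N & S N) ->
 exists U : set (set nat), [/\ UltraFilter U, (forall N0, U (fun N => is_true (N0<=N)%N)) & U S].
Proof.
move=> hS; pose F : set (set nat) := fun A => exists N0, forall N, (N0<=N)%N -> S N -> A N.
have FF: ProperFilter F.
 split; first by move=> [N0 h]; have [N h1 h2] := hS N0; exact: h N h1 h2.
 split.
 - by exists 0%N.
 - move=> A B [N1 h1] [N2 h2]; exists (maxn N1 N2) => N; rewrite geq_max => /andP[a b] s.
  by split; [apply: h1|apply: h2].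
 - by move=> A B AB [N0 h]; exists N0 => N a s; apply: AB; apply: h.
have [G [Gu FG]] := ultraFilterLemma FF.
exists G; split=> //; last by apply: FG; exists 0%N.
by move=> N0; apply: FG; exists N0.
Qed.

(** * Rational frequencies *)

Definition dchar (q : nat) (chi : nat -> C) :=
 [/\ (0<q)%N, chi 1%N = 1, forall m n, chi (m*n)%N = chi m*chi n,
   forall n, chi (n+q)%N = chi n & forall n, ~~ coprime n q -> chi n = 0].

Definition eq_ (x : R) : C := cis (2*rpi*x).
Lemma eq_D x y : eq_ (x+y) = eq_ x*eq_ y. Proof. by rewrite /eq_ mulrDr cisD. Qed.
Lemma nm_eq x : nm (eq_ x) = 1. Proof. exact: nm_cis. Qed.
Lemma eq_int (m : int) : eq_ m%:~R = 1. Proof. exact: cis_2piZ. Qed.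
Lemma eq_nat (m : nat) : eq_ m%:R = 1. Proof. exact: cis_2piN. Qed.
Lemma eq_addn x (m : nat) : eq_ (x+m%:R) = eq_ x. Proof. by rewrite eq_D eq_nat mulr1. Qed.

Lemma eq_mod (b m k : nat) : (0<b)%N -> eq_ (m%:R*(k %% b)%:R/b%:R) = eq_ (m%:R*k%:R/b%:R).
Proof.
move=> b0; rewrite {2}(divn_eq k b).
have -> : m%:R*(k %/ b*b+k %% b)%N%:R/b%:R = m%:R*(k %% b)%:R/b%:R+(m*(k %/ b))%N%:R:>R.
 by rewrite !natrM natrD natrM; field; rewrite pnatr_eq0 -lt0n.
by rewrite eq_addn.
Qed.

Lemma savg_scale (c : C) f H n : savg (fun n => c*f n) H n = c*savg f H n.
Proof. by rewrite /savg -mulr_sumr mulrCA. Qed.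

Lemma savg_sum (I : Type) (r : seq I) (f : I -> nat -> C) H n :
 savg (fun n => \sum_(i <- r) f i n) H n = \sum_(i <- r) savg (f i) H n.
Proof. by rewrite /savg exchange_big mulr_sumr. Qed.

Definition log_small (F : nat -> nat -> R) := forall eps : R, 0 < eps -> exists H0, forall H, (H0<=H)%N ->
 exists N0, forall N, (N0<=N)%N -> \sum_[n<=N] F H n/n%:R <= eps*rln N%:R.

Lemma log_small_le F G : (forall H n, F H n <= G H n) -> log_small G -> log_small F.
Proof.
move=> FG hG eps e0; have [H0 h] := hG eps e0; exists H0 => H /h [N0 h2]; exists N0 => N /h2.
by apply: leT; apply: ler_sum => n _; rewrite leMr ?invr_ge0.
Qed.

Lemma log_small0 : log_small (fun _ _ => 0).
Proof.
move=> eps e0; exists 0%N => H _; exists 1%N => N N1; rewrite big1 ?mulr_ge0 ?rln_ge0 ?ler1n ?(ltW e0) // => n _.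
by rewrite mul0r.
Qed.

Lemma log_smallZ c F : 0 <= c -> log_small F -> log_small (fun H n => c*F H n).
Proof.
move=> c0 hF eps e0; have e1: 0 < eps/(c+1) by rewrite divr_gt0 //; lra.
have [H0 h] := hF _ e1; exists H0 => H /h [N0 h2]; exists (maxn N0 1) => N; rewrite geq_max => /andP[/h2 h3 N1].
have -> : \sum_[n<=N] c*F H n/n%:R = c*\sum_[n<=N] F H n/n%:R.
 by rewrite mulr_sumr; apply: eq_bigr => n _; rewrite mulrA.
apply: leT (leMl c0 h3) _.
have -> : c*(eps/(c+1)*rln N%:R) = eps*rln N%:R*(c/(c+1)) by ring.
by rewrite ler_piMr ?mulr_ge0 ?rln_ge0 ?ler1n ?(ltW e0) // ler_pdivrMr; lra.
Qed.

Lemma log_smallD F G : log_small F -> log_small G -> log_small (fun H n => F H n+G H n).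
Proof.
move=> hF hG eps e0; have e1: 0 < eps/2 by lra.
have [H1 h1] := hF _ e1; have [H2 h2] := hG _ e1; exists (maxn H1 H2) => H; rewrite geq_max => /andP[/h1 [N1 k1] /h2 [N2 k2]].
exists (maxn N1 N2) => N; rewrite geq_max => /andP[/k1 l1 /k2 l2].
have -> : \sum_[n<=N] (F H n+G H n)/n%:R = \sum_[n<=N] F H n/n%:R+\sum_[n<=N] G H n/n%:R.
 by rewrite -big_split /=; apply: eq_bigr => n _; rewrite mulrDl.
lra.
Qed.

Lemma log_small_sum (I : Type) (r : seq I) (F : I -> nat -> nat -> R) :
 (forall i, log_small (F i)) -> log_small (fun H n => \sum_(i <- r) F i H n).
Proof.
move=> h; elim: r => [|i r IH].
 by apply: log_small_le log_small0 => H n; rewrite big_nil.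
by apply: log_small_le (log_smallD (h i) IH) => H n; rewrite big_cons.
Qed.

Lemma twist_ring (x1 x2 x3 x4 x5 : C) : x5*(x3*x4*(x2*x1)) = x3*x2*(x5*(x4*x1)).
Proof. ring. Qed.

Section Twist.
Variable a : nat -> C.
Hypotheses (a0 : a 0%N = 0) (a1 : forall n, (0<n)%N -> N2 (a n) = 1).
Hypotheses (aM : forall m n, (0<m)%N -> (0<n)%N -> a (m*n)%N = a m*a n) (unp : forall q chi, dchar q chi -> forall M : R, exists N0, forall N, (N0<=N)%N ->
 forall t : R, `|t| <= 2*N%:R ->
  M <= \sum_(1 <= p < N.+1 | prime p) (1-Re (a p*chi p*npw p t))/p%:R).

Let a_le n : nm (a n) <= 1.
Proof. by case: n => [|n]; [rewrite a0 nm0|apply: N2_nm; rewrite a1]. Qed.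

(** If [v k0 <> 0], then [lam n = v(n k0)/v(k0)] is multiplicative, periodic and of modulus 1 on
    units. Reindexing [k] by [p k] gives [S(p m) = conj(lam p) S(m)], so [a S], scaled by [V] to
    modulus at most 1, satisfies the relation of [mr_log] with [g = a chi] and [chi = conj lam]. *)
Lemma eigen_small b (v : nat -> C) : (0<b)%N -> periodic b v -> unit_supp b v ->
 (forall g, coprime g b -> exists lam, nm lam = 1 /\ forall k, v (g*k)%N = lam*v k) ->
 log_small (fun H n => nm (savg (fun n => a n*\sum_[k<b] v k*eq_ (n%:R*k%:R/b%:R)) H n)).
Proof.
move=> b0 vp vs vl.
have [[k0 vk0]|vz] := pselect (exists k0, v k0 != 0); last first.
 apply: log_small_le log_small0 => H n; rewrite /savg big1 ?mulr0 ?nm0 // => h _.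
 rewrite big1 ?mulr0 // => k _; have [->|vk] := eqVneq (v k) 0; first by rewrite mul0r.
 by case: vz; exists k.
pose lam n := v (n*k0)%N/v k0.
have lamP g k : coprime g b -> v (g*k)%N = lam g*v k.
 by move=> /vl [l [_ hl]]; rewrite /lam !hl mulfK.
have lam1 g : coprime g b -> nm (lam g) = 1.
 by move=> /vl [l [nl hl]]; rewrite /lam !hl mulfK.
have lam0 g : ~~ coprime g b -> lam g = 0.
 by move=> cg; rewrite /lam vs ?mul0r // coprimeMl negb_and cg.
pose chi n := cj (lam n).
have chiD: dchar b chi.
 split=> //.
 - by rewrite /chi /lam mul1n mulfV //; exact: rmorph1.
 - move=> m n; rewrite /chi -conjM; congr (cj _).
  have [cm|cm] := boolP (coprime m b); first by rewrite {1}/lam -mulnA lamP // -mulrA.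
  by rewrite [lam m]lam0 // mul0r lam0 // coprimeMl negb_and cm.
 - move=> n; rewrite /chi /lam mulnDl; congr (cj (_/_)).
  elim: (k0) => [|k IH]; first by rewrite !muln0.
  by apply: periodic_eqmod => //; rewrite addnC mulnC modnMDl.
 - by move=> n /lam0 h; rewrite /chi h; exact: rmorph0.
pose V : R := 1+\sum_[k<b] nm (v k).
have V0: 1 <= V by rewrite lerDl; apply: sumr_ge0 => k _; exact: nm_ge0.
have VR: 0 < V by lra.
pose S n := \sum_[k<b] v k*eq_ (n%:R*k%:R/b%:R).
pose f n := V^-1%:C*(a n*S n).
pose g n := a n*chi n.
have S_le n : nm (S n) <= V.
 apply: leT (nm_sum _ _ _) _; apply: leT (_ : \sum_[k<b] nm (v k) <= _); last by rewrite lerDr.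
 by apply: ler_sum => k _; rewrite nmM nm_eq mulr1.
have hf n : nm (f n) <= 1.
 rewrite !nmM nm_real ?invr_ge0 ?(ltW VR) // mulrC ler_pdivrMr // mul1r.
 by apply: leT (S_le n); rewrite ler_piMl ?nm_ge0.
have chi_le n : nm (chi n) <= 1.
 rewrite /chi nmJ; have [/lam1 -> //|/lam0 ->] := boolP (coprime n b); by rewrite nm0.
have hg n : nm (g n) <= 1 by rewrite nmM; apply: mulr_ile1; rewrite ?nm_ge0.
have pb p : prime p -> (b<p)%N -> coprime p b.
 by move=> pp bp; rewrite prime_coprime // gtnNdvd.
have hg1 p : prime p -> (b<p)%N -> N2 (g p) = 1.
 by move=> pp bp; rewrite N2M a1 ?prime_gt0 // mul1r /chi N2J -nm_sqr lam1 ?expr1n // pb.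
have hm p m : prime p -> (b<p)%N -> (0<m)%N -> f (p * m)%N = g p*f m.
 move=> pp bp m0; have cp := pb _ pp bp.
 have l1: cj (lam p) * lam p = 1 by rewrite mulrC N2_mulJ -nm_sqr lam1 // expr1n.
 suff e : S (p * m)%N = chi p*S m by have e1 := aM (prime_gt0 pp) m0; rewrite /f /g e e1; exact: twist_ring.
 pose s k := (p*k %% b)%N.
 have sP k : v k*eq_ ((p * m)%N%:R*k%:R/b%:R) = chi p*(v (s k)*eq_ (m%:R*(s k)%:R/b%:R)).
  rewrite eq_mod // /s periodic_mod // lamP // mulrA /chi mulrA l1 mul1r; congr (_*eq_ _).
  by rewrite !natrM; ring.
 rewrite /S (eq_bigr _ (fun k _ => sP k)) -mulr_sumr; congr (_*_).
 pose F k := v k*eq_ (m%:R*k%:R/b%:R).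
 rewrite -[LHS](big_map s predT F); apply: perm_big.
 have us: uniq (map s (index_iota 0 b)).
  rewrite map_inj_in_uniq ?iota_uniq // => i j; rewrite !mem_index_iota /= => ib jb /eqP.
  wlog ij : i j ib jb / (j<=i)%N.
   by move=> W e; have [ji|/ltnW ij] := leqP j i; [exact: W|apply/esym; apply: W => //; rewrite eq_sym].
  rewrite /s eqn_mod_dvd ?leq_mul2l ?ij ?orbT // -mulnBr Gauss_dvdr 1?coprime_sym //.
  rewrite -eqn_mod_dvd // !modn_small // => /eqP //.
 apply: uniq_perm => //; first exact: iota_uniq.
 have sub: {subset [seq s i | i <- index_iota 0 b] <= index_iota 0 b}.
  by move=> x /mapP [i _ ->]; rewrite mem_index_iota ltn_pmod.
 have sz: (size (index_iota 0 b)<=size [seq s i | i <- index_iota 0 b])%N by rewrite size_map.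
 by case: (uniq_min_size us sub sz).
have hPhi := unp chiD.
have hlog := mr_log hf hg hm hg1 hPhi.
have h2: log_small (fun H n => nm (savg f H n)) by exact: hlog.
apply: log_small_le (log_smallZ (ltW VR) h2) => H n.
by rewrite (savg_scale V^-1%:C) nmM nm_real ?invr_ge0 ?(ltW VR) // mulrA mulfV ?mul1r // gt_eqF.
Qed.

(** [e(n r/b)] is the transform of the indicator [F] of the class of [r]. As [r] is a unit modulo
    [b], [F] is supported on units and [eigen_decomp] splits it into finitely many pieces fit for
    [eigen_small]. *)
Lemma reduced_small b r : (0<b)%N -> coprime r b ->
 log_small (fun H n => nm (savg (fun n => a n*eq_ (n%:R*r%:R/b%:R)) H n)).
Proof.
move=> b0 rb.
pose F k : C := if (k == r %[mod b])%N then 1 else 0.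
have Fp: periodic b F by move=> k; rewrite /F modnDr.
have Fs: unit_supp b F.
 move=> k ck; rewrite /F; case: eqP => // e; move: ck.
 by rewrite -coprime_modl e coprime_modl rb.
have gsc: all (coprime^~ b) [seq k <- iota 0 b | coprime k b] by exact: filter_all.
have [m [v [hF hv hl]]] := eigen_decomp b0 gsc Fp Fs.
have e n : a n*eq_ (n%:R*r%:R/b%:R) = \sum_[c<m] a n*\sum_[k<b] v c k*eq_ (n%:R*k%:R/b%:R).
 rewrite -mulr_sumr; congr (_*_); rewrite exchange_big /=.
 under eq_bigr => k _ do rewrite -mulr_suml -hF.
 rewrite (bigD1_seq (r %% b)%N) /= ?mem_index_iota ?ltn_pmod ?iota_uniq //.
 rewrite {1}/F modn_mod eqxx mul1r eq_mod // big_nat_cond big1 ?addr0 // => k /andP[/andP[_ kb] kr].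
 by rewrite /F modn_small // (negbTE kr) mul0r.
apply: (@log_small_le _ (fun H n => \sum_(c <- iota 0 m) if (c<m)%N then nm (savg (fun n => a n*\sum_[k<b] v c k*eq_ (n%:R*k%:R/b%:R)) H n) else 0)).
 move=> H n; have -> : savg (fun n => a n*eq_ (n%:R*r%:R/b%:R)) H n =
   \sum_[c<m] savg (fun n => a n*\sum_[k<b] v c k*eq_ (n%:R*k%:R/b%:R)) H n.
  by rewrite -savg_sum /savg; congr (_*_); apply: eq_bigr => h _; rewrite e.
 apply: leT (nm_sum _ _ _) _; rewrite /index_iota subn0 big_seq [leRHS]big_seq; apply: ler_sum => c.
 by rewrite mem_iota /= add0n => ->.
apply: log_small_sum => c; case: ltnP => [cm|_]; last exact: log_small0.
have [vp vs] := hv c cm; apply: eigen_small => // g cg.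
have gin: (g %% b)%N \in [seq k <- iota 0 b | coprime k b].
 by rewrite mem_filter coprime_modl cg mem_iota /= add0n ltn_pmod.
have [lam [l1 l2]] := hl c cm _ gin; exists lam; split=> // k; rewrite -l2.
by apply: periodic_eqmod => //; rewrite modnMml.
Qed.

Lemma rational_small b r : (0<b)%N ->
 log_small (fun H n => nm (savg (fun n => a n*eq_ (n%:R*r%:R/b%:R)) H n)).
Proof.
move=> b0; pose g := gcdn r b; have g0: (0<g)%N by rewrite gcdn_gt0 b0 orbT.
have b'0: (0<b %/ g)%N by rewrite divn_gt0 // dvdn_leq // dvdn_gcdr.
have cop: coprime (r %/ g) (b %/ g).
 by rewrite /coprime -(eqn_pmul2r g0) muln_gcdl !divnK ?dvdn_gcdl ?dvdn_gcdr // mul1n.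
apply: log_small_le (reduced_small b'0 cop) => H n; apply: le_of_eq; congr nm.
rewrite /savg; congr (_*_); apply: eq_bigr => h _; congr (_*eq_ _).
rewrite -{1}(divnK (dvdn_gcdl r b)) -{3}(divnK (dvdn_gcdr r b)) -/g !natrM.
have gR: g%:R != 0:>R by rewrite pnatr_eq0 -lt0n.
have bR: (b %/ g)%:R != 0:>R by rewrite pnatr_eq0 -lt0n.
by field; rewrite gR bR.
Qed.
End Twist.

(** * Bilinear sums *)

Lemma exists_ge (T : eqType) (r : seq T) (w F : T -> R) (c : R) : (forall i, 0 <= w i) ->
 0 < \sum_(i <- r) w i -> c*\sum_(i <- r) w i <= \sum_(i <- r) w i*F i -> exists2 i, i \in r & c <= F i.
Proof.
move=> w0 W h; apply: contrapT => nex.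
have lt i : i \in r -> F i < c by move=> ir; rewrite ltNge; apply/negP => cF; apply: nex; exists i.
have : \sum_(i <- r) w i*(c-F i) <= 0.
 have -> : \sum_(i <- r) w i*(c-F i) = c*\sum_(i <- r) w i-\sum_(i <- r) w i*F i.
  by rewrite mulr_sumr -sumrB; apply: eq_bigr => i _; ring.
 by rewrite subr_le0.
move: W {h nex}; elim: r lt => [|i r IH] lt; first by rewrite !big_nil ltxx.
rewrite !big_cons => W h.
have ltr j : j \in r -> F j < c by move=> jr; apply: lt; rewrite in_cons jr orbT.
have fi := lt i (mem_head _ _).
have t0: 0 <= \sum_(j <- r) w j*(c-F j).
 by rewrite big_seq; apply: sumr_ge0 => j jr; rewrite mulr_ge0 // subr_ge0 ltW // ltr.
have t1: 0 <= w i*(c-F i) by rewrite mulr_ge0 // subr_ge0 ltW.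
have [wi|wi] := eqVneq (w i) 0.
 rewrite wi mul0r !add0r in W h; exact: IH.
have : 0 < w i*(c-F i) by rewrite mulr_gt0 ?subr_gt0 // lt_neqAle eq_sym wi w0.
lra.
Qed.

(** * Dilations and Turan-Kubilius for the limit mean *)

Section MeanMore.
Variable U : set (set nat).
Hypotheses (Uultra : UltraFilter U) (Ucof : forall N0, U (fun N => is_true (N0<=N)%N)).
Local Notation Lam := (Lam U).
Let LD := LamD Uultra.
Let LZ := LamZ Uultra.
Let Lge0 := Lam_ge0 Uultra.
Let Lshift := Lam_shift Uultra Ucof.
Let Ldil := Lam_dil Uultra Ucof.
Let Lcst := Lam_cst Uultra Ucof.

Lemma bdd_cst (c : R) : bdd (fun=> c). Proof. by exists `|c|. Qed.

Lemma bdd_sum (T : Type) (r : seq T) (F : T -> nat -> R) : (forall i, bdd (F i)) -> bdd (fun n => \sum_(i <- r) F i n).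
Proof.
move=> h; elim: r => [|i r IH]; first by exists 0 => n; rewrite big_nil normr0.
have [B hB] := bddD (h i) IH; exists B => n; by rewrite big_cons.
Qed.

Lemma bdd01 (F : nat -> R) (B : R) : (forall n, 0 <= F n <= B) -> bdd F.
Proof. by move=> h; exists B => n; case/andP: (h n) => h1 h2; rewrite ger0_norm. Qed.

Lemma Lam_sum (T : Type) (r : seq T) (F : T -> nat -> R) : (forall i, bdd (F i)) ->
 Lam (fun n => \sum_(i <- r) F i n) = \sum_(i <- r) Lam (F i).
Proof.
move=> h; elim: r => [|i r IH].
 rewrite big_nil -[RHS](Lcst 0); congr Lam; apply: funext => n; by rewrite big_nil.
rewrite big_cons -IH -LD //; last exact: bdd_sum.
by congr Lam; apply: funext => n; rewrite big_cons.
Qed.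

Lemma Lam_mono F G : bdd F -> bdd G -> (forall n, F n <= G n) -> Lam F <= Lam G.
Proof.
move=> bF bG FG; have bN: bdd (fun n => -1*F n) by exact: bddZ.
have := Lge0 (bddD bG bN); rewrite LD // LZ // => h.
by rewrite -subr_ge0 -mulN1r; apply: h => n; rewrite mulN1r subr_ge0.
Qed.

Lemma Lam_le_cst F (c : R) : bdd F -> (forall n, F n <= c) -> Lam F <= c.
Proof. by move=> bF h; rewrite -[leRHS]Lcst; apply: Lam_mono => //; exact: bdd_cst. Qed.

Lemma Lam_ge_ex F (c : R) : bdd F -> 0 < c -> c <= Lam F -> exists x, c/2 <= F x.
Proof.
move=> bF c0 h; apply: contrapT => nex; have : Lam F <= c/2.
 by apply: Lam_le_cst => // n; rewrite leNgt; apply/negP => hn; apply: nex; exists n; exact: ltW.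
lra.
Qed.

Lemma bdd_shift F k : bdd F -> bdd (fun n => F (n+k)%N).
Proof. by move=> [B h]; exists B. Qed.

(** Exactly one of [y+1, ..., y+q] is a multiple of [q], so [F(floor((y+q)/q))] is a sum of [q]
    shifts of the dilate of [F], each of mean [Lam F / q]. *)
Lemma Lam_floor F q : bdd F -> (0<q)%N -> Lam (fun x => F (x %/ q)%N) = Lam F.
Proof.
move=> bF q0; pose D n := if (q %| n)%N then F (n %/ q)%N else 0.
have bD: bdd D.
 have [B hB] := bF; exists B => n; rewrite /D; case: ifP => // _; rewrite normr0; exact: bdd_ge0 hB.
have bq: bdd (fun x => F (x %/ q)%N) by have [B hB] := bF; exists B.
rewrite -(Lshift q bq).
have -> : (fun y => F ((y+q) %/ q)%N) = (fun y => \sum_(s <- index_iota 1 q.+1) D (y+s)%N).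
 apply: funext => y; pose s0 := (q-y %% q)%N.
 have yq: (y %% q<q)%N by rewrite ltn_pmod.
 have s0P: (1<=s0<=q)%N by rewrite /s0; move: yq; clear; lia.
 have e: (y+s0 = (y %/ q).+1*q)%N.
  by rewrite {1}(divn_eq y q) /s0 -addnA subnKC ?(ltnW yq) // mulSn addnC.
 rewrite (bigD1_seq s0) /= ?mem_index_iota ?iota_uniq ?ltnS //.
 have -> : D (y+s0)%N = F ((y+q) %/ q)%N.
  by rewrite /D e dvdn_mull // mulnK // divnDr // divnn q0 addn1.
 rewrite big_nat_cond big1 ?addr0 // => s /andP[/andP[s1 sq] sn].
 rewrite /D; case: ifP => // /dvdnP [z hz]; exfalso; move: sn; apply/negP; rewrite negbK.
 apply/eqP; have hz0 := e; clearbody s0; move: (y %/ q).+1 hz0 => z' hz0.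
 by have [zz|zz|zz] := ltngtP z z'; move: zz hz hz0 s1 sq s0P; clear; nia.
rewrite Lam_sum; last by move=> s; exact: bdd_shift.
under eq_bigr => s _ do rewrite Lshift // Ldil //.
rewrite big_const_nat iter_addr_0 subSS subn0 -[LHS]mulr_natl mulrCA mulfV ?mulr1 //.
by rewrite pnatr_eq0 -lt0n.
Qed.
Lemma Lam_dvd q : (0<q)%N -> Lam (fun n => (q %| n)%N%:R) = q%:R^-1.
Proof.
move=> q0; have := Ldil (bdd_cst 1) q0; rewrite Lcst mul1r => <-; congr Lam; apply: funext => n.
by case: (q %| n)%N.
Qed.

Lemma bdd_dvd q : bdd (fun n => (q %| n)%N%:R).
Proof. by exists 1 => n; rewrite ger0_norm // lern1 leq_b1. Qed.

Lemma bddM F G : bdd F -> bdd G -> bdd (fun n => F n*G n).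
Proof.
move=> [A hA] [B hB]; exists (A*B) => n; rewrite normrM; exact: ler_pM.
Qed.

Section TK.
Variable P : seq nat.
Hypotheses (uP : uniq P) (pP : forall p, p \in P -> prime p).
Let W : R := \sum_(p <- P) p%:R^-1.
Hypothesis W0 : 0 < W.
Let om (n : nat) : R := \sum_(p <- P) (p %| n)%N%:R.

Lemma bdd_om : bdd om. Proof. by apply: bdd_sum => p; exact: bdd_dvd. Qed.

Lemma Lam_om : Lam om = W.
Proof.
rewrite Lam_sum; last by move=> p; exact: bdd_dvd.
by rewrite big_seq [RHS]big_seq; apply: eq_bigr => p /pP pp; rewrite Lam_dvd ?prime_gt0.
Qed.

Lemma Lam_om2 : Lam (fun n => om n^+2) <= W^+2+W.
Proof.
have e: (fun n => om n^+2) = (fun n => \sum_(p <- P) \sum_(q <- P) (p %| n)%N%:R*(q %| n)%N%:R).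
 by apply: funext => n; rewrite expr2 mulr_suml; apply: eq_bigr => p _; rewrite mulr_sumr.
have bpq p q : bdd (fun n => (p %| n)%N%:R*(q %| n)%N%:R) by apply: bddM; exact: bdd_dvd.
rewrite e Lam_sum; last by move=> p; apply: bdd_sum => q.
have -> : W^+2+W = \sum_(p <- P) (p%:R^-1*W+p%:R^-1).
 by rewrite big_split /= -mulr_suml expr2.
rewrite big_seq [leRHS]big_seq; apply: ler_sum => p pin; have pp := pP pin.
rewrite Lam_sum // (bigD1_seq p) //= addrC; apply: lerD; last first.
 rewrite -[leRHS]Lam_dvd ?prime_gt0 //; apply: Lam_mono => //; first exact: bdd_dvd.
 by move=> n; case: (p %| n)%N; rewrite ?mulr1 ?mul0r.
rewrite /W mulr_sumr [leRHS](bigD1_seq p) //= -[leLHS]add0r; apply: lerD.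
 by rewrite mulr_ge0 // invr_ge0.
rewrite big_seq_cond [leRHS]big_seq_cond; apply: ler_sum => q /andP[qin qp].
have pq := pP qin; rewrite -invfM -natrM -Lam_dvd ?muln_gt0 ?prime_gt0 //.
apply: Lam_mono => //; first exact: bdd_dvd.
move=> n; rewrite Gauss_dvd; last by rewrite prime_coprime // dvdn_prime2 // eq_sym.
by case: (p %| n)%N; case: (q %| n)%N; rewrite ?mulr1 ?mul0r ?mulr0.
Qed.

Lemma Lam_tk : Lam (fun n => (1-om n/W)^+2) <= W^-1.
Proof.
have b2: bdd (fun n => om n^+2) by apply: bddM; exact: bdd_om.
have -> : (fun n => (1-om n/W)^+2) = (fun n => 1+((- 2/W)*om n+(W^+2)^-1*om n^+2)).
 by apply: funext => n; field; rewrite gt_eqF.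
rewrite LD; [|exact: bdd_cst|by apply: bddD; apply: bddZ => //; exact: bdd_om].
rewrite LD; [|by apply: bddZ; exact: bdd_om|exact: bddZ].
rewrite !LZ //; last exact: bdd_om.
rewrite Lcst Lam_om.
have : (W^+2)^-1*Lam (fun n => om n^+2) <= (W^+2)^-1*(W^+2+W).
 by apply: leMl; [rewrite invr_ge0 exprn_ge0 // ltW|exact: Lam_om2].
have -> : (W^+2)^-1*(W^+2+W) = 1+W^-1 by field; rewrite gt_eqF.
have -> : - 2/W*W = - 2 by field; rewrite gt_eqF.
lra.
Qed.
End TK.

(** * Katai's bilinear argument *)

Section Katai.
Variables (a Psi : nat -> C).
Hypotheses (a_le : bnd1 a) (aM : forall m n, a (m*n)%N = a m*a n).
Hypothesis Psi_le : bnd1 Psi.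

Definition Ws (P : seq nat) : R := \sum_(p <- P) p%:R^-1.
Definition Phis (P : seq nat) (n : nat) : C := \sum_(p <- P) (p%:R*Ws P)^-1%:C*(a p*Psi (p*n)%N).

Lemma re_bdd (F : nat -> C) (B : R) : (forall n, nm (F n) <= B) -> bdd (fun n => Re (F n)).
Proof. by move=> h; exists B => n; apply: leT (Re_nm _) (h n). Qed.

Lemma aPsi_le n : nm (a n*Psi n) <= 1.
Proof. by rewrite nmM; apply: mulr_ile1; rewrite ?nm_ge0. Qed.

Lemma Phis_le P n : 0 < Ws P -> nm (Phis P n) <= 1.
Proof.
move=> W0; apply: leT (nm_sum _ _ _) _; apply: (leV (\sum_(p <- P) p%:R^-1/Ws P)); last first.
 by rewrite -mulr_suml mulfV // gt_eqF.
apply: ler_sum => p _; have i0: 0 <= (p%:R*Ws P)^-1 by rewrite invr_ge0 mulr_ge0 // ltW.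
rewrite nmM nm_real // invfM -[leRHS]mulr1; apply: leMl; first by rewrite -invfM.
by rewrite nmM; apply: mulr_ile1; rewrite ?nm_ge0.
Qed.

Lemma amgm_abs (x d : R) : 0 < d -> `|x| <= d/2+x^+2/(2*d).
Proof.
move=> d0; rewrite -subr_ge0; have -> : d/2+x^+2/(2*d)-`|x| = (`|x| - d)^+2/(2*d).
 by rewrite -[x^+2]real_normK ?num_real //; field; rewrite gt_eqF.
by rewrite divr_ge0 ?sqr_ge0 //; lra.
Qed.

(** Inserting [om n / W] costs at most [eps/4 + 1/(eps W)], by Turan-Kubilius and the inequality of
    the means. Then [Lam_dil] passes from multiples of [p] to [p n], and complete multiplicativity
    takes [a p] out. *)
Lemma Phis_mean (P : seq nat) (eps : R) : uniq P -> (forall p, p \in P -> prime p) -> 0 < eps ->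
 16/eps^+2 <= Ws P -> eps <= Lam (fun n => Re (a n*Psi n)) ->
 eps/2 <= Lam (fun n => Re (a n*Phis P n)).
Proof.
move=> uP pP e0 hW he; have W0: 0 < Ws P by apply: lt_le_trans hW; rewrite divr_gt0 ?exprn_gt0.
set W := Ws P in hW W0 *.
pose om (n : nat) : R := \sum_(p <- P) (p %| n)%N%:R.
have bo: bdd om by apply: bdd_sum => p; exact: bdd_dvd.
have b0 := re_bdd aPsi_le.
have b1: bdd (fun n => om n*Re (a n*Psi n)) by exact: bddM.
have b2: bdd (fun n => (1-om n/W)^+2).
 have b3: bdd (fun n => 1 + - W^-1*om n) by apply: bddD; [exact: bdd_cst|exact: bddZ].
 have [B hB] := bddM b3 b3; exists B => n; apply: leT (hB n).
 by rewrite expr2 mulNr [W^-1*_]mulrC.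
have s1: Lam (fun n => Re (a n*Psi n)) <= W^-1*Lam (fun n => om n*Re (a n*Psi n))+(eps/4+eps^-1*W^-1).
 apply: (leV (Lam (fun n => W^-1*(om n*Re (a n*Psi n))+(eps/4+eps^-1*(1-om n/W)^+2)))).
  apply: Lam_mono => //.
   by apply: bddD; [exact: bddZ|apply: bddD; [exact: bdd_cst|exact: bddZ]].
  move=> n; have := leT (Re_nm _) (aPsi_le n); move: (Re _) => x x1.
  have ex: x = W^-1*(om n*x)+(1-om n/W)*x by ring.
  rewrite [leLHS]ex lerD2l; apply: leT (ler_norm _) _; rewrite normrM.
  apply: leT (_ : `|1-om n/W| <= _); first by rewrite ler_piMr.
  have e2: 0 < eps/2 by lra.
  have := amgm_abs (1-om n/W) e2.
  have -> : 2*(eps/2) = eps by field.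
  by move: ((1-om n/W)^+2) => z; rewrite [z/eps]mulrC; lra.
 rewrite LD; [|exact: bddZ|by apply: bddD; [exact: bdd_cst|exact: bddZ]].
 rewrite LD; [|exact: bdd_cst|exact: bddZ].
 rewrite Lcst (LZ _ b1) (LZ _ b2) lerD2l lerD2l; apply: leMl; first by rewrite invr_ge0 ltW.
 exact: Lam_tk.
have s2: W^-1*Lam (fun n => om n*Re (a n*Psi n)) = Lam (fun n => Re (a n*Phis P n)).
 have bp p : bdd (fun n => (p %| n)%N%:R*Re (a n*Psi n)) by apply: bddM => //; exact: bdd_dvd.
 have -> : (fun n => om n*Re (a n*Psi n)) = (fun n => \sum_(p <- P) (p %| n)%N%:R*Re (a n*Psi n)).
  by apply: funext => n; rewrite mulr_suml.
 rewrite Lam_sum // mulr_sumr.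
 have bq p : bdd (fun n => Re (a (p*n)%N*Psi (p*n)%N)) by apply: (@re_bdd _ 1) => n; exact: aPsi_le.
 have -> : (fun n => Re (a n*Phis P n)) = (fun n => \sum_(p <- P) (p%:R*W)^-1*Re (a (p*n)%N*Psi (p*n)%N)).
  apply: funext => n; rewrite mulr_sumr Re_sum; apply: eq_bigr => p _; rewrite aM.
  have -> : a n*((p%:R*Ws P)^-1%:C*(a p*Psi (p*n)%N)) = (p%:R*W)^-1%:C*(a p*a n*Psi (p*n)%N).
   by rewrite -/W; ring.
  by case: (_*Psi _) => u v /=; rewrite mul0r subr0.
 rewrite Lam_sum; last by move=> p; exact: bddZ.
 rewrite big_seq [RHS]big_seq; apply: eq_bigr => p /pP pp; rewrite LZ //.
 have -> : (fun n => (p %| n)%N%:R*Re (a n*Psi n)) =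
  (fun n => if (p %| n)%N then (fun m => Re (a (p * m)%N*Psi (p * m)%N)) (n %/ p)%N else 0).
  by apply: funext => n; case: ifP => pn; rewrite ?mul0r // mul1r mulnC divnK.
 by rewrite (Ldil (bq p) (prime_gt0 pp)) invfM; ring.
have s3: eps^-1*W^-1 <= eps/16.
 rewrite ler_pdivrMr ?exprn_gt0 // in hW.
 rewrite -invfM -[leLHS]div1r ler_pdivrMr ?mulr_gt0 //.
 by move: hW; rewrite expr2; lra.
lra.
Qed.
Lemma N2_sum_expand (T : Type) (r : seq T) (F : T -> C) :
 N2 (\sum_(i <- r) F i) = \sum_(i <- r) \sum_(j <- r) Re (F i*cj (F j)).
Proof.
have -> : N2 (\sum_(i <- r) F i) = Re ((\sum_(i <- r) F i)*cj (\sum_(i <- r) F i)) by rewrite N2_mulJ.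
rewrite conj_sum mulr_suml Re_sum; apply: eq_bigr => i _; by rewrite mulr_sumr Re_sum.
Qed.

Lemma Re_mulJC (x y : C) : Re (x*cj y) = Re (y*cj x).
Proof. by case: x => a1 b1; case: y => a2 b2 /=; ring. Qed.

(** All the [Phis (P i)] correlate with the same bounded function [a], so by Cauchy-Schwarz they
    cannot be pairwise almost orthogonal. Using many windows, rather than pairs inside one, lets the
    second prime be far larger than the first. *)
Lemma Phis_pair (P : nat -> seq nat) (K : nat) (eps : R) : 0 < eps ->
 (forall i, uniq (P i)) -> (forall i p, p \in P i -> prime p) ->
 (forall i, (i<K)%N -> 16/eps^+2 <= Ws (P i)) -> 8/eps^+2 <= K%:R ->
 eps <= Lam (fun n => Re (a n*Psi n)) ->
 exists i i', (i<i'<K)%N /\ eps^+2/8 <= Lam (fun n => Re (Phis (P i) n*cj (Phis (P i') n))).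
Proof.
move=> e0 uP pP hW hK he; apply: contrapT => nex.
have W0 i : (i<K)%N -> 0 < Ws (P i) by move=> /hW; apply: lt_le_trans; rewrite divr_gt0 ?exprn_gt0.
have e2: 0 < eps^+2 by rewrite exprn_gt0.
have K0: 0 < K%:R:>R by apply: lt_le_trans hK; rewrite divr_gt0.
pose Ph i n := if (i<K)%N then Phis (P i) n else 0.
have Ph_le i n : nm (Ph i n) <= 1.
 by rewrite /Ph; case: ifP => [/W0 h|_]; [exact: Phis_le|rewrite nm0].
have bP i j : bdd (fun n => Re (Ph i n*cj (Ph j n))).
 by apply: (@re_bdd _ 1) => n; rewrite nmM nmJ; apply: mulr_ile1; rewrite ?nm_ge0.
have bA i : bdd (fun n => Re (a n*Ph i n)).
 by apply: (@re_bdd _ 1) => n; rewrite nmM; apply: mulr_ile1; rewrite ?nm_ge0.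
have m1 i : (i<K)%N -> eps/2 <= Lam (fun n => Re (a n*Ph i n)).
 by move=> iK; rewrite /Ph iK; apply: Phis_mean => //; [exact: pP|exact: hW].
have lo: K%:R*(eps/2) <= Lam (fun n => \sum_[i<K] Re (a n*Ph i n)).
 rewrite Lam_sum //; apply: leT (_ : \sum_[i<K] eps/2 <= _).
  by rewrite big_const_nat iter_addr_0 subn0 -[leRHS]mulr_natl.
 by apply: ler_sum_nat => i /andP[_]; exact: m1.
pose S n := \sum_[i<K] \sum_[j<K] Re (Ph i n*cj (Ph j n)).
have bS: bdd S by do 2!(apply: bdd_sum => ?).
have up: Lam (fun n => \sum_[i<K] Re (a n*Ph i n)) <= K%:R*eps/4+(K%:R*eps)^-1*Lam S.
 rewrite -(LZ _ bS) -[X in _ <= X+_]Lcst -LD; [|exact: bdd_cst|exact: bddZ].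
 apply: Lam_mono; [exact: bdd_sum|by apply: bddD; [exact: bdd_cst|exact: bddZ]|].
 move=> n; rewrite -Re_sum -mulr_sumr; apply: leT (Re_le_nm _) _; rewrite nmM.
 apply: leT (_ : nm (\sum_[i<K] Ph i n) <= _); first by rewrite ler_piMl ?nm_ge0.
 rewrite /S -N2_sum_expand -nm_sqr.
 have d0: 0 < K%:R*eps/2 by rewrite divr_gt0 ?mulr_gt0.
 have := amgm_abs (nm (\sum_[i<K] Ph i n)) d0; rewrite ger0_norm ?nm_ge0 //.
 have -> : 2*(K%:R*eps/2) = K%:R*eps by field.
 have -> : K%:R*eps/2/2 = K%:R*eps/4 by field.
 by rewrite [_/(K%:R*eps)]mulrC.
have offd i j : (i<K)%N -> (j<K)%N -> Lam (fun n => Re (Ph i n*cj (Ph j n))) <= (j == i)%:R+(j != i)%:R*(eps^+2/8).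
 move=> iK jK.
 have lt i1 j1 : (i1<j1<K)%N -> Lam (fun n => Re (Ph i1 n*cj (Ph j1 n))) <= eps^+2/8.
  move=> /andP[ij jK1]; rewrite leNgt; apply/negP => h; apply: nex; exists i1, j1; rewrite ij jK1; split=> //.
  by apply: ltW; move: h; rewrite /Ph jK1 (ltn_trans ij jK1).
 case: (ltngtP i j) => [ij|ji|->].
 - by rewrite mul1r add0r; apply: lt; rewrite ij.
 - rewrite mul1r add0r.
  have -> : (fun n => Re (Ph i n*cj (Ph j n))) = (fun n => Re (Ph j n*cj (Ph i n))).
   by apply: funext => n; rewrite Re_mulJC.
  by apply: lt; rewrite ji.
 - rewrite mul0r addr0; apply: Lam_le_cst => // n; apply: leT (Re_le_nm _) _.
  by rewrite nmM nmJ; apply: mulr_ile1; rewrite ?nm_ge0.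
have LS: Lam S <= K%:R*(1+(K%:R-1)*(eps^+2/8)).
 rewrite /S Lam_sum; last by move=> i; exact: bdd_sum.
 apply: leT (_ : \sum_[i<K] (1+(K%:R-1)*(eps^+2/8)) <= _); last first.
  by rewrite big_const_nat iter_addr_0 subn0 -[leLHS]mulr_natl.
 apply: ler_sum_nat => i /andP[_ iK]; rewrite Lam_sum //.
 apply: (leV (\sum_[j<K] ((j == i)%:R*(1-eps^+2/8)+eps^+2/8))).
  apply: ler_sum_nat => j /andP[_ jK]; apply: leT (offd i j iK jK) _.
  by case: (j == i) => /=; rewrite ?mul1r ?mul0r; lra.
 rewrite big_split /= -mulr_suml.
 have -> : \sum_[j<K] (j == i)%:R = 1:>R.
  rewrite (bigD1_seq i) /= ?mem_index_iota ?iota_uniq // eqxx big1 ?addr0 // => j /negbTE ->; by [].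
 rewrite big_const_nat iter_addr_0 subn0 -[eps^+2/8 *+ K]mulr_natl; lra.
have KE: 0 < K%:R*eps by rewrite mulr_gt0.
have f1: (K%:R*eps)^-1*Lam S <= (K%:R*eps)^-1*(K%:R*(1+(K%:R-1)*(eps^+2/8))).
 by apply: leMl => //; rewrite invr_ge0 ltW.
have f2 := leT lo (leT up (lerD (lexx _) f1)).
have e1: (K%:R*eps)^-1*(K%:R*(1+(K%:R-1)*(eps^+2/8))) = (1+(K%:R-1)*(eps^+2/8))/eps by field; rewrite !gt_eqF.
rewrite e1 in f2.
have f3: K%:R*eps/4 <= (1+(K%:R-1)*(eps^+2/8))/eps by lra.
rewrite ler_pdivlMr // in f3; rewrite ler_pdivrMr // in hK.
move: f3 hK e2; rewrite -[K%:R*eps/4*eps](_ : K%:R*eps^+2/4 = _); last by rewrite expr2; ring.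
have -> : (K%:R-1)*(eps^+2/8) = (K%:R*eps^+2-eps^+2)/8 by ring.
move: (K%:R*eps^+2) (eps^+2) => y x; lra.
Qed.
End Katai.
End MeanMore.

Lemma sum_shift1 (V : nmodType) (F : nat -> V) H s :
 \sum_[h<=H] F (h+s)%N = \sum_(s.+1 <= j < (H+s).+1) F j.
Proof. by rewrite -[s.+1]add1n big_addn -addSn addnK. Qed.

Lemma havg_addc H (F : nat -> R) (b : R) : (0<H)%N ->
 H%:R^-1*\sum_[h<=H] (F h+b) = H%:R^-1*\sum_[h<=H] F h+b.
Proof.
move=> H0; rewrite big_split /= mulrDr; congr (_+_).
rewrite big_const_nat iter_addr_0 subSS subn0 -[b *+ H]mulr_natl mulKf //.
by rewrite pnatr_eq0 -lt0n.
Qed.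

Lemma shift_count (T : nat -> R) H m s : (forall n, 0 <= T n <= 1) ->
 \sum_[h<=H] T (m-s-h)%N <= \sum_[h<=H] T (m-h)%N+s%:R.
Proof.
move=> T01; pose T' j := T (m-j)%N.
have T0 u v : 0 <= \sum_(u <= j < v) T' j by apply: sumr_ge0 => j _; case/andP: (T01 (m-j)%N).
have -> : \sum_[h<=H] T (m-s-h)%N = \sum_(s.+1 <= j < (H+s).+1) T' j.
 by rewrite -(sum_shift1 T'); apply: eq_bigr => i _; rewrite /T' -subnDA addnC.
apply: (leV (\sum_[j<=(H+s)] T' j)).
 rewrite [leRHS](@big_cat_nat _ _ _ s.+1) //=; last by rewrite ltnS leq_addl.
 by rewrite lerDr T0.
rewrite (@big_cat_nat _ _ _ H.+1) //=; last by rewrite ltnS leq_addr.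
rewrite lerD2l; apply: leT (_ : \sum_(H.+1 <= j < (H+s).+1) 1 <= _).
 by apply: ler_sum => j _; case/andP: (T01 (m-j)%N).
by rewrite big_const_nat iter_addr_0 subSS addKn.
Qed.

Lemma sum_shift_diff (T : nat -> C) H k : (bnd1 T) ->
 nm (\sum_[h<=H] T h-\sum_[h<=H] T (h+k)%N) <= 2*k%:R.
Proof.
move=> T1.
have e2: \sum_[h<=H] T (h+k)%N = \sum_(k.+1 <= j < (H+k).+1) T j.
 exact: sum_shift1.
have l1: (k.+1<=(H+k).+1)%N by rewrite ltnS leq_addl.
have l2: (H.+1<=(H+k).+1)%N by rewrite ltnS leq_addr.
have c1: \sum_[j<=(H+k)] T j = \sum_[j<=k] T j+\sum_(k.+1 <= j < (H+k).+1) T j.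
 by rewrite (@big_cat_nat _ _ _ k.+1).
have c2: \sum_[j<=(H+k)] T j = \sum_[j<=H] T j+\sum_(H.+1 <= j < (H+k).+1) T j.
 by rewrite (@big_cat_nat _ _ _ H.+1).
have b1: nm (\sum_[j<=k] T j) <= k%:R.
 apply: leT (nm_sum _ _ _) _; apply: leT (ler_sum _ (fun j _ => T1 j)) _.
 by rewrite big_const_nat iter_addr_0 subSS subn0.
have b2: nm (\sum_(H.+1 <= j < (H+k).+1) T j) <= k%:R.
 apply: leT (nm_sum _ _ _) _; apply: leT (ler_sum _ (fun j _ => T1 j)) _.
 by rewrite big_const_nat iter_addr_0 subSS addKn.
have -> : \sum_[h<=H] T h-\sum_[h<=H] T (h+k)%N = \sum_[j<=k] T j-\sum_(H.+1 <= j < (H+k).+1) T j.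
 rewrite e2; have -> : \sum_[h<=H] T h = \sum_[j<=(H+k)] T j-\sum_(H.+1 <= j < (H+k).+1) T j by rewrite c2 addrK.
 by rewrite c1 addrAC [X in X-_]addrAC subrK || (rewrite c1; ring).
apply: leT (nmB _ _) _; lra.
Qed.

Lemma havg_le H (F : nat -> C) : (0<H)%N -> (bnd1 F) ->
 nm (H%:R^-1%:C*\sum_[h<=H] F h) <= 1.
Proof.
move=> H0 h1; have HR: 0 < H%:R:>R by rewrite ltr0n.
rewrite nmM nm_real ?invr_ge0 // mulrC ler_pdivrMr // mul1r.
apply: leT (nm_sum _ _ _) _; apply: leT (ler_sum _ (fun j _ => h1 j)) _.
by rewrite big_const_nat iter_addr_0 subSS subn0.
Qed.

(** * Correlations of the twisted sums and extraction of frequencies *)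

Section Pair.
Variables (c : nat -> C) (al : nat -> R) (H : nat).
Hypotheses (c1 : bnd1 c) (H0 : (0<H)%N).
Let HR : 0 < H%:R :> RT. Proof. by rewrite ltr0n. Qed.
(** Obtained by moving the shift [h] away from [a]: by shift invariance the mean of [c n] times the
    exponential sum of [a] at [n] equals the mean of [a m * Psi m]. *)
Definition Psi (m : nat) : C := H%:R^-1%:C*\sum_[h<=H] c (m-h)%N*eq_ (h%:R*al (m-h)%N).

Lemma ce_le n x : nm (c n*eq_ x) <= 1. Proof. by rewrite nmM nm_eq mulr1. Qed.

Lemma Psi_le m : nm (Psi m) <= 1.
Proof. by apply: havg_le => // h; exact: ce_le. Qed.

Let Psk m k : C := H%:R^-1%:C*\sum_[h<=H] c (m-h)%N*eq_ ((h+k)%N%:R*al (m-h)%N).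

(** Apart from at most [k] terms at each end, moving the argument by [k] only multiplies each
    summand by [e(k al)]. *)
Lemma Psi_shift m k : nm (Psi (m+k)-Psk m k) <= 2*k%:R/H%:R.
Proof.
pose T j := c (m+k-j)%N*eq_ (j%:R*al (m+k-j)%N).
have -> : Psk m k = H%:R^-1%:C*\sum_[h<=H] T (h+k)%N.
 by congr (_*_); apply: eq_bigr => h _; rewrite /T subnDr.
have HR0: 0 < H%:R:>R by exact: HR.
rewrite -mulrBr nmM nm_real ?invr_ge0 // [leLHS]mulrC ler_pdivrMr // divfK ?gt_eqF //.
by apply: sum_shift_diff => j; exact: ce_le.
Qed.

Variables (rho : R) (K : nat).
Hypotheses (rho0 : 0 < rho) (K0 : (0<K)%N).
Definition near1 (z : R) : bool := `[< exists m : int, `|z-m%:~R| < rho >].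

Lemma near_le z : nm (K%:R^-1%:C*\sum_[k<K] eq_ (k%:R*z)) <= (near1 z)%:R+3/(rho*K%:R).
Proof.
have KR: 0 < K%:R:>R by rewrite ltr0n.
have e3: 0 <= 3/(rho*K%:R) by rewrite divr_ge0 // mulr_ge0 // ltW.
rewrite nmM nm_real ?invr_ge0 // mulrC.
have e1: \sum_[k<K] eq_ (k%:R*z) = dirk K (2*rpi*z).
 by apply: eq_bigr => k _; rewrite /eq_; congr cis; ring.
rewrite e1; have [m hm] := exists_round z; pose u := z-m%:~R.
have [us|us] := ltP `|u| rho.
 have -> : near1 z by apply/asboolP; exists m.
 apply: leT (_ : 1 <= _); last by rewrite lerDl.
 by rewrite ler_pdivrMr // mul1r nm_dirk_le.
apply: leT (_ : 3/(rho*K%:R) <= _); last by rewrite lerDr.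
rewrite invfM mulrA; apply: leMr; first by rewrite invr_ge0.
have u0: u != 0 by rewrite -normr_gt0; apply: lt_le_trans us.
have -> : 2*rpi*z = 2*rpi*u+2*rpi * m%:~R by rewrite /u; ring.
apply: leT (nm_dirk_inv _ _ u0 _) _; first by apply: leT hm _; lra.
apply: leMl => //; rewrite lef_pV2 ?posrE //; by apply: lt_le_trans us.
Qed.

Let ind0 (p q n h h' : nat) : R := [&& c (p*n-h)%N != 0, c (q*n-h')%N != 0 &
  near1 (p%:R*al (p*n-h)%N-q%:R*al (q*n-h')%N)]%:R.
(** As [ind0], with [n] replaced by [floor(x/q)] and [q n] by [x] itself. The frequency [al (x-h')]
    is thereby the same for all [q]. *)
Definition indp (p q x h h' : nat) : bool := [&& c (p*(x %/ q)-h)%N != 0, c (x-h')%N != 0 &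
  near1 (p%:R*al (p*(x %/ q)-h)%N-q%:R*al (x-h')%N)].
Definition corr (p q x : nat) : R := H%:R^-1*\sum_[h<=H] (H%:R^-1*\sum_(1 <= h' < H.+1) (indp p q x h h')%:R).
Let corr0 (p q n : nat) : R := H%:R^-1*\sum_[h<=H] (H%:R^-1*\sum_(1 <= h' < H.+1) ind0 p q n h h').

Lemma havgR_le (F : nat -> R) (B : R) : (forall h, F h <= B) -> H%:R^-1*\sum_[h<=H] F h <= B.
Proof.
have HR0: 0 < H%:R:>R by exact: HR.
move=> h1; rewrite mulrC ler_pdivrMr //; apply: leT (ler_sum _ (fun j _ => h1 j)) _.
by rewrite big_const_nat iter_addr_0 subSS subn0 -[leLHS]mulr_natr.
Qed.

Lemma swap_avg (r : seq nat) (w : nat -> R) (F : nat -> nat -> R) :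
 \sum_(q <- r) w q*(H%:R^-1*\sum_[h<=H] F q h) = \sum_[h<=H] H%:R^-1*\sum_(q <- r) w q*F q h.
Proof.
transitivity (\sum_(q <- r) \sum_[h<=H] H%:R^-1*(w q*F q h)).
 by apply: eq_bigr => q _; rewrite mulrCA !mulr_sumr.
by rewrite exchange_big /=; apply: eq_bigr => h _; rewrite mulr_sumr.
Qed.

Lemma havgR_ge0 (F : nat -> R) : (forall h, 0 <= F h) -> 0 <= H%:R^-1*\sum_[h<=H] F h.
Proof. by move=> h1; rewrite mulr_ge0 ?invr_ge0 //; apply: sumr_ge0. Qed.

(** Averaging over [n+k] with [k < K] gives the pair [(h, h')] a geometric sum in
    [p al(pn-h) - q al(qn-h')] as a factor. It is small unless this number lies within [rho] of an
    integer. *)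
Lemma corr_pointwise p q n :
 nm (K%:R^-1%:C*\sum_[k<K] Psi (p*(n+k))%N*cj (Psi (q*(n+k))%N)) <=
 corr0 p q n+3/(rho*K%:R)+2*(p+q)%:R*K%:R/H%:R.
Proof.
have KR: 0 < K%:R:>R by rewrite ltr0n.
have HR0: 0 < H%:R:>R by exact: HR.
pose x k := Psk (p*n) (p*k); pose y k := Psk (q*n) (q*k).
have x1 k : nm (x k) <= 1 by apply: havg_le => // h; exact: ce_le.
pose E : R := 2*(p+q)%:R*K%:R/H%:R.
have E0: 0 <= E by rewrite divr_ge0 ?mulr_ge0.
have ek k : (k<K)%N -> nm (Psi (p*(n+k))%N*cj (Psi (q*(n+k))%N)-x k*cj (y k)) <= E.
 move=> kK; rewrite !mulnDr.
 have -> : Psi (p*n+p*k)*cj (Psi (q*n+q*k))-x k*cj (y k) =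
   (Psi (p*n+p*k)-x k)*cj (Psi (q*n+q*k))+x k*cj (Psi (q*n+q*k)-y k).
  by rewrite conjB; ring.
 apply: leT (nmD _ _) _; rewrite (nmM (Psi _-_)) (nmM (x k)) !nmJ.
 have d1 := Psi_shift (p*n) (p*k); have d2 := Psi_shift (q*n) (q*k).
 have z1 := ler_pM (nm_ge0 _) (nm_ge0 _) d1 (Psi_le (q*n+q*k)).
 have z2 := ler_pM (nm_ge0 _) (nm_ge0 _) (x1 k) d2.
 apply: leT (lerD z1 z2) _; rewrite mulr1 mul1r /E -mulrDl; apply: leMr; first by rewrite invr_ge0.
 rewrite -mulrDr -!mulrA ler_pM2l // -natrD -natrM ler_nat -mulnDl leq_mul2l (ltnW kK) orbT //.
have main: nm (K%:R^-1%:C*\sum_[k<K] x k*cj (y k)) <= corr0 p q n+3/(rho*K%:R).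
 pose A h := al (p*n-h)%N; pose A' h := al (q*n-h)%N.
 have e: K%:R^-1%:C*\sum_[k<K] x k*cj (y k) =
  H%:R^-1%:C*\sum_[h<=H] H%:R^-1%:C*\sum_(1 <= h' < H.+1)
   (c (p*n-h)%N*cj (c (q*n-h')%N)*eq_ (h%:R*A h-h'%:R*A' h')) *
    (K%:R^-1%:C*\sum_[k<K] eq_ (k%:R*(p%:R*A h-q%:R*A' h'))).
  transitivity (\sum_[k<K] \sum_[h<=H] \sum_(1 <= h' < H.+1)
   H%:R^-1%:C*H%:R^-1%:C*K%:R^-1%:C*(c (p*n-h)%N*cj (c (q*n-h')%N)*eq_ (h%:R*A h-h'%:R*A' h')*eq_ (k%:R*(p%:R*A h-q%:R*A' h')))).
   rewrite mulr_sumr; apply: eq_bigr => k _.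
   rewrite /x /y /Psk conjM conj_real conj_sum.
   have -> : K%:R^-1%:C*(H%:R^-1%:C*(\sum_[h<=H] c (p*n-h)%N*eq_ ((h+p*k)%N%:R*al (p*n-h)%N)) *
     (H%:R^-1%:C*\sum_[h<=H] cj (c (q*n-h)%N*eq_ ((h+q*k)%N%:R*al (q*n-h)%N)))) =
     H%:R^-1%:C*H%:R^-1%:C*K%:R^-1%:C*((\sum_[h<=H] c (p*n-h)%N*eq_ ((h+p*k)%N%:R*al (p*n-h)%N)) *
     \sum_[h<=H] cj (c (q*n-h)%N*eq_ ((h+q*k)%N%:R*al (q*n-h)%N))) by ring.
   rewrite mulr_suml mulr_sumr; apply: eq_bigr => h _; rewrite mulr_sumr mulr_sumr; apply: eq_bigr => h' _.
   congr (_*_); rewrite conjM /eq_ -cisN.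
   have -> : c (p*n-h)%N*cis (2*rpi*((h+p*k)%N%:R*al (p*n-h)%N))*(cj (c (q*n-h')%N)*cis (- (2*rpi*((h'+q*k)%N%:R*al (q*n-h')%N)))) =
    c (p*n-h)%N*cj (c (q*n-h')%N)*(cis (2*rpi*((h+p*k)%N%:R*al (p*n-h)%N))*cis (- (2*rpi*((h'+q*k)%N%:R*al (q*n-h')%N)))) by ring.
   rewrite -[RHS]mulrA -!cisD; congr (_*cis _); rewrite /A /A' !natrD !natrM; ring.
  rewrite exchange_big /= mulr_sumr; apply: eq_bigr => h _; rewrite exchange_big /= mulrA mulr_sumr; apply: eq_bigr => h' _.
  by rewrite !mulr_sumr; apply: eq_bigr => k _; ring.
 have e3: 0 <= 3/(rho*K%:R) by rewrite divr_ge0 // mulr_ge0 // ltW.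
 have avg_nm (F : nat -> C) : nm (H%:R^-1%:C*\sum_[h<=H] F h) <= H%:R^-1*\sum_[h<=H] nm (F h).
  by rewrite nmM nm_real ?invr_ge0 //; apply: leMl; [rewrite invr_ge0|exact: nm_sum].
 rewrite e; apply: leT (avg_nm _) _.
 apply: (leV (H%:R^-1*\sum_[h<=H] (H%:R^-1*\sum_(1 <= h' < H.+1) ind0 p q n h h'+3/(rho*K%:R)))); last first.
  by rewrite havg_addc.
 apply: leMl; first by rewrite invr_ge0.
 apply: ler_sum => h _; apply: leT (avg_nm _) _.
 apply: (leV (H%:R^-1*\sum_(1 <= h' < H.+1) (ind0 p q n h h'+3/(rho*K%:R)))); last first.
  by rewrite havg_addc.
 apply: leMl; first by rewrite invr_ge0.
 apply: ler_sum => h' _; rewrite nmM /ind0.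
 have [c0|cn] := eqVneq (c (p*n-h)%N) 0; first by rewrite c0 !mul0r nm0 mul0r add0r.
 have [c0|cn'] := eqVneq (c (q*n-h')%N) 0.
  by rewrite c0 [cj 0](_ : _ = 0) ?rmorph0 // mulr0 mul0r nm0 mul0r add0r.
 apply: leT (near_le _); rewrite ler_piMl ?nm_ge0 // nmM nm_eq mulr1 nmM nmJ.
 by apply: mulr_ile1; rewrite ?nm_ge0.
have -> : K%:R^-1%:C*\sum_[k<K] Psi (p*(n+k))%N*cj (Psi (q*(n+k))%N) =
  K%:R^-1%:C*(\sum_[k<K] (Psi (p*(n+k))%N*cj (Psi (q*(n+k))%N)-x k*cj (y k)))+K%:R^-1%:C*\sum_[k<K] x k*cj (y k).
 by rewrite -mulrDr -big_split /=; congr (_*_); apply: eq_bigr => k _; rewrite subrK.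
apply: leT (nmD _ _) _; rewrite addrC; apply: lerD => //.
rewrite nmM nm_real ?invr_ge0 // mulrC ler_pdivrMr //.
apply: leT (nm_sum _ _ _) _; apply: leT (_ : \sum_[k<K] E <= _).
 by apply: ler_sum_nat => k /andP[_ kK]; exact: ek.
by rewrite big_const_nat iter_addr_0 subn0 -[leLHS]mulr_natr.
Qed.

(** [q floor(x/q)] falls short of [x] by less than [q], so [shift_count] bounds the change in the
    sum over [h'] by [q]. *)
Lemma corr0_floor p q x : (0<q)%N -> corr0 p q (x %/ q) <= corr p q x+q%:R/H%:R.
Proof.
have HR0: 0 < H%:R:>R by exact: HR.
move=> q0; rewrite /corr /corr0.
apply: (leV (H%:R^-1*\sum_[h<=H] (H%:R^-1*\sum_(1 <= h' < H.+1) (indp p q x h h')%:R+q%:R/H%:R))); last first.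
 by rewrite havg_addc.
apply: leMl; first by rewrite invr_ge0.
apply: ler_sum => h _; rewrite [q%:R/_]mulrC -mulrDr; apply: leMl; first by rewrite invr_ge0.
pose T n : R := [&& c (p*(x %/ q)-h)%N != 0, c n != 0 & near1 (p%:R*al (p*(x %/ q)-h)%N-q%:R*al n)]%:R.
have T01 n : 0 <= T n <= 1 by rewrite /T ler0n lern1 leq_b1.
have := shift_count H x (x %% q) T01 => hc.
have e: (q*(x %/ q) = x-x %% q)%N by rewrite {2}(divn_eq x q) addnK mulnC.
have -> : \sum_(1 <= h' < H.+1) ind0 p q (x %/ q) h h' = \sum_(1 <= h' < H.+1) T (x-x %% q-h')%N.
 by apply: eq_bigr => h' _; rewrite /ind0 /T e.
apply: leT hc _; rewrite lerD2l ler_nat ltnW // ltn_pmod //.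
Qed.

Section Means.
Variable U : set (set nat).
Hypotheses (Uultra : UltraFilter U) (Ucof : forall N0, U (fun N => is_true (N0<=N)%N)).
Local Notation Lam := (Lam U).

Lemma corr01 p q x : 0 <= corr p q x <= 1.
Proof.
apply/andP; split; first by apply: havgR_ge0 => h; apply: havgR_ge0 => h'.
by apply: havgR_le => h; apply: havgR_le => h'; rewrite lern1 leq_b1.
Qed.

Lemma corr0_01 p q x : 0 <= corr0 p q x <= 1.
Proof.
apply/andP; split; first by apply: havgR_ge0 => h; apply: havgR_ge0 => h'; exact: ler0n.
by apply: havgR_le => h; apply: havgR_le => h'; rewrite lern1 leq_b1.
Qed.

Lemma pair_mean p q (u : C) : (0<q)%N -> nm u <= 1 ->
 Lam (fun n => Re (u*(Psi (p*n)%N*cj (Psi (q*n)%N)))) <=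
 Lam (corr p q)+(3/(rho*K%:R)+2*(p+q)%:R*K%:R/H%:R+q%:R/H%:R).
Proof.
move=> q0 u1; have KR: 0 < K%:R:>R by rewrite ltr0n.
pose G n := u*(Psi (p*n)%N*cj (Psi (q*n)%N)).
have G1 n : nm (G n) <= 1.
 rewrite nmM; apply: mulr_ile1; rewrite ?nm_ge0 // nmM nmJ; apply: mulr_ile1; rewrite ?nm_ge0 //; exact: Psi_le.
have bG := re_bdd G1.
have bc: bdd (corr p q) by exact: bdd01 (corr01 p q).
have bc0: bdd (corr0 p q) by exact: bdd01 (corr0_01 p q).
have bGk k : bdd (fun n => Re (G (n+k)%N)) by apply: (@re_bdd _ 1) => n; exact: G1.
have e1: Lam (fun n => Re (G n)) = Lam (fun n => K%:R^-1*\sum_[k<K] Re (G (n+k)%N)).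
 rewrite (LamZ Uultra); last exact: bdd_sum.
 rewrite Lam_sum //; have ek k : Lam (fun n => Re (G (n+k)%N)) = Lam (fun n => Re (G n)) by exact: (Lam_shift Uultra Ucof k bG).
 rewrite (eq_bigr _ (fun k _ => ek k)); move: (Lam (fun n => Re (G n))) => l.
 by rewrite big_const_nat iter_addr_0 subn0 -[l *+ K]mulr_natl mulKf // gt_eqF.
set C1 : R := 3/(rho*K%:R)+2*(p+q)%:R*K%:R/H%:R.
have e2: Lam (fun n => Re (G n)) <= Lam (corr0 p q)+C1.
 rewrite e1 -[X in _ <= _+X](Lam_cst Uultra Ucof C1) -(LamD Uultra) //; last exact: bdd_cst.
 apply: Lam_mono => //.
 - by apply: bddZ; exact: bdd_sum.
 - by apply: bddD => //; exact: bdd_cst.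
 move=> n; rewrite addrA; apply: leT (corr_pointwise p q n).
 have -> : K%:R^-1*\sum_[k<K] Re (G (n+k)%N) = Re (u*(K%:R^-1%:C*\sum_[k<K] Psi (p*(n+k))%N*cj (Psi (q*(n+k))%N))).
  rewrite -Re_sum /G -mulr_sumr mulrCA.
  by case: (u*_) => v1 v2 /=; rewrite mul0r subr0.
 apply: leT (Re_le_nm _) _; rewrite (nmM u) ler_piMl ?nm_ge0 //.
have e3: Lam (corr0 p q) <= Lam (corr p q)+q%:R/H%:R.
 rewrite -(Lam_floor Uultra Ucof bc0 q0) -[X in _ <= _+X](Lam_cst Uultra Ucof (q%:R/H%:R)) -(LamD Uultra) //; last exact: bdd_cst.
 apply: Lam_mono => //.
 - by have [B hB] := bc0; exists B.
 - by apply: bddD => //; exact: bdd_cst.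
 by move=> x; exact: corr0_floor.
apply: leT e2 _; apply: leT (lerD e3 (lexx C1)) _.
by rewrite -addrA (addrC (q%:R/H%:R)).
Qed.
(** Pigeonholing over [x], [p], [h] and [h'], but not over [q], keeps a positive weighted proportion
    of the window [P i'] for one common frequency [A = al (x-h')]. *)
Lemma katai_extract (a : nat -> C) (P : nat -> seq nat) (Kw Pm : nat) (eps : R) :
 (bnd1 a) -> (forall m n, a (m*n)%N = a m*a n) -> 0 < eps ->
 (forall i, uniq (P i)) -> (forall i p, p \in P i -> prime p) ->
 (forall i, (i<Kw)%N -> 16/eps^+2 <= Ws (P i)) -> 8/eps^+2 <= Kw%:R ->
 eps <= Lam (fun n => Re (a n*Psi n)) ->
 (forall i p, (i<Kw)%N -> p \in P i -> (p<=Pm)%N) ->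
 3/(rho*K%:R)+4*Pm%:R*K%:R/H%:R+Pm%:R/H%:R <= eps^+2/16 ->
 exists i i' p0, exists (A : R) (y : nat -> nat), [/\ (i<i'<Kw)%N, p0 \in P i &
  eps^+2/32 <= \sum_(q <- P i') (q%:R*Ws (P i'))^-1 *
   ((c (y q) != 0) && near1 (p0%:R*al (y q)-q%:R*A))%:R].
Proof.
move=> a1 aM e0 uP pP hW hK he hPm herr.
have HR0: 0 < H%:R:>R by exact: HR.
have KR: 0 < K%:R:>R by rewrite ltr0n.
have [i [i' [/andP[ii' iK'] hpair]]] := Phis_pair Uultra Ucof a1 aM Psi_le e0 uP pP hW hK he.
have iK: (i<Kw)%N by exact: ltn_trans ii' iK'.
have e2: 0 < eps^+2 by rewrite exprn_gt0.
have W0 k : (k<Kw)%N -> 0 < Ws (P k) by move=> /hW; apply: lt_le_trans; rewrite divr_gt0.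
have Wi := W0 _ iK; have Wi' := W0 _ iK'.
pose w (k p : nat) : R := (p%:R*Ws (P k))^-1.
have w0 k p : (k<Kw)%N -> 0 <= w k p by move=> /W0 h; rewrite invr_ge0 mulr_ge0 // ltW.
have sw k : (k<Kw)%N -> \sum_(p <- P k) w k p = 1.
 move=> /W0 h; rewrite /w; under eq_bigr => p _ do rewrite invfM.
 by rewrite -mulr_suml mulfV // gt_eqF.
have bcorr p q : bdd (corr p q) by exact: bdd01 (corr01 p q).
have bR p q : bdd (fun n => Re (a p*cj (a q)*(Psi (p*n)%N*cj (Psi (q*n)%N)))).
 apply: (@re_bdd _ 1) => n; rewrite (nmM (a p*_)) (nmM (a p)) nmJ (nmM (Psi _)) nmJ.
 apply: mulr_ile1; rewrite ?mulr_ge0 ?nm_ge0 //; apply: mulr_ile1; rewrite ?nm_ge0 ?Psi_le //.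
have eP: (fun n => Re (Phis a Psi (P i) n*cj (Phis a Psi (P i') n))) =
 (fun n => \sum_(p <- P i) \sum_(q <- P i') (w i p*w i' q)*Re (a p*cj (a q)*(Psi (p*n)%N*cj (Psi (q*n)%N)))).
 apply: funext => n; rewrite /Phis conj_sum mulr_suml Re_sum; apply: eq_bigr => p _.
 rewrite mulr_sumr Re_sum; apply: eq_bigr => q _; rewrite -/(w i p) -/(w i' q) (conjM (w i' q)%:C) (conjM (a q)) conj_real.
 have -> : (w i p)%:C*(a p*Psi (p*n)%N)*((w i' q)%:C*(cj (a q)*cj (Psi (q*n)%N))) =
   (w i p)%:C*((w i' q)%:C*(a p*cj (a q)*(Psi (p*n)%N*cj (Psi (q*n)%N)))) by ring.
 by case: (a p*_*_) => v1 v2 /=; rewrite !mul0r !subr0 mulrA.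
have s1: eps^+2/8 <= Lam (fun x => \sum_(p <- P i) \sum_(q <- P i') (w i p*w i' q)*corr p q x)+eps^+2/16.
 apply: leT hpair _; rewrite eP.
 rewrite (Lam_sum Uultra Ucof); last by move=> p; apply: bdd_sum => q; exact: bddZ.
 rewrite (Lam_sum Uultra Ucof); last by move=> p; apply: bdd_sum => q; exact: bddZ.
 have -> : eps^+2/16 = \sum_(p <- P i) \sum_(q <- P i') (w i p*w i' q)*(eps^+2/16).
  under eq_bigr => p _ do (rewrite -mulr_suml -mulr_sumr sw // mulr1).
  by rewrite -mulr_suml sw // mul1r.
 rewrite -big_split /= big_seq [leRHS]big_seq; apply: ler_sum => p pin.
 rewrite (Lam_sum Uultra Ucof); last by move=> q; exact: bddZ.
 rewrite (Lam_sum Uultra Ucof); last by move=> q; exact: bddZ.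
 rewrite -big_split /= big_seq [leRHS]big_seq; apply: ler_sum => q qin.
 rewrite (LamZ Uultra _ (bR p q)) (LamZ Uultra _ (bcorr p q)) -mulrDr; apply: leMl; first by rewrite mulr_ge0 ?w0.
 have u1: nm (a p*cj (a q)) <= 1 by rewrite nmM nmJ; apply: mulr_ile1; rewrite ?nm_ge0.
 apply: leT (pair_mean p (prime_gt0 (pP _ _ qin)) u1) _; rewrite lerD2l.
 apply: leT herr; have pp := hPm _ _ iK pin; have qq := hPm _ _ iK' qin.
 have ppR: p%:R <= Pm%:R:>R by rewrite ler_nat.
 have qqR: q%:R <= Pm%:R:>R by rewrite ler_nat.
 apply: lerD; last by apply: leMr => //; rewrite invr_ge0.
 rewrite lerD2l; apply: leMr; first by rewrite invr_ge0.
 apply: leMr => //; rewrite natrD; lra.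
have s2: eps^+2/16 <= Lam (fun x => \sum_(p <- P i) \sum_(q <- P i') (w i p*w i' q)*corr p q x) by lra.
have e16: 0 < eps^+2/16 by lra.
have bb: bdd (fun x => \sum_(p <- P i) \sum_(q <- P i') (w i p*w i' q)*corr p q x).
 by apply: bdd_sum => p; apply: bdd_sum => q; exact: bddZ.
have [x hx] := Lam_ge_ex Uultra Ucof bb e16 s2.
pose I p h h' q : R := (indp p q x h h')%:R.
have ex: \sum_(p <- P i) \sum_(q <- P i') (w i p*w i' q)*corr p q x =
 \sum_(p <- P i) w i p*\sum_[h<=H] H%:R^-1*\sum_(1 <= h' < H.+1) H%:R^-1*\sum_(q <- P i') w i' q*I p h h' q.
 apply: eq_bigr => p _; rewrite /corr.
 under eq_bigr => q _ do rewrite -mulrA.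
 rewrite -[LHS]mulr_sumr; congr (_*_).
 by rewrite swap_avg; apply: eq_bigr => h _; rewrite swap_avg.
rewrite ex in hx.
have e32: eps^+2/16/2 = eps^+2/32 by field.
rewrite e32 in hx.
have sH: \sum_[h<=H] H%:R^-1 = 1:>R.
 by rewrite big_const_nat iter_addr_0 subSS subn0 -[LHS]mulr_natl mulfV // gt_eqF.
have wi p : 0 <= w i p by exact: w0.
have Hi (h : nat) : 0 <= H%:R^-1:>R by rewrite invr_ge0.
have pos1: 0 < \sum_(p <- P i) w i p by rewrite sw.
have posH: 0 < \sum_(h <- index_iota 1 H.+1) H%:R^-1:>R by rewrite sH.
have m1 (z : R) : eps^+2/32 <= z -> eps^+2/32*\sum_(p <- P i) w i p <= z by rewrite sw // mulr1.
have mH (z : R) : eps^+2/32 <= z -> eps^+2/32*\sum_(h <- index_iota 1 H.+1) H%:R^-1 <= z by rewrite sH mulr1.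
have [p0 p0i hx1] := exists_ge wi pos1 (m1 _ hx).
have [h hh hx2] := exists_ge Hi posH (mH _ hx1).
have [h' hh' hx3] := exists_ge Hi posH (mH _ hx2).
exists i, i', p0, (al (x-h')%N), (fun q => (p0*(x %/ q)-h)%N); rewrite ii' iK'; split=> //.
apply: leT hx3 _; apply: ler_sum => q _; apply: leMl; first exact: w0.
by rewrite /I ler_nat /indp; case: (c _ != 0) => //=; case: (c _ != 0).
Qed.
End Means.
End Pair.

(** * Major and minor arcs *)

Definition Pw (u r : nat) : seq nat := [seq p <- index_iota (2 ^ u).+1 (2 ^ (u*kap ^ r)).+1 | prime p].

Lemma Pw_uniq u r : uniq (Pw u r). Proof. by rewrite filter_uniq // iota_uniq. Qed.

Lemma mem_Pw u r p : p \in Pw u r -> prime p /\ (2 ^ u<p<=2 ^ (u*kap ^ r))%N.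
Proof. by rewrite mem_filter mem_index_iota ltnS => /andP[-> ->]. Qed.

Lemma Ws_Pw u r : (3<=u)%N -> r%:R/4 <= Ws (Pw u r).
Proof.
move=> u3; rewrite /Ws /Pw big_filter.
elim: r => [|r IH]; first by rewrite mul0r; apply: sumr_ge0 => p _; rewrite invr_ge0.
have k1: (u*kap ^ r<=u*kap ^ r.+1)%N by rewrite leq_mul2l leq_exp2l // leqnSn orbT.
have uk: (u<=u*kap ^ r)%N by rewrite leq_pmulr.
rewrite (@big_cat_nat _ _ _ (2 ^ (u*kap ^ r)).+1) /=; first last.
- by rewrite ltnS leq_exp2l.
- by rewrite ltnS leq_exp2l.
rewrite -[r.+1%:R]natr1 mulrDl; apply: lerD => //.
have m8: (8<=2 ^ (u*kap ^ r))%N by rewrite -[8%N]/(2 ^ 3)%N leq_exp2l // (leqT u3).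
have := mertens_window m8; rewrite -kapE -expnM -mulnA -expnSr; exact: leT.
Qed.

Lemma sum_inv_le u v : (0<u)%N -> (u<=v)%N -> \sum_(u <= j < v) j%:R^-1 <= 1+rln v%:R-rln u%:R:>R.
Proof.
move=> u0.
have h k : \sum_(u <= j < (k+u).+1) j%:R^-1 <= 1+rln (k+u)%:R-rln u%:R:>R.
 elim: k => [|k IH].
  rewrite add0n big_nat1; have : u%:R^-1 <= 1:>R by rewrite invf_le1 ?ltr0n // ler1n.
  lra.
 rewrite addSn big_nat_recr ?(leqT (leq_addl k u)) //=.
 have w0: 0 < (k+u)%:R:>R by rewrite ltr0n addn_gt0 u0 orbT.
 have w1: 0 < (k+u).+1%:R:>R by rewrite ltr0n.
 have h: (k+u).+1%:R^-1 <= rln (k+u).+1%:R-rln (k+u)%:R.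
  rewrite -rlnD //; apply: leT (rln_ge_subV _); last by rewrite divr_gt0.
  have -> : 1-((k+u).+1%:R/(k+u)%:R)^-1 = (k+u).+1%:R^-1:>R.
   by rewrite -[(k+u).+1%:R]natr1; field; rewrite !gt_eqF //; lra.
  exact: lexx.
 apply: leT (lerD IH h) _; lra.
rewrite leq_eqVlt => /orP [/eqP <-|uv]; first by rewrite big_geq //; lra.
case: v uv => // v; rewrite ltnS => uv; have := h (v-u)%N; rewrite subnK // => h2; apply: leT h2 _.
have : rln v%:R <= rln v.+1%:R by apply: rln_le; rewrite ?ltr0n ?(leqT u0) // ler_nat.
lra.
Qed.

(** If all dyadic blocks were sparse, the reciprocal sum would be at most [2 eta] times the sum of
    [1/j] for [u <= j < u kap^r], and that sum is at most [1 + r log kap] with [log kap <= 9]. *)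
Lemma dyad u r (G : seq nat) (eta : R) : (3<=u)%N -> 0 < eta -> {subset G <= Pw u r} ->
 2*eta*(2+9*r%:R) < \sum_(q <- G) q%:R^-1 ->
 exists j, (u<=j)%N /\ (j<u*kap ^ r)%N /\
  eta*(2 ^ j)%:R <= (size [seq q <- G | 2 ^ j < q <= 2*2 ^ j]%N)%:R*rln (2 ^ j)%:R.
Proof.
move=> u3 eta0 GP hG; apply: contrapT => nex.
set v := (u*kap ^ r)%N in nex.
have u0: (0<u)%N by apply: leqT u3.
have uv: (u<=v)%N by rewrite /v leq_pmulr.
have blk q : q \in G -> exists2 j, (u<=j<v)%N & (2 ^ j<q<=2*2 ^ j)%N.
 move=> /GP /mem_Pw [_ /andP[q1 q2]].
 have q0: (1<q)%N by apply: leq_ltn_trans q1; rewrite expn_gt0.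
 have /andP[l1 l2] := up_log_bounds (isT : 1<2)%N q0.
 have l0: (0<up_log 2 q)%N by rewrite up_log_gt0.
 exists (up_log 2 q).-1; last by rewrite l1 -expnS prednK.
 apply/andP; split.
  by rewrite -ltnS prednK // -(@ltn_exp2l 2) // (leqT q1).
 by rewrite -(@ltn_exp2l 2) // (leqT l1).
have l2 := rln2_ge.
have s1: \sum_(q <- G) q%:R^-1 <= \sum_(u <= j < v) \sum_(q <- G | (2 ^ j<q<=2*2 ^ j)%N) q%:R^-1:>R.
 have em j : \sum_(q <- G | (2 ^ j<q<=2*2 ^ j)%N) q%:R^-1 = \sum_(q <- G) (if (2 ^ j<q<=2*2 ^ j)%N then q%:R^-1 else 0):>R by rewrite big_mkcond.
 rewrite (eq_bigr _ (fun j _ => em j)) exchange_big /= big_seq [leRHS]big_seq; apply: ler_sum => q qG; have [j hj hq] := blk q qG.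
 rewrite (bigD1_seq j) /= ?mem_index_iota ?iota_uniq // hq lerDl; apply: sumr_ge0 => i _.
 by case: ifP => // _; rewrite invr_ge0.
have s2: \sum_(u <= j < v) \sum_(q <- G | (2 ^ j<q<=2*2 ^ j)%N) q%:R^-1 <= \sum_(u <= j < v) 2*eta*j%:R^-1.
 apply: ler_sum_nat => j /andP[uj jv]; have j0: (0<j)%N by apply: leqT uj.
 have jR: 0 < j%:R:>R by rewrite ltr0n.
 have J0: 0 < (2 ^ j)%:R:>R by rewrite ltr0n expn_gt0.
 apply: (leV ((size [seq q <- G | 2 ^ j < q <= 2*2 ^ j]%N)%:R/(2 ^ j)%:R)).
  rewrite -sum1_size natr_sum mulr_suml big_filter; apply: ler_sum => q /andP[q1 _].
  have q0: 0 < q%:R:>R by rewrite ltr0n (leq_ltn_trans _ q1).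
  by rewrite div1r lef_pV2 ?posrE // ler_nat ltnW.
 have nb: (size [seq q <- G | 2 ^ j < q <= 2*2 ^ j]%N)%:R*rln (2 ^ j)%:R <= eta*(2 ^ j)%:R.
  by rewrite leNgt; apply/negP => h; apply: nex; exists j; split=> //; split=> //; exact: ltW.
 rewrite rln_2w in nb; rewrite ler_pdivrMr //; set s := (size _)%:R in nb *.
 have s0: 0 <= s:>R by rewrite /s.
 rewrite mulrAC ler_pdivlMr //.
 have : s*(j%:R*(1/2)) <= s*(j%:R*rln 2) by rewrite leMl // leMl // ltW.
 lra.
have s3 := sum_inv_le u0 uv.
have lv: rln v%:R-rln u%:R <= 9*r%:R.
 rewrite /v natrM rlnM ?ltr0n //.
 rewrite addrC addKr natrX rlnX; last by rewrite kapE ltr0n.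
 rewrite mulrC leMr //.
 apply: leT (_ : rln (2^+9) <= _).
  by apply: rln_le; rewrite kapE ?ltr0n // -natrX ler_nat.
 rewrite rlnX //; have := rln2_le; lra.
rewrite -mulr_sumr in s2.
have e2: 0 < 2*eta by lra.
have : 2*eta*\sum_(u <= j < v) j%:R^-1 <= 2*eta*(2+9*r%:R) by rewrite ler_pM2l //; lra.
lra.
Qed.

Section ArcKill.
Variable C : R -> Prop.
Hypothesis cov : forall e : R, 0 < e -> exists n0 : nat, forall n, (n0<=n)%N ->
 exists xs : seq R, (size xs)%:R*rln n%:R <= e*n%:R /\
  forall c, C c -> exists2 x, x \in xs & x <= c <= x+n%:R^-1.

(** Among the classes modulo [p0] of the integers nearly equal to [p0 Aq(q) - q A], one keeps a
    share [1/p0] of the reciprocal sum. There [Aq(q)] is close to [q (A/p0) + i/p0] modulo 1, the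
    shape treated by [equidist_rational], used at the dyadic scale from [dyad]. A rational near
    [A/p0] of denominator [b] yields one near [Aq(q)] of denominator [b p0]. *)
Lemma arc_kill (Pm : nat) (eta0 : R) : (0<Pm)%N -> 0 < eta0 -> exists D : nat, forall H' : nat, (0<H')%N ->
 exists Q0 : nat, forall (u r p0 : nat) (A rho : R) (Aq : nat -> R) (G : seq nat),
 (Q0<=2 ^ u)%N -> (3<=u)%N -> (20<=r)%N -> (0<p0<=Pm)%N -> uniq G -> {subset G <= Pw u r} ->
 (forall q, q \in G -> C (Aq q) /\ exists m : int, `|p0%:R*Aq q-q%:R*A-m%:~R| < rho) ->
 rho*(4*(2 ^ (u*kap ^ r))%:R) <= 1 ->
 eta0*Ws (Pw u r) <= \sum_(q <- G) q%:R^-1 ->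
 exists2 q, q \in G & exists (d : nat) (a : int), (0<d<=D)%N /\ `|Aq q-a%:~R/d%:R| <= H'%:R^-1.
Proof.
move=> Pm0 eta00; have PmR: 0 < Pm%:R:>R by rewrite ltr0n.
pose eta : R := eta0/(100*Pm%:R).
have eta_gt0: 0 < eta by rewrite divr_gt0 // mulr_gt0.
have [B hB] := equidist_rational cov eta_gt0.
exists (B*Pm)%N => H' H'0; have [Q0 hQ0] := hB H' H'0.
exists (maxn Q0 H') => u r p0 A rho Aq G; rewrite geq_max => /andP[Qu Hu] u3 r20 /andP[p00 pPm] uG GP hG hrho hW.
have p0R: 0 < p0%:R:>R by rewrite ltr0n.
have p0R1: 1 <= p0%:R:>R by rewrite ler1n.
have [k hk] : exists k : nat -> int, forall q, q \in G -> `|p0%:R*Aq q-q%:R*A-(k q)%:~R| < rho.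
 have h q : exists m : int, q \in G -> `|p0%:R*Aq q-q%:R*A-m%:~R| < rho.
  by have [/hG [_ [m hm]]|_] := boolP (q \in G); [exists m|exists 0].
 by have [k hk] := choice h; exists k.
pose cl q := `|(k q %% p0%:Z)%Z|%N.
have cllt q : (cl q<p0)%N.
 by rewrite /cl -ltz_nat gez0_abs ?modz_ge0 ?ltz_pmod // eqz_nat -lt0n.
have clE q : k q = (k q %/ p0%:Z)%Z * p0%:Z+(cl q)%:Z.
 by rewrite /cl gez0_abs ?modz_ge0 // ?eqz_nat -?lt0n // -divz_eq.
have s1p: \sum_(i <- iota 0 p0) 1 = p0%:R:>R by rewrite big_const_seq count_predT size_iota iter_addr_0.
have [i ip hi] : exists2 i, i \in iota 0 p0 & (\sum_(q <- G) q%:R^-1)/p0%:R <= \sum_(q <- G | cl q == i) q%:R^-1:>R.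
 apply: (@exists_ge _ (iota 0 p0) (fun=> 1) (fun i => \sum_(q <- G | cl q == i) q%:R^-1)) => //.
  by rewrite s1p.
 rewrite s1p divfK ?gt_eqF //.
 under [leRHS]eq_bigr => j _ do rewrite mul1r big_mkcond.
 rewrite exchange_big /= big_seq [leRHS]big_seq; apply: ler_sum => q qG.
 rewrite (bigD1_seq (cl q)) /= ?mem_iota ?iota_uniq ?add0n ?cllt // eqxx lerDl; apply: sumr_ge0 => j _.
 by case: ifP => // _; rewrite invr_ge0.
pose G1 := [seq q <- G | cl q == i].
have G1P: {subset G1 <= Pw u r} by move=> q; rewrite mem_filter => /andP[_ /GP].
have rR: 20 <= r%:R:>R by rewrite (ler_nat _ 20).
have big: 2*eta*(2+9*r%:R) < \sum_(q <- G1) q%:R^-1.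
 rewrite /G1 big_filter; apply: lt_le_trans hi.
 have h1: eta0*(r%:R/4) <= \sum_(q <- G) q%:R^-1 by apply: leT hW; rewrite ler_pM2l // Ws_Pw.
 have h2: eta0*(r%:R/4)/Pm%:R <= (\sum_(q <- G) q%:R^-1)/p0%:R.
  apply: ler_pM => //; [apply: mulr_ge0; [exact: ltW|exact: divr_ge0]|by rewrite invr_ge0|].
  by rewrite lef_pV2 ?posrE // ler_nat.
 apply: lt_le_trans h2; rewrite /eta.
 have -> : 2*(eta0/(100*Pm%:R))*(2+9*r%:R) = eta0/Pm%:R*((2+9*r%:R)/50) by field; rewrite gt_eqF.
 have -> : eta0*(r%:R/4)/Pm%:R = eta0/Pm%:R*(r%:R/4) by field; rewrite gt_eqF.
 rewrite ltr_pM2l ?divr_gt0 //; lra.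
have [j [uj [jv hj]]] := dyad u3 eta_gt0 G1P big.
pose G2 := [seq q <- G1 | 2 ^ j < q <= 2*2 ^ j]%N.
have uG2: uniq G2 by rewrite !filter_uniq.
have Qj: (Q0<=2 ^ j)%N by apply: leqT Qu _; rewrite leq_exp2l.
have QR: 0 < (2 ^ j)%:R:>R by rewrite ltr0n expn_gt0.
have G2P q : q \in G2 -> [/\ q \in G, cl q = i & (2 ^ j<q<=2*2 ^ j)%N].
 by rewrite mem_filter => /andP[hq]; rewrite mem_filter => /andP[/eqP].
pose k' q := (k q %/ p0%:Z)%Z.
have cl2 q : q \in G2 -> `|Aq q-q%:R*(A/p0%:R)-i%:R/p0%:R-(k' q)%:~R| <= (4*(2 ^ j)%:R)^-1.
 move=> /G2P [qG ci qj].
 have -> : Aq q-q%:R*(A/p0%:R)-i%:R/p0%:R-(k' q)%:~R = (p0%:R*Aq q-q%:R*A-(k q)%:~R)/p0%:R.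
  by rewrite (clE q) ci intrD intrM -/(k' q) -!pmulrn; field; rewrite gt_eqF.
 rewrite normrM normfV [`|p0%:R|]ger0_norm // ler_pdivrMr //.
 apply: leT (ltW (hk q qG)) _; apply: (leV ((4*(2 ^ j)%:R)^-1)); last by rewrite ler_peMr // invr_ge0 mulr_ge0.
 rewrite -[leRHS]div1r ler_pdivlMr ?mulr_gt0 //; apply: leT hrho; apply: leMl.
  by apply: leT (ltW (hk q qG)).
 by rewrite ler_pM2l // ler_nat leq_exp2l // ltnW.
have [|b [a [/andP[b0 bB] hab]]] := hQ0 (2 ^ j)%N G2 (A/p0%:R) (i%:R/p0%:R) Aq k' Qj uG2 _ hj.
 move=> q qG2; have [qG ci qj] := G2P q qG2; split=> //; first by have [] := mem_Pw (GP _ qG).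
 - by have [] := hG q qG.
 - exact: cl2.
have [q qG2] : exists q, q \in G2.
 have : 0 < (size G2)%:R:>R.
  rewrite lt_neqAle ler0n andbT eq_sym; apply/negP => /eqP e0; move: hj; rewrite -/G2 e0 mul0r.
  by rewrite leNgt mulr_gt0.
 by rewrite ltr0n; case: (G2) => // q s _; exists q; rewrite mem_head.
have [qG ci /andP[qj1 qj2]] := G2P q qG2.
exists q => //; exists (b * p0)%N, (q%:Z*a * p0%:Z + i%:Z*b%:Z+k' q*b%:Z * p0%:Z).
rewrite muln_gt0 b0 p00 leq_mul //; split=> //.
have bR: 0 < b%:R:>R by rewrite ltr0n.
have HR: 0 < H'%:R:>R by rewrite ltr0n.
have e: Aq q-(q%:Z*a * p0%:Z + i%:Z*b%:Z+k' q*b%:Z * p0%:Z)%:~R/(b * p0)%N%:R =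
 (Aq q-q%:R*(A/p0%:R)-i%:R/p0%:R-(k' q)%:~R)+q%:R*(A/p0%:R-a%:~R/b%:R).
 by rewrite !intrD !intrM -!pmulrn natrM; field; rewrite !gt_eqF.
rewrite e; apply: leT (ler_normD _ _) _.
have t1 := cl2 q qG2.
have t2: `|q%:R*(A/p0%:R-a%:~R/b%:R)| <= (2*H'%:R)^-1.
 rewrite normrM ger0_norm //; apply: leT (leMl _ hab) _ => //.
 have -> : (2*H'%:R)^-1 = 2*(2 ^ j)%:R*(4*H'%:R*(2 ^ j)%:R)^-1:>R by field; rewrite !gt_eqF.
 apply: leMr; first by rewrite invr_ge0 !mulr_ge0.
 by rewrite -natrM ler_nat.
have t3: (4*(2 ^ j)%:R)^-1 <= (2*H'%:R)^-1:>R.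
 rewrite lef_pV2 ?posrE ?mulr_gt0 //.
 by apply: ler_pM => //; rewrite ler_nat // (leqT Hu) // leq_exp2l.
have t4: (2*H'%:R)^-1+(2*H'%:R)^-1 = H'%:R^-1:>R by field; rewrite gt_eqF.
by rewrite -t4; apply: lerD t2; exact: leT t1 t3.
Qed.
End ArcKill.

Lemma Re_realM (x : R) (z : C) : Re (x%:C*z) = x*Re z.
Proof. by case: z => u v /=; rewrite mul0r subr0. Qed.

Definition Sn (a : nat -> C) (H n : nat) (x : R) : C :=
 H%:R^-1%:C*\sum_[h<=H] a (n+h)%N*eq_ (h%:R*x).

Lemma eq_lip x y : nm (eq_ x-eq_ y) <= 8*`|x-y|.
Proof.
apply: leT (cis_lip _ _) _; rewrite -mulrBr normrM; apply: leMr => //.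
have p4 := rpi_le4; have p0 := rpi_gt0; rewrite ger0_norm; lra.
Qed.

Lemma avg_nm_le H (F : nat -> C) (B : R) : (0<H)%N -> (forall k, (1<=k<=H)%N -> nm (F k) <= B) ->
 nm (H%:R^-1%:C*\sum_[k<=H] F k) <= B.
Proof.
move=> H0 h; have HR: 0 < H%:R:>R by rewrite ltr0n.
rewrite nmM nm_real ?invr_ge0 // mulrC ler_pdivrMr //; apply: leT (nm_sum _ _ _) _.
apply: leT (_ : \sum_[k<=H] B <= _); first by apply: ler_sum_nat => k; rewrite ltnS; exact: h.
by rewrite big_const_nat iter_addr_0 subSS subn0 -[leLHS]mulr_natr.
Qed.

Lemma untwist (z z' z1 z2 z3 z4 : C) : z*z' = 1 -> z4*(z1*z2) = z1*(z4*(z2-z3))+z1*z'*(z4*(z*z3)).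
Proof.
move=> uu.
have -> : z1*(z4*(z2-z3))+z1*z'*(z4*(z*z3)) = z1*(z4*(z2-z3))+z1*(z4*z3)*(z*z') by ring.
by rewrite uu; ring.
Qed.

Lemma err_bound1 (rho k e : R) : 0 < rho -> 0 < k -> 0 < e -> 96/(rho*e) <= k -> 3/(rho*k) <= e/32.
Proof.
move=> r0 k0 e0; rewrite ler_pdivrMr ?mulr_gt0 // => h; rewrite ler_pdivrMr ?mulr_gt0 //.
have -> : e/32*(rho*k) = k*(rho*e)/32 by ring.
lra.
Qed.

Lemma err_bound2 (p k e h : R) : 0 < e -> 0 < h -> p <= p*k -> 32*(5 * p*k)/e <= h -> 4 * p*k/h+p/h <= e/32.
Proof.
move=> e0 h0 pk; rewrite ler_pdivrMr // => hk; rewrite -mulrDl ler_pdivrMr //.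
have -> : e/32*h = h*e/32 by ring.
rewrite -[5 * p*k]mulrA in hk; rewrite -[4 * p*k]mulrA; lra.
Qed.

Lemma split_weight (e k d : R) : 0 < k -> 0 < d -> e/8/(k*d*d)*d*d <= e/8/k.
Proof.
move=> k0 d0; have -> // : e/8/(k*d*d)*d*d = e/8/k.
by field; rewrite !gt_eqF.
Qed.

(** * Reduction of a major arc to a rational frequency *)

Section Major.
Variable a : nat -> C.
Hypothesis a_le : bnd1 a.

Definition rat_tw (d r : nat) (m : nat) : C := a m*eq_ (m%:R*r%:R/d%:R).

(** The sum is averaged over inner blocks of length [H2], on which [e(k x)] may be replaced by
    [e(k r/d)] at cost [O(H2/H')]. For integers [k] only the residue of [r] modulo [d] matters, so
    finitely many twists are involved. *)
Lemma major_point H H2 n (x : R) d (r : int) (H' : nat) : (0<H)%N -> (0<H2)%N -> (0<H')%N -> (0<d)%N ->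
 `|x-r%:~R/d%:R| <= H'%:R^-1 ->
 nm (Sn a H n x) <= H%:R^-1*\sum_[h<=H] nm (savg (rat_tw d `|(r %% d%:Z)%Z|%N) H2 (n+h)%N) +
  (2*H2%:R/H%:R+8*H2%:R/H'%:R).
Proof.
move=> H0 H20 H'0 d0 hx.
have HR: 0 < H%:R:>R by rewrite ltr0n.
have H2R: 0 < H2%:R:>R by rewrite ltr0n.
have dR: d%:R != 0:>R by rewrite pnatr_eq0 -lt0n.
pose T j := a (n+j)%N*eq_ (j%:R*x).
have T1 j : nm (T j) <= 1 by rewrite nmM nm_eq mulr1.
pose S2 := H2%:R^-1%:C*\sum_[k<=H2] (H%:R^-1%:C*\sum_[h<=H] T (h+k)%N).
have cst (z : C) : H2%:R^-1%:C*\sum_[k<=H2] z = z.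
 rewrite big_const_nat iter_addr_0 subSS subn0 -[z *+ H2]mulr_natl mulrA.
 have -> : H2%:R^-1%:C*H2%:R = 1 :> C.
  have -> : H2%:R = H2%:R%:C :> C by rewrite -(rmorph_nat (real_complex RT)).
  by rewrite -rmorphM /= mulVf ?gt_eqF.
 by rewrite mul1r.
have d1: nm (Sn a H n x-S2) <= 2*H2%:R/H%:R.
 rewrite -{1}(cst (Sn a H n x)) /S2 -mulrBr -sumrB; apply: avg_nm_le => // k /andP[_ kH].
 rewrite /Sn -mulrBr nmM nm_real ?invr_ge0 // [leLHS]mulrC; apply: leMr; first by rewrite invr_ge0.
 apply: leT (sum_shift_diff H k T1) _; by rewrite ler_pM2l // ler_nat.
have e2: S2 = H%:R^-1%:C*\sum_[h<=H] (H2%:R^-1%:C*\sum_[k<=H2] T (h+k)%N).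
 rewrite /S2 mulr_sumr.
 under eq_bigr => k _ do rewrite mulr_sumr mulr_sumr.
 rewrite exchange_big /= mulr_sumr; apply: eq_bigr => h _; rewrite mulr_sumr mulr_sumr.
 by apply: eq_bigr => k _; rewrite mulrCA.
pose r' := `|(r %% d%:Z)%Z|%N.
have rE: r = (r %/ d%:Z)%Z*d%:Z+r'%:Z.
 by rewrite /r' gez0_abs ?modz_ge0 // ?eqz_nat -?lt0n // -divz_eq.
have d2 h : nm (H2%:R^-1%:C*\sum_[k<=H2] T (h+k)%N) <= nm (savg (rat_tw d r') H2 (n+h)%N)+8*H2%:R/H'%:R.
 have -> : H2%:R^-1%:C*\sum_[k<=H2] T (h+k)%N =
  H2%:R^-1%:C*\sum_[k<=H2] (eq_ (h%:R*x)*(a (n+h+k)%N*(eq_ (k%:R*x)-eq_ (k%:R*(r%:~R/d%:R))))) +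
  eq_ (h%:R*x)*cj (eq_ ((n+h)%N%:R*r'%:R/d%:R))*savg (rat_tw d r') H2 (n+h)%N.
  have -> : eq_ (h%:R*x)*cj (eq_ ((n+h)%N%:R*r'%:R/d%:R))*savg (rat_tw d r') H2 (n+h)%N =
    H2%:R^-1%:C*\sum_[k<=H2] eq_ (h%:R*x)*cj (eq_ ((n+h)%N%:R*r'%:R/d%:R))*rat_tw d r' (n+h+k)%N.
   by rewrite /savg [LHS]mulrCA; congr (_*_); rewrite mulr_sumr.
  rewrite -[RHS]mulrDr -big_split /=; congr (_*_); apply: eq_bigr => k _.
  rewrite /T /rat_tw addnA.
  have -> : eq_ ((n+h+k)%N%:R*r'%:R/d%:R) = eq_ ((n+h)%N%:R*r'%:R/d%:R)*eq_ (k%:R*(r%:~R/d%:R)).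
   rewrite -eq_D; have -> : (n+h)%N%:R*r'%:R/d%:R+k%:R*(r%:~R/d%:R) = (n+h+k)%N%:R*r'%:R/d%:R+(k%:Z*(r %/ d%:Z)%Z)%:~R:>R.
    by rewrite {1}rE !intrD !intrM -!pmulrn !natrD; field.
   by rewrite eq_D eq_int mulr1.
  have -> : eq_ ((h+k)%N%:R*x) = eq_ (h%:R*x)*eq_ (k%:R*x) by rewrite -eq_D natrD mulrDl.
  have uu: eq_ ((n+h)%N%:R*r'%:R/d%:R)*cj (eq_ ((n+h)%N%:R*r'%:R/d%:R)) = 1 by exact: cis_mulJ.
  exact: untwist uu.
 apply: leT (nmD _ _) _; rewrite addrC; apply: lerD.
  by rewrite !nmM nmJ !nm_eq !mul1r.
 apply: avg_nm_le => // k /andP[_ kH]; rewrite nmM nm_eq mul1r nmM.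
 apply: leT (_ : 1*nm (eq_ (k%:R*x)-eq_ (k%:R*(r%:~R/d%:R))) <= _); first by rewrite leMr ?nm_ge0.
 rewrite mul1r; apply: leT (eq_lip _ _) _; rewrite -mulrA ler_pM2l // -mulrBr normrM ger0_norm //.
 by apply: ler_pM => //; rewrite ler_nat.
have d3: nm S2 <= H%:R^-1*\sum_[h<=H] nm (savg (rat_tw d r') H2 (n+h)%N)+8*H2%:R/H'%:R.
 rewrite -havg_addc // e2 nmM nm_real ?invr_ge0 //; apply: leMl; first by rewrite invr_ge0.
 by apply: leT (nm_sum _ _ _) _; apply: ler_sum => h _; exact: d2.
have -> : Sn a H n x = (Sn a H n x-S2)+S2 by rewrite subrK.
apply: leT (nmD _ _) _; lra.
Qed.
End Major.

Lemma fin_max (P : nat -> nat -> Prop) : (forall i, exists h, forall H, (h<=H)%N -> P i H) ->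
 forall n, exists h, forall H, (h<=H)%N -> forall i, (i<n)%N -> P i H.
Proof.
move=> hP; elim=> [|n [h IH]]; first by exists 0%N.
have [h2 IH2] := hP n; exists (maxn h h2) => H; rewrite geq_max => /andP[h1 h3] i.
by rewrite ltnS leq_eqVlt => /orP [/eqP ->|]; [exact: IH2|exact: IH].
Qed.

Definition ultra_cof (U : set (set nat)) := UltraFilter U /\ forall N0, U (fun N => is_true (N0<=N)%N).

Lemma log_small_Lam (F : nat -> nat -> R) (d : R) : (forall H, bdd (F H)) -> log_small F -> 0 < d ->
 exists h, forall H, (h<=H)%N -> forall U, ultra_cof U -> Lam U (F H) <= d.
Proof.
move=> bF hF d0; have [h hh] := hF d d0; exists h => H /hh [N0 hN0] U [Uu Uc].
apply: (Lam_le Uu Uc (N0 := maxn N0 1)) => // N; rewrite geq_max => /andP[/hN0 h1 N1].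
rewrite /lavg ler_pdivrMr ?harm_gt0 //; apply: leT h1 _; rewrite ler_pM2l //.
apply: leT (harmonic_ge N); apply: rln_le; rewrite ?ltr0n // ler_nat //.
Qed.

Section Main.
Variables (Cs : R -> Prop) (a : nat -> C).
Hypothesis cov : forall e : R, 0 < e -> exists n0 : nat, forall n, (n0<=n)%N ->
 exists xs : seq R, (size xs)%:R*rln n%:R <= e*n%:R /\
  forall c, Cs c -> exists2 x, x \in xs & x <= c <= x+n%:R^-1.
Hypotheses (a0 : a 0%N = 0) (a1 : forall n, (0<n)%N -> N2 (a n) = 1).
Hypotheses (aM : forall m n, (0<m)%N -> (0<n)%N -> a (m*n)%N = a m*a n) (unp : forall q chi, dchar q chi -> forall M : R, exists N0, forall N, (N0<=N)%N ->
 forall t : R, `|t| <= 2*N%:R ->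
  M <= \sum_(1 <= p < N.+1 | prime p) (1-Re (a p*chi p*npw p t))/p%:R).

Let a_le n : nm (a n) <= 1.
Proof. by case: n => [|n]; [rewrite a0 nm0|apply: N2_nm; rewrite a1]. Qed.

Let aM' m n : a (m*n)%N = a m*a n.
Proof.
case: m => [|m]; first by rewrite mul0n a0 mul0r.
by case: n => [|n]; [rewrite muln0 a0 mulr0|exact: aM].
Qed.

Lemma Sn_le H n x : (0<H)%N -> nm (Sn a H n x) <= 1.
Proof. by move=> H0; apply: havg_le => // h; rewrite nmM nm_eq mulr1. Qed.

Lemma savg_rat_le b r H n : nm (savg (rat_tw a b r) H n) <= 1.
Proof.
case: (posnP H) => [->|H0].
 by rewrite /savg invr0 mul0r nm0.
by apply: havg_le => // k; rewrite nmM nm_eq mulr1.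
Qed.

Lemma rat_Lam D (d : R) : 0 < d -> exists h, forall H, (h<=H)%N -> forall U, ultra_cof U ->
 forall b r, (0<b)%N -> (b<D)%N -> (r<D)%N -> Lam U (fun n => nm (savg (rat_tw a b r) H n)) <= d.
Proof.
move=> d0.
have h1 b r : exists h, forall H, (h<=H)%N -> forall U, ultra_cof U -> (0<b)%N -> Lam U (fun n => nm (savg (rat_tw a b r) H n)) <= d.
 have [b0|b0] := posnP b; first by exists 0%N => H _ U _; rewrite b0.
 have bF H : bdd (fun n => nm (savg (rat_tw a b r) H n)).
  by exists 1 => n; rewrite ger0_norm ?nm_ge0 //; exact: savg_rat_le.
 have [h hh] := log_small_Lam bF (rational_small a0 a1 aM unp r b0) d0.
 by exists h => H hH U hU _; exact: hh.
have h2 b := fin_max (h1 b) D; have [h hh] := fin_max h2 D.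
by exists h => H hH U hU b r b0 bD rD; exact: hh.
Qed.

Definition arc (D H' : nat) (x : R) := exists (d : nat) (r : int), (0<d<=D)%N /\ `|x-r%:~R/d%:R| <= H'%:R^-1.

(* For each bound [Pm] on the small primes: the denominators [D], the width [1/H'] of the arcs, the
   length [H''] at which the rational twists cancel, and the threshold [Q0] for the large primes. *)
Definition arc_data (eps eta0 : R) (Kw Pm : nat) (x : nat*nat*nat*nat) :=
 let: (D, H', H'', Q0) := x in
 [/\ (0<H')%N, (0<H'')%N, 8*H''%:R/H'%:R <= eps/8,
  (forall U, ultra_cof U -> forall b r, (0<b)%N -> (b<D.+1)%N -> (r<D.+1)%N ->
   Lam U (fun n => nm (savg (rat_tw a b r) H'' n))*(Kw*D.+1*D.+1)%:R <= eps/8) &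
  forall (u r p0 : nat) (A rho : R) (Aq : nat -> R) (G : seq nat),
   (Q0<=2 ^ u)%N -> (3<=u)%N -> (20<=r)%N -> (0<p0<=Pm)%N -> uniq G -> {subset G <= Pw u r} ->
   (forall q, q \in G -> Cs (Aq q) /\ exists m : int, `|p0%:R*Aq q-q%:R*A-m%:~R| < rho) ->
   rho*(4*(2 ^ (u*kap ^ r))%:R) <= 1 ->
   eta0*Ws (Pw u r) <= \sum_(q <- G) q%:R^-1 ->
   exists2 q, q \in G & arc D H' (Aq q)].

Lemma arc_data_ex (eps eta0 : R) Kw Pm : 0 < eps -> 0 < eta0 -> (0<Kw)%N -> exists x, (0<Pm)%N -> arc_data eps eta0 Kw Pm x.
Proof.
move=> e0 eta00 Kw0; have [->|Pm0] := posnP Pm; first by exists (0, 0, 0, 0)%N.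
have [D hD] := arc_kill cov Pm0 eta00.
have KR: 0 < (Kw*D.+1*D.+1)%:R:>R by rewrite ltr0n !muln_gt0 Kw0.
have e1: 0 < eps/8/(Kw*D.+1*D.+1)%:R by rewrite !divr_gt0.
have [h hh] := rat_Lam D.+1 e1; pose H'' := maxn h 1.
pose m := (Num.truncn (64/eps)).+1; pose H' := (H'' * m)%N.
have H''0: (0<H'')%N by rewrite leq_max orbT.
have H'0: (0<H')%N by rewrite muln_gt0 H''0.
have [Q0 hQ0] := hD H' H'0; exists (D, H', H'', Q0) => _; split=> //.
- have mR: 64/eps <= m%:R.
  by have /andP[_ /ltW] := truncn_itv (ltW (divr_gt0 (ltr0n _ 64) e0)).
 have mR0: 0 < m%:R:>R by rewrite ltr0n.
 have -> : 8*H''%:R/H'%:R = 8/m%:R:>R by rewrite /H' natrM; field; rewrite !gt_eqF ?ltr0n.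
 rewrite ler_pdivrMr // in mR; rewrite ler_pdivrMr //; lra.
- move=> U hU b r b0 bD rD; rewrite -ler_pdivlMr //.
 by apply: hh => //; rewrite leq_maxl.
Qed.

(** The arcs must be fixed before it is known which window the small prime comes from. So [inM] is
    the union of the arcs of all [Kw] windows, and the coefficients [c] vanish on it; a contribution
    of the remaining [n] above [eps/4] would produce some [q] with [c (y q) <> 0] but [al (y q)] in
    an arc. The bound is uniform in [U] and [al], which are chosen only after [H]. *)
Theorem main_C (eps : R) : 0 < eps -> exists H0, forall H, (H0<=H)%N -> forall U, ultra_cof U ->
 forall al : nat -> R, (forall n, Cs (al n)) -> Lam U (fun n => nm (Sn a H n (al n))) <= eps.
Proof.
move=> eps0; pose e1 : R := eps/4; have e10: 0 < e1 by rewrite /e1; lra.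
pose eta0 : R := e1^+2/32; have e2: 0 < e1^+2 by rewrite exprn_gt0.
have eta00: 0 < eta0 by rewrite divr_gt0.
have [r0 hr0] := nat_above (64/e1^+2); pose r := maxn r0 20.
have r20: (20<=r)%N by rewrite leq_maxr.
have hr: 64/e1^+2 <= r%:R by apply: leT hr0 _; rewrite ler_nat leq_maxl.
have [Kw0 hKw0] := nat_above (8/e1^+2); pose Kw := Kw0.+1.
have hKw: 8/e1^+2 <= Kw%:R by apply: leT hKw0 _; rewrite ler_nat leqnSn.
have [dat hdat] := choice (fun Pm => @arc_data_ex eps eta0 Kw Pm eps0 eta00 (ltn0Sn Kw0)).
pose Pmx u := (2 ^ (u*kap ^ r))%N.
(* Adding the threshold [Q0] that belongs to small primes up to [Pmx (us i')] ensures [Q0 <= 2^u]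
   for every later window. *)
pose fix us (i : nat) : nat := if i is i'.+1 then (us i'+(dat (Pmx (us i'))).2)%N else 3.
have us3 i : (3<=us i)%N by elim: i => //= i IH; apply: leqT IH (leq_addr _ _).
have usm i j : (i<=j)%N -> (us i<=us j)%N.
 by move=> /subnK <-; elim: (j-i)%N => // k IH; rewrite addSn /=; exact: leqT IH (leq_addr _ _).
pose P i := Pw (us i) r; pose Pm := Pmx (us Kw).
pose DD i := dat (Pmx (us i)).
have Pmx0 u : (0<Pmx u)%N by rewrite expn_gt0.
have PmR: 0 < Pm%:R:>R by rewrite ltr0n; exact: Pmx0.
(* The accuracy [1/(4Q)] of [equidist_rational], for every scale [Q] up to the largest prime
   considered. *)
pose rho : R := (4*Pm%:R)^-1; have rho0: 0 < rho by rewrite invr_gt0 mulr_gt0.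
have [K1 hK1] := nat_above (96/(rho*e1^+2)); pose K' := K1.+1.
have K'0: (0<K')%N by [].
have K'R: 0 < K'%:R:>R by rewrite ltr0n.
have [h1 hh1] := nat_above (32*(5*Pm%:R*K'%:R)/e1^+2).
pose H2 i := (DD i).1.2.
have [h2 hh2] := nat_above (16*(\sum_[i<Kw] H2 i)%N%:R/eps).
exists (maxn (maxn h1 h2) 1) => H; rewrite !geq_max => /andP[/andP[Hh1 Hh2] H0] U hU al hal.
have [Uu Uc] := hU.
have HR: 0 < H%:R:>R by rewrite ltr0n.
pose D i := (DD i).1.1.1; pose H' i := (DD i).1.1.2.
have DDE i : DD i = (D i, H' i, H2 i, (DD i).2) by rewrite /D /H' /H2; case: (DD i) => [[[]]].
have hdd i : arc_data eps eta0 Kw (Pmx (us i)) (D i, H' i, H2 i, (DD i).2).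
 by rewrite -DDE; apply: hdat; exact: Pmx0.
pose inM x := exists2 i, (i<Kw)%N & arc (D i) (H' i) x.
pose M n : bool := `[< inM (al n) >].
pose c n : C := if M n then 0 else (if Sn a H n (al n) == 0 then 0 else cj (Sn a H n (al n))/(nm (Sn a H n (al n)))%:C).
have c1 n : nm (c n) <= 1.
 rewrite /c; case: ifP => _; first by rewrite nm0.
 case: eqP => [_|/eqP z0]; first by rewrite nm0.
 have n0: nm (Sn a H n (al n)) != 0 by apply/negP => /eqP /nm_eq0 h; rewrite h eqxx in z0.
 rewrite nmM nmJ nm_inv ?nm_real ?nm_ge0 // ?mulfV //.
 by apply/negP => /eqP [h]; rewrite h eqxx in n0.
have cS n : Re (c n*Sn a H n (al n)) = if M n then 0 else nm (Sn a H n (al n)).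
 rewrite /c; case: ifP => _; first by rewrite mul0r.
 case: eqP => [->|/eqP z0]; first by rewrite mul0r nm0.
 have n0: nm (Sn a H n (al n)) != 0 by apply/negP => /eqP /nm_eq0 h; rewrite h eqxx in z0.
 set z := Sn a H n (al n) in n0 *.
 have -> : cj z/(nm z)%:C*z = (nm z)%:C.
  have n0': (nm z)%:C != 0 by apply/negP => /eqP [h]; rewrite h eqxx in n0.
  by rewrite mulrAC [cj z*z]mulrC N2_mulJ -nm_sqr expr2 realCM mulfK.
 by [].
pose F n := nm (Sn a H n (al n)).
pose F1 n := Re (c n*Sn a H n (al n)).
pose Fm n := if M n then F n else 0.
have F01 n : 0 <= F n <= 1 by rewrite nm_ge0 Sn_le.
have bF1: bdd F1 by apply: (@re_bdd _ 1) => n; rewrite nmM; apply: mulr_ile1; rewrite ?nm_ge0 ?Sn_le.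
have bFm: bdd Fm by apply: (@bdd01 _ 1) => n; rewrite /Fm; case: ifP => // _; rewrite lexx ler01.
have FE: (fun n => nm (Sn a H n (al n))) = (fun n => F1 n+Fm n).
 by apply: funext => n; rewrite /F1 cS /Fm; case: ifP => _; rewrite ?add0r ?addr0.
rewrite FE (LamD Uu) //.
have partA: Lam U F1 <= e1.
 rewrite leNgt; apply/negP => /ltW hF1.
 have hmean: e1 <= Lam U (fun n => Re (a n*Psi c al H n)).
  apply: leT hF1 _; pose G h m := Re (a m*(c (m-h)%N*eq_ (h%:R*al (m-h)%N))).
  have bG h : bdd (G h) by apply: (@re_bdd _ 1) => m; rewrite !nmM nm_eq mulr1; apply: mulr_ile1; rewrite ?nm_ge0.
  have e3: F1 = (fun n => H%:R^-1*\sum_[h<=H] G h (n+h)%N).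
   apply: funext => n; rewrite /F1 /Sn mulrCA mulr_sumr.
   rewrite Re_realM Re_sum; congr (_*_); apply: eq_bigr => h _; rewrite /G addnK; congr Re; ring.
  have e4: (fun n => Re (a n*Psi c al H n)) = (fun n => H%:R^-1*\sum_[h<=H] G h n).
   apply: funext => n; rewrite /Psi mulrCA mulr_sumr.
   by rewrite Re_realM Re_sum.
  have bG' h : bdd (fun n => G h (n+h)%N) by exact: (bdd_shift h (bG h)).
  have bs1: bdd (fun n => \sum_[h<=H] G h (n+h)%N) by exact: bdd_sum.
  have bs2: bdd (fun n => \sum_[h<=H] G h n) by exact: bdd_sum.
  rewrite e3 e4 (LamZ Uu _ bs1) (LamZ Uu _ bs2) (Lam_sum Uu Uc _ bG') (Lam_sum Uu Uc _ bG).
  apply: le_of_eq; congr (_*_); apply: eq_bigr => h _.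
  exact: (Lam_shift Uu Uc h (bG h)).
 have uP i : uniq (P i) by exact: Pw_uniq.
 have pP i p : p \in P i -> prime p by move=> /mem_Pw [].
 have hW i : (i<Kw)%N -> 16/e1^+2 <= Ws (P i).
  move=> _; apply: leT (Ws_Pw r (us3 i)).
  by move: hr; rewrite !ler_pdivrMr // => hr'; lra.
 have hPm i p : (i<Kw)%N -> p \in P i -> (p<=Pm)%N.
  move=> iK /mem_Pw [_ /andP[_ h]]; apply: leqT h _; rewrite leq_exp2l // leq_mul2r usm ?orbT //; exact: ltnW.
 have herr: 3/(rho*K'%:R)+4*Pm%:R*K'%:R/H%:R+Pm%:R/H%:R <= e1^+2/16.
  have t1: 3/(rho*K'%:R) <= e1^+2/32.
   have : 96/(rho*e1^+2) <= K'%:R by apply: leT hK1 _; rewrite ler_nat leqnSn.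
   exact: err_bound1.
  have t2: 4*Pm%:R*K'%:R/H%:R+Pm%:R/H%:R <= e1^+2/32.
   have h3: 32*(5*Pm%:R*K'%:R)/e1^+2 <= H%:R by apply: leT hh1 _; rewrite ler_nat.
   by apply: err_bound2 => //; rewrite ler_peMr ?(ltW PmR) // ler1n.
  lra.
 have [i [i' [p0 [A [y [/andP[ii' iK'] p0P hs]]]]]] :=
  katai_extract c1 H0 rho0 K'0 Uu Uc a_le aM' e10 uP pP hW hKw hmean hPm herr.
 pose G := [seq q <- P i' | (c (y q) != 0) && near1 rho (p0%:R*al (y q)-q%:R*A)].
 have [_ _ _ _ kill] := hdd i.
 have W0: 0 < Ws (P i') by apply: lt_le_trans (hW _ iK'); rewrite divr_gt0.
 have [q qG hq] : exists2 q, q \in G & arc (D i) (H' i) (al (y q)).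
  apply: (kill (us i') r p0 A rho (fun q => al (y q)) G) => //.
  - apply: leqT (ltnW (ltn_expl _ (isT : 1<2)%N)); apply: leqT (usm _ _ ii').
   by rewrite /= /DD leq_addl.
  - by have [pp /andP[_ ->]] := mem_Pw p0P; rewrite prime_gt0.
  - by rewrite filter_uniq // uP.
  - by move=> q; rewrite mem_filter => /andP[].
  - by move=> q; rewrite mem_filter => /andP[/andP[_ /asboolP h] _]; split.
  - rewrite /rho mulrC ler_pdivrMr ?mulr_gt0 // mul1r ler_pM2l // ler_nat /Pm /Pmx leq_exp2l // leq_mul2r usm ?orbT //.
   exact: ltnW.
  rewrite /G big_filter.
  have -> : \sum_(q <- P i' | (c (y q) != 0) && near1 rho (p0%:R*al (y q)-q%:R*A)) q%:R^-1 =
   Ws (P i')*\sum_(q <- P i') (q%:R*Ws (P i'))^-1*((c (y q) != 0) && near1 rho (p0%:R*al (y q)-q%:R*A))%:R.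
   rewrite mulr_sumr big_mkcond /=; apply: eq_bigr => q _; rewrite invfM.
   by case: ((c (y q) != 0) && _); rewrite ?mulr1 ?mulr0 // mulrCA mulfV ?mulr1 // gt_eqF.
  by rewrite mulrC; apply: leMl => //; exact: ltW.
 move: qG; rewrite mem_filter => /andP[/andP[cy _] _]; move: cy; rewrite /c.
 have -> : M (y q) by apply/asboolP; exists i => //; exact: ltn_trans ii' iK'.
 by rewrite eqxx.
have partB: Lam U Fm <= eps/8+eps/4.
 pose J i b s n := H%:R^-1*\sum_[h<=H] nm (savg (rat_tw a b s) (H2 i) (n+h)%N).
 have J0 i b s n : 0 <= J i b s n.
  by rewrite mulr_ge0 ?invr_ge0 //; apply: sumr_ge0 => h _; exact: nm_ge0.
 have bs i b s : bdd (fun n => nm (savg (rat_tw a b s) (H2 i) n)).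
  by apply: (@bdd01 _ 1) => n; rewrite nm_ge0 savg_rat_le.
 have bJ i b s : bdd (J i b s) by apply: bddZ; apply: bdd_sum => h; exact: (bdd_shift h (bs i b s)).
 (* The index [b] below starts at 0, which is not a denominator; the term is set to 0 there. *)
 pose J' i b s n := if (0<b)%N then J i b s n else 0.
 have J'0 i b s n : 0 <= J' i b s n by rewrite /J'; case: ifP.
 have bJ' i b s : bdd (J' i b s) by rewrite /J'; case: (0<b)%N => //; exact: bdd_cst.
 (* Summing over all twists of all windows avoids selecting the arc as a function of [n]; the factor
    [Kw*D.+1*D.+1] in [arc_data] pays for their number. *)
 pose T n := \sum_[i<Kw] \sum_[b<(D i).+1] \sum_[s<(D i).+1] J' i b s n.
 have bT: bdd T by do 3!(apply: bdd_sum => ?).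
 have single (E : nat -> R) n i : (forall j, 0 <= E j) -> (i<n)%N -> E i <= \sum_[j<n] E j.
  move=> E0 ilt; rewrite (bigD1_seq i) /= ?mem_index_iota ?iota_uniq // lerDl; exact: sumr_ge0.
 have FT n : Fm n <= T n+eps/4.
  have T0: 0 <= T n by do 3!(apply: sumr_ge0 => ? _).
  rewrite /Fm; case: ifP => [/asboolP [i iK [d [s [/andP[d0 dD] hds]]]]|_]; last by lra.
  have [H'0 H20 hH' _ _] := hdd i.
  apply: leT (major_point a_le n H0 H20 H'0 d0 hds) _; apply: lerD.
   set s' := `|_|%N; have s'D: (s'<(D i).+1)%N.
    apply: ltn_trans (_ : d<_)%N => //; rewrite /s' -ltz_nat gez0_abs ?modz_ge0 ?ltz_pmod // eqz_nat -lt0n //.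
   have -> : H%:R^-1*\sum_[h<=H] nm (savg (rat_tw a d s') (H2 i) (n+h)%N) = J' i d s' n by rewrite /J' d0.
   apply: leT (single (fun s => J' i d s n) (D i).+1 s' _ s'D) _ => //.
   apply: leT (single (fun b => \sum_[s<(D i).+1] J' i b s n) (D i).+1 d _ _) _ => //.
    by move=> j; apply: sumr_ge0.
   apply: (single (fun i => \sum_[b<(D i).+1] \sum_[s<(D i).+1] J' i b s n) Kw i _ iK).
   by move=> j; do 2!(apply: sumr_ge0 => ? _).
  have h2': 2*(H2 i)%:R/H%:R <= eps/8.
   have : 16*(\sum_[j<Kw] H2 j)%N%:R/eps <= H%:R by apply: leT hh2 _; rewrite ler_nat.
   have : (H2 i)%:R <= (\sum_[j<Kw] H2 j)%N%:R:>R.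
    by rewrite natr_sum; exact: (single (fun j => (H2 j)%:R) Kw i _ iK).
   rewrite !ler_pdivrMr //; lra.
  lra.
 have LT: Lam U T <= eps/8.
  rewrite (Lam_sum Uu Uc); last by move=> i; do 2!(apply: bdd_sum => ?).
  apply: leT (_ : \sum_[i<Kw] eps/8/Kw%:R <= _); last first.
   by rewrite big_const_nat iter_addr_0 subn0 -[leLHS]mulr_natr divfK // pnatr_eq0.
  apply: ler_sum => i _; rewrite (Lam_sum Uu Uc); last by move=> b; apply: bdd_sum => ?.
  have [_ _ _ hL _] := hdd i.
  have DR: 0 < (D i).+1%:R:>R by rewrite ltr0n.
  have KR: 0 < Kw%:R:>R by rewrite ltr0n.
  apply: leT (_ : \sum_[b<(D i).+1] \sum_[s<(D i).+1] eps/8/(Kw*(D i).+1*(D i).+1)%:R <= _); last first.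
   rewrite !big_const_nat !iter_addr_0 !subn0 -[X in X *+ _]mulr_natr -[leLHS]mulr_natr !natrM.
   exact: split_weight.
  apply: ler_sum_nat => b /andP[_ bD]; rewrite (Lam_sum Uu Uc) //; apply: ler_sum_nat => s /andP[_ sD].
  have KD: 0 < (Kw*(D i).+1*(D i).+1)%:R:>R by rewrite ltr0n !muln_gt0.
  rewrite /J'; case: posnP => [_|b0]; first by rewrite (Lam_cst Uu Uc) divr_ge0 // divr_ge0 // ltW.
  rewrite ler_pdivlMr //; apply: leT (hL U hU b s b0 bD sD); apply: leMr => //.
  rewrite /J (LamZ Uu) ?(Lam_sum Uu Uc); first last.
  - by apply: bdd_sum => h; exact: (bdd_shift h (bs i b s)).
  - by move=> h; exact: (bdd_shift h (bs i b s)).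
  have eh h : Lam U (fun n => nm (savg (rat_tw a b s) (H2 i) (n+h)%N)) = Lam U (fun n => nm (savg (rat_tw a b s) (H2 i) n)).
   exact: (Lam_shift Uu Uc h (bs i b s)).
  rewrite (eq_bigr _ (fun h _ => eh h)); move: (Lam U _) => l.
  by rewrite big_const_nat iter_addr_0 subSS subn0 -[l *+ H]mulr_natl mulKf // gt_eqF.
 apply: leT (_ : Lam U (fun n => T n+eps/4) <= _).
  by apply: Lam_mono => //; apply: bddD => //; exact: bdd_cst.
 by rewrite (LamD Uu) ?(Lam_cst Uu Uc) ?lerD2r //; exact: bdd_cst.
move: partA partB; rewrite /e1; lra.
Qed.
End Main.

(** * Transfer *)

Definition cx (z : Defs.Cx) : C := (fst z : R) +i* (snd z : R).

Lemma cx_mul z w : cx (Defs.Cmul z w) = cx z*cx w.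
Proof. by case: z; case: w. Qed.

Lemma cx_inj z w : cx z = cx w -> z = w.
Proof. by case: z => a b; case: w => c d [-> ->]. Qed.

Lemma cx_scale (r : R) z : cx (Defs.Cscale r z) = r%:C*cx z.
Proof.
case: z => x y; apply/eqP; rewrite eq_complex /= !mul0r subr0 addr0; by apply/andP; split; apply/eqP.
Qed.

Lemma Cnorm_nm z : Defs.Cnorm z = nm (cx z).
Proof. by rewrite /Defs.Cnorm RsqrtE !RpowE. Qed.

Lemma cx_Cexpi x : cx (Defs.Cexpi x) = cis x.
Proof. by rewrite cisE. Qed.

Lemma sum1E (f : nat -> R) N : Defs.sum1 f N = \sum_[n<=N] f n.
Proof. by elim: N => [|N IH]; [rewrite big_geq|rewrite big_nat_recr //= -IH]. Qed.

Lemma cx_Csum1 f N : cx (Defs.Csum1 f N) = \sum_[n<=N] cx (f n).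
Proof. by elim: N => [|N IH]; [rewrite big_geq|rewrite big_nat_recr //= -IH]. Qed.

Lemma log_avgE (F : nat -> R) N : Defs.log_avg F N = lavg F N.
Proof.
rewrite /Defs.log_avg /lavg RmultE RinvE !sum1E [LHS]mulrC; congr (_*_^-1).
 by apply: eq_bigr => n _; rewrite RdivE INRE.
by apply: eq_bigr => n _; rewrite RinvE INRE.
Qed.

Lemma nat_dividesP (d n : nat) : PeanoNat.Nat.divide d n <-> (d %| n)%N.
Proof. by split=> [[z ->]|/dvdnP [z ->]]; [exact: dvdn_mull|exists z]. Qed.

Lemma Z_dividesP (d n : nat) : (0<d)%N -> BinInt.Z.divide (BinInt.Z.of_nat d) (BinInt.Z.of_nat n) <-> (d %| n)%N.
Proof.
move=> d0; split=> [[z h]|/dvdnP [z ->]]; last by exists (BinInt.Z.of_nat z); lia.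
have z0: BinInt.Z.le BinNums.Z0 z by nia.
by apply/dvdnP; exists (BinInt.Z.to_nat z); nia.
Qed.

Lemma nprimeP p : Defs.nprime p <-> prime p.
Proof.
rewrite /Defs.nprime; split=> [/Znumtheory.prime_alt [p1 hp]|pp].
 apply/primeP; split; first lia.
 move=> d dp; apply: contrapT => /negP; rewrite negb_or => /andP[d1 d2].
 have p0: (0<p)%N by lia.
 have dle := dvdn_leq p0 dp; have d0 := dvdn_gt0 p0 dp.
 apply: (hp (BinInt.Z.of_nat d)); first by lia.
 exact/Z_dividesP.
apply/Znumtheory.prime_alt; split; first by have := prime_gt1 pp; lia.
move=> n n1 nd; have e: n = BinInt.Z.of_nat (BinInt.Z.to_nat n) by lia.
move: nd; rewrite e => /Z_dividesP; have n0: (0<BinInt.Z.to_nat n)%N by lia.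
move=> /(_ n0); by case/primeP: pp => _ h /h; lia.
Qed.

Lemma gcd_coprime n q : Nat.gcd n q <> 1%N -> ~~ coprime n q.
Proof.
move=> h; apply/negP => /eqP gcd1; apply: h.
have [h1 h2] : (Nat.gcd n q %| n)%N /\ (Nat.gcd n q %| q)%N.
 by split; apply/nat_dividesP; [exact: PeanoNat.Nat.gcd_divide_l|exact: PeanoNat.Nat.gcd_divide_r].
by have : (Nat.gcd n q %| gcdn n q)%N; [rewrite dvdn_gcd h1|rewrite gcd1 dvdn1 => /eqP].
Qed.

Lemma exp_dominates (c e L : R) : 0 < c -> 0 < e -> 4/(e*c^+2) <= L -> L <= e*rexp (c*L).
Proof.
move=> c0 e0; have c2: 0 < c^+2 by rewrite exprn_gt0.
have ec: 0 < e*c^+2 by rewrite mulr_gt0.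
move=> h; have L0: 0 < L by apply: lt_le_trans h; rewrite divr_gt0.
have h1: (c*L/2)^+2 <= rexp (c*L).
 have e1: c*L = c*L/2+c*L/2 by field.
 rewrite [in leRHS]e1 rexpD expr2; have x0: 0 <= c*L/2 by rewrite divr_ge0 // mulr_ge0 // ltW.
 by apply: ler_pM => //; have := rexp_ge1D (c*L/2); lra.
apply: leT (_ : e*(c*L/2)^+2 <= _); last by rewrite ler_pM2l.
rewrite ler_pdivrMr // in h.
have -> : e*(c*L/2)^+2 = L*(L*(e*c^+2))/4 by field.
have : L*4 <= L*(L*(e*c^+2)) by rewrite ler_pM2l.
lra.
Qed.

(** At scale [1/n] at most [n^s] intervals are needed, and [n^s log n <= e n] as soon as
    [log n <= e n^(1-s)]. *)
Lemma cov_of_box (K : R -> Prop) : Defs.upper_box_dim_lt_1 K ->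
 forall e : R, 0 < e -> exists n0 : nat, forall n, (n0<=n)%N ->
 exists xs : seq R, (size xs)%:R*rln n%:R <= e*n%:R /\
  forall c, K c -> exists2 x, x \in xs & x <= c <= x+n%:R^-1.
Proof.
move=> [s [/RltP s1 [d0 [/RltP d00 hd]]]] e e0.
have c0: 0 < 1-s by rewrite subr_gt0.
have [n1 h1] := nat_above (rexp (4/(e*(1-s)^+2))).
have [n2 h2] := nat_above (d0^-1+1).
exists (maxn n1 (maxn n2 2)) => n; rewrite !geq_max => /andP[nn1 /andP[nn2 n2']].
have nR: 0 < n%:R:>R by rewrite ltr0n; lia.
have hn: d0^-1 < n%:R:>R.
 by have : n2%:R <= n%:R:>R; [rewrite ler_nat|lra].
have [m [[xs [hl hc]] hm]] : exists m, Defs.covers K (n%:R^-1 : R) m /\ Rdefinitions.Rle (Raxioms.INR m) (Rpower.Rpower (Rdefinitions.Rinv (n%:R^-1 : R)) s).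
 apply: hd; split; apply/RltP; first by rewrite invr_gt0.
 by rewrite -[d0]invrK ltf_pV2 // posrE invr_gt0.
exists xs; split; last first.
 move=> c /hc [x [hx [/RleP l1 /RleP l2]]]; exists x; last by rewrite l1.
 by elim: xs hx {hl hc} => //= y xs IH [->|/IH]; rewrite inE ?eqxx // => ->; rewrite orbT.
have hm': (size xs)%:R <= rexp (s*rln n%:R):>R.
 have -> : size xs = m by rewrite -hl; elim: (xs) => //= y ys ->.
 by move/RleP: hm; rewrite INRE RinvE invrK.
have L0: 0 <= rln n%:R by rewrite rln_ge0 // ler1n; lia.
have hL: 4/(e*(1-s)^+2) <= rln n%:R.
 rewrite -[leLHS]rexpK; apply: rln_le; first exact: rexp_gt0.
 by apply: leT h1 _; rewrite ler_nat.
apply: leT (_ : rexp (s*rln n%:R)*(e*rexp ((1-s)*rln n%:R)) <= _).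
 by apply: ler_pM => //; exact: exp_dominates.
rewrite mulrCA -rexpD -mulrDl; have -> : s+(1-s) = 1 by ring.
by rewrite mul1r rlnK.
Qed.

Section Transfer.
Variables (a : nat -> Defs.Cx).
Hypotheses (a_unit : forall n : nat, (1 <= n)%coq_nat -> Defs.Cnorm (a n) = (1 : R)) (a_mult : Defs.completely_multiplicative a).
Hypothesis a_unpr : Defs.unpretentious a.

(** The hypotheses leave the value at 0 open; with the value 0 the multiplicativity extends to all
    arguments, which the truncated subtractions require. *)
Definition az (n : nat) : C := if n == 0%N then 0 else cx (a n).

Lemma azE n : (0<n)%N -> az n = cx (a n).
Proof. by rewrite /az; case: n. Qed.

Lemma az_unit n : (0<n)%N -> N2 (az n) = 1.
Proof.
move=> n0; rewrite azE // -nm_sqr -Cnorm_nm a_unit; first exact: expr1n.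
exact/ssrnat.leP.
Qed.

Lemma az_mul m n : (0<m)%N -> (0<n)%N -> az (m*n)%N = az m*az n.
Proof.
move=> m0 n0; rewrite !azE ?muln_gt0 ?m0 // -cx_mul; congr cx.
by case: a_mult => _; apply; apply/ssrnat.leP.
Qed.

Lemma az_unpr q chi : dchar q chi -> forall M : R, exists N0, forall N, (N0<=N)%N ->
 forall t : R, `|t| <= 2*N%:R ->
  M <= \sum_(1 <= p < N.+1 | prime p) (1-Re (az p*chi p*npw p t))/p%:R.
Proof.
move=> [q0 chi1 chiM chiP chi0] M.
have [phi [hphi hu]] := a_unpr.
have [M' hM'] := nat_above M; have [A0 hA0] := hphi M'.
(* [A0] makes [phi A] large enough, [q] admits the character, and 2 admits all [|t| <= 2N]. *)
pose A := maxn A0 (maxn q 2).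
pose f n : Defs.Cx := (Re (chi n) : Rdefinitions.R, Im (chi n) : Rdefinitions.R).
have fE n : cx (f n) = chi n by rewrite /cx /f /=; case: (chi n).
have [||N0 hN0] := hu A q f.
- by apply/ssrnat.leP; rewrite !leq_max leqnn orbT.
- split; first exact/ssrnat.leP.
 split; first by apply: cx_inj; rewrite fE.
 split; first by move=> m n; apply: cx_inj; rewrite cx_mul !fE; exact: chiM.
 split; first by move=> n; apply: cx_inj; rewrite !fE; exact: chiP.
 by move=> n /gcd_coprime h; apply: cx_inj; rewrite fE chi0.
exists N0 => N /ssrnat.leP hN t ht.
have AN: `|t| <= A%:R*N%:R by apply: leT ht _; rewrite leMr // ler_nat !leq_max leqnn !orbT.
(* The hypothesis is stated with [p^(-it)], hence the sign. *)
have /RIneq.Rge_le /RleP := hN0 N hN (- t) (ltac:(apply/RleP; rewrite RabsE !INRE normrN; exact: AN)).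
rewrite INRE => h; apply: leT hM' _; apply: leT (_ : (phi A)%:R <= _).
 by rewrite ler_nat; apply/ssrnat.leP; apply: hA0; apply/ssrnat.leP; rewrite leq_maxl.
apply: leT h _; rewrite /Defs.pretentious_sum sum1E [leRHS]big_mkcond /=.
apply: le_of_eq; apply: eq_big_nat => p /andP[p1 _].
case: Defs.nprime_dec => [/nprimeP ->|np]; last by case: ifP => // /nprimeP.
rewrite INRE RdivE; congr (_/_).
have -> : az p*chi p*npw p t = cx (Defs.Cmul (Defs.Cmul (a p) (f p)) (Defs.Cexpi (- - t*rln p%:R)%R)).
 by rewrite !cx_mul cx_Cexpi azE // fE opprK.
by [].
Qed.

Lemma short_avgE n H x : cx (Defs.short_avg a n H x) = Sn az H n x.
Proof.
rewrite /Defs.short_avg /Sn cx_scale RinvE INRE cx_Csum1; congr (_*_).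
apply: eq_big_nat => h /andP[h1 _]; rewrite cx_mul -azE ?addn_gt0 ?h1 ?orbT //; congr (_*_).
by rewrite /Defs.e cx_Cexpi INRE /eq_ rpiE.
Qed.

Variable K : R -> Prop.
Hypothesis K_dim : Defs.upper_box_dim_lt_1 K.

Lemma Sn_az_le H n x : nm (Sn az H n x) <= 1.
Proof.
have [->|H0] := posnP H; first by rewrite /Sn invr0 mul0r nm0.
by apply: Sn_le => //; exact: az_unit.
Qed.

(** [Rsup] is a choice by [epsilon]; the set contains 0 and is bounded by 1, so a least upper bound
    exists and is the one chosen. *)
Lemma sup_lub n H : Raxioms.is_lub (fun y => y = (0 : R) \/ exists x, K x /\ y = Defs.Cnorm (Defs.short_avg a n H x))
 (Defs.sup_short_avg K a n H).
Proof.
rewrite /Defs.sup_short_avg /Defs.Rsup; apply: ClassicalEpsilon.epsilon_spec.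
case: (Raxioms.completeness (fun y => y = (0 : R) \/ exists x, K x /\ y = Defs.Cnorm (Defs.short_avg a n H x))).
- exists (1 : R) => y [->|[x [_ ->]]]; apply/RleP; first exact: ler01.
 by rewrite Cnorm_nm short_avgE Sn_az_le.
- by exists (0 : R); left.
- by move=> l hl; exists l.
Qed.

Lemma near_maximizer n H (d : R) : 0 < d -> (exists x, K x) ->
 exists x, K x /\ Defs.sup_short_avg K a n H-d <= nm (Sn az H n x).
Proof.
move=> d0 [x0 Kx0]; have [ub lb] := sup_lub n H; apply: contrapT => nex.
have h x : K x -> nm (Sn az H n x) < Defs.sup_short_avg K a n H-d.
 by move=> Kx; rewrite ltNge; apply/negP => hx; apply: nex; exists x.
have : Rdefinitions.Rle (Defs.sup_short_avg K a n H) (Defs.sup_short_avg K a n H-d)%R.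
 apply: lb => y [->|[x [Kx ->]]]; apply/RleP.
  by apply: ltW; apply: le_lt_trans (h x0 Kx0); exact: nm_ge0.
 by rewrite Cnorm_nm short_avgE ltW // h.
move/RleP; move: (Defs.sup_short_avg K a n H : R) => s; change (s <= s-d -> False); lra.
Qed.

Lemma sup_empty n H : ~ (exists x, K x) -> Defs.sup_short_avg K a n H = (0 : R).
Proof.
move=> nK; have [ub lb] := sup_lub n H; apply/eqP; rewrite eq_le; apply/andP; split; apply/RleP.
 by apply: lb => y [->|[x [Kx _]]]; [apply/RleP|case: nK; exists x].
by apply: ub; left.
Qed.

(** If the claim failed for some [H], the mean would be at least [eps] for arbitrarily large [N]. An
    ultrafilter on these [N] and frequencies maximising up to [eps/4] would contradict [main_C].
    Both depend on [H], which explains the uniformity there. *)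
Theorem sup_log_avg_small (eps : R) : 0 < eps -> exists H0 : nat, forall H, (H0<=H)%N ->
 exists N0 : nat, forall N, (N0<=N)%N -> lavg (fun n => Defs.sup_short_avg K a n H) N < eps.
Proof.
move=> e0; have [nK|/asboolP] := pselect (exists x, K x); last first.
 move=> /asboolP nK; exists 0%N => H _; exists 0%N => N _.
 by rewrite /lavg /lsum big1 ?mul0r // => n _; rewrite sup_empty // mul0r.
have e40: 0 < eps/4 by lra.
have [H0 hH0] := main_C (cov_of_box K_dim) (erefl : az 0 = 0) az_unit az_mul az_unpr e40.
exists H0 => H /hH0 hH; apply: contrapT => nex.
pose F n : R := Defs.sup_short_avg K a n H.
have [|U [Uu Uc US]] := @exists_ultra (fun N => (0<N)%N /\ eps <= lavg F N).
 move=> N0; apply: contrapT => h; apply: nex; exists (maxn N0 1) => N; rewrite geq_max => /andP[hN N1].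
 by rewrite ltNge; apply/negP => hl; apply: h; exists N.
have [al hal] := choice (fun n => near_maximizer n H e40 nK).
have bF: bdd (fun n => nm (Sn az H n (al n))).
 by exists 1 => n; rewrite ger0_norm ?nm_ge0 // Sn_az_le.
have h1 := hH U (conj Uu Uc) al (fun n => (hal n).1).
have : eps-eps/4 <= Lam U (fun n => nm (Sn az H n (al n))).
 apply: (Lam_ge Uu bF US) => N [N0 hN].
 have hp := harm_gt0 N0; move: hN; rewrite /lavg !ler_pdivlMr // => hN.
 apply: leT (_ : lsum F N-eps/4*harm N <= _); first lra.
 rewrite /lsum /harm mulr_sumr -sumrB; apply: ler_sum => n _; rewrite -mulrBl.
 by apply: leMr; [rewrite invr_ge0|case: (hal n)].
lra.
Qed.

Theorem sup_log_avg_std (eps : R) : Rdefinitions.Rlt (0 : R) eps -> exists H0 : nat, forall H, (H0 <= H)%coq_nat ->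
 exists N0 : nat, forall N, (N0 <= N)%coq_nat ->
 Rdefinitions.Rlt (Defs.log_avg (fun n => Defs.sup_short_avg K a n H) N) eps.
Proof.
move=> /RltP /sup_log_avg_small [H0 hH0]; exists H0 => H /ssrnat.leP /hH0 [N0 hN0].
by exists N0 => N /ssrnat.leP /hN0 h; apply/RltP; rewrite log_avgE.
Qed.
End Transfer.

End ShortSums.

(* lim_{H->oo} limsup_{N->oo} E^log_{n<=N} sup_{alpha in C} |E_{h<=H} a(n+h) e(h alpha)| = 0,
   with the (nonnegative, bounded) limit and limsup unfolded. *)
Theorem theorem1p7 (C : R -> Prop) (a : nat -> Cx) :
  (forall x, C x -> 0 <= x <= 1) ->
  upper_box_dim_lt_1 C ->
  (forall n : nat, (1 <= n)%nat -> Cnorm (a n) = 1) ->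
  completely_multiplicative a ->
  unpretentious a ->
  forall eps : R, 0 < eps ->
    exists H0 : nat, forall H : nat, (H0 <= H)%nat ->
      exists N0 : nat, forall N : nat, (N0 <= N)%nat ->
        log_avg (fun n => sup_short_avg C a n H) N < eps.
Proof.
intros _ hdim hunit hmul hunp eps heps.
exact (ShortSums.sup_log_avg_std hunit hmul hunp hdim heps).
Qed.
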